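(* Let $\mathbb G=(A,\Delta_A)$ be a $C^*$-quantum group with reduced bicharacter $W\in\mathcal U(\hat A\otimes A)$, write $\boxtimes=\boxtimes_W$, and let $(B,\Delta_B)$ be a braided $C^*$-bialgebra in the category of $\mathbb G$-Yetter–Drinfeld $C^*$-algebras (equivalently, over the quantum codouble of $\mathbb G$). Let $C:=A\boxtimes B$ and $\Delta_C:=\Psi\circ(\mathrm{id}_A\boxtimes\Delta_B)\colon C\to C\otimes C$. Then $(C,\Delta_C)$ is a compact quantum group if $\mathbb G$ is a compact quantum group and $(B,\Delta_B)$ is a braided compact quantum group.
   Context: Conventions: $\otimes$ is the minimal $C^*$-tensor product, $\mathcal U(A)$ the unitary group of the multiplier algebra, $\sigma$ the flip; a morphism $A\to B$ is a nondegenerate $*$-homomorphism $A\to\mathcal M(B)$; $X\cdot Y$ is the closed linear span of products; leg numbering notation is used. A compact quantum group is a unital $C^*$-algebra $C$ with a coassociative unital $*$-homomorphism $\Delta_C\colon C\to C\otimes C$ satisfying $\Delta_C(C)\cdot(1\otimes C)=C\otimes C=\Delta_C(C)\cdot(C\otimes1)$. A $C^*$-quantum group $(A,\Delta_A)$ is compact if $A$ is unital. A $C^*$-quantum group is a pair $(A,\Delta_A)$ obtained from a manageable (in Woronowicz's sense) multiplicative unitary $\mathbb W\in\mathcal U(\mathcal L\otimes\mathcal L)$, $\mathbb W_{23}\mathbb W_{12}=\mathbb W_{12}\mathbb W_{13}\mathbb W_{23}$, $\mathcal L$ separable: $A$ and $\hat A$ are the closed linear spans of the slices $(\omega\otimes\mathrm{id})\mathbb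 W$ and $(\mathrm{id}\otimes\omega)\mathbb W$, $\omega\in\mathbb B(\mathcal L)_*$; $W\in\mathcal U(\hat A\otimes A)$ is $\mathbb W$ viewed as a multiplier; $(\mathrm{id}\otimes\Delta_A)W=W_{12}W_{13}$, $(\hat\Delta_A\otimes\mathrm{id})W=W_{23}W_{13}$. The dual is $\hat{\mathbb G}=(\hat A,\hat\Delta_A)$ with reduced bicharacter $\hat W=\sigma(W^* )\in\mathcal U(A\otimes\hat A)$; the dual of $\hat{\mathbb G}$ is $\mathbb G$. Corepresentation of $(A,\Delta_A)$ on $\mathcal H$: $U\in\mathcal U(\mathbb K(\mathcal H)\otimes A)$ with $(\mathrm{id}\otimes\Delta_A)U=U_{12}U_{13}$. Continuous coaction on $C$: injective morphism $\gamma\colon C\to C\otimes A$ with $(\mathrm{id}\otimes\Delta_A)\gamma=(\gamma\otimes\mathrm{id})\gamma$ and $\gamma(C)\cdot(1\otimes A)=C\otimes A$; similarly for $\hat A$. A morphism $f$ is equivariant if $\delta f=(f\otimes\mathrm{id})\gamma$. Covariant representation: $(\varphi,U)$ with $(\varphi\otimes\mathrm{id})\gamma(c)=U(\varphi(c)\otimes1)U^*$; faithful ones always exist. Universal dual: $\hat A^{u}$ comes with $\tilde{\mathcal V}\in\mathcal U(\hat A^{u}\otimes A)$ whose slices span $\hat A^{u}$, such that each corepresentation $U$ on $\mathcal H$ is $(\rho^{\mathcal H}\otimes\mathrm{id})\tilde{\mathcal V}$ for a unique representation $\rho^{\mathcal H}$ of $\hat A^{u}$; $(\hat\Delta^{u}\otimes\mathrm{id})\tilde{\mathcal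 V}=\tilde{\mathcal V}_{23}\tilde{\mathcal V}_{13}$; the reducing map satisfies $(\hat\Lambda\otimes\mathrm{id})\tilde{\mathcal V}=W$. Applied to $\hat{\mathbb G}$ this gives $A^{u}$, and corepresentations $V\in\mathcal U(\mathbb K(\mathcal K)\otimes\hat A)$ of $\hat{\mathbb G}$ correspond to representations $\pi^{\mathcal K}$ of $A^{u}$. Twisted tensor product $\boxtimes=\boxtimes_W$: let $W^{u}\in\mathcal U(\hat A^{u}\otimes A^{u})$ be the unique bicharacter lifting $W$. For $C$ with continuous $A$-coaction and $D$ with continuous $\hat A$-coaction, with faithful covariant representations $(\varphi,U^{\mathcal H})$ and $(\psi,V^{\mathcal K})$, put $Z:=(\rho^{\mathcal H}\otimes\pi^{\mathcal K})(W^{u})^*$, $\iota_C(c)=\varphi(c)\otimes1$, $\iota_D(d)=Z(1\otimes\psi(d))Z^*$ and $C\boxtimes D:=\iota_C(C)\cdot\iota_D(D)\subseteq\mathbb B(\mathcal H\otimes\mathcal K)$, a $C^*$-algebra independent of the choices up to isomorphism intertwining $\iota_C,\iota_D$. For equivariant $f\colon C_1\to C_2$, $g\colon D_1\to D_2$, $f\boxtimes g$ is the unique morphism with $(f\boxtimes g)\iota_{C_1}=\iota_{C_2}f$, $(f\boxtimes g)\iota_{D_1}=\iota_{D_2}g$. A $\mathbb G$-Yetter–Drinfeld $C^*$-algebra is a $C^*$-algebra $B$ with continuous coactions $\beta\colon B\to B\otimes A$ and $\hat\beta\colon B\to B\otimes\hat A$ with $\sigma^W_{23}((\beta\otimes\mathrm{id}_{\hat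 A})\hat\beta)=(\hat\beta\otimes\mathrm{id}_A)\beta$, where $\sigma^W(a\otimes\hat a)=W(\hat a\otimes a)W^*$. For such $B,B'$, $B\boxtimes B'$ carries the unique Yetter–Drinfeld structure for which the embeddings of $B,B'$ are equivariant for both coactions; $\boxtimes$ is associative up to the unique isomorphism intertwining the embeddings of the factors. A braided $C^*$-bialgebra is a $\mathbb G$-Yetter–Drinfeld $C^*$-algebra $B$ with a morphism $\Delta_B\colon B\to B\boxtimes B$ that is equivariant for both coactions and coassociative: $(\Delta_B\boxtimes\mathrm{id}_B)\Delta_B=(\mathrm{id}_B\boxtimes\Delta_B)\Delta_B$. It is bisimplifiable if $\Delta_B(B)\cdot\iota_1(B)=B\boxtimes B=\Delta_B(B)\cdot\iota_2(B)$, where $\iota_1,\iota_2\colon B\rightrightarrows B\boxtimes B$ are the canonical morphisms. A braided compact quantum group is a unital, bisimplifiable braided $C^*$-bialgebra. $A$ carries the $A$-coaction $\Delta_A$, which suffices to form $A\boxtimes B$ and $A\boxtimes B\boxtimes B:=A\boxtimes(B\boxtimes B)$. The morphism $\mathrm{id}_A\boxtimes\Delta_B\colon A\boxtimes B\to A\boxtimes B\boxtimes B$ restricts to $\iota_A$ on $A$ and to $\iota_{B\boxtimes B}\circ\Delta_B$ on $B$. The morphism $\Psi\colon A\boxtimes B\boxtimes B\to(A\boxtimes B)\otimes(A\boxtimes B)$ is the unique (injective) one with $\Psi(\iota_A(a))=(\iota_A\otimes\iota_A)\Delta_A(a)$, $\Psi(b)=(\iota_B\otimes\iota_A)\beta(b)$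 for $b$ in the first copy of $B$, and $\Psi(b)=1\otimes\iota_B(b)$ for $b$ in the second copy of $B$.
   Formalization: The map $\Psi$ is taken with $\Psi(b)=(\iota_B\otimes\iota_A)\beta(b)$ for $b$ in the first copy of $B$; the formula $(\iota_B\otimes\iota_B)\beta(b)$ given for it is undefined because $\beta(b)$ is a multiplier of $B\otimes A$. *)

(* Defs.v *)
(* Up to unitary equivalence a Hilbert space is l2(I) for a set I,
   and l2(I) (x) l2(J) = l2(I * J).  A bounded operator on l2(I) is given by its
   matrix T i j = <e_i, T e_j>.  A C*-algebra is a nondegenerate norm-closed
   *-subalgebra of some B(l2(I)); its minimal tensor products and its multiplier
   algebra are then the spatial ones. *)
From HB Require Import structures.
From mathcomp Require Import all_boot all_order all_algebra.
From mathcomp Require Import complex.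
From mathcomp Require Import all_classical all_reals all_analysis.

Set Implicit Arguments.
Unset Strict Implicit.
Unset Printing Implicit Defensive.

Import Order.TTheory GRing.Theory Num.Theory.

Local Open Scope classical_set_scope.
Local Open Scope ring_scope.

Definition vec (R : realType) (I : choiceType) := I -> R[i].
Definition mat (R : realType) (I : choiceType) := I -> I -> R[i].

(* Unordered sum of an absolutely summable complex family (meaningless when the
   family is not absolutely summable). *)
Definition csum (R : realType) (I : choiceType) (f : I -> R[i]) : R[i] :=
  let s (g : I -> R) : R :=
    fine (\esum_(i in [set: I]) (Num.max (g i) 0)%:E)
    - fine (\esum_(i in [set: I]) (Num.max (- g i) 0)%:E) in
  Complex (s (fun i => complex.Re (f i))) (s (fun i => complex.Im (f i))).

Definition normsq (R : realType) (I : choiceType) (x : vec R I) : \bar R :=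
  \esum_(i in [set: I]) ((complex.Re (x i)) ^+ 2 + (complex.Im (x i)) ^+ 2)%:E.

Definition l2 (R : realType) (I : choiceType) (x : vec R I) : Prop :=
  (normsq x < +oo)%E.

(* Antilinear in the first variable. *)
Definition dot (R : realType) (I : choiceType) (x y : vec R I) : R[i] :=
  csum (fun i => Num.conj (x i) * y i).

Definition vconj (R : realType) (I : choiceType) (x : vec R I) : vec R I :=
  fun i => Num.conj (x i).

Definition vsub (R : realType) (I : choiceType) (x y : vec R I) : vec R I :=
  fun i => x i - y i.

Definition distsq_le (R : realType) (I : choiceType) (x y : vec R I) (e : R) :
    Prop :=
  (normsq (vsub x y) <= e%:E)%E.

Definition vtens (R : realType) (I J : choiceType) (x : vec R I) (y : vec R J) :
    vec R (I * J)%type :=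
  fun p => x p.1 * y p.2.

Definition mapply (R : realType) (I : choiceType) (T : mat R I) (x : vec R I) :
    vec R I :=
  fun i => csum (fun j => T i j * x j).

Definition mone {R : realType} {I : choiceType} : mat R I :=
  fun i j => (i == j)%:R.

Definition mmul (R : realType) (I : choiceType) (S T : mat R I) : mat R I :=
  fun i k => csum (fun j => S i j * T j k).

Definition madj (R : realType) (I : choiceType) (T : mat R I) : mat R I :=
  fun i j => Num.conj (T j i).

Definition mlin (R : realType) (I : choiceType) (c : R[i]) (S T : mat R I) :
    mat R I :=
  fun i j => c * S i j + T i j.

Definition mconjg (R : realType) (I : choiceType) (u x : mat R I) : mat R I :=
  mmul u (mmul x (madj u)).

Definition mtens (R : realType) (I J : choiceType) (S : mat R I) (T : mat R J) :
    mat R (I * J)%type :=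
  fun p q => S p.1 q.1 * T p.2 q.2.

Definition opnorm_le (R : realType) (I : choiceType) (M : R) (T : mat R I) :
    Prop :=
  forall (s : seq I), uniq s -> forall x y : vec R I,
    `|\sum_(i <- s) \sum_(j <- s) Num.conj (y i) * T i j * x j| ^+ 2
    <= Complex (M ^+ 2) 0 * (\sum_(i <- s) `|y i| ^+ 2)
       * (\sum_(j <- s) `|x j| ^+ 2).

Definition bounded_op (R : realType) (I : choiceType) (T : mat R I) : Prop :=
  exists M : R, opnorm_le M T.

Definition unitary_op (R : realType) (I : choiceType) (u : mat R I) : Prop :=
  [/\ bounded_op u, mmul (madj u) u = mone & mmul u (madj u) = mone].

Definition lspan (R : realType) (I : choiceType) (S : set (mat R I)) :
    set (mat R I) :=
  [set T | exists (n : nat) (c : 'I_n -> R[i]) (s : 'I_n -> mat R I),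
     (forall k, S (s k)) /\ T = (fun i j => \sum_(k < n) c k * s k i j)].

Definition cspan (R : realType) (I : choiceType) (S : set (mat R I)) :
    set (mat R I) :=
  [set T | forall e : R, 0 < e ->
     exists2 T', lspan S T' & opnorm_le e (mlin (-1) T' T)].

(* X . Y, the closed linear span of the products *)
Definition sprod (R : realType) (I : choiceType) (X Y : set (mat R I)) :
    set (mat R I) :=
  cspan [set T | exists x y, [/\ X x, Y y & T = mmul x y]].

Definition cstar (R : realType) (I : choiceType) (A : set (mat R I)) : Prop :=
  [/\ (forall a, A a -> bounded_op a),
      cspan A = A,
      (forall a b, A a -> A b -> A (mmul a b)),
      (forall a, A a -> A (madj a)) &
      (forall v, l2 v -> (forall a, A a -> mapply a v = (fun=> 0)) ->
         v = (fun=> 0))].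

Definition multiplier (R : realType) (I : choiceType) (A : set (mat R I)) :
    set (mat R I) :=
  [set m | bounded_op m /\
     (forall a, A a -> A (mmul m a) /\ A (mmul a m))].

Definition unitaries (R : realType) (I : choiceType) (A : set (mat R I)) :
    set (mat R I) :=
  [set u | multiplier A u /\ unitary_op u].

Definition compacts (R : realType) (I : choiceType) : set (mat R I) :=
  cspan [set T | exists x y : vec R I,
    [/\ l2 x, l2 y & T = (fun i j => x i * Num.conj (y j))]].
Arguments compacts : clear implicits.

Definition atens (R : realType) (I J : choiceType)
    (A : set (mat R I)) (B : set (mat R J)) : set (mat R (I * J)%type) :=
  cspan [set T | exists a b, [/\ A a, B b & T = mtens a b]].

(* A morphism from A to B, i.e. a nondegenerate *-homomorphism from A to M(B),
   is represented by its unique strictly continuous extension M(A) -> M(B), so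
   that morphisms compose as functions.  Values outside M(A) are irrelevant. *)
Definition morphism (R : realType) (I J : choiceType)
    (A : set (mat R I)) (B : set (mat R J)) (f : mat R I -> mat R J) : Prop :=
  [/\ (forall m, multiplier A m -> multiplier B (f m)),
      (forall c m n, multiplier A m -> multiplier A n ->
         f (mlin c m n) = mlin c (f m) (f n)),
      (forall m n, multiplier A m -> multiplier A n ->
         f (mmul m n) = mmul (f m) (f n)),
      (forall m, multiplier A m -> f (madj m) = madj (f m)) &
      sprod (f @` A) B = B].

(* Nondegenerate representations on l2(J): M(K(l2(J))) is B(l2(J)). *)
Definition representation (R : realType) (I J : choiceType)
    (A : set (mat R I)) (f : mat R I -> mat R J) : Prop :=
  morphism A (compacts R J) f.

Definition injective_on (R : realType) (I J : choiceType)
    (A : set (mat R I)) (f : mat R I -> mat R J) : Prop :=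
  forall a b, A a -> A b -> f a = f b -> a = b.

(* f (x) g for morphisms f from A and g from B: on M(A (x) B), the only
   nondegenerate representation mapping a (x) b to f a (x) g b.  If f and g are
   morphisms to A' and B', this is a morphism to A' (x) B'. *)
Definition tmor (R : realType) (I J I' J' : choiceType)
    (A : set (mat R I)) (B : set (mat R J))
    (f : mat R I -> mat R I') (g : mat R J -> mat R J') :
    mat R (I * J)%type -> mat R (I' * J')%type :=
  xget (fun=> mone)
    [set h | representation (atens A B) h /\
       (forall a b, A a -> B b -> h (mtens a b) = mtens (f a) (g b))].

(* Threefold tensor products are left-associated. *)
Definition reassoc (R : realType) (I J K : choiceType)
    (T : mat R (I * (J * K))%type) : mat R (I * J * K)%type :=
  fun p q => T (p.1.1, (p.1.2, p.2)) (q.1.1, (q.1.2, q.2)).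

Definition flip (R : realType) (I J : choiceType) (T : mat R (I * J)%type) :
    mat R (J * I)%type :=
  fun p q => T (p.2, p.1) (q.2, q.1).

Definition flip23 (R : realType) (I J K : choiceType)
    (T : mat R (I * J * K)%type) : mat R (I * K * J)%type :=
  fun p q => T (p.1.1, p.2, p.1.2) (q.1.1, q.2, q.1.2).

Definition leg12 (R : realType) (I J K : choiceType)
    (T : mat R (I * J)%type) : mat R (I * J * K)%type :=
  mtens T mone.

Definition leg23 (R : realType) (I J K : choiceType)
    (T : mat R (J * K)%type) : mat R (I * J * K)%type :=
  reassoc (mtens mone T).

Definition leg13 (R : realType) (I J K : choiceType)
    (T : mat R (I * K)%type) : mat R (I * J * K)%type :=
  flip23 (mtens T mone).

(* Unbounded operators are given by their graphs: Q x y says that x is in the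
   domain of Q and Q x = y. *)
Definition pos_selfadjoint (R : realType) (I : choiceType)
    (Q : vec R I -> vec R I -> Prop) : Prop :=
  [/\ (forall x y, Q x y -> l2 x /\ l2 y),
      (forall x, l2 x -> forall e : R, 0 < e ->
         exists x' y', Q x' y' /\ distsq_le x x' e),
      (forall y z, l2 y -> l2 z ->
         (Q y z <-> forall x w, Q x w -> dot y w = dot z x)) &
      (forall x y, Q x y -> 0 <= dot x y)].

(* The closure of the algebraic tensor product of Q with itself. *)
Definition graph_tens2 (R : realType) (I : choiceType)
    (Q : vec R I -> vec R I -> Prop) (u v : vec R (I * I)%type) : Prop :=
  [/\ l2 u, l2 v &
    forall e : R, 0 < e ->
      exists (n : nat) (x y x' y' : 'I_n -> vec R I),
        [/\ (forall k, Q (x k) (y k) /\ Q (x' k) (y' k)),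
            distsq_le u (fun p => \sum_(k < n) vtens (x k) (x' k) p) e &
            distsq_le v (fun p => \sum_(k < n) vtens (y k) (y' k) p) e]].

Definition pentagon (R : realType) (L : choiceType) (W : mat R (L * L)%type) :
    Prop :=
  mmul (leg23 W) (leg12 W) = mmul (leg12 W) (mmul (leg13 W) (leg23 W))
    :> mat R (L * L * L)%type.

(* Woronowicz's definition.  The conjugate Hilbert space of l2(L) is identified
   with l2(L) by entrywise conjugation. *)
Definition manageable (R : realType) (L : choiceType) (W : mat R (L * L)%type) :
    Prop :=
  exists (Q : vec R L -> vec R L -> Prop) (W' : mat R (L * L)%type),
    [/\ pos_selfadjoint Q,
        (forall x, Q x (fun=> 0) -> x = (fun=> 0)),
        unitary_op W',
        (forall u v, l2 u -> l2 v ->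
           (graph_tens2 Q u v <-> graph_tens2 Q (mapply W u) (mapply W v))) &
        (forall x z u u' y y', l2 x -> l2 z -> Q u u' -> Q y' y ->
           dot (vtens x u) (mapply W (vtens z y))
           = dot (vtens (vconj z) u') (mapply W' (vtens (vconj x) y')))].

(* Normal functionals on B(l2(L)): T |-> sum_n <x_n, T y_n> with
   sum_n |x_n|^2 and sum_n |y_n|^2 finite. *)
Definition normal_functional (R : realType) (L : choiceType)
    (w : mat R L -> R[i]) : Prop :=
  exists x y : nat -> vec R L,
    [/\ (\esum_(n in [set: nat]) normsq (x n) < +oo)%E,
        (\esum_(n in [set: nat]) normsq (y n) < +oo)%E &
        w = (fun T => csum (fun n : nat => dot (x n) (mapply T (y n))))].

(* (w (x) id) T *)
Definition lslice (R : realType) (I J : choiceType) (w : mat R I -> R[i])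
    (T : mat R (I * J)%type) : mat R J :=
  fun k l => w (fun i j => T (i, k) (j, l)).

(* (id (x) w) T *)
Definition rslice (R : realType) (I J : choiceType) (w : mat R J -> R[i])
    (T : mat R (I * J)%type) : mat R I :=
  fun i j => w (fun k l => T (i, k) (j, l)).

(* The pair (A, Delta_A) on l2(L) together with its dual. *)
Record qgroup (R : realType) := QGroup {
  qL : choiceType;
  qL_countable : countable [set: qL];
  qW : mat R (qL * qL)%type;
  qW_unitary : unitary_op qW;
  qW_pentagon : pentagon qW;
  qW_manageable : manageable qW;
  qA : set (mat R qL);
  qA_def : qA = cspan [set lslice w qW | w in @normal_functional R qL];
  qA_cstar : cstar qA;
  qAh : set (mat R qL);
  qAh_def : qAh = cspan [set rslice w qW | w in @normal_functional R qL];
  qAh_cstar : cstar qAh;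
  qW_mult : unitaries (atens qAh qA) qW;
  qD : mat R qL -> mat R (qL * qL)%type;
  qD_mor : morphism qA (atens qA qA) qD;
  qD_W : reassoc (tmor qAh qA id qD qW) = mmul (leg12 qW) (leg13 qW);
  qDh : mat R qL -> mat R (qL * qL)%type;
  qDh_mor : morphism qAh (atens qAh qAh) qDh;
  qDh_W : tmor qAh qA qDh id qW = mmul (leg23 qW) (leg13 qW) }.
Arguments qW {R} G _ _ : rename.
Arguments qA {R} G _ : rename.
Arguments qAh {R} G _ : rename.
Arguments qD {R} G _ _ _ : rename.
Arguments qDh {R} G _ _ _ : rename.

Definition compact_qgroup (R : realType) (G : qgroup R) : Prop := qA G mone.

Definition qWh (R : realType) (G : qgroup R) : mat R (qL G * qL G)%type :=
  flip (madj (qW G)).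
Arguments qWh {R} G _ _.

(* Stated for an arbitrary (A, D), to be used for both G and its dual. *)
Definition corep (R : realType) (L : choiceType) (A : set (mat R L))
    (D : mat R L -> mat R (L * L)%type) (H : choiceType)
    (U : mat R (H * L)%type) : Prop :=
  unitaries (atens (compacts R H) A) U /\
  reassoc (tmor (compacts R H) A id D U) = mmul (leg12 U) (leg13 U).

Definition coaction (R : realType) (L : choiceType) (A : set (mat R L))
    (D : mat R L -> mat R (L * L)%type) (I : choiceType) (C : set (mat R I))
    (g : mat R I -> mat R (I * L)%type) : Prop :=
  [/\ morphism C (atens C A) g,
      injective_on C g,
      (forall c, C c -> reassoc (tmor C A id D (g c)) = tmor C A g id (g c)) &
      sprod (g @` C) [set mtens mone a | a in A] = atens C A].

Definition equivariant (R : realType) (L : choiceType) (A : set (mat R L))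
    (I J : choiceType) (C : set (mat R I)) (g : mat R I -> mat R (I * L)%type)
    (d : mat R J -> mat R (J * L)%type) (f : mat R I -> mat R J) : Prop :=
  forall c, C c -> d (f c) = tmor C A f id (g c).

(* The universal dual of a C*-quantum group (A, D) whose reduced bicharacter W
   is in U(Ah (x) A). *)
Record udual (R : realType) (L : choiceType) (A Ah : set (mat R L))
    (D : mat R L -> mat R (L * L)%type) (W : mat R (L * L)%type) := UDual {
  uI : choiceType;
  uA : set (mat R uI);
  uA_cstar : cstar uA;
  uV : mat R (uI * L)%type;
  uV_mult : unitaries (atens uA A) uV;
  uV_corep : reassoc (tmor uA A id D uV) = mmul (leg12 uV) (leg13 uV);
  uA_span : uA = cspan [set rslice w uV | w in @normal_functional R L];
  uV_universal : forall (H : choiceType) (U : mat R (H * L)%type),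
    corep A D U ->
    exists r : mat R uI -> mat R H,
      [/\ representation uA r, tmor uA A r id uV = U &
          forall r' : mat R uI -> mat R H,
            representation uA r' -> tmor uA A r' id uV = U ->
            forall a, uA a -> r' a = r a];
  uD : mat R uI -> mat R (uI * uI)%type;
  uD_mor : morphism uA (atens uA uA) uD;
  uD_V : tmor uA A uD id uV = mmul (leg23 uV) (leg13 uV);
  uLam : mat R uI -> mat R L;
  uLam_mor : morphism uA Ah uLam;
  uLam_V : tmor uA A uLam id uV = W }.
Arguments uA {R L A Ah D W} u _ : rename.
Arguments uV {R L A Ah D W} u _ _ : rename.
Arguments uD {R L A Ah D W} u _ _ _ : rename.
Arguments uLam {R L A Ah D W} u _ _ _ : rename.

Record universal (R : realType) (G : qgroup R) := Universal {
  ud : udual (qA G) (qAh G) (qD G) (qW G);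
  udh : udual (qAh G) (qA G) (qDh G) (qWh G);
  Wu : mat R (uI ud * uI udh)%type;
  Wu_mult : unitaries (atens (uA ud) (uA udh)) Wu;
  Wu_l : tmor (uA ud) (uA udh) (uD ud)
           id Wu = mmul (leg23 Wu) (leg13 Wu);
  Wu_r : reassoc (tmor (uA ud) (uA udh) id
           (uD udh) Wu) = mmul (leg12 Wu) (leg13 Wu);
  Wu_lift : tmor (uA ud) (uA udh)
              (uLam ud) (uLam udh) Wu = qW G }.
Arguments Wu {R G} w _ _ : rename.

(* (phi, U) is a faithful covariant representation of (C, g) on l2(H), and r is
   the representation of the universal dual that corresponds to U. *)
Definition faithful_covrep (R : realType) (L : choiceType) (A Ah : set (mat R L))
    (D : mat R L -> mat R (L * L)%type) (W : mat R (L * L)%type)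
    (u : udual A Ah D W) (I : choiceType) (C : set (mat R I))
    (g : mat R I -> mat R (I * L)%type) (H : choiceType)
    (phi : mat R I -> mat R H) (U : mat R (H * L)%type)
    (r : mat R (uI u) -> mat R H) : Prop :=
  [/\ representation C phi /\ injective_on C phi,
      corep A D U,
      (forall c, C c ->
         tmor C A phi id (g c) = mconjg U (mtens (phi c) mone)),
      representation (uA u) r &
      tmor (uA u) A r id (uV u) = U].

(* E with i1 : C -> E and i2 : D -> E is (isomorphic to) the twisted tensor
   product of C (an A-coaction) and D (an Ah-coaction): th identifies E with the
   C*-algebra iota_C(C) . iota_D(D) on l2(H) (x) l2(K). *)
Definition twisted (R : realType) (G : qgroup R) (w : universal G)
    (I : choiceType) (C : set (mat R I)) (g : mat R I -> mat R (I * qL G)%type)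
    (J : choiceType) (D : set (mat R J)) (d : mat R J -> mat R (J * qL G)%type)
    (N : choiceType) (E : set (mat R N))
    (i1 : mat R I -> mat R N) (i2 : mat R J -> mat R N) : Prop :=
  [/\ [/\ cstar C, cstar D, coaction (qA G) (qD G) C g &
          coaction (qAh G) (qDh G) D d],
      [/\ cstar E, morphism C E i1, morphism D E i2 &
          sprod (i1 @` C) (i2 @` D) = E] &
      exists (H K : choiceType)
        (phi : mat R I -> mat R H) (U : mat R (H * qL G)%type)
        (r : mat R (uI (ud w)) -> mat R H)
        (psi : mat R J -> mat R K) (V : mat R (K * qL G)%type)
        (s : mat R (uI (udh w)) -> mat R K)
        (th : mat R N -> mat R (H * K)%type),
        let Z := madj (tmor (uA (ud w)) (uA (udh w))
                         r s (Wu w)) in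
        [/\ faithful_covrep C g phi U r,
            faithful_covrep D d psi V s,
            representation E th /\ injective_on E th,
            (forall c, C c -> th (i1 c) = mtens (phi c) mone) &
            (forall x, D x -> th (i2 x) = mconjg Z (mtens mone (psi x)))]].

(* h is the twisted tensor product of the equivariant morphisms f and g, from
   the model E (with i1, i2) to the model E' (with i1', i2'). *)
Definition is_bmor (R : realType) (I J N I' J' N' : choiceType)
    (C : set (mat R I)) (D : set (mat R J)) (E : set (mat R N))
    (i1 : mat R I -> mat R N) (i2 : mat R J -> mat R N)
    (E' : set (mat R N'))
    (i1' : mat R I' -> mat R N') (i2' : mat R J' -> mat R N')
    (f : mat R I -> mat R I') (g : mat R J -> mat R J')
    (h : mat R N -> mat R N') : Prop :=
  [/\ morphism E E' h,
      (forall c, C c -> h (i1 c) = i1' (f c)) &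
      (forall d, D d -> h (i2 d) = i2' (g d))].

Definition yetter_drinfeld (R : realType) (G : qgroup R) (I : choiceType)
    (B : set (mat R I)) (b bh : mat R I -> mat R (I * qL G)%type) : Prop :=
  [/\ cstar B,
      coaction (qA G) (qD G) B b,
      coaction (qAh G) (qDh G) B bh &
      (forall x, B x ->
         mconjg (leg23 (qW G)) (flip23 (tmor B (qAh G) b id (bh x)))
         = tmor B (qA G) bh id (b x))].

(* BB, with its embeddings and coactions, is a model of B [x] B.  Coassociativity
   compares two morphisms from B to models F of (B [x] B) [x] B and F' of
   B [x] (B [x] B), through the isomorphism al that intertwines the three
   embeddings of B. *)
Record braided_bialgebra (R : realType) (G : qgroup R) (w : universal G) :=
    BraidedBialgebra {
  bI : choiceType;
  bB : set (mat R bI);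
  bco : mat R bI -> mat R (bI * qL G)%type;
  bcoh : mat R bI -> mat R (bI * qL G)%type;
  b_yd : yetter_drinfeld bB bco bcoh;
  bbI : choiceType;
  bBB : set (mat R bbI);
  bi1 : mat R bI -> mat R bbI;
  bi2 : mat R bI -> mat R bbI;
  bb_twisted : twisted w bB bco bB bcoh bBB bi1 bi2;
  bbco : mat R bbI -> mat R (bbI * qL G)%type;
  bbcoh : mat R bbI -> mat R (bbI * qL G)%type;
  bb_yd : yetter_drinfeld bBB bbco bbcoh;
  bi1_equiv : equivariant (qA G) bB bco bbco bi1;
  bi1_equivh : equivariant (qAh G) bB bcoh bbcoh bi1;
  bi2_equiv : equivariant (qA G) bB bco bbco bi2;
  bi2_equivh : equivariant (qAh G) bB bcoh bbcoh bi2;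
  bD : mat R bI -> mat R bbI;
  bD_mor : morphism bB bBB bD;
  bD_equiv : equivariant (qA G) bB bco bbco bD;
  bD_equivh : equivariant (qAh G) bB bcoh bbcoh bD;
  bD_coassoc :
    exists (N N' : choiceType)
      (F : set (mat R N)) (f1 : mat R bbI -> mat R N) (f2 : mat R bI -> mat R N)
      (F' : set (mat R N'))
      (f1' : mat R bI -> mat R N') (f2' : mat R bbI -> mat R N')
      (al : mat R N -> mat R N')
      (Did : mat R bbI -> mat R N) (idD : mat R bbI -> mat R N'),
      [/\ twisted w bBB bbco bB bcoh F f1 f2 /\
          twisted w bB bco bBB bbcoh F' f1' f2',
          [/\ morphism F F' al, injective_on F al & al @` F = F'],
          (forall x, bB x ->
             [/\ al (f1 (bi1 x)) = f1' x, al (f1 (bi2 x)) = f2' (bi1 x) &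
                 al (f2 x) = f2' (bi2 x)]),
          is_bmor bB bB bBB bi1 bi2 F f1 f2 bD id Did /\
          is_bmor bB bB bBB bi1 bi2 F' f1' f2' id bD idD &
          forall x, bB x -> al (Did (bD x)) = idD (bD x)] }.
Arguments bB {R G w} B _ : rename.
Arguments bco {R G w} B _ _ _ : rename.
Arguments bcoh {R G w} B _ _ _ : rename.
Arguments bBB {R G w} B _ : rename.
Arguments bi1 {R G w} B _ _ _ : rename.
Arguments bi2 {R G w} B _ _ _ : rename.
Arguments bbco {R G w} B _ _ _ : rename.
Arguments bbcoh {R G w} B _ _ _ : rename.
Arguments bD {R G w} B _ _ _ : rename.

Definition braided_compact_qgroup (R : realType) (G : qgroup R)
    (w : universal G) (B : braided_bialgebra w) : Prop :=
  [/\ bB B mone,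
      sprod (bD B @` bB B) (bi1 B @` bB B) = bBB B &
      sprod (bD B @` bB B) (bi2 B @` bB B) = bBB B].

(* For unital C one has M(C) = C and M(C (x) C) = C (x) C. *)
Definition compact_quantum_group (R : realType) (I : choiceType)
    (C : set (mat R I)) (D : mat R I -> mat R (I * I)%type) : Prop :=
  [/\ cstar C /\ C mone,
      morphism C (atens C C) D /\ D mone = mone,
      (forall c, C c -> tmor C C D id (D c) = reassoc (tmor C C id D (D c))),
      sprod (D @` C) [set mtens mone c | c in C] = atens C C &
      sprod (D @` C) [set mtens c mone | c in C] = atens C C].

(* Psi : A [x] B [x] B -> (A [x] B) (x) (A [x] B), where C (with iA, iB) is a
   model of A [x] B and T (with tA, tBB) is a model of A [x] (B [x] B). *)
Definition is_Psi (R : realType) (G : qgroup R) (w : universal G)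
    (B : braided_bialgebra w) (N M : choiceType)
    (C : set (mat R N))
    (iA : mat R (qL G) -> mat R N) (iB : mat R (bI B) -> mat R N)
    (T : set (mat R M))
    (tA : mat R (qL G) -> mat R M) (tBB : mat R (bbI B) -> mat R M)
    (Psi : mat R M -> mat R (N * N)%type) : Prop :=
  [/\ morphism T (atens C C) Psi,
      (forall a, qA G a -> Psi (tA a) = tmor (qA G) (qA G) iA iA (qD G a)),
      (forall x, bB B x -> Psi (tBB (bi1 B x)) = tmor (bB B) (qA G) iB iA (bco B x)) &
      (forall x, bB B x -> Psi (tBB (bi2 B x)) = mtens mone (iB x))].

(* Main.v *)
(* Write [J] for the restriction of [Psi] to [B [x] B].

   Heisenberg form.  [Delta_A] is conjugation by [W]; hence [(Lam (x) id) Delta^u]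
   is conjugation by the flipped fundamental unitary of the universal dual.
   Applied to [W^u], for both duals, this gives [U_13 V_23 Z_12 = V_23 U_13].  So
   conjugation by [U_13 V_23] turns the model [iota_C(C) iota_D(D)] of [C [x] D]
   into the C*-algebra generated by [((phi (x) id) gamma(c))_13] and
   [((psi (x) id) delta(d))_23], a form in which [phi] and [psi] can be replaced by
   arbitrary homomorphisms.

   Coassociativity.  On [iota_A(A)] it is that of [Delta_A].  For [b] in [B], apply
   the Heisenberg form of [C] in the third leg.  With the homomorphisms
   [(J (x) phi) beta] and [psi], the Heisenberg form of [(B [x] B) [x] B] yields a
   homomorphism that maps [(Delta_B [x] id) Delta_B(b)] to one side and
   [(id [x] Delta_B) Delta_B(b)] to the other.

   Cancellation.  One combines [B [x] B = Delta_B(B) iota_1(B) = Delta_B(B) iota_2(B)]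
   with [beta(B)(1 (x) A) = B (x) A], [Delta_A(A)(1 (x) A) = A (x) A] and
   [Delta_A(A)(A (x) 1) = A (x) A].  The last equality holds because
   [W_13^* (x (x) a (x) 1)] is a limit of sums of
   [(id (x) Delta_A)(W^* (x' (x) 1)) (1 (x) a' (x) 1)], as [W (x (x) a)] is in
   [Ah (x) A]. *)
Require Import Defs.
From HB Require Import structures.
From mathcomp Require Import all_boot all_order all_algebra.
From mathcomp Require Import complex ring lra.
From mathcomp Require Import all_classical all_reals all_analysis.

Set Implicit Arguments.
Unset Strict Implicit.
Unset Printing Implicit Defensive.

Import Order.TTheory GRing.Theory Num.Theory ComplexField Normc.

Local Open Scope classical_set_scope.
Local Open Scope ring_scope.

(** * Sums and operators on l2 in matrix form *)

(** The twisted tensor product is defined through representations of universal duals, and [tmor]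
    through a choice among nondegenerate representations, so neither can be computed with directly.
    The way out is to let $f\otimes g$ act on matrix entries, as [amq g (amp f m)]. This agrees with
    [tmor] on multipliers ([tmorE]), and then leg-numbered identities become identities between
    blocks of matrices. The obstacle is that a product of infinite block matrices is an infinite
    sum, which a *-homomorphism need not respect. Boundedness is therefore checked on finite
    corners, that is, on matrices over the algebra, and multiplicativity by testing against compact
    operators; nondegeneracy is used in the form $f(A)\mathbb K=\mathbb K$. Contractivity of
    *-homomorphisms and isometry of injective ones come from a square root iteration and from
    identities between sums of squares, in place of spectral theory. Once $A$ and $B$ are unital,
    the maps on $C$ are treated as plain unital *-homomorphisms; $\hat A$, which need not be unital,
    is handled through multipliers throughout. *)

Section Modulus.
Context {R : realType}.
Implicit Types (x y z : R[i]) (I : choiceType).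

Lemma normc_ge0 z : 0 <= normc z.
Proof. by case: z => a b; exact: sqrtr_ge0. Qed.

Lemma normcD x y : normc (x + y) <= normc x + normc y.
Proof. exact: le_normcD. Qed.

Lemma normcN' x : normc (- x) = normc x.
Proof. exact: (@normcN R x). Qed.

Lemma normc_0 : normc (0 : R[i]) = 0.
Proof. exact: normc0. Qed.

Lemma normc_1 : normc (1 : R[i]) = 1.
Proof. exact: normc1. Qed.

Lemma normcJ x : normc (Num.conj x) = normc x.
Proof. by case: x => a b /=; rewrite sqrrN. Qed.

Lemma sqr_normc x : normc x ^+ 2 = complex.Re x ^+ 2 + complex.Im x ^+ 2.
Proof. by case: x => a b; rewrite /= sqr_sqrtr // addr_ge0 // sqr_ge0. Qed.

Lemma normc_Re x : `|complex.Re x| <= normc x.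
Proof.
rewrite -(ler_pXn2r (n := 2)) ?nnegrE ?normc_ge0 // sqr_normc real_normK ?num_real //.
by rewrite lerDl sqr_ge0.
Qed.

Lemma normc_Im x : `|complex.Im x| <= normc x.
Proof.
rewrite -(ler_pXn2r (n := 2)) ?nnegrE ?normc_ge0 // sqr_normc real_normK ?num_real //.
by rewrite lerDr sqr_ge0.
Qed.

Lemma normc_real (r : R) : normc (r%:C)%C = `|r|.
Proof. by rewrite /= expr0n addr0 sqrtr_sqr. Qed.

Lemma normc_sum (I : Type) (s : seq I) (f : I -> R[i]) :
  normc (\sum_(i <- s) f i) <= \sum_(i <- s) normc (f i).
Proof.
elim: s => [|i s IH]; first by rewrite !big_nil normc_0.
by rewrite !big_cons (le_trans (normcD _ _)) // lerD2l.
Qed.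

Lemma normc_eps x y : (forall e, 0 < e -> normc (x - y) <= e) -> x = y.
Proof.
move=> h; apply/eqP; rewrite -subr_eq0; apply/eqP/eq0_normc/eqP.
rewrite eq_le normc_ge0 andbT; apply/ler_addgt0Pr => e e0.
by rewrite add0r; exact: h.
Qed.

Lemma mulJ_normc x : Num.conj x * x = ((normc x ^+ 2)%:C)%C.
Proof.
rewrite sqr_normc; case: x => a b; apply/eqP; rewrite eq_complex /=.
by apply/andP; split; apply/eqP; ring.
Qed.

Lemma sum_real (I : Type) (s : seq I) (f : I -> R) :
  \sum_(i <- s) (f i)%:C%C = (\sum_(i <- s) f i)%:C%C :> R[i].
Proof. by rewrite rmorph_sum. Qed.

Lemma Re_sum (I : Type) (s : seq I) (f : I -> R[i]) :
  complex.Re (\sum_(i <- s) f i) = \sum_(i <- s) complex.Re (f i).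
Proof. by apply: (big_morph _ (id1 := 0)) => //; case=> a b [c d]. Qed.

Lemma Im_sum (I : Type) (s : seq I) (f : I -> R[i]) :
  complex.Im (\sum_(i <- s) f i) = \sum_(i <- s) complex.Im (f i).
Proof. by apply: (big_morph _ (id1 := 0)) => //; case=> a b [c d]. Qed.

Lemma conj_sum (I : Type) (s : seq I) (f : I -> R[i]) :
  Num.conj (\sum_(i <- s) f i) = \sum_(i <- s) Num.conj (f i).
Proof. exact: rmorph_sum. Qed.

End Modulus.

(** * Unordered sums of complex families *)

Section Summation.
Context {R : realType}.
Implicit Types (I J : choiceType).

(** Convergence along the directed set of finite index sets, given by duplicate-free lists. [csum]
    is assembled from suprema of positive and negative parts; it is computed through this relation
    ([csumE]) for families that satisfy [abs_bounded]. *)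
Definition hassum I (f : I -> R[i]) (z : R[i]) : Prop :=
  forall e : R, 0 < e -> exists s0 : seq I, forall s, uniq s -> {subset s0 <= s} ->
    normc (\sum_(i <- s) f i - z) <= e.

Definition abs_bounded I (M : R) (f : I -> R[i]) : Prop :=
  forall s : seq I, uniq s -> \sum_(i <- s) normc (f i) <= M.

Lemma sum_subset I (f : I -> R) (s t : seq I) : uniq s -> uniq t ->
  (forall i, 0 <= f i) -> {subset s <= t} ->
  \sum_(i <- s) f i <= \sum_(i <- t) f i.
Proof.
move=> us ut f0 st; rewrite [leRHS](bigID (mem s)) /=.
rewrite -[X in _ <= X + _]big_filter.
have -> : \sum_(i <- [seq x <- t | x \in s]) f i = \sum_(i <- s) f i.
  apply: perm_big; apply: uniq_perm => //; first exact: filter_uniq.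
  move=> x; rewrite mem_filter; case xs: (x \in s) => //=.
  exact: st.
by rewrite lerDl sumr_ge0.
Qed.

Lemma sumB_subset I (V : zmodType) (f : I -> V) (s t : seq I) : uniq s -> uniq t ->
  {subset s <= t} ->
  \sum_(i <- t) f i - \sum_(i <- s) f i = \sum_(i <- [seq x <- t | x \notin s]) f i.
Proof.
move=> us ut st; rewrite [X in X - _](bigID (mem s)) /= -[X in X + _ - _]big_filter.
have -> : \sum_(i <- [seq x <- t | x \in s]) f i = \sum_(i <- s) f i.
  apply: perm_big; apply: uniq_perm => //; first exact: filter_uniq.
  move=> x; rewrite mem_filter; case xs: (x \in s) => //=.
  exact: st.
by rewrite [X in X - _]addrC addrK big_filter.
Qed.

(** Translates an extended-real sum into the two halves of the description of a supremum over
    duplicate-free lists; the bound [M] makes the sum finite, so that [fine] loses nothing. *)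
Lemma esum_seqP I (f : I -> R) (M : R) : (forall i, 0 <= f i) ->
  (forall s : seq I, uniq s -> \sum_(i <- s) f i <= M) ->
  let S := fine (\esum_(i in [set: I]) (f i)%:E) in
  (forall s : seq I, uniq s -> \sum_(i <- s) f i <= S) /\
  (forall e, 0 < e -> exists2 s : seq I, uniq s & S - e <= \sum_(i <- s) f i).
Proof.
move=> f0 fM S.
have le1 (s : seq I) : uniq s ->
    ((\sum_(i <- s) f i)%:E <= \esum_(i in [set: I]) (f i)%:E)%E.
  move=> us; apply: esum_ge; exists [set` s].
    by split => //; exact: finite_seq.
  by rewrite -fsbig_seq // sumEFin.
have le2 : (\esum_(i in [set: I]) (f i)%:E <= M%:E)%E.
  apply: ge_ereal_sup => /= _ [X [/finite_seqP[s Xs] _] <-].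
  rewrite Xs; have -> : [set` s] = [set` undup s] by apply/seteqP; split=> i /=; rewrite mem_undup.
  by rewrite -fsbig_seq ?undup_uniq // sumEFin lee_fin fM // undup_uniq.
have ge0 : (0 <= \esum_(i in [set: I]) (f i)%:E)%E.
  by apply: esum_ge0 => i _; rewrite lee_fin.
have fS : (\esum_(i in [set: I]) (f i)%:E = S%:E)%E.
  by rewrite fineK // ge0_fin_numE // (le_lt_trans le2) ?ltry.
split=> [s us|e e0]; first by rewrite -lee_fin -fS le1.
have : (S%:E - e%:E < \esum_(i in [set: I]) (f i)%:E)%E.
  by rewrite fS -EFinB lte_fin ltrBlDr ltrDl.
move=> /ereal_sup_gt [_ [X [/finite_seqP[s Xs] _] <-]].
rewrite Xs; have -> : [set` s] = [set` undup s] by apply/seteqP; split=> i /=; rewrite mem_undup.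
rewrite -fsbig_seq ?undup_uniq // sumEFin -EFinB lte_fin => /ltW h.
by exists (undup s); rewrite ?undup_uniq.
Qed.

Lemma csum_part I (f : I -> R) (M : R) :
  (forall s : seq I, uniq s -> \sum_(i <- s) `|f i| <= M) ->
  forall e, 0 < e -> exists s0 : seq I, forall s, uniq s -> {subset s0 <= s} ->
   `|\sum_(i <- s) f i -
    (fine (\esum_(i in [set: I]) (Num.max (f i) 0)%:E)
    - fine (\esum_(i in [set: I]) (Num.max (- f i) 0)%:E))| <= e.
Proof.
move=> fM e e0.
have e20 : 0 < e / 2 by rewrite divr_gt0.
have h (g : I -> R) : (forall i, 0 <= g i <= `|f i|) ->
    let S := fine (\esum_(i in [set: I]) (g i)%:E) in
    exists s0 : seq I, forall s, uniq s -> {subset s0 <= s} ->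
       `|\sum_(i <- s) g i - S| <= e / 2.
  move=> gf S; have [||h1 h2] := @esum_seqP I g M.
  - by move=> i; case/andP: (gf i).
  - move=> s us; apply: le_trans (fM s us).
    by apply: ler_sum => i _; case/andP: (gf i).
  - have [s0 us0 hs0] := h2 _ e20; exists s0 => s us ss.
    rewrite ler_norml; apply/andP; split; last first.
      rewrite lerBlDr (le_trans (h1 _ us)) // lerDr ltW //.
    rewrite lerBrDl (le_trans hs0) // sum_subset //.
    by move=> i; case/andP: (gf i).
have [i|s1 hs1] := h (fun i => Num.max (f i) 0).
  by rewrite le_max lexx orbT ge_max ler_norm normr_ge0.
have [i|s2 hs2] := h (fun i => Num.max (- f i) 0).
  by rewrite le_max lexx orbT ge_max -normrN ler_norm normr_ge0.
exists (s1 ++ s2) => s us ss.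
have ss1 : {subset s1 <= s} by move=> x xs; apply: ss; rewrite mem_cat xs.
have ss2 : {subset s2 <= s} by move=> x xs; apply: ss; rewrite mem_cat xs orbT.
have := hs1 s us ss1; have := hs2 s us ss2 => H2 H1.
have -> : \sum_(i <- s) f i =
    \sum_(i <- s) Num.max (f i) 0 - \sum_(i <- s) Num.max (- f i) 0.
  rewrite -sumrB; apply: eq_bigr => i _.
  have [h0|/ltW h0] := leP (f i) 0.
    by rewrite (max_l (y := 0)) ?oppr_ge0 // sub0r opprK.
  by rewrite (max_r (x := - f i)) ?oppr_le0 // subr0.
rewrite (_ : forall a b c d : R, a - b - (c - d) = (a - c) - (b - d)); last by move=> *; ring.
by rewrite (le_trans (ler_normB _ _)) // [e]splitr lerD.
Qed.

Lemma hassum_csum I (M : R) (f : I -> R[i]) : abs_bounded M f -> hassum f (csum f).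
Proof.
move=> fM e e0; have e20 : 0 < e / 2 by rewrite divr_gt0.
have [|s1 h1] := @csum_part I (fun i => complex.Re (f i)) M _ _ e20.
  move=> s us; apply: le_trans (fM s us); apply: ler_sum => i _; exact: normc_Re.
have [|s2 h2] := @csum_part I (fun i => complex.Im (f i)) M _ _ e20.
  move=> s us; apply: le_trans (fM s us); apply: ler_sum => i _; exact: normc_Im.
exists (s1 ++ s2) => s us ss.
have ss1 : {subset s1 <= s} by move=> x xs; apply: ss; rewrite mem_cat xs.
have ss2 : {subset s2 <= s} by move=> x xs; apply: ss; rewrite mem_cat xs orbT.
have {h1} := h1 s us ss1; have {h2} := h2 s us ss2.
rewrite /csum; set a := fine _ - fine _; set b := fine _ - fine _ => h1 h2.
set S := \sum_(i <- s) f i.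
have -> : S - Complex b a = ((complex.Re S - b)%:C)%C + ((complex.Im S - a)%:C)%C * Complex 0 1.
  by case: S => u v; apply/eqP; rewrite eq_complex /=; apply/andP; split; apply/eqP; ring.
rewrite (le_trans (normcD _ _)) // normcM !normc_real.
have -> : normc (Complex 0 (1 : R)) = 1 by rewrite /= expr0n expr1n add0r sqrtr1.
by rewrite mulr1 [e]splitr lerD // /S ?Re_sum ?Im_sum.
Qed.

Lemma hassum_uniq I (f : I -> R[i]) z w : hassum f z -> hassum f w -> z = w.
Proof.
move=> hz hw; apply: normc_eps => e e0; have e20 : 0 < e / 2 by rewrite divr_gt0.
have [s1 h1] := hz _ e20; have [s2 h2] := hw _ e20.
have us := undup_uniq (s1 ++ s2); set s := undup _ in us.
have ss1 : {subset s1 <= s} by move=> x xs; rewrite mem_undup mem_cat xs.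
have ss2 : {subset s2 <= s} by move=> x xs; rewrite mem_undup mem_cat xs orbT.
have := h1 s us ss1; have := h2 s us ss2; set S := \sum_(i <- s) _ => H2 H1.
rewrite (_ : z - w = (S - w) - (S - z)); last by ring.
by rewrite (le_trans (normcD _ _)) // normcN' [e]splitr lerD.
Qed.

Lemma csumE I (M : R) (f : I -> R[i]) z : abs_bounded M f -> hassum f z -> csum f = z.
Proof. by move=> /hassum_csum h1 h2; exact: hassum_uniq h1 h2. Qed.

Lemma hassum_lin I (c : R[i]) (f g : I -> R[i]) z w :
  hassum f z -> hassum g w -> hassum (fun i => c * f i + g i) (c * z + w).
Proof.
move=> hz hw e e0; set n := normc c + 1.
have n0 : 0 < n by rewrite ltr_pwDr // normc_ge0.
have e1 : 0 < e / (2 * n) by rewrite divr_gt0 // mulr_gt0.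
have e20 : 0 < e / 2 by rewrite divr_gt0.
have [s1 h1] := hz _ e1; have [s2 h2] := hw _ e20.
exists (s1 ++ s2) => s us ss.
have ss1 : {subset s1 <= s} by move=> x xs; apply: ss; rewrite mem_cat xs.
have ss2 : {subset s2 <= s} by move=> x xs; apply: ss; rewrite mem_cat xs orbT.
rewrite big_split /= -mulr_sumr.
rewrite (_ : forall a b c' d : R[i], c * a + b - (c * c' + d) = c * (a - c') + (b - d)); last first.
  by move=> *; ring.
rewrite (le_trans (normcD _ _)) // normcM [e]splitr lerD ?h2 //.
apply: le_trans (_ : n * (e / (2 * n)) <= _).
  by apply: ler_pM; rewrite ?normc_ge0 ?h1 // /n lerDl.
by rewrite le_eqVlt; apply/orP; left; apply/eqP; field; rewrite gt_eqF.
Qed.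

Lemma hassum0 I : hassum (fun _ : I => 0 : R[i]) 0.
Proof. by move=> e e0; exists [::] => s _ _; rewrite big1 // subr0 normc_0 ltW. Qed.

Lemma hassumD I (f g : I -> R[i]) z w :
  hassum f z -> hassum g w -> hassum (fun i => f i + g i) (z + w).
Proof.
move=> h1 h2; have := hassum_lin 1 h1 h2; rewrite mul1r.
by under [X in hassum X _]eq_fun do rewrite mul1r.
Qed.

Lemma hassumZ I c (f : I -> R[i]) z :
  hassum f z -> hassum (fun i => c * f i) (c * z).
Proof.
move=> h1; have := hassum_lin c h1 (hassum0 I); rewrite addr0.
by under [X in hassum X _]eq_fun do rewrite addr0.
Qed.

Lemma hassum_sum I (J : Type) (s : seq J) (f : J -> I -> R[i]) (z : J -> R[i]) :
  (forall j, hassum (f j) (z j)) ->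
  hassum (fun i => \sum_(j <- s) f j i) (\sum_(j <- s) z j).
Proof.
move=> h; elim: s => [|j s IH].
  rewrite big_nil (_ : (fun _ => _) = (fun=> 0)); first exact: hassum0.
  by apply/funext => i; rewrite big_nil.
rewrite big_cons (_ : (fun _ => _) = (fun i => f j i + \sum_(k <- s) f k i)).
  exact: hassumD.
by apply/funext => i; rewrite big_cons.
Qed.

Lemma hassumJ I (f : I -> R[i]) z :
  hassum f z -> hassum (fun i => Num.conj (f i)) (Num.conj z).
Proof.
move=> h e e0; have [s0 hs] := h e e0; exists s0 => s us ss.
by rewrite -conj_sum -rmorphB /= normcJ hs.
Qed.

Lemma hassum_fin I (s : seq I) (f : I -> R[i]) : uniq s ->
  (forall i, i \notin s -> f i = 0) -> hassum f (\sum_(i <- s) f i).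
Proof.
move=> us fs e e0; exists s => t ut st; rewrite sumB_subset // big_seq big1.
  by rewrite normc_0 ltW.
by move=> i; rewrite mem_filter => /andP[/fs].
Qed.

Lemma csum_fin I (s : seq I) (f : I -> R[i]) : uniq s ->
  (forall i, i \notin s -> f i = 0) -> csum f = \sum_(i <- s) f i.
Proof.
move=> us fs; apply: (@csumE _ (\sum_(i <- s) normc (f i))) => [t ut|]; last exact: hassum_fin.
rewrite (bigID (mem s)) /= [X in _ + X]big1 ?addr0; last by move=> i /fs ->; rewrite normc_0.
rewrite -big_filter; apply: sum_subset; rewrite ?filter_uniq //.
  by move=> i; exact: normc_ge0.
by move=> i; rewrite mem_filter => /andP[].
Qed.

Lemma hassum_le I (f : I -> R[i]) z M : hassum f z ->
  (forall s : seq I, uniq s -> normc (\sum_(i <- s) f i) <= M) -> normc z <= M.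
Proof.
move=> h fM; apply/ler_addgt0Pr => e e0.
have [s0 hs] := h e e0; have us := undup_uniq s0.
have /(hs _ us) H : {subset s0 <= undup s0} by move=> x; rewrite mem_undup.
set S := \sum_(i <- _) _ in H.
rewrite (_ : z = S - (S - z)); last by ring.
by rewrite (le_trans (normcD _ _)) // normcN' lerD // fM.
Qed.

Lemma hassum_reindex I J (u : J -> I) (v : I -> J) (f : I -> R[i]) z :
  cancel u v -> cancel v u -> hassum f z -> hassum (fun j => f (u j)) z.
Proof.
move=> uK vK h e e0; have [s0 hs] := h e e0; exists (map v s0) => s us ss.
rewrite -(big_map u predT f); apply: hs.
  by rewrite map_inj_uniq //; exact: can_inj uK.
by move=> x xs; rewrite -[x]vK map_f // ss // map_f.
Qed.

(** Every finite set of pairs lies in a rectangle, so the product family is absolutely bounded by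
    [M * N] and its sum exists. Sums over large rectangles factor, which identifies the value. *)
Lemma hassum_prod I J (f : I -> R[i]) (g : J -> R[i]) z w :
  hassum f z -> hassum g w ->
  (exists M, abs_bounded M f) -> (exists M, abs_bounded M g) ->
  (exists M, abs_bounded M (fun p : I * J => f p.1 * g p.2)) /\
  hassum (fun p : I * J => f p.1 * g p.2) (z * w).
Proof.
move=> hz hw [M hM] [N hN].
have sub (s : seq (I * J)) : {subset s <= allpairs pair (undup (map fst s)) (undup (map snd s))}.
  move=> [i j] ij; apply: allpairs_f; rewrite mem_undup;
  [exact: (map_f fst ij)|exact: (map_f snd ij)].
have upr (s : seq I) (t : seq J) : uniq s -> uniq t -> uniq (allpairs pair s t).
  by move=> us ut; apply: allpairs_uniq => // -[a b] [c d].
have M0 : 0 <= M by rewrite (le_trans _ (hM [::] isT)) // big_nil.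
have N0 : 0 <= N by rewrite (le_trans _ (hN [::] isT)) // big_nil.
have AB : abs_bounded (M * N) (fun p : I * J => f p.1 * g p.2).
  move=> s us; apply: le_trans (sum_subset us (upr _ _ (undup_uniq _) (undup_uniq _)) _ (sub s)) _.
    by move=> p; exact: normc_ge0.
  rewrite big_allpairs /=.
  under eq_bigr do (under eq_bigr do rewrite normcM; rewrite -mulr_sumr).
  rewrite -mulr_suml; apply: ler_pM.
  - by apply: sumr_ge0 => i _; exact: normc_ge0.
  - by apply: sumr_ge0 => i _; exact: normc_ge0.
  - exact/hM/undup_uniq.
  - exact/hN/undup_uniq.
split; first by exists (M * N).
suff -> : z * w = csum (fun p : I * J => f p.1 * g p.2) by exact: hassum_csum AB.
have hp := hassum_csum AB; set c := csum _ in hp *.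
apply: normc_eps => e e0.
(* With this radius the error [M * d + d * N] of a product of partial sums stays below [e / 2]. *)
pose d := Num.min (1 : R) (e / (2 * (M + N + 1))).
have K0 : 0 < M + N + 1 by rewrite ltr_wpDl // addr_ge0.
have d0 : 0 < d by rewrite lt_min ltr01 /= divr_gt0 // mulr_gt0.
have e20 : 0 < e / 2 by rewrite divr_gt0.
have [s0 hs] := hp _ e20; have [s1 hs1] := hz _ d0; have [t1 ht1] := hw _ d0.
set s := undup (s1 ++ map fst s0); set t := undup (t1 ++ map snd s0).
have us : uniq s by exact: undup_uniq.
have ut : uniq t by exact: undup_uniq.
have H : normc (\sum_(p <- allpairs pair s t) f p.1 * g p.2 - c) <= e / 2.
  apply: hs; first exact: upr.
  move=> [i j] ij; apply: allpairs_f; rewrite mem_undup mem_cat;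
   apply/orP; right; [exact: (map_f fst ij)|exact: (map_f snd ij)].
have {hs1} : normc (\sum_(i <- s) f i - z) <= d.
  by apply: hs1 => // x xs; rewrite mem_undup mem_cat xs.
have {ht1} : normc (\sum_(i <- t) g i - w) <= d.
  by apply: ht1 => // x xs; rewrite mem_undup mem_cat xs.
move: H; rewrite big_allpairs /=.
under eq_bigr do rewrite -mulr_sumr.
rewrite -mulr_suml; set F := \sum_(i <- s) _; set G := \sum_(i <- t) _ => H hG hF.
have FM : normc F <= M by rewrite (le_trans (normc_sum _ _)) // hM.
have wN : normc w <= N by apply: hassum_le hw _ => r ur; rewrite (le_trans (normc_sum _ _)) // hN.
rewrite (_ : z * w - c = (F * G - c) - (F * (G - w) + (F - z) * w)); last by ring.
rewrite (le_trans (normcD _ _)) // normcN' [e]splitr lerD //.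
rewrite (le_trans (normcD _ _)) // !normcM.
apply: le_trans (_ : M * d + d * N <= _).
  by apply: lerD; apply: ler_pM; rewrite ?normc_ge0.
have : d <= e / (2 * (M + N + 1)) by rewrite ge_min lexx orbT.
rewrite ler_pdivlMr ?mulr_gt0 // => hd.
rewrite ler_pdivlMr //; nra.
Qed.

End Summation.

(** * Bounded operators as matrices: norm bounds, adjoints, products *)

Section Operators.
Context {R : realType}.
Implicit Types (I J K L : choiceType) (M N : R).

Definition nrm I (s : seq I) (x : I -> R[i]) : R :=
  Num.sqrt (\sum_(i <- s) normc (x i) ^+ 2).

Lemma nrm_ge0 I (s : seq I) x : 0 <= nrm s x.
Proof. exact: sqrtr_ge0. Qed.

Lemma sqr_nrm I (s : seq I) x : nrm s x ^+ 2 = \sum_(i <- s) normc (x i) ^+ 2.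
Proof. by rewrite sqr_sqrtr // sumr_ge0 // => i _; rewrite sqr_ge0. Qed.

Lemma eq_nrm I (s : seq I) x y : {in s, x =1 y} -> nrm s x = nrm s y.
Proof. by move=> xy; congr Num.sqrt; apply: eq_big_seq => i /xy ->. Qed.

Lemma nrm_sub I (s t : seq I) x : uniq s -> uniq t -> {subset s <= t} ->
  nrm s x <= nrm t x.
Proof.
by move=> us ut st; apply: ler_wsqrtr; apply: sum_subset => // i; rewrite sqr_ge0.
Qed.

Lemma nrmJ I (s : seq I) x : nrm s (fun i => Num.conj (x i)) = nrm s x.
Proof. by congr Num.sqrt; apply: eq_bigr => i _; rewrite normcJ. Qed.

Lemma nrm1 I (i : I) x : nrm [:: i] x = normc (x i).
Proof. by rewrite /nrm big_seq1 sqrtr_sqr ger0_norm // normc_ge0. Qed.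

Lemma cauchy_schwarz I (s : seq I) (x y : I -> R[i]) :
  \sum_(i <- s) normc (x i) * normc (y i) <= nrm s x * nrm s y.
Proof.
elim: s => [|i s IH]; first by rewrite big_nil mulr_ge0 // nrm_ge0.
rewrite big_cons; set S := \sum_(j <- s) _ in IH *.
have S0 : 0 <= S by apply: sumr_ge0 => j _; rewrite mulr_ge0 // normc_ge0.
have := nrm_ge0 s x; have := nrm_ge0 s y; have := sqr_nrm s x; have := sqr_nrm s y.
set p := nrm s x in IH *; set q := nrm s y in IH * => hq hp q0 p0.
have := nrm_ge0 (i :: s) x; have := nrm_ge0 (i :: s) y.
have := sqr_nrm (i :: s) x; have := sqr_nrm (i :: s) y; rewrite !big_cons -hp -hq.
set p' := nrm _ x; set q' := nrm _ y => hq' hp' q'0 p'0.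
have a0 := normc_ge0 (x i); have b0 := normc_ge0 (y i).
set a := normc (x i) in a0 hp' *; set b := normc (y i) in b0 hq' *.
rewrite -(ler_pXn2r (n := 2)) ?nnegrE ?addr_ge0 ?mulr_ge0 //.
rewrite exprMn hp' hq'.
apply: le_trans (_ : (a * b + p * q) ^+ 2 <= _).
  by rewrite ler_pXn2r ?nnegrE ?addr_ge0 ?mulr_ge0 // lerD2l.
(* Lagrange's identity: $(a^2+p^2)(b^2+q^2)-(ab+pq)^2=(aq-bp)^2$. *)
rewrite -subr_ge0 (_ : _ - _ = (a * q - b * p) ^+ 2) ?sqr_ge0 //; ring.
Qed.

Lemma normc_dot_le I (s : seq I) (x y : I -> R[i]) :
  normc (\sum_(i <- s) x i * y i) <= nrm s x * nrm s y.
Proof.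
apply: le_trans (cauchy_schwarz s x y); apply: le_trans (normc_sum _ _) _.
by apply: ler_sum => i _; rewrite normcM.
Qed.

Definition op I J := I -> J -> R[i].

Definition opmul I J K (S : op I J) (T : op J K) : op I K :=
  fun i k => csum (fun j => S i j * T j k).
Local Notation "S ** T" := (opmul S T) (at level 40, left associativity).

Definition opadj I J (T : op I J) : op J I := fun j i => Num.conj (T i j).

Definition opscale I J (c : R[i]) (T : op I J) : op I J := fun i j => c * T i j.

(** The operator norm is bounded through the sesquilinear form on finite supports. In contrast to
    [opnorm_le], rows and columns have separate index sets and supports, so that vectors are covered
    as operators from [unit], and [0 <= M] is part of the notion because [opnorm_le] only sees the
    square of [M]. *)
Definition bnd I J M (T : op I J) : Prop :=
  0 <= M /\ forall s t, uniq s -> uniq t -> forall (y : I -> R[i]) (x : J -> R[i]),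
  normc (\sum_(i <- s) \sum_(j <- t) Num.conj (y i) * T i j * x j)
    <= M * (nrm s y * nrm t x).

Definition bounded I J (T : op I J) : Prop := exists M, bnd M T.

Lemma bnd_ge0 I J M (T : op I J) : bnd M T -> 0 <= M.
Proof. by case. Qed.

Lemma bnd_bounded I J M (T : op I J) : bnd M T -> bounded T.
Proof. by exists M. Qed.

Lemma bnd_opnorm_le I M (T : mat R I) : bnd M T -> opnorm_le M T.
Proof.
case=> M0 h s us x y; have := h s s us us y x.
set S := \sum_(i <- s) _ => H.
have E (z : vec R I) : \sum_(i <- s) `|z i| ^+ 2 = ((nrm s z ^+ 2)%:C)%C :> R[i].
  by rewrite sqr_nrm -sum_real; apply: eq_bigr => i _; rewrite rmorphXn.
rewrite !E -[Complex _ 0]/((M ^+ 2)%:C)%C.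
rewrite (_ : `|S| ^+ 2 = ((normc S ^+ 2)%:C)%C); last by rewrite rmorphXn.
rewrite -!rmorphM /= lecR -!exprMn ler_pXn2r ?nnegrE ?normc_ge0 //; first by rewrite -mulrA.
by rewrite !mulr_ge0 // nrm_ge0.
Qed.

(** Both test vectors are extended by zero to the union [r] of their supports, where [opnorm_le]
    applies with a single list. *)
Lemma opnorm_le_bnd I M (T : mat R I) : 0 <= M -> opnorm_le M T -> bnd M T.
Proof.
move=> M0 h; split=> // s t us ut y x.
pose r := undup (s ++ t); have ur : uniq r by exact: undup_uniq.
pose y' i := if i \in s then y i else 0; pose x' i := if i \in t then x i else 0.
have sr : {subset s <= r} by move=> i is_; rewrite mem_undup mem_cat is_.
have tr : {subset t <= r} by move=> i is_; rewrite mem_undup mem_cat is_ orbT.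
have sumE (V : zmodType) (u : seq I) (f : I -> V) : uniq u -> {subset u <= r} ->
    \sum_(i <- r) (if i \in u then f i else 0) = \sum_(i <- u) f i.
  move=> uu ur'; rewrite -big_mkcond -big_filter; apply: perm_big.
  apply: uniq_perm; rewrite ?filter_uniq // => i; rewrite mem_filter.
  by case iu: (i \in u) => //=; rewrite ur'.
have := h r ur x' y'.
have -> : \sum_(i <- r) \sum_(j <- r) Num.conj (y' i) * T i j * x' j =
    \sum_(i <- s) \sum_(j <- t) Num.conj (y i) * T i j * x j.
  rewrite -(sumE _ s) //; apply: eq_bigr => i _; rewrite /y'; case: ifP => _.
    rewrite -(sumE _ t) //; apply: eq_bigr => j _; rewrite /x'; case: ifP => // _.
    by rewrite mulr0.
  by rewrite big1 // => j _; rewrite rmorph0 !mul0r.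
have E (u : seq I) (z z' : vec R I) : uniq u -> {subset u <= r} ->
    z' = (fun i => if i \in u then z i else 0) ->
    \sum_(i <- r) `|z' i| ^+ 2 = ((nrm u z ^+ 2)%:C)%C :> R[i].
  move=> uu sur ->; rewrite sqr_nrm -sum_real -(sumE _ u) //; apply: eq_bigr => i _.
  by case: ifP => _; rewrite ?rmorphXn // normr0 expr0n.
rewrite (E s y) // (E t x) // -[Complex _ 0]/((M ^+ 2)%:C)%C.
set S := \sum_(i <- s) _.
rewrite (_ : `|S| ^+ 2 = ((normc S ^+ 2)%:C)%C); last by rewrite rmorphXn.
rewrite -!rmorphM /= lecR -!exprMn ler_pXn2r ?nnegrE ?normc_ge0 //; first by rewrite -mulrA.
by rewrite !mulr_ge0 // nrm_ge0.
Qed.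

Lemma bounded_opP I (T : mat R I) : bounded_op T <-> bounded T.
Proof.
split=> [[M h]|[M h]]; last by exists M; exact: bnd_opnorm_le.
exists `|M|; apply: opnorm_le_bnd => // s us x y.
by have := h s us x y; rewrite -(real_normK (num_real M)).
Qed.

Lemma bnd_le I J M N (T : op I J) : bnd M T -> M <= N -> bnd N T.
Proof.
move=> [M0 h] MN; split=> [|s t us ut y x]; first exact: le_trans MN.
by rewrite (le_trans (h _ _ us ut _ _)) // ler_wpM2r // mulr_ge0 // nrm_ge0.
Qed.

(** Testing the form against [y = T x] gives $\|Tx\|^2\le M\|Tx\|\,\|x\|$, from which one factor
    cancels. *)
Lemma bnd_col I J M (T : op I J) (s : seq I) (t : seq J) x : bnd M T ->
  uniq s -> uniq t -> nrm s (fun i => \sum_(j <- t) T i j * x j) <= M * nrm t x.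
Proof.
move=> [M0 h] us ut; set y := fun i => _; have := h s t us ut y x.
have -> : \sum_(i <- s) \sum_(j <- t) Num.conj (y i) * T i j * x j = ((nrm s y ^+ 2)%:C)%C.
  rewrite sqr_nrm -sum_real; apply: eq_bigr => i _; rewrite -mulJ_normc /y mulr_sumr.
  by apply: eq_bigr => j _; rewrite mulrA.
rewrite normc_real ger0_norm ?sqr_ge0 // expr2 mulrCA.
have := nrm_ge0 s y; rewrite le_eqVlt => /orP[/eqP <- _|y0]; last by rewrite ler_pM2l.
by rewrite mulr_ge0 // nrm_ge0.
Qed.

Lemma bnd_colI I J M (T : op I J) : 0 <= M ->
  (forall s t x, uniq s -> uniq t ->
    nrm s (fun i => \sum_(j <- t) T i j * x j) <= M * nrm t x) -> bnd M T.
Proof.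
move=> M0 h; split=> // s t us ut y x.
under eq_bigr do (under eq_bigr do rewrite -mulrA; rewrite -mulr_sumr).
apply: le_trans (normc_dot_le _ _ _) _; rewrite nrmJ mulrCA.
by rewrite ler_wpM2l ?nrm_ge0 // h.
Qed.

Lemma bnd_adj I J M (T : op I J) : bnd M T -> bnd M (opadj T).
Proof.
move=> [M0 h]; split=> // s t us ut y x.
have := h t s ut us x y; rewrite [nrm t x * _]mulrC -normcJ; apply: le_trans.
rewrite le_eqVlt; apply/orP; left; apply/eqP; congr normc.
rewrite exchange_big /= conj_sum; apply: eq_bigr => i _.
rewrite conj_sum; apply: eq_bigr => j _.
by rewrite /opadj !rmorphM /= conjCK; ring.
Qed.

Lemma opadjK I J (T : op I J) : opadj (opadj T) = T.
Proof. by apply/funext=> i; apply/funext=> j; rewrite /opadj conjCK. Qed.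

Lemma bnd_lin I J M N c (S T : op I J) : bnd M S -> bnd N T ->
  bnd (normc c * M + N) (opscale c S + T).
Proof.
move=> [M0 hS] [N0 hT]; split=> [|s t us ut y x]; first by rewrite addr_ge0 // mulr_ge0 // normc_ge0.
have -> : \sum_(i <- s) \sum_(j <- t) Num.conj (y i) * (opscale c S + T) i j * x j =
    c * (\sum_(i <- s) \sum_(j <- t) Num.conj (y i) * S i j * x j) +
    \sum_(i <- s) \sum_(j <- t) Num.conj (y i) * T i j * x j.
  rewrite mulr_sumr -big_split /=; apply: eq_bigr => i _.
  rewrite mulr_sumr -big_split /=; apply: eq_bigr => j _.
  by rewrite /opscale !fctE; ring.
rewrite (le_trans (normcD _ _)) // mulrDl lerD ?hT // normcM -mulrA.
by rewrite ler_wpM2l ?normc_ge0 // hS.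
Qed.

Lemma opscale1 I J (T : op I J) : opscale 1 T = T.
Proof. by apply/funext=> i; apply/funext=> j; rewrite /opscale mul1r. Qed.

Lemma opscaleN1 I J (T : op I J) : opscale (-1) T = - T.
Proof. by apply/funext=> i; apply/funext=> j; rewrite /opscale !fctE mulN1r. Qed.

Lemma op0E I J i j : (0 : op I J) i j = 0.
Proof. by []. Qed.

Lemma bnd0 I J : bnd 0 (0 : op I J).
Proof.
split=> // s t us ut y x; rewrite mul0r big1 ?normc_0 // => i _.
by rewrite big1 // => j _; rewrite op0E mulr0 mul0r.
Qed.

Lemma bndD I J M N (S T : op I J) : bnd M S -> bnd N T -> bnd (M + N) (S + T).
Proof. by move=> /(bnd_lin 1) h /h; rewrite normc_1 mul1r opscale1. Qed.

Lemma bndZ I J M c (S : op I J) : bnd M S -> bnd (normc c * M) (opscale c S).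
Proof. by move=> /(bnd_lin c) /(_ (bnd0 _ _)); rewrite !addr0. Qed.

Lemma bndN I J M (S : op I J) : bnd M S -> bnd M (- S).
Proof. by move=> /(bndZ (-1)); rewrite opscaleN1 normcN' normc_1 mul1r. Qed.

Lemma bndB I J M N (S T : op I J) : bnd M S -> bnd N T -> bnd (M + N) (S - T).
Proof. by move=> h1 /bndN h2; exact: bndD. Qed.

Lemma bnd_entry I J M (T : op I J) i j : bnd M T -> normc (T i j) <= M.
Proof.
move=> h; have := @bnd_col _ _ _ _ [:: i] [:: j] (fun=> 1) h isT isT.
by rewrite !nrm1 big_seq1 !mulr1 normc_1 mulr1.
Qed.

Lemma bnd_nrm_col I J M (T : op I J) (s : seq I) j : bnd M T -> uniq s ->
  nrm s (T^~ j) <= M.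
Proof.
move=> h us; have := @bnd_col _ _ _ _ s [:: j] (fun=> 1) h us isT.
by rewrite nrm1 normc_1 mulr1; under eq_nrm do rewrite big_seq1 mulr1.
Qed.

Lemma bnd_nrm_row I J M (T : op I J) (s : seq J) i : bnd M T -> uniq s ->
  nrm s (T i) <= M.
Proof. by move=> /bnd_adj h us; rewrite -nrmJ; exact: (bnd_nrm_col i h us). Qed.

Lemma bnd0_eq I J (T : op I J) : (forall e, 0 < e -> bnd e T) -> T = 0.
Proof.
move=> h; apply/funext=> i; apply/funext=> j.
by apply: normc_eps => e e0; rewrite subr0; exact: bnd_entry (h _ e0).
Qed.

Lemma mul_abs_bounded I J K M N (S : op I J) (T : op J K) i k :
  bnd M S -> bnd N T -> abs_bounded (M * N) (fun j => S i j * T j k).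
Proof.
move=> hS hT s us; under eq_bigr do rewrite normcM.
apply: le_trans (cauchy_schwarz s (S i) (T^~ k)) _.
by apply: ler_pM; rewrite ?nrm_ge0 ?(bnd_nrm_row _ hS) ?(bnd_nrm_col _ hT).
Qed.

Lemma opmul_hassum I J K (S : op I J) (T : op J K) i k :
  bounded S -> bounded T -> hassum (fun j => S i j * T j k) ((S ** T) i k).
Proof. move=> [M hM] [N hN]; apply: hassum_csum; exact: mul_abs_bounded hM hN. Qed.

Lemma opmul_eq I J K (S : op I J) (T : op J K) i k z :
  bounded S -> bounded T -> hassum (fun j => S i j * T j k) z -> (S ** T) i k = z.
Proof. by move=> bS bT; apply: hassum_uniq; exact: opmul_hassum. Qed.

(** The form of the product is a sum over the middle index of $a_jb_j$, where $a$ is $S^*y$ up to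
    conjugation and $b=Tx$; the Cauchy-Schwarz inequality bounds its finite parts. *)
Lemma bnd_mul I J K M N (S : op I J) (T : op J K) :
  bnd M S -> bnd N T -> bnd (M * N) (S ** T).
Proof.
move=> hS hT; have M0 := bnd_ge0 hS; have N0 := bnd_ge0 hT.
split=> [|s t us ut y x]; first exact: mulr_ge0.
pose a j := \sum_(i <- s) Num.conj (y i) * S i j.
pose b j := \sum_(k <- t) T j k * x k.
have H : hassum (fun j => a j * b j)
    (\sum_(i <- s) \sum_(k <- t) Num.conj (y i) * (S ** T) i k * x k).
  have -> : (fun j => a j * b j) = (fun j => \sum_(i <- s) \sum_(k <- t)
       Num.conj (y i) * x k * (S i j * T j k)).
    apply/funext=> j; rewrite /a mulr_suml; apply: eq_bigr => i _.
    by rewrite /b mulr_sumr; apply: eq_bigr => k _; ring.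
  apply: hassum_sum => i; apply: hassum_sum => k.
  rewrite mulrAC; apply: hassumZ.
  by apply: opmul_hassum; [exists M|exists N].
apply: hassum_le H _ => r ur; apply: le_trans (normc_dot_le _ _ _) _.
rewrite mulrACA; apply: ler_pM; rewrite ?nrm_ge0 //; last exact: bnd_col.
have := bnd_col y (bnd_adj hS) ur us; apply: le_trans.
rewrite -nrmJ le_eqVlt; apply/orP; left; apply/eqP; apply: eq_nrm => j _.
rewrite /a conj_sum; apply: eq_bigr => i _.
by rewrite rmorphM /= conjCK mulrC.
Qed.

Lemma bounded_mul I J K (S : op I J) (T : op J K) :
  bounded S -> bounded T -> bounded (S ** T).
Proof. by move=> [M hM] [N hN]; exists (M * N); exact: bnd_mul. Qed.

Lemma bounded_adj I J (S : op I J) : bounded S -> bounded (opadj S).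
Proof. by move=> [M hM]; exists M; exact: bnd_adj. Qed.

Lemma boundedD I J (S T : op I J) : bounded S -> bounded T -> bounded (S + T).
Proof. by move=> [M hM] [N hN]; exists (M + N); exact: bndD. Qed.

Lemma boundedN I J (S : op I J) : bounded S -> bounded (- S).
Proof. by move=> [M hM]; exists M; exact: bndN. Qed.

Lemma boundedB I J (S T : op I J) : bounded S -> bounded T -> bounded (S - T).
Proof. by move=> hS hT; apply: boundedD => //; exact: boundedN. Qed.

Lemma boundedZ I J c (S : op I J) : bounded S -> bounded (opscale c S).
Proof. by move=> [M hM]; exists (normc c * M); exact: bndZ. Qed.

Lemma bounded0 I J : bounded (0 : op I J).
Proof. by exists 0; exact: bnd0. Qed.

Lemma bounded_sum (A : Type) I J (s : seq A) (f : A -> op I J) :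
  (forall a, bounded (f a)) -> bounded (\sum_(a <- s) f a).
Proof.
move=> h; elim: s => [|a s IH]; first by rewrite big_nil; exact: bounded0.
by rewrite big_cons; exact: boundedD.
Qed.

Lemma opmul_linl I J K c (S S' : op I J) (T : op J K) :
  bounded S -> bounded S' -> bounded T ->
  (opscale c S + S') ** T = opscale c (S ** T) + S' ** T.
Proof.
move=> bS bS' bT; apply/funext=> i; apply/funext=> k; apply: opmul_eq => //.
  by apply: boundedD => //; exact: boundedZ.
under eq_fun do rewrite /opscale !fctE mulrDl -mulrA.
by rewrite !fctE; apply: hassum_lin; exact: opmul_hassum.
Qed.

Lemma opmul_linr I J K c (S : op I J) (T T' : op J K) :
  bounded S -> bounded T -> bounded T' ->
  S ** (opscale c T + T') = opscale c (S ** T) + S ** T'.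
Proof.
move=> bS bT bT'; apply/funext=> i; apply/funext=> k; apply: opmul_eq => //.
  by apply: boundedD => //; exact: boundedZ.
under eq_fun do rewrite /opscale !fctE mulrDr mulrCA.
by rewrite !fctE; apply: hassum_lin; exact: opmul_hassum.
Qed.

Lemma opmulDl I J K (S S' : op I J) (T : op J K) :
  bounded S -> bounded S' -> bounded T -> (S + S') ** T = S ** T + S' ** T.
Proof. by move=> bS bS' bT; have := opmul_linl 1 bS bS' bT; rewrite !opscale1. Qed.

Lemma opmulDr I J K (S : op I J) (T T' : op J K) :
  bounded S -> bounded T -> bounded T' -> S ** (T + T') = S ** T + S ** T'.
Proof. by move=> bS bT bT'; have := opmul_linr 1 bS bT bT'; rewrite !opscale1. Qed.

Lemma opmul0l I J K (T : op J K) : (0 : op I J) ** T = 0.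
Proof.
apply/funext=> i; apply/funext=> k; rewrite /opmul (@csum_fin _ _ [::]) ?big_nil //.
by move=> j _; rewrite op0E mul0r.
Qed.

Lemma opmul0r I J K (S : op I J) : S ** (0 : op J K) = 0.
Proof.
apply/funext=> i; apply/funext=> k; rewrite /opmul (@csum_fin _ _ [::]) ?big_nil //.
by move=> j _; rewrite op0E mulr0.
Qed.

Lemma opmulZl I J K c (S : op I J) (T : op J K) :
  bounded S -> bounded T -> opscale c S ** T = opscale c (S ** T).
Proof. by move=> bS bT; have := opmul_linl c bS (bounded0 _ _) bT; rewrite opmul0l !addr0. Qed.

Lemma opmulZr I J K c (S : op I J) (T : op J K) :
  bounded S -> bounded T -> S ** opscale c T = opscale c (S ** T).
Proof. by move=> bS bT; have := opmul_linr c bS bT (bounded0 _ _); rewrite opmul0r !addr0. Qed.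

Lemma opmulNl I J K (S : op I J) (T : op J K) :
  bounded S -> bounded T -> (- S) ** T = - (S ** T).
Proof. by move=> bS bT; rewrite -!opscaleN1 opmulZl. Qed.

Lemma opmulNr I J K (S : op I J) (T : op J K) :
  bounded S -> bounded T -> S ** (- T) = - (S ** T).
Proof. by move=> bS bT; rewrite -!opscaleN1 opmulZr. Qed.

Lemma opmulBl I J K (S S' : op I J) (T : op J K) :
  bounded S -> bounded S' -> bounded T -> (S - S') ** T = S ** T - S' ** T.
Proof. by move=> bS bS' bT; rewrite opmulDl ?opmulNl //; exact: boundedN. Qed.

Lemma opmulBr I J K (S : op I J) (T T' : op J K) :
  bounded S -> bounded T -> bounded T' -> S ** (T - T') = S ** T - S ** T'.
Proof. by move=> bS bS' bT; rewrite opmulDr ?opmulNr //; exact: boundedN. Qed.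

Lemma opmul_suml (A : Type) (s : seq A) I J K (f : A -> op I J) (T : op J K) :
  (forall a, bounded (f a)) -> bounded T ->
  (\sum_(a <- s) f a) ** T = \sum_(a <- s) (f a ** T).
Proof.
move=> hf bT; elim: s => [|a s IH]; first by rewrite !big_nil opmul0l.
by rewrite !big_cons opmulDl ?IH //; exact: bounded_sum.
Qed.

Lemma opmul_sumr (A : Type) (s : seq A) I J K (S : op I J) (f : A -> op J K) :
  bounded S -> (forall a, bounded (f a)) ->
  S ** (\sum_(a <- s) f a) = \sum_(a <- s) (S ** f a).
Proof.
move=> hS bf; elim: s => [|a s IH]; first by rewrite !big_nil opmul0r.
by rewrite !big_cons opmulDr ?IH //; exact: bounded_sum.
Qed.

Lemma opadj_mul I J K (S : op I J) (T : op J K) :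
  bounded S -> bounded T -> opadj (S ** T) = opadj T ** opadj S.
Proof.
move=> bS bT; apply/funext=> i; apply/funext=> k; apply/esym/opmul_eq; try exact: bounded_adj.
under eq_fun do rewrite /opadj -rmorphM /= mulrC.
by apply: hassumJ; exact: opmul_hassum.
Qed.

Lemma opadjD I J (S T : op I J) : opadj (S + T) = opadj S + opadj T.
Proof. by apply/funext=> i; apply/funext=> j; rewrite /opadj !fctE rmorphD. Qed.

Lemma opadjN I J (S : op I J) : opadj (- S) = - opadj S.
Proof. by apply/funext=> i; apply/funext=> j; rewrite /opadj !fctE rmorphN. Qed.

Lemma opadjZ I J c (S : op I J) : opadj (opscale c S) = opscale (Num.conj c) (opadj S).
Proof. by apply/funext=> i; apply/funext=> j; rewrite /opadj /opscale rmorphM. Qed.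

Lemma bnd_one I : bnd 1 (mone : op I I).
Proof.
apply: bnd_colI => // s t x us ut; rewrite mul1r.
apply: ler_wsqrtr; rewrite [leLHS](bigID (mem t)) /= [X in _ + X]big1 ?addr0; last first.
  move=> i it; rewrite big_seq big1 ?normc_0 ?expr0n // => j jt.
  by rewrite /mone; case: eqP it => [->|_ _]; rewrite ?jt // mul0r.
rewrite -big_filter.
have -> : \sum_(i <- [seq i <- s | i \in t]) normc (\sum_(j <- t) mone i j * x j) ^+ 2
   = \sum_(i <- [seq i <- s | i \in t]) normc (x i) ^+ 2.
  apply: eq_big_seq => i; rewrite mem_filter => /andP[it _].
  rewrite (bigD1_seq i) //= big1 ?addr0 => [|j ji]; first by rewrite /mone eqxx mul1r.
  by rewrite /mone eq_sym (negbTE ji) mul0r.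
apply: sum_subset; rewrite ?filter_uniq // => i; rewrite ?sqr_ge0 //.
by rewrite mem_filter => /andP[].
Qed.

Lemma bounded_one I : bounded (mone : op I I).
Proof. by exists 1; exact: bnd_one. Qed.

Lemma opmul1l I J (T : op I J) : mone ** T = T.
Proof.
apply/funext=> i; apply/funext=> j; rewrite /opmul (@csum_fin _ _ [:: i]) //.
  by rewrite big_seq1 /mone eqxx mul1r.
by move=> k; rewrite inE eq_sym /mone => /negbTE ->; rewrite mul0r.
Qed.

Lemma opmul1r I J (T : op I J) : T ** mone = T.
Proof.
apply/funext=> i; apply/funext=> j; rewrite /opmul (@csum_fin _ _ [:: j]) //.
  by rewrite big_seq1 /mone eqxx mulr1.
by move=> k; rewrite inE /mone => /negbTE ->; rewrite mulr0.
Qed.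

Lemma opadj1 I : opadj (mone : op I I) = mone.
Proof. by apply/funext=> i; apply/funext=> j; rewrite /opadj /mone eq_sym conjC_nat. Qed.

(** The supremum of the partial sums of squares is reached up to [e ^ 2] on some finite set, and
    only that much is left outside it. The truncation arguments below rest on this. *)
Lemma nrm_tail I (x : I -> R[i]) M : (forall s, uniq s -> nrm s x <= M) ->
  forall e, 0 < e -> exists2 s0 : seq I, uniq s0 &
    forall s, uniq s -> nrm s (fun i => if i \in s0 then 0 else x i) <= e.
Proof.
move=> hM e e0; pose f i := normc (x i) ^+ 2.
have M0 : 0 <= M by rewrite (le_trans _ (hM [::] isT)) // nrm_ge0.
have [||h1 h2] := @esum_seqP _ _ f (M ^+ 2).
- by move=> i; rewrite sqr_ge0.
- move=> s us; rewrite -sqr_nrm ler_pXn2r ?nnegrE ?nrm_ge0 //; exact: hM.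
have [s0 us0 hs0] := h2 _ (exprn_gt0 2 e0); exists s0 => // s us.
rewrite -(ler_pXn2r (n := 2)) ?nnegrE ?nrm_ge0 ?(ltW e0) // sqr_nrm.
have H1 := h1 (undup (s0 ++ s)) (undup_uniq _).
have sub : {subset s0 <= undup (s0 ++ s)} by move=> i; rewrite mem_undup mem_cat => ->.
have E := sumB_subset f us0 (undup_uniq _) sub.
have H : \sum_(i <- [seq x <- undup (s0 ++ s) | x \notin s0]) f i <= e ^+ 2.
  rewrite -E; lra.
apply: le_trans H; rewrite (bigID (mem s0)) /= big1 ?add0r; last first.
  by move=> i ->; rewrite normc_0 expr0n.
rewrite -big_filter.
rewrite (eq_big_seq f) => [|i]; last by rewrite mem_filter /f => /andP[/negbTE ->].
apply: sum_subset; rewrite ?filter_uniq ?undup_uniq // => i; rewrite ?sqr_ge0 //.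
by rewrite !mem_filter mem_undup mem_cat => /andP[-> ->]; rewrite orbT.
Qed.

Lemma bnd_row1 J M (x : J -> R[i]) : 0 <= M ->
  (forall s, uniq s -> nrm s x <= M) ->
  bnd M ((fun _ j => x j) : op unit J).
Proof.
move=> M0 h; apply: bnd_colI => // s t y us ut.
have : forall s : seq unit, uniq s -> s = [::] \/ s = [:: tt].
  by case=> [|[] [|[] r]] //; [left|right].
move=> /(_ _ us)[->|->]; first by rewrite /nrm big_nil sqrtr0 mulr_ge0 // sqrtr_ge0.
rewrite nrm1 (le_trans (normc_dot_le _ _ _)) // ler_wpM2r ?nrm_ge0 //; exact: h.
Qed.

(** The double family $S_{ij}T_{jk}U_{kl}$ need not be absolutely summable, so the two sums cannot
    simply be exchanged. Instead row [i] of [S] is cut to a finite support: there the exchange is a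
    finite sum, and the remaining row has small norm, hence contributes little to both
    bracketings. *)
Lemma opmulA I J K L (S : op I J) (T : op J K) (U : op K L) :
  bounded S -> bounded T -> bounded U -> S ** (T ** U) = S ** T ** U.
Proof.
move=> bS bT bU; apply/funext=> i; apply/funext=> l.
have [M1 h1] := bS; have [M2 h2] := bT; have [M3 h3] := bU.
have m1 := bnd_ge0 h1; have m2 := bnd_ge0 h2; have m3 := bnd_ge0 h3.
pose row (x : J -> R[i]) : op unit J := fun _ j => x j.
have fin (s : seq J) (x : J -> R[i]) : uniq s -> (forall j, j \notin s -> x j = 0) ->
    (row x ** (T ** U)) tt l = (row x ** T ** U) tt l.
  move=> us xs; rewrite {1}/opmul (csum_fin us); last first.
    by move=> j /xs; rewrite /row => ->; rewrite mul0r.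
  apply/esym/(csumE (M := nrm s x * M2 * M3)).
    apply: mul_abs_bounded h3; apply: bnd_mul h2; apply: bnd_row1 => //; first exact: nrm_ge0.
    move=> t ut; have -> : nrm t x = nrm [seq j <- t | j \in s] x.
      congr Num.sqrt; rewrite (bigID (mem s)) /= [X in _ + X]big1 ?addr0 ?big_filter //.
      by move=> j /xs ->; rewrite normc_0 expr0n.
    by apply: nrm_sub; rewrite ?filter_uniq // => j; rewrite mem_filter => /andP[].
  under eq_fun => k.
    rewrite {1}/opmul (csum_fin us); last by move=> j /xs; rewrite /row => ->; rewrite mul0r.
    rewrite mulr_suml; under eq_bigr do rewrite -mulrA.
    over.
  by apply: hassum_sum => j; apply: hassumZ; exact: opmul_hassum.
apply: normc_eps => e e0.
(* The cut-off row contributes at most [d * (M2 * M3)] to each side, and twice this is at most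
   [e]. *)
pose d := e / (2 * (M2 * M3 + 1)).
have K0 : 0 < M2 * M3 + 1 by rewrite ltr_wpDl // mulr_ge0.
have d0 : 0 < d by rewrite divr_gt0 // mulr_gt0.
have [s0 us0 hs0] := nrm_tail (fun s us => bnd_nrm_row i h1 us) d0.
pose x1 j := if j \in s0 then S i j else 0; pose x2 j := if j \in s0 then 0 else S i j.
have E : row (S i) = row x1 + row x2.
  apply/funext=> -[]; apply/funext=> j; rewrite !fctE /row /x1 /x2.
  by case: ifP; rewrite ?addr0 ?add0r.
have b2 : bnd d (row x2) by apply: bnd_row1 => //; exact: ltW.
have b1 : bounded (row x1).
  have : bounded (row (S i)) by exists M1; apply: bnd_row1 => // s us; exact: bnd_nrm_row h1 us.
  by move=> /boundedB /(_ (bnd_bounded b2)); rewrite E addrK.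
have bb2 := bnd_bounded b2.
have bTU := bounded_mul bT bU.
have EE V (X : op J V) : bounded X -> (fun v => (S ** X) i v) = (fun v => (row x1 ** X + row x2 ** X) tt v).
  by move=> bX; rewrite -opmulDl // -E.
have -> : (S ** (T ** U)) i l = (row x1 ** (T ** U) + row x2 ** (T ** U)) tt l.
  exact: (congr1 (fun f => f l) (EE _ _ bTU)).
have -> : (S ** T ** U) i l = (row x1 ** T ** U + row x2 ** T ** U) tt l.
  rewrite -[LHS]/(((fun (_ : unit) v => (S ** T) i v) ** U) tt l) (EE _ _ bT).
  have -> : (fun _ : unit => (fun v => (row x1 ** T + row x2 ** T) tt v)) = row x1 ** T + row x2 ** T.
    by apply/funext=> -[].
  by rewrite opmulDl //; exact: bounded_mul.
rewrite !fctE (fin s0) //; last by move=> j /negbTE; rewrite /x1 => ->.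
rewrite opprD addrACA subrr add0r.
have /(@bnd_entry _ _ _ _ tt l) B1 : bnd (d * (M2 * M3)) (row x2 ** (T ** U)).
  by apply: bnd_mul => //; exact: bnd_mul.
have /(@bnd_entry _ _ _ _ tt l) B2 : bnd (d * M2 * M3) (row x2 ** T ** U).
  by apply: bnd_mul => //; exact: bnd_mul.
rewrite (le_trans (normcD _ _)) // normcN' (le_trans (lerD B1 B2)) //.
have : d * (2 * (M2 * M3 + 1)) = e.
  by rewrite /d divfK // mulf_neq0 ?pnatr_eq0 // gt_eqF.
nra.
Qed.

End Operators.
Notation "S ** T" := (opmul S T) (at level 40, left associativity).
Arguments op : clear implicits.

(** * Relabelling of index sets and tensor products of operators *)

Section TensorReindex.
Context {R : realType}.
Implicit Types (I J K L : choiceType) (M N : R).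

Definition ridx I I' (u : I' -> I) (T : mat R I) : mat R I' := fun p q => T (u p) (u q).

(** Test vectors are pushed forward along the injections, which preserves their norms. Passing to a
    block, restricting to a corner and permuting legs are all instances. *)
Lemma bnd_inj I I' J J' M (u : I' -> I) (v : J' -> J) (T : op R I J) :
  injective u -> injective v ->
  bnd M T -> bnd M ((fun p q => T (u p) (v q)) : op R I' J').
Proof.
move=> ui vi [M0 h]; split=> // s t us ut y x.
pose lift (X X' : choiceType) (w : X' -> X) (r : seq X') (z : X' -> R[i]) (i : X) : R[i] :=
  \sum_(p <- r) (if w p == i then z p else 0).
have liftE (X X' : choiceType) (w : X' -> X) r z p : injective w -> uniq r -> p \in r -> lift _ _ w r z (w p) = z p.
  move=> wi ur pr; rewrite /lift (bigD1_seq p) //= eqxx big1 ?addr0 // => q qp.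
  by rewrite (inj_eq wi) (negbTE qp).
have ms : uniq (map u s) by rewrite map_inj_uniq.
have mt : uniq (map v t) by rewrite map_inj_uniq.
have := h _ _ ms mt (lift _ _ u s y) (lift _ _ v t x).
have -> : nrm (map u s) (lift _ _ u s y) = nrm s y.
  rewrite /nrm big_map; congr Num.sqrt; apply: eq_big_seq => p ps.
  by rewrite liftE.
have -> : nrm (map v t) (lift _ _ v t x) = nrm t x.
  rewrite /nrm big_map; congr Num.sqrt; apply: eq_big_seq => p ps.
  by rewrite liftE.
rewrite big_map (eq_big_seq (fun i => \sum_(j <- t) Num.conj (y i) * T (u i) (v j) * x j)) //.
move=> p ps; rewrite big_map; apply: eq_big_seq => q qt.
by rewrite !liftE.
Qed.

Lemma bnd_ridx I I' M (u : I' -> I) (T : mat R I) : injective u ->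
  bnd M T -> bnd M (ridx u T).
Proof. by move=> ui; exact: bnd_inj. Qed.

Lemma bounded_ridx I I' (u : I' -> I) (T : mat R I) : injective u ->
  bounded T -> bounded (ridx u T).
Proof. by move=> ui [M h]; exists M; exact: bnd_ridx. Qed.

Lemma ridx_mul I I' (u : I' -> I) (v : I -> I') (S T : mat R I) :
  cancel u v -> cancel v u -> bounded S -> bounded T ->
  ridx u (S ** T) = ridx u S ** ridx u T.
Proof.
move=> uK vK bS bT; have ui := can_inj uK.
apply/funext=> p; apply/funext=> q; apply/esym/opmul_eq; try exact: bounded_ridx.
exact: hassum_reindex uK vK (opmul_hassum _ _ bS bT).
Qed.

Lemma ridx_adj I I' (u : I' -> I) (T : mat R I) : ridx u (opadj T) = opadj (ridx u T).
Proof. by []. Qed.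

Lemma ridx_one I I' (u : I' -> I) : injective u -> ridx u (mone : mat R I) = mone.
Proof. by move=> ui; apply/funext=> p; apply/funext=> q; rewrite /ridx /mone (inj_eq ui). Qed.

(** For a fixed second index [b] the operator acts as [S] on the slice of the vector at [b]; the
    squared bounds for the slices are added. *)
Lemma bnd_mtens1 I J M (S : mat R I) : bnd M S -> bnd M (mtens S (mone : mat R J)).
Proof.
move=> hS; have M0 := bnd_ge0 hS; apply: bnd_colI => // s t x us ut.
pose s1 := undup (map fst s); pose s2 := undup (map snd s).
pose t1 := undup (map fst t).
have us1 : uniq s1 by exact: undup_uniq.
have us2 : uniq s2 by exact: undup_uniq.
have ut1 : uniq t1 by exact: undup_uniq.
pose x' p := if p \in t then x p else 0.
have ux (u : seq I) (v : seq J) : uniq u -> uniq v -> uniq (allpairs pair v u).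
  by move=> uu uv; apply: allpairs_uniq => // -[a b] [c d].
have E p : \sum_(q <- t) mtens S mone p q * x q = \sum_(c <- t1) S p.1 c * x' (c, p.2).
  pose f c := (c, p.2) : I * J; have fi : injective f by move=> c d [].
  have -> : \sum_(q <- t) mtens S mone p q * x q =
      \sum_(q <- t | q \in map f t1) S p.1 q.1 * x q.
    rewrite [LHS](bigID (fun q => q.2 == p.2)) /= [X in _ + X]big1 ?addr0; last first.
      by move=> q /negbTE qp; rewrite /mtens /mone eq_sym qp mulr0 mul0r.
    rewrite big_seq_cond [RHS]big_seq_cond; apply: eq_big => [[a b]|q /andP[qt /eqP qp]].
      case abt: ((a, b) \in t) => //; rewrite !andTb; apply/eqP/mapP => [/= be|[c _ [_ ->]] //].
      by exists a; rewrite ?mem_undup ?(map_f fst abt) // /f be.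
    by rewrite /mtens /mone qp eqxx mulr1.
  rewrite -big_filter.
  pose c1 := [seq c <- t1 | (c, p.2) \in t].
  have -> : \sum_(i <- [seq q <- t | q \in map f t1]) S p.1 i.1 * x i =
     \sum_(i <- map f c1) S p.1 i.1 * x i.
    apply: perm_big; apply: uniq_perm; rewrite ?filter_uniq //.
      by rewrite map_inj_uniq ?filter_uniq.
    move=> q; rewrite mem_filter; apply/andP/mapP.
      move=> [/mapP[c ct1 ->] ct]; exists c => //.
      by rewrite mem_filter ct.
    by move=> [c]; rewrite mem_filter => /andP[H1 H2] ->; split=> //; exact: map_f.
  rewrite big_map big_filter big_mkcond; apply: eq_bigr => c _ /=.
  by rewrite /x'; case: ifP; rewrite ?mulr0.
rewrite -(ler_pXn2r (n := 2)) ?nnegrE ?mulr_ge0 ?nrm_ge0 // exprMn !sqr_nrm.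
under eq_bigr do rewrite E.
have sub : {subset s <= allpairs (fun b a => (a, b)) s2 s1}.
  by move=> [a b] ab; apply/allpairsP; exists (b, a); rewrite /= !mem_undup
    (map_f fst ab) (map_f snd ab).
have ua (u : seq I) (v : seq J) : uniq u -> uniq v -> uniq (allpairs (fun b a => (a, b)) v u).
  by move=> uu uv; apply: allpairs_uniq => // -[a b] [c d] _ _ [-> ->].
apply: le_trans (sum_subset us (ua _ _ us1 us2) _ sub) _.
  by move=> p; rewrite sqr_ge0.
rewrite big_allpairs_dep /=.
apply: le_trans (_ : \sum_(b <- s2) M ^+ 2 * \sum_(c <- t1) normc (x' (c, b)) ^+ 2 <= _).
  apply: ler_sum => b _; rewrite -!sqr_nrm -exprMn ler_pXn2r ?nnegrE ?mulr_ge0 ?nrm_ge0 //.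
  exact: bnd_col.
rewrite -mulr_sumr ler_wpM2l ?exprn_ge0 //.
have -> : \sum_(b <- s2) \sum_(c <- t1) normc (x' (c, b)) ^+ 2 =
    \sum_(p <- allpairs (fun b a => (a, b)) s2 t1) normc (x' p) ^+ 2.
  by rewrite big_allpairs_dep.
rewrite (bigID (mem t)) /= [X in _ + X]big1 ?addr0; last first.
  by move=> p /negbTE pt; rewrite /x' pt normc_0 expr0n.
rewrite -big_filter (eq_big_seq (fun p => normc (x p) ^+ 2)); last first.
  by move=> p; rewrite mem_filter /x' => /andP[->].
apply: sum_subset; rewrite ?filter_uniq ?ua // => p; rewrite ?sqr_ge0 //.
by rewrite mem_filter => /andP[].
Qed.

Definition swp I J (p : I * J) : J * I := (p.2, p.1).

Lemma swpK I J : cancel (@swp I J) (@swp J I).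
Proof. by case. Qed.

Lemma swp_inj I J : injective (@swp I J).
Proof. exact: can_inj (@swpK I J). Qed.

Lemma flipK I J (T : mat R (I * J)%type) : flip (flip T) = T.
Proof. by apply/funext=> -[i j]; apply/funext=> -[k l]. Qed.

Lemma bnd_flip I J M (T : mat R (I * J)%type) : bnd M T -> bnd M (flip T).
Proof. exact: bnd_ridx (@swp_inj _ _). Qed.

Lemma bounded_flip I J (T : mat R (I * J)%type) : bounded T -> bounded (flip T).
Proof. exact: bounded_ridx (@swp_inj _ _). Qed.

Lemma flip_mul I J (S T : mat R (I * J)%type) : bounded S -> bounded T ->
  flip (S ** T) = flip S ** flip T.
Proof. exact: ridx_mul (@swpK _ _) (@swpK _ _). Qed.

Lemma flip_mtens I J (S : mat R I) (T : mat R J) : flip (mtens S T) = mtens T S.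
Proof. by apply/funext=> p; apply/funext=> q; rewrite /flip /mtens mulrC. Qed.

Lemma bnd_mtens1l I J M (T : mat R J) : bnd M T -> bnd M (mtens (mone : mat R I) T).
Proof. by move=> /(@bnd_mtens1 _ I) /bnd_flip; rewrite flip_mtens. Qed.

Lemma bounded_mtens1 I J (S : mat R I) : bounded S -> bounded (mtens S (mone : mat R J)).
Proof. by move=> [M h]; exists M; exact: bnd_mtens1. Qed.

Lemma bounded_mtens1l I J (T : mat R J) : bounded T -> bounded (mtens (mone : mat R I) T).
Proof. by move=> [M h]; exists M; exact: bnd_mtens1l. Qed.

Lemma hassum_abs I (f : I -> R[i]) s : uniq s -> (forall i, i \notin s -> f i = 0) ->
  exists M, abs_bounded M f.
Proof.
move=> us fs; exists (\sum_(i <- s) normc (f i)) => t ut.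
rewrite (bigID (mem s)) /= [X in _ + X]big1 ?addr0; last by move=> i /fs ->; rewrite normc_0.
rewrite -big_filter; apply: sum_subset; rewrite ?filter_uniq // => i; rewrite ?normc_ge0 //.
by rewrite mem_filter => /andP[].
Qed.

Lemma mtens_split I J (S : mat R I) (T : mat R J) :
  bounded S -> bounded T -> mtens S T = mtens S mone ** mtens mone T.
Proof.
move=> bS bT; apply/funext=> p; apply/funext=> q; apply/esym/opmul_eq.
- exact: bounded_mtens1.
- exact: bounded_mtens1l.
pose f a := S p.1 a * (a == q.1)%:R; pose g b := (p.2 == b)%:R * T b q.2.
have -> : (fun r : I * J => mtens S mone p r * mtens mone T r q) = (fun r => f r.1 * g r.2).
  by apply/funext=> r; rewrite /mtens /mone /f /g mulrACA mulrA.
have fs i : i \notin [:: q.1] -> f i = 0 by rewrite inE /f => /negbTE ->; rewrite mulr0.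
have gs j : j \notin [:: p.2] -> g j = 0 by rewrite inE eq_sym /g => /negbTE ->; rewrite mul0r.
have := hassum_prod (@hassum_fin _ _ [:: q.1] f isT fs) (@hassum_fin _ _ [:: p.2] g isT gs)
  (@hassum_abs _ f [:: q.1] isT fs) (@hassum_abs _ g [:: p.2] isT gs).
by case=> _; rewrite !big_seq1 /f /g !eqxx mulr1 mul1r.
Qed.

Lemma bnd_mtens I J M N (S : mat R I) (T : mat R J) :
  bnd M S -> bnd N T -> bnd (M * N) (mtens S T).
Proof.
move=> hS hT; rewrite mtens_split; try by eexists; eassumption.
by apply: bnd_mul; [exact: bnd_mtens1|exact: bnd_mtens1l].
Qed.

Lemma bounded_mtens I J (S : mat R I) (T : mat R J) :
  bounded S -> bounded T -> bounded (mtens S T).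
Proof. by move=> [M hS] [N hT]; exists (M * N); exact: bnd_mtens. Qed.

Lemma mtens_mul I J (S S' : mat R I) (T T' : mat R J) :
  bounded S -> bounded S' -> bounded T -> bounded T' ->
  mtens S T ** mtens S' T' = mtens (S ** S') (T ** T').
Proof.
move=> bS bS' bT bT'; apply/funext=> p; apply/funext=> q; apply/opmul_eq.
- exact: bounded_mtens.
- exact: bounded_mtens.
under eq_fun do rewrite /mtens mulrACA.
have [M hM] := bS; have [N hN] := bS'; have [M' hM'] := bT; have [N' hN'] := bT'.
apply: (hassum_prod (f := fun a => S p.1 a * S' a q.1) (g := fun b => T p.2 b * T' b q.2)
  (opmul_hassum _ _ bS bS') (opmul_hassum _ _ bT bT') _ _).2.
- by exists (M * N); exact: mul_abs_bounded hM hN.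
- by exists (M' * N'); exact: mul_abs_bounded hM' hN'.
Qed.

Lemma mtens_one I J : mtens (mone : mat R I) (mone : mat R J) = mone.
Proof.
by apply/funext=> -[i j]; apply/funext=> -[k l]; rewrite /mtens /mone /= -natrM mulnb xpair_eqE.
Qed.

Lemma mtens_adj I J (S : mat R I) (T : mat R J) :
  opadj (mtens S T) = mtens (opadj S) (opadj T).
Proof. by apply/funext=> p; apply/funext=> q; rewrite /opadj /mtens rmorphM. Qed.

Lemma mtens_linl I J c (S S' : mat R I) (T : mat R J) :
  mtens (opscale c S + S') T = opscale c (mtens S T) + mtens S' T.
Proof.
by apply/funext=> p; apply/funext=> q; rewrite /mtens /opscale !fctE mulrDl mulrA.
Qed.

Lemma mtens_linr I J c (S : mat R I) (T T' : mat R J) :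
  mtens S (opscale c T + T') = opscale c (mtens S T) + mtens S T'.
Proof.
by apply/funext=> p; apply/funext=> q; rewrite /mtens /opscale !fctE mulrDr mulrCA.
Qed.

End TensorReindex.

(** * Completeness of the bounded operators *)

Section Completeness.
Context {R : realType}.
Implicit Types (I J : choiceType).

(** The limit is the supremum of the lower ends of the intervals of radius [c n] around [x n], so
    the given rate is kept without loss. *)
Lemma real_nested_limit (x c : nat -> R) :
  (forall n m, (n <= m)%N -> `|x m - x n| <= c n) -> exists l, forall n, `|x n - l| <= c n.
Proof.
move=> h; pose E := [set y | exists n, y = x n - c n].
have ub m : ubound E (x m + c m).
  move=> _ [n ->]; have H1 := h n _ (leq_maxl n m); have H2 := h m _ (leq_maxr n m).
  by move: H1 H2; rewrite !ler_norml => /andP[? ?] /andP[? ?]; lra.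
have hE : has_sup E by split; [exists (x 0%N - c 0%N), 0%N | exists (x 0%N + c 0%N)].
exists (sup E) => n; rewrite ler_norml.
have : x n - c n <= sup E by apply: ub_le_sup; [case: hE | exists n].
have : sup E <= x n + c n by apply: ge_sup; [case: hE|exact: ub].
by move=> ? ?; apply/andP; split; lra.
Qed.

(** The limit is taken entrywise, where real and imaginary parts together lose a factor 2. The sharp
    rate [c n] for the operator is recovered by comparing [u n] with a much later [u m] inside each
    finite form. *)
Lemma op_complete I J (u : nat -> op R I J) (c : nat -> R) :
  (forall n m, (n <= m)%N -> bnd (c n) (u m - u n)) ->
  (forall e, 0 < e -> exists n, c n <= e) ->
  exists T : op R I J, forall n, bnd (c n) (u n - T).
Proof.
move=> h c0.
have H i j : exists z : R[i], forall n, normc (u n i j - z) <= c n + c n.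
  have [n m nm|a ha] := @real_nested_limit (fun n => complex.Re (u n i j)) c.
    have := bnd_entry i j (h n m nm); rewrite !fctE; apply: le_trans.
    move: (u m i j) (u n i j) => [a b] [a' b'].
    exact: (normc_Re (Complex a b - Complex a' b')).
  have [n m nm|b hb] := @real_nested_limit (fun n => complex.Im (u n i j)) c.
    have := bnd_entry i j (h n m nm); rewrite !fctE; apply: le_trans.
    move: (u m i j) (u n i j) => [a' b] [a'' b'].
    exact: (normc_Im (Complex a' b - Complex a'' b')).
  exists (Complex a b) => n; have := ha n; have := hb n.
  case: (u n i j) => x y hy hx.
  rewrite (_ : Complex x y - Complex a b = ((x - a)%:C)%C + ((y - b)%:C)%C * Complex 0 1); last first.
    by apply/eqP; rewrite eq_complex /=; apply/andP; split; apply/eqP; ring.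
  rewrite (le_trans (normcD _ _)) // normcM !normc_real.
  have -> : normc (Complex 0 (1 : R)) = 1 by rewrite /= expr0n expr1n add0r sqrtr1.
  by rewrite mulr1; exact: lerD hx hy.
have [T hT] : exists T : op R I J, forall i j n, normc (u n i j - T i j) <= c n + c n.
  have /choice[T hT] : forall p : I * J, exists z : R[i], forall n, normc (u n p.1 p.2 - z) <= c n + c n.
    by move=> p; exact: H.
  by exists (fun i j => T (i, j)) => i j; exact: (hT (i, j)).
exists T => n; split=> [|s t us ut y x]; first exact: bnd_ge0 (h n n (leqnn n)).
pose F (S : op R I J) := \sum_(i <- s) \sum_(j <- t) Num.conj (y i) * S i j * x j.
have FD S S' : F (S + S') = F S + F S'.
  rewrite /F -big_split /=; apply: eq_bigr => i _; rewrite -big_split /=.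
  by apply: eq_bigr => j _; rewrite !fctE; ring.
(* A crude bound for the finite form in terms of its entries: an entrywise error of [3 * c m1] costs
   at most [K * (3 * c m1)], which is made smaller than [e]. *)
pose K := \sum_(i <- s) \sum_(j <- t) normc (y i) * normc (x j).
have K0 : 0 <= K by apply: sumr_ge0 => i _; apply: sumr_ge0 => j _; rewrite mulr_ge0 // normc_ge0.
apply/ler_addgt0Pr => e e0.
have K10 : 0 < 3 * (K + 1) by lra.
have [m1 hm1] := c0 _ (divr_gt0 e0 K10).
pose m := maxn n m1.
have em : normc (F (u m - T)) <= e.
  apply: le_trans (_ : K * (c m1 + (c m1 + c m1)) <= _); last first.
    move: hm1; rewrite ler_pdivlMr // => hm1.
    have := bnd_ge0 (h m1 m1 (leqnn m1)); nra.
  rewrite /F (le_trans (normc_sum _ _)) // /K mulr_suml; apply: ler_sum => i _.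
  rewrite (le_trans (normc_sum _ _)) // mulr_suml; apply: ler_sum => j _.
  rewrite !normcM normcJ mulrAC ler_wpM2l ?mulr_ge0 ?normc_ge0 // !fctE.
  rewrite (_ : u m i j - T i j = (u m - u m1) i j + (u m1 i j - T i j)); last first.
    by rewrite !fctE addrA subrK.
  rewrite (le_trans (normcD _ _)) // lerD //.
  exact: bnd_entry (h m1 m (leq_maxr _ _)).
rewrite -/(F (u n - T)) (_ : u n - T = (u n - u m) + (u m - T)); last by rewrite addrA subrK.
rewrite FD (le_trans (normcD _ _)) // lerD //.
by have [_] := bndN (h n m (leq_maxl _ _)); rewrite opprB; apply.
Qed.

End Completeness.

(** * *-algebras and *-homomorphisms *)

Create HintDb bdb discriminated.
#[global] Hint Constants Opaque : bdb.
#[global] Hint Resolve bounded_mul bounded_adj boundedB boundedD boundedN boundedZ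
  bounded_one bounded0 bounded_mtens bounded_flip : bdb.
#[global] Hint Immediate bnd_bounded : bdb.
Ltac bb := solve [eauto 12 with bdb].
Ltac opext := apply/funext=> ?; apply/funext=> ?; rewrite /opscale ?fctE; ring.

Section CStar.
Context {R : realType}.
Implicit Types (I J K : choiceType) (M N e : R).

Lemma bnd_eq I J M (S T : op R I J) : bnd M S -> S = T -> bnd M T.
Proof. by move=> h <-. Qed.

Lemma bnd_lim I J M (T : op R I J) : 0 <= M ->
  (forall e, 0 < e -> bnd (M + e) T) -> bnd M T.
Proof.
move=> M0 h; split=> // s t us ut y x; set S := normc _; set n := nrm s y * nrm t x.
have n0 : 0 <= n by rewrite mulr_ge0 // nrm_ge0.
apply/ler_addgt0Pr => e e0; have d0 : 0 < e / (n + 1) by rewrite divr_gt0 // ltr_wpDl.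
have [_ /(_ s t us ut y x)] := h _ d0; rewrite -/S -/n => /le_trans; apply.
rewrite mulrDl lerD2l -mulrA ler_piMr ?(ltW e0) // mulrC ler_pdivrMr ?ltr_wpDl // mul1r.
by rewrite lerDl.
Qed.

Definition closed_ops I J (A : set (op R I J)) : Prop :=
  forall T, (forall e, 0 < e -> exists2 a, A a & bnd e (a - T)) -> A T.

Definition csub I J (A : set (op R I J)) : Prop :=
  [/\ A 0, (forall c a b, A a -> A b -> A (opscale c a + b)) & closed_ops A].

Lemma csub0 I J (A : set (op R I J)) : csub A -> A 0. Proof. by case. Qed.
Lemma csub_lin I J (A : set (op R I J)) c a b : csub A -> A a -> A b -> A (opscale c a + b).
Proof. by case=> _ h _; exact: h. Qed.
Lemma csub_closed I J (A : set (op R I J)) : csub A -> closed_ops A. Proof. by case. Qed.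
Lemma csubD I J (A : set (op R I J)) a b : csub A -> A a -> A b -> A (a + b).
Proof. by move=> hA ha hb; have := csub_lin 1 hA ha hb; rewrite opscale1. Qed.
Lemma csubZ I J (A : set (op R I J)) c a : csub A -> A a -> A (opscale c a).
Proof. by move=> hA ha; have := csub_lin c hA ha (csub0 hA); rewrite addr0. Qed.
Lemma csubN I J (A : set (op R I J)) a : csub A -> A a -> A (- a).
Proof. by move=> hA ha; rewrite -opscaleN1; exact: csubZ. Qed.
Lemma csubB I J (A : set (op R I J)) a b : csub A -> A a -> A b -> A (a - b).
Proof. by move=> hA ha hb; apply: csubD => //; exact: csubN. Qed.
Lemma csub_sum (B : Type) (s : seq B) I J (A : set (op R I J)) (f : B -> op R I J) :
  csub A -> (forall b, A (f b)) -> A (\sum_(b <- s) f b).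
Proof.
move=> hA h; elim: s => [|b s IH]; first by rewrite big_nil; exact: csub0.
by rewrite big_cons; exact: csubD.
Qed.

Lemma op_sumE (B : Type) (s : seq B) I J (f : B -> op R I J) i j :
  (\sum_(b <- s) f b) i j = \sum_(b <- s) f b i j.
Proof. by elim: s => [|b s IH]; rewrite ?big_nil // !big_cons !fctE IH. Qed.

Lemma lspan_min I (S A : set (mat R I)) : A 0 ->
  (forall c a b, A a -> A b -> A (opscale c a + b)) -> S `<=` A -> lspan S `<=` A.
Proof.
move=> A0 hA SA T [n [c [s [hs ->]]]].
have -> : (fun i j => \sum_(k < n) c k * s k i j) = \sum_(k < n) opscale (c k) (s k) :> mat R I.
  by apply/funext=> i; apply/funext=> j; rewrite op_sumE.
elim/big_ind: _ => //.
  by move=> a b Aa Ab; have := hA 1 _ _ Aa Ab; rewrite opscale1.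
by move=> k _; rewrite -[opscale _ _]addr0; apply: hA => //; exact/SA/hs.
Qed.

Lemma lspan_sub I (S : set (mat R I)) : S `<=` lspan S.
Proof.
move=> T ST; exists 1%N, (fun=> 1), (fun=> T); split=> //.
by apply/funext=> i; apply/funext=> j; rewrite big_ord1 mul1r.
Qed.

Lemma lspan0 I (S : set (mat R I)) : lspan S 0.
Proof.
exists 0%N, (fun=> 0), (fun=> 0); split; first by case.
by apply/funext=> i; apply/funext=> j; rewrite big_ord0.
Qed.

Lemma lspan_lin I (S : set (mat R I)) c a b : lspan S a -> lspan S b ->
  lspan S (opscale c a + b).
Proof.
move=> [n [d [s [hs ->]]]] [m [d' [s' [hs' ->]]]].
exists (n + m)%N.
exists (fun k => match fintype.split k with inl k => c * d k | inr k => d' k end).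
exists (fun k => match fintype.split k with inl k => s k | inr k => s' k end); split.
  by move=> k; case: (fintype.split k).
apply/funext=> i; apply/funext=> j; rewrite /opscale !fctE big_split_ord /= mulr_sumr.
congr (_ + _); apply: eq_bigr => k _.
  by rewrite -[lshift _ _]/(unsplit (inl k)) unsplitK mulrA.
by rewrite -[rshift _ _]/(unsplit (inr k)) unsplitK.
Qed.

Lemma cspanP I (S : set (mat R I)) T : cspan S T <->
  forall e, 0 < e -> exists2 T', lspan S T' & bnd e (T' - T).
Proof.
split=> h e e0; have [T' h1 h2] := h e e0; exists T' => //.
  move: (opnorm_le_bnd (ltW e0) h2) => /bndN.
  by rewrite (_ : - _ = T' - T) //; apply/funext=> i; apply/funext=> j; rewrite /mlin !fctE; ring.
apply: bnd_opnorm_le; move: h2 => /bndN.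
by rewrite (_ : - _ = mlin (-1) T' T) //; apply/funext=> i; apply/funext=> j; rewrite /mlin !fctE; ring.
Qed.

Lemma cspan_csub I (S : set (mat R I)) : csub (cspan S).
Proof.
split.
- by apply/cspanP=> e e0; exists 0; [exact: lspan0|rewrite subrr; apply: bnd_le (bnd0 _ _) (ltW e0)].
- move=> c a b /cspanP ha /cspanP hb; apply/cspanP => e e0.
  have n0 : 0 < 2 * (normc c + 1) by rewrite mulr_gt0 // ltr_wpDl // normc_ge0.
  have [a' la ba] := ha _ (divr_gt0 e0 n0).
  have [b' lb bb'] := hb _ (divr_gt0 e0 (ltr0Sn R 1)).
  exists (opscale c a' + b'); first exact: lspan_lin.
  rewrite (_ : _ - _ = opscale c (a' - a) + (b' - b)); last first.
    by apply/funext=> i; apply/funext=> j; rewrite /opscale !fctE; ring.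
  apply: bnd_le (bnd_lin c ba bb') _.
  rewrite [leRHS]splitr lerD2r mulrA ler_pdivrMr // mulrA [leRHS]mulrC mulrA.
  have := normc_ge0 c; nra.
- move=> T h; apply/cspanP=> e e0; have e20 : 0 < e / 2 by rewrite divr_gt0.
  have [a /cspanP /(_ _ e20)[a' la ba] baT] := h _ e20.
  by exists a' => //; rewrite -(subrK a a') -addrA [e]splitr; exact: bndD.
Qed.

Lemma cspan_min I (S A : set (mat R I)) : csub A -> S `<=` A -> cspan S `<=` A.
Proof.
move=> hA SA T /cspanP hT; apply: (csub_closed hA) => e /hT[T' lT bT].
exists T' => //; apply: lspan_min lT => //; first exact: csub0.
by move=> *; exact: csub_lin.
Qed.

Lemma sub_cspan I (S : set (mat R I)) : S `<=` cspan S.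
Proof.
move=> T ST; apply/cspanP => e e0; exists T; first exact: lspan_sub.
by rewrite subrr; apply: bnd_le (bnd0 _ _) (ltW e0).
Qed.

Lemma selfdot_ge I (V : op R I unit) (s : seq I) : bounded V -> uniq s ->
  nrm s (V^~ tt) ^+ 2 <= complex.Re ((opadj V ** V) tt tt).
Proof.
move=> bV us; apply/ler_addgt0Pr => e e0.
have [s0 h] := opmul_hassum tt tt (bounded_adj bV) bV e0.
pose t := undup (s ++ s0).
have ht : normc (\sum_(i <- t) opadj V tt i * V i tt - (opadj V ** V) tt tt) <= e.
  apply: h; first exact: undup_uniq.
  by move=> i is0; rewrite mem_undup mem_cat is0 orbT.
have E : \sum_(i <- t) opadj V tt i * V i tt = ((nrm t (V^~ tt) ^+ 2)%:C)%C.
  by rewrite sqr_nrm -sum_real; apply: eq_bigr => i _; rewrite mulJ_normc.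
have le1 : nrm s (V^~ tt) ^+ 2 <= nrm t (V^~ tt) ^+ 2.
  rewrite !sqr_nrm; apply: sum_subset => //; first exact: undup_uniq.
    by move=> i; rewrite sqr_ge0.
  by move=> i si; rewrite mem_undup mem_cat si.
have := le_trans (normc_Re _) ht; rewrite E.
case: ((opadj V ** V) tt tt) => a b; rewrite -[complex.Re (_ - _)]/(nrm t (V^~ tt) ^+ 2 - a).
rewrite -[complex.Re (Complex a b)]/a ler_norml => /andP[_]; move: le1.
set p := nrm s _ ^+ 2; set q := nrm t _ ^+ 2; lra.
Qed.

(** $\|Sx\|^2=M^2\|x\|^2-\|Tx\|^2$. Inequalities between operators are expressed by explicit squares
    like this one, which *-homomorphisms preserve. *)
Lemma sum_squares_bnd I J K M (S : op R I J) (T : op R K J) : bounded S -> bounded T ->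
  0 <= M -> opadj S ** S + opadj T ** T = opscale ((M ^+ 2)%:C)%C mone -> bnd M S.
Proof.
move=> bS bT M0 E; apply: bnd_colI => // s t x us ut.
pose X : op R J unit := fun j _ => if j \in t then x j else 0.
have bX : bounded X.
  exists (nrm t x); rewrite -[X]opadjK; apply: bnd_adj.
  apply: bnd_row1; first exact: nrm_ge0.
  move=> r ur; rewrite nrmJ.
  have -> : nrm r (X^~ tt) = nrm [seq j <- r | j \in t] x.
    congr Num.sqrt; rewrite (bigID (mem t)) /= [X in _ + X]big1 ?addr0; last first.
      by move=> j /negbTE jt; rewrite /X jt normc_0 expr0n.
    by rewrite -big_filter; apply: eq_big_seq => j; rewrite mem_filter /X => /andP[->].
  by apply: nrm_sub; rewrite ?filter_uniq // => j; rewrite mem_filter => /andP[].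
rewrite -(ler_pXn2r (n := 2)) ?nnegrE ?mulr_ge0 ?nrm_ge0 // exprMn.
have SX i : \sum_(j <- t) S i j * x j = (S ** X) i tt.
  rewrite /opmul (csum_fin ut) => [|j /negbTE jt]; last by rewrite /X jt mulr0.
  by apply: eq_big_seq => j jt; rewrite /X jt.
have XX : (opadj X ** X) tt tt = ((nrm t x ^+ 2)%:C)%C.
  rewrite /opmul (csum_fin ut) => [|j /negbTE jt]; last by rewrite /X jt mulr0.
  rewrite sqr_nrm -sum_real; apply: eq_big_seq => j jt.
  by rewrite /opadj /X jt mulJ_normc.
under [X in X ^+ 2 <= _]eq_nrm do rewrite SX.
apply: le_trans (selfdot_ge (bounded_mul bS bX) us) _.
have bTX := bounded_mul bT bX.
have H2 := le_trans (sqr_ge0 _) (selfdot_ge bTX (isT : uniq [::])).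
have : opadj (S ** X) ** (S ** X) + opadj (T ** X) ** (T ** X) =
    opscale ((M ^+ 2)%:C)%C (opadj X ** X).
  rewrite !opadj_mul // !opmulA; try bb.
  rewrite -[opadj X ** opadj S ** S]opmulA -1?[opadj X ** opadj T ** T]opmulA; try bb.
  rewrite -opmulDl; try bb.
  by rewrite -opmulDr ?E ?opmulZr ?opmul1r ?opmulZl //; bb.
move=> /(congr1 (fun f => f tt tt)); rewrite !fctE /opscale XX.
move: H2; move: ((opadj (S ** X) ** _) tt tt) ((opadj (T ** X) ** _) tt tt) => a b hb EE.
have -> : M ^+ 2 * nrm t x ^+ 2 = complex.Re (a + b) by rewrite EE -rmorphM.
by move: a b hb {EE} => [a a'] [b b'] /=; rewrite lerDl.
Qed.

Definition calg I (A : set (mat R I)) : Prop :=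
  [/\ csub A, A mone, (forall a b, A a -> A b -> A (a ** b)),
      (forall a, A a -> A (opadj a)) & (forall a, A a -> bounded a)].

Lemma calg_csub I (A : set (mat R I)) : calg A -> csub A. Proof. by case. Qed.
Lemma calg1 I (A : set (mat R I)) : calg A -> A mone. Proof. by case. Qed.
Lemma calg_mul I (A : set (mat R I)) a b : calg A -> A a -> A b -> A (a ** b).
Proof. by case=> _ _ h _ _; exact: h. Qed.
Lemma calg_adj I (A : set (mat R I)) a : calg A -> A a -> A (opadj a).
Proof. by case=> _ _ _ h _; exact: h. Qed.
Lemma calg_bounded I (A : set (mat R I)) a : calg A -> A a -> bounded a.
Proof. by case=> _ _ _ _ h; exact: h. Qed.

Lemma closed_bounded I : closed_ops [set T : mat R I | bounded T].
Proof.
move=> T /(_ 1 ltr01)[a /= ba bT].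
by rewrite -(subrK a T) -opprB; apply: boundedD => //; apply: boundedN; exact: bnd_bounded bT.
Qed.

Lemma calg_all I : calg [set T : mat R I | bounded T].
Proof.
split=> //=; [|exact: bounded_one|by move=> *; bb|by move=> *; bb].
split=> /=; [exact: bounded0|by move=> *; bb|exact: closed_bounded].
Qed.

(* The norms of the iterates below are dominated by the same iteration applied to
   the number 1; it increases to 1. *)
Fixpoint sqrt_rate (n : nat) : R :=
  if n is m.+1 then (1 + sqrt_rate m ^+ 2) / 2 else 0.

Lemma sqrt_rate_bounds n : 0 <= sqrt_rate n <= 1.
Proof.
elim: n => [|n /andP[h0 h1]] /=; first by rewrite lexx ler01.
by rewrite divr_ge0 ?addr_ge0 ?sqr_ge0 //= ler_pdivrMr //; nra.
Qed.

Lemma sqrt_rate_incr n m : (n <= m)%N -> sqrt_rate n <= sqrt_rate m.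
Proof.
elim: m => [|m IH]; first by rewrite leqn0 => /eqP ->.
rewrite leq_eqVlt => /orP[/eqP -> //|/IH h]; apply: le_trans h _ => /=.
by rewrite ler_pdivlMr //; have /andP[] := sqrt_rate_bounds m; nra.
Qed.

(** One step of the iteration increases the rate by half the square of its distance to 1; as long as
    that distance exceeds [e], this is at least [e ^ 2 / 2], which cannot happen indefinitely below
    1. *)
Lemma sqrt_rate_lim e : 0 < e -> exists n, 1 - sqrt_rate n <= e.
Proof.
move=> e0; apply: contrapT => /forallNP h.
have he n : e < 1 - sqrt_rate n by rewrite ltNge; exact/negP/h.
have H n : 1 - sqrt_rate n <= 1 - n%:R * (e ^+ 2 / 2).
  elim: n => [|n IH]; first by rewrite mul0r !subr0.
  have := he n; have /andP[h0 h1] := sqrt_rate_bounds n; rewrite /= -(natr1 n) => hn.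
  have : e ^+ 2 <= (1 - sqrt_rate n) ^+ 2 by rewrite ler_pXn2r ?nnegrE ?subr_ge0 // ltW.
  have : (1 + sqrt_rate n ^+ 2) / 2 = sqrt_rate n + (1 - sqrt_rate n) ^+ 2 / 2 by field.
  by move=> ->; lra.
have e20 : 0 < e ^+ 2 / 2 by rewrite divr_gt0 ?exprn_gt0.
pose n := Num.Def.archi_bound (1 / (e ^+ 2 / 2)).
have : 1 / (e ^+ 2 / 2) < n%:R by apply: archi_boundP; rewrite divr_ge0 // ltW.
rewrite ltr_pdivrMr // => hn.
by have := H n; have /andP[_] := sqrt_rate_bounds n; lra.
Qed.

Lemma opmul_sqrB I (S T : mat R I) : bounded S -> bounded T ->
  S ** S - T ** T = S ** (S - T) + (S - T) ** T.
Proof.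
by move=> bS bT; rewrite opmulBr // opmulBl // addrA subrK.
Qed.

Lemma half_real : normc (((2^-1 : R)%:C)%C) = 2^-1.
Proof. by rewrite normc_real ger0_norm // invr_ge0. Qed.

(** The element [u] is the limit, starting from 0, of the iteration $u\mapsto(z+u^2)/2$, whose fixed
    points satisfy $(1-u)^2=1-z$. The iterates are polynomials in [z], so they lie in [A], are
    self-adjoint and commute with whatever commutes with [z]; all of this passes to the norm
    limit. *)
Lemma calg_sqrt I (A : set (mat R I)) z : calg A -> A z -> opadj z = z -> bnd 1 z ->
  exists u, [/\ A u, opadj u = u, bnd 1 u,
    (mone - u) ** (mone - u) = mone - z &
    forall w, bounded w -> w ** z = z ** w -> w ** u = u ** w].
Proof.
move=> hA Az zz b1; have bz := bnd_bounded b1.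
pose h : R[i] := ((2^-1 : R)%:C)%C.
pose u := fix u n := if n is m.+1 then opscale h (z + u m ** u m) else 0.
have Au n : A (u n).
  elim: n => [|n IH] /=; first exact: csub0 (calg_csub hA).
  apply: csubZ (calg_csub hA) _; apply: csubD (calg_csub hA) Az _; exact: calg_mul.
have bu n := calg_bounded hA (Au n).
have cu n : bnd (sqrt_rate n) (u n).
  elim: n => [|n IH] /=; first exact: bnd0.
  have := bndZ h (bndD b1 (bnd_mul IH IH)); rewrite half_real.
  by rewrite mulrC -expr2.
have hB (S T : mat R I) : bounded S -> bounded T -> opscale h (z + S ** S) - opscale h (z + T ** T) =
    opscale h (S ** (S - T) + (S - T) ** T).
  move=> bS bT; rewrite -opmul_sqrB //.
  by apply/funext=> i; apply/funext=> j; rewrite /opscale !fctE; ring.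
(* Since $S^2-T^2=S(S-T)+(S-T)T$, the bounds of the increments satisfy exactly the recursion of the
   increments of [sqrt_rate]. *)
have step n : bnd (sqrt_rate n.+1 - sqrt_rate n) (u n.+1 - u n).
  elim: n => [|n IH].
    have -> : u 1%N - u 0%N = u 1%N by exact: subr0.
    have -> : sqrt_rate 1 - sqrt_rate 0 = sqrt_rate 1 by exact: subr0.
    exact: cu.
  have -> : u n.+2 - u n.+1 = opscale h (z + u n.+1 ** u n.+1) - opscale h (z + u n ** u n) by [].
  rewrite hB //; apply: bnd_le (bndZ h (bndD (bnd_mul (cu _) IH) (bnd_mul IH (cu _)))) _.
  rewrite half_real -[sqrt_rate n.+2]/((1 + sqrt_rate n.+1 ^+ 2) / 2).
  have : sqrt_rate n.+1 = (1 + sqrt_rate n ^+ 2) / 2 by [].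
  move: (sqrt_rate n.+1) (sqrt_rate n) => a b ->.
  by rewrite le_eqVlt; apply/orP; left; apply/eqP; field.
have steps n m : (n <= m)%N -> bnd (sqrt_rate m - sqrt_rate n) (u m - u n).
  elim: m => [|m IH]; first by rewrite leqn0 => /eqP ->; rewrite !subrr; exact: bnd0.
  rewrite leq_eqVlt => /orP[/eqP ->|/IH hm]; first by rewrite !subrr; exact: bnd0.
  by have := bndD (step m) hm; rewrite !addrA !subrK.
have [n m nm||T hT] := @op_complete _ _ _ u (fun n => 1 - sqrt_rate n).
- apply: bnd_le (steps _ _ nm) _; rewrite lerD2r.
  by case/andP: (sqrt_rate_bounds m).
- exact: sqrt_rate_lim.
have eq_lim (S S' : mat R I) : (forall n, bnd (2 * (1 - sqrt_rate n)) (S - S')) -> S = S'.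
  move=> hS; apply/eqP; rewrite -subr_eq0; apply/eqP/bnd0_eq => e e0.
  have [n hn] := sqrt_rate_lim (divr_gt0 e0 (ltr0Sn R 1)); apply: bnd_le (hS n) _.
  by rewrite mulrC -ler_pdivlMr.
have AT : A T.
  apply: (csub_closed (calg_csub hA)) => e /sqrt_rate_lim[n hn].
  by exists (u n) => //; exact: bnd_le (hT n) hn.
have bT := calg_bounded hA AT.
have b1T : bnd 1 T.
  have := bndB (cu 0%N) (hT 0%N); rewrite [X in bnd X _]addrC subrK => H.
  by apply: (bnd_eq H); opext.
exists T; split=> //.
- apply: eq_lim => n; rewrite mulr_natl mulr2n.
  have uu : opadj (u n) = u n.
    elim: n => [|n IH]; first by apply/funext=> i; apply/funext=> j; rewrite /opadj rmorph0.
    rewrite /= opadjZ opadjD opadj_mul // IH zz; congr opscale.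
    by apply/eqP; rewrite eq_complex /= oppr0 !eqxx.
  have := bndB (hT n) (bnd_adj (hT n)); rewrite opadjD opadjN uu => H.
  by apply: (bnd_eq H); opext.
- have fixp : T = opscale h (z + T ** T).
    apply: eq_lim => n; rewrite mulr_natl mulr2n.
    have b1u : bnd 1 (u n) by apply: bnd_le (cu n) _; case/andP: (sqrt_rate_bounds n).
    have H : bnd (1 - sqrt_rate n) (opscale h (z + u n ** u n) - opscale h (z + T ** T)).
      rewrite hB //; apply: bnd_le (bndZ h (bndD (bnd_mul b1u (hT n)) (bnd_mul (hT n) b1T))) _.
      by rewrite half_real le_eqVlt; apply/orP; left; apply/eqP; field.
    have {}H := bndB H (hT n.+1).
    have {}H := bnd_le H (lerD (lexx _) (lerB (lexx 1) (sqrt_rate_incr (leqnSn n)))).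
    apply: (bnd_eq H); rewrite -[u n.+1]/(opscale h (z + u n ** u n)).
    move: (u n ** u n) (T ** T) => X Y; opext.
  have : opscale 2 T = z + T ** T.
    rewrite {1}fixp; apply/funext=> i; apply/funext=> j; rewrite /opscale mulrA.
    have -> : 2 * h = 1 by rewrite /h fmorphV rmorph_nat mulfV // pnatr_eq0.
    by rewrite mul1r.
  move=> E; rewrite opmulBl ?opmulBr ?opmul1l ?opmul1r; try bb.
  have -> : T ** T = opscale 2 T - z by rewrite E addrC addKr.
  by apply/funext=> i; apply/funext=> j; rewrite /opscale !fctE; ring.
- move=> w bw wz; apply/eqP; rewrite -subr_eq0; apply/eqP/bnd0_eq => e e0.
  have [N hw] := bw; have N0 := bnd_ge0 hw.
  have wu n : w ** u n = u n ** w.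
    elim: n => [|n IH]; first by rewrite opmul0l opmul0r.
    rewrite /= opmulZr ?opmulZl; try bb.
    rewrite opmulDr ?opmulDl; try bb.
    by rewrite wz opmulA // IH -opmulA // IH opmulA.
  have K0 : 0 < 2 * (N + 1) by lra.
  have [n hn] := sqrt_rate_lim (divr_gt0 e0 K0).
  have := bndB (bnd_mul (hT n) hw) (bnd_mul hw (hT n)).
  rewrite opmulBl // opmulBr // wu => H.
  apply: (bnd_le (bnd_eq H _)); first by opext.
  move: hn; rewrite ler_pdivlMr //.
  have /andP[] := sqrt_rate_bounds n; nra.
Qed.

End CStar.

(** * Contractivity of *-homomorphisms and isometry of the injective ones *)

Section StarHom.
Context {R : realType}.
Implicit Types (I J K : choiceType) (M N e : R).

(** Each value is required to be bounded, but continuity is not assumed: it is derived in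
    [shom_contr]. *)
Definition shom I J (A : set (mat R I)) (f : mat R I -> mat R J) : Prop :=
  [/\ (forall c a b, A a -> A b -> f (opscale c a + b) = opscale c (f a) + f b),
      (forall a b, A a -> A b -> f (a ** b) = f a ** f b),
      (forall a, A a -> f (opadj a) = opadj (f a)),
      f mone = mone & (forall a, A a -> bounded (f a))].

Section Basics.
Context {I J : choiceType} {A : set (mat R I)} {f : mat R I -> mat R J}.
Hypotheses (hA : calg A) (hf : shom A f).

Lemma shom_lin c a b : A a -> A b -> f (opscale c a + b) = opscale c (f a) + f b.
Proof. by case: hf => h _ _ _ _; exact: h. Qed.
Lemma shomM a b : A a -> A b -> f (a ** b) = f a ** f b.
Proof. by case: hf => _ h _ _ _; exact: h. Qed.
Lemma shomJ a : A a -> f (opadj a) = opadj (f a).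
Proof. by case: hf => _ _ h _ _; exact: h. Qed.
Lemma shom1 : f mone = mone. Proof. by case: hf. Qed.
Lemma shom_bounded a : A a -> bounded (f a).
Proof. by case: hf => _ _ _ _ h; exact: h. Qed.
Lemma shomD a b : A a -> A b -> f (a + b) = f a + f b.
Proof. by move=> ha hb; have := shom_lin 1 ha hb; rewrite !opscale1. Qed.
Lemma shom0 : f 0 = 0.
Proof.
have A0 := csub0 (calg_csub hA); have := shomD A0 A0; rewrite addr0 => /eqP.
by rewrite -subr_eq0 opprD addrA subrr sub0r oppr_eq0 => /eqP.
Qed.
Lemma shomZ c a : A a -> f (opscale c a) = opscale c (f a).
Proof.
by move=> ha; have := shom_lin c ha (csub0 (calg_csub hA)); rewrite shom0 !addr0.
Qed.
Lemma shomN a : A a -> f (- a) = - f a.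
Proof. by move=> ha; rewrite -!opscaleN1 shomZ. Qed.
Lemma shomB a b : A a -> A b -> f (a - b) = f a - f b.
Proof.
move=> ha hb; rewrite shomD ?shomN //; exact: csubN (calg_csub hA) hb.
Qed.
Lemma shom_sum (B : Type) (s : seq B) (g : B -> mat R I) : (forall b, A (g b)) ->
  f (\sum_(b <- s) g b) = \sum_(b <- s) f (g b).
Proof.
move=> h; elim: s => [|b s IH]; first by rewrite !big_nil shom0.
by rewrite !big_cons shomD ?IH //; exact: csub_sum (calg_csub hA) h.
Qed.
End Basics.

Lemma realcM (a b : R) : ((a * b)%:C)%C = (a%:C)%C * (b%:C)%C :> R[i].
Proof. by rewrite rmorphM. Qed.

Lemma opscaleA I J c d (T : op R I J) : opscale c (opscale d T) = opscale (c * d) T.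
Proof. by apply/funext=> i; apply/funext=> j; rewrite /opscale mulrA. Qed.

Lemma opscaleD I J c (S T : op R I J) : opscale c (S + T) = opscale c S + opscale c T.
Proof. by opext. Qed.

Lemma conj_real (a : R) : Num.conj ((a%:C)%C : R[i]) = (a%:C)%C.
Proof. by apply/eqP; rewrite eq_complex /= oppr0 !eqxx. Qed.

Lemma bnd_rescale I J M (T : op R I J) : 0 < M ->
  bnd 1 (opscale ((M^-1)%:C)%C T) -> bnd M T.
Proof.
move=> M0 /(bndZ (M%:C)%C); rewrite opscaleA -realcM mulfV ?gt_eqF // opscale1 mulr1.
by rewrite normc_real ger0_norm // ltW.
Qed.

Lemma bnd_unscale I J M (T : op R I J) : 0 < M ->
  bnd M T -> bnd 1 (opscale ((M^-1)%:C)%C T).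
Proof.
move=> M0 /(bndZ ((M^-1)%:C)%C); rewrite normc_real ger0_norm ?invr_ge0 ?ltW //.
by rewrite mulVf // gt_eqF.
Qed.

(** The square root of $1-x^*x$ lies in the algebra, so that the bound on [x] becomes an algebraic
    identity that a *-homomorphism carries over. *)
Lemma calg_sqrt_gram I (A : set (mat R I)) x : calg A -> A x -> bnd 1 x ->
  exists y, [/\ A y, opadj y = y & opadj x ** x + opadj y ** y = mone].
Proof.
move=> hA Ax b1; have bx := calg_bounded hA Ax; have Ax' := calg_adj hA Ax.
have b2 : bnd 1 (opadj x ** x) by have := bnd_mul (bnd_adj b1) b1; rewrite mulr1.
have sa : opadj (opadj x ** x) = opadj x ** x by rewrite opadj_mul ?opadjK //; bb.
have [u [Au uu b1u E _]] := calg_sqrt hA (calg_mul hA Ax' Ax) sa b2.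
exists (mone - u); have yy : opadj (mone - u) = mone - u by rewrite opadjD opadjN opadj1 uu.
split=> //; first exact: csubB (calg_csub hA) (calg1 hA) Au.
by rewrite yy E addrC subrK.
Qed.

Lemma opscale_one2 I : opscale (((1 : R) ^+ 2)%:C)%C (mone : mat R I) = mone.
Proof. by rewrite expr1n opscale1. Qed.

(* [1 - x*x = y*y] with [y] in the algebra, hence [1 - f(x)*f(x) = f(y)*f(y)]. *)
Lemma shom_contr I J (A : set (mat R I)) (f : mat R I -> mat R J) a M :
  calg A -> shom A f -> A a -> bnd M a -> bnd M (f a).
Proof.
move=> hA hf Aa ba; apply: bnd_lim (bnd_ge0 ba) _ => e e0.
have Me0 : 0 < M + e by rewrite ltr_wpDl // (bnd_ge0 ba).
have {}ba : bnd (M + e) a by apply: bnd_le ba _; rewrite lerDl ltW.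
apply: bnd_rescale => //; move: (bnd_unscale Me0 ba).
rewrite -(shomZ hA hf) //; have := csubZ ((M + e)^-1%:C)%C (calg_csub hA) Aa.
move: (opscale _ a) => x Ax b1.
have [y [Ay yy E]] := calg_sqrt_gram hA Ax b1.
have Ax' := calg_adj hA Ax; have Ay' := calg_adj hA Ay.
have bfx := shom_bounded hf Ax; have bfy := shom_bounded hf Ay.
apply: (sum_squares_bnd bfx bfy ler01).
rewrite opscale_one2 -!(shomJ hf) // -!(shomM hf) //.
by rewrite -(shomD hf) ?E ?(shom1 hf) //; exact: calg_mul.
Qed.

(** The case [M = 0] of [sum_squares_bnd], used for both summands. *)
Lemma sum_squares0 I J K (S : op R I J) (T : op R K J) : bounded S -> bounded T ->
  opadj S ** S + opadj T ** T = 0 -> S = 0 /\ T = 0.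
Proof.
move=> bS bT E; split; apply: bnd0_eq => e e0.
  apply: (bnd_le _ (ltW e0)); apply: sum_squares_bnd bS bT (lexx 0) _.
  by rewrite E expr0n; apply/funext=> i; apply/funext=> j; rewrite /opscale mul0r.
apply: (bnd_le _ (ltW e0)); apply: sum_squares_bnd bT bS (lexx 0) _.
by rewrite addrC E expr0n; apply/funext=> i; apply/funext=> j; rewrite /opscale mul0r.
Qed.

Lemma square0 I J (S : op R I J) : bounded S -> opadj S ** S = 0 -> S = 0.
Proof.
move=> bS E; apply: (sum_squares0 bS (bounded0 I J) _).1.
by rewrite E opmul0r addr0.
Qed.

(* With [y = (x*x - 1)/c] and [a = |y| = b*b], the element [f(y)] is [- q q] because
   [f x] is a contraction, so [f(a)] and [q q] are two commuting positive square
   roots of [f(y)^2]; hence [f(a + y) = 0], [a = - y], and [1 - x*x = c b*b]. *)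
Lemma shom_isometric1 I J (A : set (mat R I)) (f : mat R I -> mat R J) x :
  calg A -> shom A f -> (forall a, A a -> f a = 0 -> a = 0) -> A x ->
  bnd 1 (f x) -> bnd 1 x.
Proof.
move=> hA hf inj Ax b1; have sA := calg_csub hA; have A1 := calg1 hA.
have Ax' := calg_adj hA Ax; have Axx := calg_mul hA Ax' Ax.
have [N hN] := calg_bounded hA Axx; have N0 := bnd_ge0 hN.
pose c := N + 1; have c0 : 0 < c by rewrite ltr_wpDl.
pose y := opscale ((c^-1)%:C)%C (opadj x ** x - mone).
have Ay : A y by apply: csubZ sA (csubB sA Axx A1).
have by1 : bnd 1 y by apply: (bnd_unscale c0); exact: (bndB hN (bnd_one _)).
have yy : opadj y = y.
  rewrite /y opadjZ conj_real opadjD opadjN opadj1 opadj_mul ?opadjK //;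
  exact: calg_bounded hA _.
have bx := calg_bounded hA Ax; have b_y := calg_bounded hA Ay.
have [w [Aw ww Ew]] := calg_sqrt_gram hA Ay by1; rewrite yy ww in Ew.
have bw := calg_bounded hA Aw.
have bw1 : bnd 1 w.
  apply: (sum_squares_bnd bw b_y ler01); rewrite opscale_one2 yy ww.
  by rewrite addrC.
have bz1 : bnd 1 (w ** w) by have := bnd_mul bw1 bw1; rewrite mulr1.
have zz : opadj (w ** w) = w ** w by rewrite opadj_mul // ww.
have [u [Au uu bu1 Eu comm]] := calg_sqrt hA (calg_mul hA Aw Aw) zz bz1.
have bu := calg_bounded hA Au.
have [v [Av vv bv1 Ev _]] := calg_sqrt hA Au uu bu1.
pose a := mone - u; pose b := mone - v.
have Aa : A a by exact: csubB.
have Ab : A b by exact: csubB.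
have ab : b ** b = a by [].
have bb : opadj b = b by rewrite /b opadjD opadjN opadj1 vv.
have ayy : a ** a = y ** y by rewrite /a Eu -Ew addrK.
have ya : y ** a = a ** y.
  rewrite /a opmulBr ?opmulBl ?opmul1r ?opmul1l; try bb.
  congr (_ - _); apply: comm => //.
  have -> : w ** w = mone - y ** y by rewrite -Ew addrC addKr.
  by rewrite opmulBr ?opmulBl ?opmul1r ?opmul1l ?opmulA //; bb.
have bfx := shom_bounded hf Ax.
have [q0 [bq0 q00 Eq]] := calg_sqrt_gram (@calg_all R J) (bfx : [set T | bounded T] (f x)) b1.
pose r := Num.sqrt c^-1; pose q := opscale (r%:C)%C q0.
have {}bq0 : bounded q0 := bq0.
have bq : bounded q by exact: boundedZ.
have qq : opadj q = q by rewrite /q opadjZ conj_real q00.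
have fy : f y = - (q ** q).
  rewrite /q opmulZl ?opmulZr //; try bb.
  rewrite opscaleA -realcM -expr2 sqr_sqrtr ?invr_ge0 ?ltW //.
  rewrite /y (shomZ hA hf) ?(shomB hA hf) ?(shomM hf) ?(shomJ hf) ?(shom1 hf) //; last exact: csubB.
  rewrite q00 in Eq.
  have -> : q0 ** q0 = mone - opadj (f x) ** f x by rewrite -Eq addrC addKr.
  by opext.
have bfa := shom_bounded hf Aa; have bfb := shom_bounded hf Ab.
have bqq : bounded (q ** q) by bb.
pose d := f (a + y).
have Ed : d = f a - q ** q by rewrite /d (shomD hf) // fy.
have bd : bounded d by rewrite Ed; bb.
have dd : opadj d = d.
  by rewrite Ed opadjD opadjN opadj_mul ?qq -?(shomJ hf) // /a opadjD opadjN opadj1 uu.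
have fafa : f a ** f a = (q ** q) ** (q ** q).
  rewrite -(shomM hf) // ayy (shomM hf) // fy opmulNl ?opmulNr ?opprK //; bb.
have fac : (q ** q) ** f a = f a ** (q ** q).
  have := congr1 f ya; rewrite !(shomM hf) // fy opmulNl ?opmulNr //; try bb.
  by move/oppr_inj.
have H0 : d ** (f a + q ** q) = 0.
  rewrite Ed opmulBl ?opmulDr //; try bb.
  rewrite fafa fac; opext.
(* Multiplying [H0] by [d] shows that $d\,f(a)\,d+d\,q^2d$ vanishes; it is a sum of two squares
   because $f(a)=f(b)^2$. Hence $f(b)d=qd=0$, and then $d^2=(f(a)-q^2)d=0$. *)
have H1 : opadj (f b ** d) ** (f b ** d) + opadj (q ** d) ** (q ** d) = 0.
  rewrite !opadj_mul // dd qq -(shomJ hf) // bb !opmulA //; try bb.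
  rewrite -[d ** f b ** f b]opmulA // -(shomM hf) // ab -[d ** q ** q]opmulA //.
  rewrite -opmulDl //; try bb.
  by rewrite -opmulDr // H0 opmul0l.
have [|| h1 h2] := sum_squares0 _ _ H1; try bb.
have d0 : d = 0.
  apply: (square0 bd); rewrite dd {1}Ed opmulBl //; try bb.
  rewrite -ab (shomM hf) // -!opmulA //.
  by rewrite h1 h2 !opmul0r subrr.
have ay0 : a + y = 0 by apply: inj d0; exact: csubD.
have ey : opscale (c%:C)%C y = opadj x ** x - mone.
  by rewrite /y opscaleA -realcM mulfV ?gt_eqF // opscale1.
have bbnd := calg_bounded hA Ab.
pose t := opscale ((Num.sqrt c)%:C)%C b.
have tt : opadj t ** t = opscale (c%:C)%C a.
  rewrite /t opadjZ conj_real bb opmulZl ?opmulZr //; try bb.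
  by rewrite opscaleA -realcM -expr2 sqr_sqrtr ?ltW // ab.
apply: (@sum_squares_bnd _ _ _ _ _ x t) => //; first exact: boundedZ.
rewrite opscale_one2 tt; have -> : a = - y by apply/eqP; rewrite -addr_eq0 ay0.
by rewrite -opscaleN1 opscaleA mulrC -opscaleA opscaleN1 ey opprB addrC subrK.
Qed.

(** Rescaling to norm 1; the additional [e] makes the scale positive when [M] is 0. *)
Lemma shom_isometric I J (A : set (mat R I)) (f : mat R I -> mat R J) a M :
  calg A -> shom A f -> injective_on A f -> A a ->
  bnd M (f a) -> bnd M a.
Proof.
move=> hA hf inj Aa ba; apply: bnd_lim (bnd_ge0 ba) _ => e e0.
have Me0 : 0 < M + e by rewrite ltr_wpDl // (bnd_ge0 ba).
have {}ba : bnd (M + e) (f a) by apply: bnd_le ba _; rewrite lerDl ltW.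
apply: bnd_rescale => //; move: (bnd_unscale Me0 ba).
rewrite -(shomZ hA hf) //; have := csubZ ((M + e)^-1%:C)%C (calg_csub hA) Aa.
move: (opscale _ a) => x Ax b1; apply: (shom_isometric1 hA hf _ Ax b1) => y Ay fy.
have A0 := csub0 (calg_csub hA).
by apply: inj => //; rewrite fy (shom0 hA hf).
Qed.

End StarHom.

(** * Blockwise application of maps and compact operators *)

Section Blocks.
Context {R : realType}.
Implicit Types (I J K : choiceType) (M N e : R).

Definition blk I J (T : mat R (I * J)%type) (j l : J) : mat R I :=
  fun i k => T (i, j) (k, l).

Definition blk2 I J (T : mat R (I * J)%type) (i k : I) : mat R J :=
  fun j l => T (i, j) (k, l).

(** This is $f\otimes\mathrm{id}$, computed on the matrix entries of the second factor. It makes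
    sense for every operator with blocks in the domain of [f], not only for limits of elementary
    tensors, and [amq] is its counterpart for the second factor. *)
Definition amp I I' J (f : mat R I -> mat R I') (T : mat R (I * J)%type) :
    mat R (I' * J)%type :=
  fun p q => f (blk T p.2 q.2) p.1 q.1.

Definition amq I J J' (g : mat R J -> mat R J') (T : mat R (I * J)%type) :
    mat R (I * J')%type :=
  fun p q => g (blk2 T p.1 q.1) p.2 q.2.

Lemma amqE I J J' (g : mat R J -> mat R J') (T : mat R (I * J)%type) :
  amq g T = flip (amp g (flip T)).
Proof. by []. Qed.

Lemma blk_amp I I' J (f : mat R I -> mat R I') (T : mat R (I * J)%type) j l :
  blk (amp f T) j l = f (blk T j l).
Proof. by []. Qed.

Lemma blkP I J (S T : mat R (I * J)%type) :
  (forall j l, blk S j l = blk T j l) -> S = T.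
Proof.
move=> h; apply/funext=> -[i j]; apply/funext=> -[k l].
exact: (congr1 (fun X => X i k) (h j l)).
Qed.

Lemma bnd_blk I J M (T : mat R (I * J)%type) j l : bnd M T -> bnd M (blk T j l).
Proof.
by apply: (@bnd_inj _ _ _ _ _ _ (fun i => (i, j)) (fun i => (i, l))) => a b [].
Qed.

Lemma bounded_blk I J (T : mat R (I * J)%type) j l : bounded T -> bounded (blk T j l).
Proof. by move=> [M h]; exists M; exact: bnd_blk. Qed.

Lemma bounded_blk2 I J (T : mat R (I * J)%type) j l : bounded T -> bounded (blk2 T j l).
Proof. by move=> /bounded_flip h; exact: (bounded_blk j l h). Qed.

Definition dlt J (k l : J) : mat R J := fun i j => ((i == k) && (j == l))%:R.

Lemma bnd_dlt J (k l : J) : bnd 1 (dlt k l).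
Proof.
apply: bnd_colI => // s t x us ut; rewrite mul1r.
have E i : \sum_(j <- t) dlt k l i j * x j = (i == k)%:R * (if l \in t then x l else 0).
  have [lt|lt] := boolP (l \in t).
    rewrite (bigD1_seq l) //= /dlt eqxx andbT big1 ?addr0 // => j /negbTE jl.
    by rewrite jl andbF mul0r.
  rewrite big_seq big1 ?mulr0 // => j jt; rewrite /dlt.
  have -> : (j == l) = false by apply: contraNF lt => /eqP <-.
  by rewrite andbF mul0r.
under eq_nrm do rewrite E.
rewrite -(ler_pXn2r (n := 2)) ?nnegrE ?nrm_ge0 // !sqr_nrm.
case: ifP => [lt|_]; last first.
  by rewrite big1 ?sumr_ge0 // => i _; rewrite ?sqr_ge0 // mulr0 normc_0 expr0n.
have -> : \sum_(i <- s) normc ((i == k)%:R * x l) ^+ 2 = (k \in s)%:R * normc (x l) ^+ 2.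
  have [ks|ks] := boolP (k \in s).
    rewrite (bigD1_seq k) //= eqxx !mul1r big1 ?addr0 // => i /negbTE ->.
    by rewrite mul0r normc_0 expr0n.
  rewrite mul0r big_seq big1 // => i iss.
  have -> : (i == k) = false by apply: contraNF ks => /eqP <-.
  by rewrite mul0r normc_0 expr0n.
rewrite (bigD1_seq l) //=; apply: ler_wpDr; first by apply: sumr_ge0 => i _; rewrite sqr_ge0.
by case: (k \in s); rewrite ?mul1r // mul0r sqr_ge0.
Qed.

Lemma bounded_dlt J (k l : J) : bounded (dlt k l).
Proof. by exists 1; exact: bnd_dlt. Qed.

Lemma blk_lin I J c (S T : mat R (I * J)%type) j l :
  blk (opscale c S + T) j l = opscale c (blk S j l) + blk T j l.
Proof. by []. Qed.

Lemma blk_adj I J (T : mat R (I * J)%type) j l : blk (opadj T) j l = opadj (blk T l j).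
Proof. by []. Qed.

Lemma blk_mtens I J (a : mat R I) (b : mat R J) j l :
  blk (mtens a b) j l = opscale (b j l) a.
Proof. by apply/funext=> i; apply/funext=> k; rewrite /blk /mtens /opscale mulrC. Qed.

Lemma blk_one I J (j l : J) : blk (mone : mat R (I * J)%type) j l = opscale (j == l)%:R mone.
Proof. by rewrite -mtens_one blk_mtens. Qed.

Lemma hassum_slice I J (f : I -> R[i]) (j : J) z :
  hassum f z -> (exists M, abs_bounded M f) ->
  hassum (fun p : I * J => f p.1 * (p.2 == j)%:R) z.
Proof.
move=> hf bf; have h : hassum (fun b : J => (b == j)%:R : R[i]) 1.
  suff : hassum (fun b : J => (b == j)%:R : R[i]) (\sum_(b <- [:: j]) (b == j)%:R).
    by rewrite big_seq1 eqxx.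
  by apply: hassum_fin => // b; rewrite inE => /negbTE ->.
have b1 : exists M, abs_bounded M (fun b : J => (b == j)%:R : R[i]).
  by apply: (@hassum_abs _ _ _ [:: j]) => // b; rewrite inE => /negbTE ->.
by have := (hassum_prod hf h bf b1).2; rewrite mulr1.
Qed.

Lemma blk_mul_fin I n (S T : mat R (I * 'I_n)%type) j l : bounded S -> bounded T ->
  blk (S ** T) j l = \sum_(m < n) blk S j m ** blk T m l.
Proof.
move=> bS bT; apply/funext=> i; apply/funext=> k; apply: opmul_eq => //.
rewrite op_sumE.
have -> : (fun p : I * 'I_n => S (i, j) p * T p (k, l)) =
   (fun p => \sum_(m < n) (blk S j m i p.1 * blk T m l p.1 k) * (p.2 == m)%:R).
  apply/funext=> -[a m] /=; rewrite (bigD1 m) //= eqxx mulr1 big1 ?addr0 // => m' /negbTE.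
  by rewrite eq_sym => ->; rewrite mulr0.
apply: hassum_sum => m.
apply: (hassum_slice (f := fun a => blk S j m i a * blk T m l a k)).
  by apply: opmul_hassum; exact: bounded_blk.
have [M hM] := bounded_blk j m bS; have [N hN] := bounded_blk m l bT.
by exists (M * N); exact: mul_abs_bounded hM hN.
Qed.

Lemma blk_fin_sum I n (T : mat R (I * 'I_n)%type) :
  T = \sum_(k < n) \sum_(l < n) mtens (blk T k l) (dlt k l).
Proof.
apply/funext=> -[i j]; apply/funext=> -[i' l]; rewrite op_sumE.
under eq_bigr do rewrite op_sumE.
rewrite (bigD1 j) //= [X in _ + X]big1 ?addr0; last first.
  move=> k /negbTE kj; rewrite big1 // => m _; rewrite /mtens /dlt /=.
  by rewrite eq_sym kj mulr0.
rewrite (bigD1 l) //= [X in _ + X]big1 ?addr0; last first.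
  by move=> k /negbTE kj; rewrite /mtens /dlt /= eqxx eq_sym kj mulr0.
by rewrite /mtens /dlt /= !eqxx mulr1.
Qed.

Definition blocks_in I J (A : set (mat R I)) (T : mat R (I * J)%type) : Prop :=
  forall j l, A (blk T j l).

(** These are the matrices over [A]. With finitely many blocks an operator is a finite sum of
    elementary tensors with matrix units, hence bounded, and block multiplication is purely
    algebraic. *)
Lemma calg_blocks I n (A : set (mat R I)) : calg A -> calg (@blocks_in I 'I_n A).
Proof.
move=> hA; have sA := calg_csub hA.
have bb T : @blocks_in I 'I_n A T -> bounded T.
  move=> h; rewrite (blk_fin_sum T); apply: bounded_sum => k; apply: bounded_sum => l.
  by apply: bounded_mtens; [exact: (calg_bounded hA (h k l))|exact: bounded_dlt].
split=> //.
- split.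
  + by move=> j l; exact: csub0 sA.
  + by move=> c S T hS hT j l; rewrite blk_lin; exact: csub_lin.
  + move=> T hT j l; apply: (csub_closed sA) => e /hT[S hS bS].
    by exists (blk S j l) => //; exact: (bnd_blk j l bS).
- by move=> j l; rewrite blk_one; apply: csubZ sA _; exact: calg1.
- move=> S T hS hT j l; rewrite blk_mul_fin; try exact: bb.
  by apply: csub_sum => // m; exact: calg_mul.
- by move=> T hT j l; rewrite blk_adj; exact: calg_adj.
Qed.

Lemma shom_blocks I I' n (A : set (mat R I)) (f : mat R I -> mat R I') :
  calg A -> shom A f -> shom (@blocks_in I 'I_n A) (amp f).
Proof.
move=> hA hf; have hn := calg_blocks n hA.
have bf T : blocks_in A T -> bounded (amp f (T : mat R (I * 'I_n)%type)).
  move=> h; rewrite (blk_fin_sum (amp f T)); apply: bounded_sum => k; apply: bounded_sum => l.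
  by apply: bounded_mtens; [rewrite blk_amp; apply: (shom_bounded hf); exact: h|exact: bounded_dlt].
split=> //.
- move=> c S T hS hT; apply: blkP => j l.
  by rewrite blk_amp !blk_lin !blk_amp (shom_lin hf).
- move=> S T hS hT; apply: blkP => j l.
  have bS := calg_bounded hn hS; have bT := calg_bounded hn hT.
  rewrite blk_amp !blk_mul_fin //; try exact: bf.
  rewrite (shom_sum hA hf) => [|m]; last exact: calg_mul.
  by apply: eq_bigr => m _; rewrite (shomM hf).
- by move=> T hT; apply: blkP => j l; rewrite blk_amp !blk_adj blk_amp (shomJ hf).
- apply: blkP => j l; rewrite blk_amp !blk_one (shomZ hA hf) ?(shom1 hf) //.
  exact: calg1.
Qed.

Lemma seq_lift (X Y : eqType) (u : X -> Y) (s : seq Y) :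
  (forall y, y \in s -> exists x, u x = y) -> exists s', map u s' = s.
Proof.
elim: s => [|y s IH] h; first by exists [::].
have [|s' <-] := IH; first by move=> z zs; apply: h; rewrite inE zs orbT.
by have [x <-] := h y (mem_head _ _); exists (x :: s').
Qed.

(** The finite lists in [bnd] involve only finitely many indices of the second leg, which lie in the
    range of one injection [e]. *)
Lemma bnd_local I J M (T : mat R (I * J)%type) : 0 <= M ->
  (forall n (e : 'I_n -> J), injective e ->
     bnd M (ridx (fun p : I * 'I_n => (p.1, e p.2)) T)) -> bnd M T.
Proof.
move=> M0 h; split=> // s t us ut y x.
have [n [e [ei he]]] : exists n (e : 'I_n -> J), injective e /\
    forall p, p \in s ++ t -> exists k, e k = p.2.
  pose r := in_tuple (undup (map snd (s ++ t))); exists _, (tnth r); split.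
    by apply/tuple_uniqP; exact: undup_uniq.
  move=> p pst; have : p.2 \in r by rewrite mem_undup map_f.
  by move=> /tnthP[k ->]; exists k.
have [_ hb] := h _ _ ei; pose v (p : I * 'I_n) := (p.1, e p.2).
have L (q : seq (I * J)) : {subset q <= s ++ t} -> exists q', map v q' = q.
  move=> qst; apply: seq_lift => -[i j] /qst /he[k /= <-].
  by exists (i, k).
have [|s' es] := L s; first by move=> p ps; rewrite mem_cat ps.
have [|t' et] := L t; first by move=> p ps; rewrite mem_cat ps orbT.
rewrite -es in us *; rewrite -et in ut *.
have := hb s' t' (map_uniq us) (map_uniq ut) (y \o v) (x \o v).
rewrite big_map /nrm !big_map.
congr (normc _ <= _); apply: eq_bigr => p _.
by rewrite big_map.
Qed.

Lemma bnd_restrict I J n (e : 'I_n -> J) M (T : mat R (I * J)%type) : injective e ->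
  bnd M T -> bnd M (ridx (fun p : I * 'I_n => (p.1, e p.2)) T).
Proof. by move=> ei; apply: bnd_ridx => -[a b] [c d] [-> /ei ->]. Qed.

(** *-homomorphisms are completely contractive: on a finite corner [amp f] is a *-homomorphism of
    matrices over [A], so [shom_contr] applies, and norms are detected on finite corners. *)
Lemma amp_contr I I' J M (A : set (mat R I)) (f : mat R I -> mat R I')
    (T : mat R (I * J)%type) :
  calg A -> shom A f -> blocks_in A T -> bnd M T -> bnd M (amp f T).
Proof.
move=> hA hf hT bT; apply: bnd_local (bnd_ge0 bT) _ => n e ei.
rewrite -[ridx _ _]/(amp f (ridx (fun p : I * 'I_n => (p.1, e p.2)) T)).
apply: (shom_contr (calg_blocks n hA) (shom_blocks n hA hf)).
  by move=> j l; exact: (hT (e j) (e l)).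
exact: bnd_restrict.
Qed.

Section Amp.
Context {I I' : choiceType} {A : set (mat R I)} {f : mat R I -> mat R I'}.
Hypotheses (hA : calg A) (hf : shom A f).

Lemma amp_lin J c (S T : mat R (I * J)%type) : blocks_in A S -> blocks_in A T ->
  amp f (opscale c S + T) = opscale c (amp f S) + amp f T.
Proof.
by move=> hS hT; apply: blkP => j l; rewrite blk_amp !blk_lin !blk_amp (shom_lin hf).
Qed.

Lemma amp_adj J (T : mat R (I * J)%type) : blocks_in A T ->
  amp f (opadj T) = opadj (amp f T).
Proof. by move=> hT; apply: blkP => j l; rewrite blk_amp !blk_adj blk_amp (shomJ hf). Qed.

Lemma amp_one J : amp f (mone : mat R (I * J)%type) = mone.
Proof.
apply: blkP => j l; rewrite blk_amp !blk_one (shomZ hA hf) ?(shom1 hf) //.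
exact: calg1.
Qed.

Lemma amp_mtens J a (b : mat R J) : A a -> amp f (mtens a b) = mtens (f a) b.
Proof. by move=> Aa; apply: blkP => j l; rewrite blk_amp !blk_mtens (shomZ hA hf). Qed.

Lemma amp_bounded J (T : mat R (I * J)%type) : blocks_in A T -> bounded T ->
  bounded (amp f T).
Proof. by move=> hT [M bT]; exists M; exact: amp_contr hA hf hT bT. Qed.

Lemma blocks_in_mtens J a (b : mat R J) : A a -> blocks_in A (mtens a b).
Proof. by move=> Aa j l; rewrite blk_mtens; exact: csubZ (calg_csub hA) Aa. Qed.

Lemma blocks_in_closed J : closed_ops (@blocks_in I J A).
Proof.
move=> T hT j l; apply: (csub_closed (calg_csub hA)) => e /hT[S hS bS].
by exists (blk S j l) => //; exact: (bnd_blk j l bS).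
Qed.

End Amp.

End Blocks.
#[global] Hint Resolve bounded_dlt bounded_blk bounded_blk2 : bdb.

(** * Bounded linear maps and arguments by density *)

Section Density.
Context {R : realType}.
Implicit Types (I J K L : choiceType) (M N e : R).

(** The maps in question, such as a *-homomorphism or [amp f], are linear and bounded only on a
    domain [D], and outside it their values are arbitrary; hence the relative notion. *)
Definition blin I J K L (D : set (op R I J)) (F : op R I J -> op R K L) : Prop :=
  (forall c S T, D S -> D T -> F (opscale c S + T) = opscale c (F S) + F T) /\
  (exists C, 0 <= C /\ forall M T, D T -> bnd M T -> bnd (C * M) (F T)).

Lemma blinB I J K L (D : set (op R I J)) (F : op R I J -> op R K L) S T :
  csub D -> blin D F -> D S -> D T -> F (S - T) = F S - F T.
Proof.
move=> hD [hF _] hS hT; rewrite addrC -opscaleN1 hF // opscaleN1.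
by rewrite addrC.
Qed.

Lemma blin_csub I J K L (D : set (op R I J)) (F : op R I J -> op R K L) (A : set (op R K L)) :
  csub D -> blin D F -> csub A -> csub [set T | D T /\ A (F T)].
Proof.
move=> hD bF hA; have [lF [C [C0 hC]]] := bF; split=> /=.
- split; first exact: csub0.
  have -> : F 0 = 0 by have := blinB hD bF (csub0 hD) (csub0 hD); rewrite !subrr.
  exact: csub0.
- move=> c S T [DS AS] [DT AT]; split; first exact: csub_lin.
  by rewrite lF //; exact: csub_lin.
- move=> T hT; have DT : D T.
    by apply: (csub_closed hD) => e /hT[S [DS _] bS]; exists S.
  split=> //; apply: (csub_closed hA) => e e0.
  have C1 : 0 < C + 1 by rewrite ltr_wpDl.
  have [S [DS AS] bS] := hT _ (divr_gt0 e0 C1); exists (F S) => //.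
  rewrite -(blinB hD bF) //; apply: bnd_le (hC _ _ (csubB hD DS DT) bS) _.
  by rewrite mulrA ler_pdivrMr // mulrDr mulr1 [leLHS]mulrC lerDl ltW.
Qed.

(** The preimage of a closed subspace under a bounded linear map is a closed subspace ([blin_csub]),
    so only generators have to be inspected. Most density arguments below have this form. *)
Lemma blin_cspan I K L (D : set (mat R I)) (F : mat R I -> op R K L) (A : set (op R K L))
    (X : set (mat R I)) :
  csub D -> blin D F -> csub A -> X `<=` D -> (forall x, X x -> A (F x)) ->
  forall T, cspan X T -> A (F T).
Proof.
move=> hD bF hA XD XA T hT.
suff [] : [set T | D T /\ A (F T)] T by [].
by apply: (cspan_min (blin_csub hD bF hA)) hT => x Xx; split; [exact: XD|exact: XA].
Qed.

Lemma csub_zero I J : csub [set T : op R I J | T = 0].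
Proof.
split=> //=; first by move=> c a b -> ->; rewrite addr0; apply/funext=> i; apply/funext=> j; rewrite /opscale mulr0.
move=> T h; apply/oppr_inj; rewrite oppr0; apply: bnd0_eq => e /h[S ->].
by rewrite sub0r.
Qed.

Lemma blin_sub I J K L (D : set (op R I J)) (F G : op R I J -> op R K L) :
  blin D F -> blin D G -> blin D (fun T => F T - G T).
Proof.
move=> [lF [C [C0 hC]]] [lG [C' [C'0 hC']]]; split.
  by move=> c S T DS DT; rewrite lF // lG //; opext.
exists (C + C'); split; first exact: addr_ge0.
by move=> M T DT bT; rewrite mulrDl; apply: bndB; [exact: hC|exact: hC'].
Qed.

Lemma blin_eq I K L (D : set (mat R I)) (F G : mat R I -> op R K L) (X : set (mat R I)) :
  csub D -> blin D F -> blin D G -> X `<=` D -> (forall x, X x -> F x = G x) ->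
  forall T, cspan X T -> F T = G T.
Proof.
move=> hD bF bG XD h T hT; apply/eqP; rewrite -subr_eq0; apply/eqP.
apply: (blin_cspan hD (blin_sub bF bG) (@csub_zero K L) XD) hT => x Xx /=.
by rewrite h // subrr.
Qed.

Lemma blin_mull I J K (D : set (op R J K)) (S : op R I J) : bounded S ->
  (forall T, D T -> bounded T) -> blin D (opmul S).
Proof.
move=> bS hD; split; first by move=> c T T' /hD ? /hD ?; rewrite opmul_linr.
have [N hN] := bS; exists N; split; first exact: bnd_ge0 hN.
by move=> M T _ hT; exact: bnd_mul.
Qed.

Lemma blin_mulr I J K (D : set (op R I J)) (S : op R J K) : bounded S ->
  (forall T, D T -> bounded T) -> blin D (fun T => T ** S).
Proof.
move=> bS hD; split; first by move=> c T T' /hD ? /hD ?; rewrite opmul_linl.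
have [N hN] := bS; exists N; split; first exact: bnd_ge0 hN.
by move=> M T _ hT; rewrite mulrC; exact: bnd_mul.
Qed.

Lemma blin_tensl I J (D : set (mat R I)) (b : mat R J) : bounded b -> blin D (fun a => mtens a b).
Proof.
move=> [N hN]; split; first by move=> *; rewrite mtens_linl.
exists N; split; first exact: bnd_ge0 hN.
by move=> M T _ hT; rewrite mulrC; exact: bnd_mtens.
Qed.

Lemma blin_tensr I J (D : set (mat R J)) (a : mat R I) : bounded a -> blin D (fun b => mtens a b).
Proof.
move=> [N hN]; split; first by move=> *; rewrite mtens_linr.
exists N; split; first exact: bnd_ge0 hN.
by move=> M T _ hT; exact: bnd_mtens.
Qed.

Lemma blin_comp I J K L I' J' (D : set (op R I J)) (D' : set (op R K L))
    (F : op R I J -> op R K L) (G : op R K L -> op R I' J') :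
  blin D F -> blin D' G -> (forall T, D T -> D' (F T)) -> blin D (fun T => G (F T)).
Proof.
move=> [lF [C [C0 hC]]] [lG [C' [C'0 hC']]] h; split.
  by move=> c S T DS DT; rewrite lF // lG //; exact: h.
exists (C' * C); split; first exact: mulr_ge0.
by move=> M T DT bT; rewrite -mulrA; apply: hC'; [exact: h|exact: hC].
Qed.

Lemma blin_subset I J K L (D D' : set (op R I J)) (F : op R I J -> op R K L) :
  blin D F -> D' `<=` D -> blin D' F.
Proof.
move=> [lF [C [C0 hC]]] h; split; first by move=> c S T /h ? /h ?; exact: lF.
by exists C; split=> // M T /h DT; exact: hC.
Qed.

Lemma blin_shom I J (A : set (mat R I)) (f : mat R I -> mat R J) :
  calg A -> shom A f -> blin A f.
Proof.
move=> hA hf; split; first by move=> c S T hS hT; apply: (shom_lin hf).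
by exists 1; split=> // M T AT bT; rewrite mul1r; exact: (shom_contr hA hf AT bT).
Qed.

Lemma blin_amp I I' J (A : set (mat R I)) (f : mat R I -> mat R I') :
  calg A -> shom A f -> blin (@blocks_in R I J A) (amp f).
Proof.
move=> hA hf; split; first by move=> c S T hS hT; apply: (amp_lin hf).
by exists 1; split=> // M T AT bT; rewrite mul1r; exact: (amp_contr hA hf AT bT).
Qed.

Lemma csub_bounded I : csub [set T : mat R I | bounded T].
Proof. by case: (@calg_all R I). Qed.

Lemma csub_blocks I J (A : set (mat R I)) : calg A -> csub (@blocks_in R I J A).
Proof.
move=> hA; split.
- by move=> j l; exact: csub0 (calg_csub hA).
- by move=> c S T hS hT j l; rewrite blk_lin; exact: csub_lin (calg_csub hA) (hS j l) (hT j l).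
- exact: blocks_in_closed.
Qed.

End Density.

(** * Compact operators and matrix units *)

Section Compacts.
Context {R : realType}.
Implicit Types (I J K L : choiceType) (M N e : R).

Lemma l2P I (x : vec R I) : l2 x <-> exists M, forall s, uniq s -> nrm s x <= M.
Proof.
have f0 i : 0 <= (normc (x i)) ^+ 2 by rewrite sqr_ge0.
have E : normsq x = (\esum_(i in [set: I]) (normc (x i) ^+ 2)%:E)%E.
  by rewrite /normsq; apply: eq_esum => i _; rewrite sqr_normc.
have le1 (s : seq I) : uniq s -> ((nrm s x ^+ 2)%:E <= normsq x)%E.
  move=> us; rewrite E sqr_nrm; apply: esum_ge; exists [set` s].
    by split => //; exact: finite_seq.
  by rewrite -fsbig_seq // sumEFin.
split=> [fin|[M hM]].
  exists (fine (normsq x) + 1) => s us.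
  have n0 : (0 <= normsq x)%E by rewrite E; apply: esum_ge0 => i _; rewrite lee_fin.
  have := le1 _ us; rewrite -[normsq x]fineK ?ge0_fin_numE // lee_fin => h.
  have := fine_ge0 n0; have := nrm_ge0 s x; nra.
have M0 : 0 <= M by rewrite (le_trans _ (hM [::] isT)) // nrm_ge0.
rewrite /l2 E; apply: le_lt_trans (ltry (M ^+ 2)).
apply: ge_ereal_sup => /= _ [X [/finite_seqP[s Xs] _] <-].
rewrite Xs; have -> : [set` s] = [set` undup s] by apply/seteqP; split=> i /=; rewrite mem_undup.
rewrite -fsbig_seq ?undup_uniq // sumEFin lee_fin -sqr_nrm.
by rewrite ler_pXn2r ?nnegrE ?nrm_ge0 // hM // undup_uniq.
Qed.

Definition colop I (x : I -> R[i]) : op R I unit := fun i _ => x i.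

Lemma bnd_colop I M (x : I -> R[i]) : 0 <= M -> (forall s, uniq s -> nrm s x <= M) ->
  bnd M (colop x).
Proof.
move=> M0 h; rewrite -[colop x]opadjK; apply: bnd_adj.
by apply: bnd_row1 => // s us; rewrite nrmJ; exact: h.
Qed.

Lemma l2_colop I (x : vec R I) : l2 x <-> bounded (colop x).
Proof.
split=> [/l2P[M h]|[M h]].
  exists M; apply: bnd_colop => //.
  by rewrite (le_trans _ (h [::] isT)) // nrm_ge0.
by apply/l2P; exists M => s us; exact: (bnd_nrm_col tt h us).
Qed.

Lemma rank1E I J (x : I -> R[i]) (y : J -> R[i]) :
  (fun i j => x i * Num.conj (y j)) = colop x ** opadj (colop y).
Proof.
apply/funext=> i; apply/funext=> j; rewrite /opmul (@csum_fin _ _ [:: tt]) ?big_seq1 //; by case.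
Qed.

Lemma colop_dlt I (T : mat R I) k l : T ** dlt k l = colop (T^~ k) ** opadj (colop (fun i => (i == l)%:R)).
Proof.
rewrite -rank1E; apply/funext=> i; apply/funext=> j.
rewrite /opmul (@csum_fin _ _ [:: k]) ?big_seq1 //.
  by rewrite /dlt eqxx conjC_nat.
by move=> m; rewrite inE /dlt => /negbTE ->; rewrite mulr0.
Qed.

Lemma bounded_col_entry I (k : I) : bounded (colop (fun i => (i == k)%:R : R[i])).
Proof.
exists 1; apply: bnd_colop => // s us.
have := bnd_nrm_col k (bnd_dlt (R := R) k k) us.
by congr (_ <= _); apply: eq_nrm => i _; rewrite /dlt eqxx andbT.
Qed.

Lemma bounded_colT I (T : mat R I) k : bounded T -> bounded (colop (T^~ k)).
Proof.
move=> [M h]; exists M; apply: bnd_colop; first exact: bnd_ge0 h.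
by move=> s us; exact: bnd_nrm_col h us.
Qed.

Lemma csub_compacts I : csub (compacts R I). Proof. exact: cspan_csub. Qed.

Lemma compacts_rank1 I (x y : op R I unit) : bounded x -> bounded y ->
  compacts R I (x ** opadj y).
Proof.
have xE (z : op R I unit) : z = colop (z^~ tt) by apply/funext=> i; apply/funext=> -[].
rewrite (xE x) (xE y) => bx by_; rewrite -rank1E; apply: sub_cspan.
by exists (x^~ tt), (y^~ tt); split=> //; apply/l2_colop.
Qed.

Lemma compacts_mul_dlt I (T : mat R I) k l : bounded T -> compacts R I (T ** dlt k l).
Proof.
by move=> bT; rewrite colop_dlt; apply: compacts_rank1; [exact: bounded_colT|exact: bounded_col_entry].
Qed.

Lemma compacts_dlt I (k l : I) : compacts R I (dlt k l).
Proof. by rewrite -[dlt k l]opmul1l; apply: compacts_mul_dlt; exact: bounded_one. Qed.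

Lemma colop_fin I (x : I -> R[i]) (s : seq I) : uniq s ->
  colop (fun i => if i \in s then x i else 0) =
  \sum_(k <- s) opscale (x k) (colop (fun i => (i == k)%:R)).
Proof.
move=> us; apply/funext=> i; apply/funext=> -[]; rewrite op_sumE /colop /opscale.
have [si|si] := boolP (i \in s).
  rewrite (bigD1_seq i) //= eqxx mulr1 big1 ?addr0 // => k /negbTE.
  by rewrite eq_sym => ->; rewrite mulr0.
rewrite big_seq big1 // => k ks; have -> : (i == k) = false by apply: contraNF si => /eqP ->.
by rewrite mulr0.
Qed.

(** A rank-one operator is approximated by cutting both of its vectors to finite supports, after
    which it is a combination of matrix units. This reduces statements about compact operators to
    [dlt k l]. *)
Lemma compacts_min I (A : set (mat R I)) : csub A -> (forall k l, A (dlt k l)) ->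
  compacts R I `<=` A.
Proof.
move=> hA Ad; apply: cspan_min => // _ [x [y [/l2P[M hx] /l2P[N hy] ->]]]; rewrite rank1E.
have M0 : 0 <= M by rewrite (le_trans _ (hx [::] isT)) // nrm_ge0.
have N0 : 0 <= N by rewrite (le_trans _ (hy [::] isT)) // nrm_ge0.
apply: (csub_closed hA) => e e0.
have K0 : 0 < 2 * (M + N + 1) by rewrite mulr_gt0 // ltr_wpDl // addr_ge0.
(* With tails of this norm the two errors, at most [d * N] and [M * d], add up to less than [e]. *)
have d0 : 0 < e / (2 * (M + N + 1)) by rewrite divr_gt0.
have [s us hs] := nrm_tail hx d0; have [t ut ht] := nrm_tail hy d0.
pose xs := colop (fun i => if i \in s then x i else 0).
pose yt := colop (fun i => if i \in t then y i else 0).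
have tail (z : I -> R[i]) (r : seq I) : colop z =
    colop (fun i => if i \in r then z i else 0) + colop (fun i => if i \in r then 0 else z i).
  by apply/funext=> i; apply/funext=> -[]; rewrite fctE /colop; case: ifP; rewrite ?addr0 ?add0r.
have b1 := bnd_colop (ltW d0) hs; have b2 := bnd_colop (ltW d0) ht.
have bx := bnd_colop M0 hx; have by_ := bnd_colop N0 hy.
have bxs : bounded xs.
  rewrite /xs colop_fin //; apply: bounded_sum => k; apply: boundedZ; exact: bounded_col_entry.
have byt : bnd N yt.
  apply: bnd_colop => // r ur; apply: le_trans (hy _ ur).
  apply: ler_wsqrtr; apply: ler_sum => i _; case: ifP => // _.
  by rewrite normc_0 expr0n sqr_ge0.
exists (xs ** opadj yt).
  rewrite /xs colop_fin // /yt colop_fin // opmul_suml; last first.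
  - by apply: bounded_adj; apply: bounded_sum => k; apply: boundedZ; exact: bounded_col_entry.
  - by move=> k; apply: boundedZ; exact: bounded_col_entry.
  apply: csub_sum => // k.
  have -> : opadj (\sum_(k0 <- t) opscale (y k0) (colop (fun i => (i == k0)%:R : R[i]))) =
     \sum_(k0 <- t) opscale (Num.conj (y k0)) (opadj (colop (fun i => (i == k0)%:R : R[i]))).
    apply/funext=> i; apply/funext=> j; rewrite /opadj !op_sumE conj_sum.
    by apply: eq_bigr => l _; rewrite /opscale rmorphM.
  have bk l : bounded (opadj (colop (fun i : I => (i == l)%:R : R[i]))).
    by apply: bounded_adj; exact: bounded_col_entry.
  rewrite opmul_sumr; last first.
  - by move=> l; exact: boundedZ.
  - by apply: boundedZ; exact: bounded_col_entry.
  apply: csub_sum => // l; rewrite opmulZl ?opmulZr //; try exact: bounded_col_entry; last exact: boundedZ.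
  apply: csubZ => //; apply: csubZ => //.
  have := Ad k l; rewrite -[dlt k l]opmul1l colop_dlt; congr (A (_ ** _)).
have -> : xs ** opadj yt - colop x ** opadj (colop y) =
   - ((colop (fun i => if i \in s then 0 else x i)) ** opadj yt +
   colop x ** opadj (colop (fun i => if i \in t then 0 else y i))).
  have -> : opadj (colop (fun i => if i \in t then 0 else y i)) = opadj (colop y) - opadj yt.
    by rewrite (tail y t) opadjD addrC addKr.
  have -> : colop (fun i => if i \in s then 0 else x i) = colop x - xs.
    by rewrite (tail x s) addrC addKr.
  rewrite opmulBl ?opmulBr; try by [|exact: bnd_bounded bx|exact: bounded_adj (bnd_bounded by_)
   |exact: bounded_adj (bnd_bounded byt)].
  by opext.
apply: bndN; apply: bnd_le (bndD (bnd_mul b1 (bnd_adj byt)) (bnd_mul bx (bnd_adj b2))) _.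
rewrite [X in X + _]mulrC -mulrDl mulrA ler_pdivrMr //.
nra.
Qed.

Lemma compacts_bounded I (c : mat R I) : compacts R I c -> bounded c.
Proof. by move=> hc; apply: (compacts_min (@csub_bounded R I) _ hc) => k l; exact: bounded_dlt. Qed.

Lemma compacts_mull I (b c : mat R I) : bounded b -> compacts R I c -> compacts R I (b ** c).
Proof.
move=> bb hc; suff [] : [set T | bounded T /\ compacts R I (b ** T)] c by [].
apply: compacts_min hc => [|k l].
  by apply: blin_csub (@csub_compacts I); [exact: csub_bounded|exact: blin_mull].
by split; [exact: bounded_dlt|exact: compacts_mul_dlt].
Qed.

Lemma dlt_adj I (k l : I) : opadj (dlt k l) = dlt l k :> mat R I.
Proof. by apply/funext=> i; apply/funext=> j; rewrite /opadj /dlt conjC_nat andbC. Qed.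

Lemma compacts_adj I (c : mat R I) : compacts R I c -> compacts R I (opadj c).
Proof.
apply: (compacts_min (A := [set T | compacts R I (opadj T)])).
  have sK := @csub_compacts I; split=> /=.
  - suff -> : opadj (0 : mat R I) = 0 by exact: csub0 sK.
    by apply/funext=> i; apply/funext=> j; rewrite /opadj rmorph0.
  - by move=> c' a b ha hb; rewrite opadjD opadjZ; exact: (csub_lin _ sK ha hb).
  - move=> T h; apply: (csub_closed sK) => e /h[a ha ba]; exists (opadj a) => //.
    by rewrite -opadjN -opadjD; exact: (bnd_adj ba).
by move=> k l /=; rewrite dlt_adj; exact: compacts_dlt.
Qed.

Lemma compacts_mulr I (b c : mat R I) : bounded b -> compacts R I c -> compacts R I (c ** b).
Proof.
move=> bb hc; have bc := compacts_bounded hc; rewrite -[c ** b]opadjK opadj_mul //.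
apply: compacts_adj; apply: compacts_mull; first exact: bounded_adj.
exact: compacts_adj.
Qed.

Lemma dlt_mul I (k l m : I) : dlt k l ** dlt l m = dlt k m :> mat R I.
Proof.
apply/funext=> i; apply/funext=> j; rewrite /opmul (@csum_fin _ _ [:: l]) ?big_seq1 //.
  by rewrite /dlt !eqxx andbT /= -natrM mulnb.
by move=> n; rewrite inE /dlt => /negbTE ->; rewrite mulr0.
Qed.

Lemma mul_dltE I J (T : op R J I) k l j i : (T ** dlt k l) j i = T j k * (i == l)%:R.
Proof.
rewrite /opmul (@csum_fin _ _ [:: k]) ?big_seq1 /dlt ?eqxx //.
by move=> n; rewrite inE => /negbTE ->; rewrite mulr0.
Qed.

Lemma mul_dlt_eq0 I J (T : op R J I) : (forall k, T ** dlt k k = 0) -> T = 0.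
Proof.
move=> h; apply/funext=> j; apply/funext=> k.
by have := congr1 (fun X => X j k) (h k); rewrite mul_dltE eqxx mulr1.
Qed.

End Compacts.

(** * Nondegenerate representations and tensor products *)

Section Multipliers.
Context {R : realType}.
Implicit Types (I J K L : choiceType) (M N e : R).

Lemma multP I (A : set (mat R I)) m : multiplier A m <->
  bounded m /\ forall a, A a -> A (m ** a) /\ A (a ** m).
Proof. by split=> -[/bounded_opP h1 h2]; split. Qed.

Lemma mult_bounded I (A : set (mat R I)) m : multiplier A m -> bounded m.
Proof. by move=> /multP[]. Qed.

Lemma mult_mull I (A : set (mat R I)) m a : multiplier A m -> A a -> A (m ** a).
Proof. by move=> /multP[_ h] /h[]. Qed.

Lemma mult_mulr I (A : set (mat R I)) m a : multiplier A m -> A a -> A (a ** m).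
Proof. by move=> /multP[_ h] /h[]. Qed.

Definition star_alg I (A : set (mat R I)) : Prop :=
  [/\ csub A, (forall a, A a -> bounded a), (forall a b, A a -> A b -> A (a ** b)) &
      (forall a, A a -> A (opadj a))].

Lemma calg_mult I (A : set (mat R I)) : star_alg A -> calg (multiplier A).
Proof.
move=> [sA bA mA jA]; split.
- split.
  + apply/multP; split=> [|a Aa]; first exact: bounded0.
    by rewrite opmul0l opmul0r; split; exact: csub0.
  + move=> c m n /multP[bm hm] /multP[bn hn]; apply/multP; split; first by bb.
    move=> a Aa; have ba := bA _ Aa; rewrite opmul_linl ?opmul_linr //.
    by have [? ?] := hm _ Aa; have [? ?] := hn _ Aa; split; exact: csub_lin.
  + move=> T h; have bT : bounded T.
      by apply: closed_bounded => e /h[m /mult_bounded bm b]; exists m.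
    apply/multP; split=> // a Aa; have ba := bA _ Aa; have [C hC] := ba; have C0 := bnd_ge0 hC.
    split; apply: (csub_closed sA) => e e0;
    have C1 : 0 < C + 1 by [rewrite ltr_wpDl|rewrite ltr_wpDl].
    * have [m mm bmT] := h _ (divr_gt0 e0 C1); exists (m ** a); first exact: mult_mull.
      have bm := mult_bounded mm.
      rewrite -opmulBl //; apply: bnd_le (bnd_mul bmT hC) _.
      by rewrite mulrAC ler_pdivrMr // mulrDr mulr1 lerDl ltW.
    * have [m mm bmT] := h _ (divr_gt0 e0 C1); exists (a ** m); first exact: mult_mulr.
      have bm := mult_bounded mm.
      rewrite -opmulBr //; apply: bnd_le (bnd_mul hC bmT) _.
      by rewrite mulrA ler_pdivrMr // mulrDr mulr1 [leLHS]mulrC lerDl ltW.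
- by apply/multP; split=> [|a Aa]; [exact: bounded_one|rewrite opmul1l opmul1r].
- move=> m n hm hn; have bm := mult_bounded hm; have bn := mult_bounded hn.
  apply/multP; split=> [|a Aa]; first by bb.
  have ba := bA _ Aa; split.
    by rewrite -opmulA //; apply: (mult_mull hm); exact: mult_mull.
  by rewrite opmulA //; apply: (mult_mulr hn); exact: mult_mulr.
- move=> m hm; have bm := mult_bounded hm; apply/multP; split=> [|a Aa]; first by bb.
  have ba := bA _ Aa; have Aa' := jA _ Aa; split.
    rewrite -[_ ** a]opadjK opadj_mul ?opadjK //; try bb.
    by apply: jA; exact: mult_mulr.
  rewrite -[_ ** opadj m]opadjK opadj_mul ?opadjK //; try bb.
  by apply: jA; exact: mult_mull.
- by move=> m; exact: mult_bounded.
Qed.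

Lemma star_alg_mult I (A : set (mat R I)) a : star_alg A -> A a -> multiplier A a.
Proof. by move=> [_ bA mA _] Aa; apply/multP; split=> [|b Ab]; [exact: bA|split; exact: mA]. Qed.

Lemma mult_unital I (A : set (mat R I)) m : A mone -> multiplier A m -> A m.
Proof. by move=> A1 hm; rewrite -[m]opmul1r; exact: mult_mull. Qed.

Lemma star_alg_unital I (A : set (mat R I)) : star_alg A -> A mone -> calg A.
Proof. by move=> [? ? ? ?] A1; split. Qed.

Lemma calg_star I (A : set (mat R I)) : calg A -> star_alg A.
Proof. by case=> ? ? ? ? ?; split. Qed.

Lemma star_compacts I : star_alg (compacts R I).
Proof.
split; [exact: csub_compacts|exact: compacts_bounded| |exact: compacts_adj].
by move=> a b ha hb; apply: compacts_mull => //; exact: compacts_bounded.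
Qed.

Lemma multKP I (m : mat R I) : multiplier (compacts R I) m <-> bounded m.
Proof.
split=> [|bm]; first exact: mult_bounded.
by apply/multP; split=> // a ha; split; [exact: compacts_mull|exact: compacts_mulr].
Qed.

Lemma cstar_star I (A : set (mat R I)) : cstar A -> star_alg A.
Proof.
move=> [bA cA mA jA _]; split=> //.
- by rewrite -cA; exact: cspan_csub.
- by move=> a /bA /bounded_opP.
Qed.

Lemma sprod_csub I (X Y : set (mat R I)) : csub (sprod X Y).
Proof. exact: cspan_csub. Qed.

Lemma sub_sprod I (X Y : set (mat R I)) x y : X x -> Y y -> sprod X Y (x ** y).
Proof. by move=> hx hy; apply: sub_cspan; exists x, y. Qed.

Lemma sprod_ind I J K (X Y : set (mat R I)) (D : set (mat R I)) (F : mat R I -> op R J K)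
    (A : set (op R J K)) :
  csub D -> blin D F -> csub A -> (forall x y, X x -> Y y -> D (x ** y)) ->
  (forall x y, X x -> Y y -> A (F (x ** y))) -> forall T, sprod X Y T -> A (F T).
Proof.
move=> hD bF hA h1 h2; apply: (blin_cspan hD bF hA) => [T [x [y [Xx Yy ->]]]|T [x [y [Xx Yy ->]]]].
  exact: h1.
exact: h2.
Qed.

End Multipliers.

(** * Orthogonal projection of a vector onto a closed subspace *)

Section Projection.
Context {R : realType}.
Variables (I : choiceType) (S : set (op R I unit)).
Hypotheses (sS : csub S) (bS : forall x, S x -> bounded x).

Let N (x : op R I unit) : R := complex.Re ((opadj x ** x) tt tt).

Lemma N_ge0 x : bounded x -> 0 <= N x.
Proof. by move=> bx; exact: le_trans (sqr_ge0 _) (selfdot_ge bx (isT : uniq [::])). Qed.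

Lemma Nbnd x : bounded x -> bnd (Num.sqrt (N x)) x.
Proof.
move=> bx; have E : x = colop (x^~ tt) by apply/funext=> i; apply/funext=> -[].
rewrite [X in bnd _ X]E; apply: bnd_colop; first exact: sqrtr_ge0.
move=> s us; rewrite -(ler_pXn2r (n := 2)) ?nnegrE ?nrm_ge0 ?sqrtr_ge0 //.
by rewrite [leRHS](sqr_sqrtr (N_ge0 bx)); exact: selfdot_ge.
Qed.

Lemma N_le M x : bnd M x -> N x <= M ^+ 2.
Proof.
move=> h; have := bnd_entry tt tt (bnd_mul (bnd_adj h) h); rewrite -expr2.
exact: le_trans (le_trans (ler_norm _) (normc_Re _)).
Qed.

Lemma parallelogram x y : bounded x -> bounded y ->
  N (x + y) + N (x - y) = 2 * N x + 2 * N y.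
Proof.
move=> bx by_; rewrite /N !(opadjD, opadjN) !opmulDl ?opmulDr ?opmulNr ?opmulNl //; try bb.
rewrite !fctE; move: ((_ ** _) _ _) ((_ ** _) _ _) ((_ ** _) _ _) ((_ ** _) _ _).
by move=> [? ?] [? ?] [? ?] [? ?] /=; ring.
Qed.

Lemma N_quadratic x t (d : R) : bounded x -> bounded t ->
  N (x - opscale ((d%:C)%C * (opadj t ** x) tt tt) t) =
  N x - 2 * d * normc ((opadj t ** x) tt tt) ^+ 2 + d ^+ 2 * normc ((opadj t ** x) tt tt) ^+ 2 * N t.
Proof.
move=> bx bt; rewrite /N opadjD opadjN opadjZ.
rewrite opmulBl ?opmulBr ?opmulZl ?opmulZr //; try bb.
have E : (opadj x ** t) tt tt = Num.conj ((opadj t ** x) tt tt).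
  rewrite -[in LHS](opadjK t) -[x in opadj x ** opadj _]opadjK -opadj_mul ?opadjK //; bb.
rewrite !fctE /opscale ?fctE E sqr_normc.
move: ((opadj t ** x) tt tt) ((opadj t ** t) tt tt) ((opadj x ** x) tt tt).
by move=> [? ?] [? ?] [? ?]; rewrite /=; ring.
Qed.

(** A minimising sequence for the distance is Cauchy by the parallelogram law, and a first-order
    variation at its limit gives orthogonality. Vectors are columns, so that completeness of
    operators applies. *)
Lemma projection (x : op R I unit) : bounded x ->
  exists s, S s /\ forall t, S t -> (opadj t ** (x - s)) tt tt = 0.
Proof.
move=> bx; pose E := [set N (x - s) | s in S].
have S0 := csub0 sS.
have lbE : lbound E 0 by move=> _ [s Ss <-]; apply: N_ge0; have := bS Ss; bb.
have hE : has_inf E by split; [exists (N (x - 0)), 0|exists 0].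
pose d := inf E; have d0 : 0 <= d by apply: lb_le_inf; case: hE.
have dle s : S s -> d <= N (x - s) by move=> Ss; apply: ge_inf; [exists 0|exists s].
pose eps (n : nat) : R := n.+1%:R^-1.
have eps0 n : 0 < eps n by rewrite invr_gt0 ltr0Sn.
have /choice[u hu] : forall n, exists s, S s /\ N (x - s) <= d + eps n ^+ 2.
  move=> n; have [_ [s Ss <-]] := inf_adherent (exprn_gt0 2 (eps0 n)) hE.
  by rewrite -/d => /ltW h; exists s.
have Su n : S (u n) by have [] := hu n.
have bu n : bounded (u n) := bS (Su n).
have epsle n m : (n <= m)%N -> eps m <= eps n.
  by move=> nm; rewrite lef_pV2 ?posrE ?ltr0Sn // ler_nat.
have [n m nm|e e0|s hs] := @op_complete _ _ _ u (fun n => 2 * eps n).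
- apply: bnd_le (Nbnd (boundedB (bu m) (bu n))) _.
  rewrite -(ler_pXn2r (n := 2)) ?nnegrE ?sqrtr_ge0 ?mulr_ge0 ?(ltW (eps0 _)) //.
  rewrite sqr_sqrtr; last by apply: N_ge0; bb.
  pose a := x - u n; pose b := x - u m.
  have ba : bounded a by rewrite /a; bb.
  have bb : bounded b by rewrite /b; bb.
  have -> : u m - u n = a - b by rewrite /a /b; opext.
  (* The midpoint lies in [S], so its squared distance to [x] is at least [d]; the parallelogram law
     then bounds the squared distance of the two near-minimisers by
     [2 * (eps n ^ 2 + eps m ^ 2)]. *)
  pose mid := opscale ((2^-1 : R)%:C)%C (u n + u m).
  have Smid : S mid by apply: csubZ => //; exact: csubD.
  have mE : a + b = (x - mid) + (x - mid).
    have -> : mid = opscale ((2^-1 : R)%:C)%C (u n) + opscale ((2^-1 : R)%:C)%C (u m).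
      by rewrite /mid opscaleD.
    apply/funext=> i; apply/funext=> j; rewrite /a /b /opscale !fctE.
    have h2 : ((2^-1 : R)%:C)%C + ((2^-1 : R)%:C)%C = 1 :> R[i].
      by rewrite -rmorphD /=; have -> : 2^-1 + 2^-1 = 1 :> R by lra.
    move: h2; set h := (_%:C)%C => h2; apply/eqP; rewrite -subr_eq0; apply/eqP.
    transitivity ((h + h - 1) * (u n i j + u m i j)); first by ring.
    by rewrite h2 subrr mul0r.
  have bm := bS Smid.
  have := parallelogram ba bb; rewrite mE.
  have := parallelogram (x := x - mid) (y := x - mid); rewrite subrr.
  have N00 : N 0 = 0 by rewrite /N opmul0r.
  rewrite N00 => /(_ _ _) P; have {}P := P (boundedB bx bm) (boundedB bx bm).
  have := dle _ Smid; have [_ h1] := hu n; have [_ h2] := hu m.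
  have h3 : eps m ^+ 2 <= eps n ^+ 2 by rewrite ler_pXn2r ?nnegrE ?(ltW (eps0 _)) ?epsle.
  rewrite -/a -/b in h1 h2; nra.
- pose n := Num.Def.archi_bound (2 / e); exists n.
  have h : 2 / e < n%:R by apply: archi_boundP; rewrite divr_ge0 // ltW.
  rewrite /eps ler_pdivrMr ?ltr0Sn // [leRHS]mulrC -ler_pdivrMr //.
  by apply: le_trans (ltW h) _; rewrite ler_nat.
have Ss : S s.
  apply: (csub_closed sS) => e e0; pose n := Num.Def.archi_bound (2 / e); exists (u n) => //.
  apply: bnd_le (hs n) _.
  have h : 2 / e < n%:R by apply: archi_boundP; rewrite divr_ge0 // ltW.
  rewrite /eps ler_pdivrMr ?ltr0Sn // [leRHS]mulrC -ler_pdivrMr //.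
  by apply: le_trans (ltW h) _; rewrite ler_nat.
exists s; split=> // t St; have bs := bS Ss; have bt := bS St.
pose v := x - s; have bv : bounded v by rewrite /v; bb.
have Nv : N v <= d.
  suff /N_le : bnd (Num.sqrt d) v by rewrite sqr_sqrtr.
  apply: bnd_lim; first exact: sqrtr_ge0.
  move=> e e0; pose n := Num.Def.archi_bound (3 / e).
  have h : 3 / e < n%:R by apply: archi_boundP; rewrite divr_ge0 // ltW.
  have he : 3 * eps n <= e.
    rewrite /eps ler_pdivrMr ?ltr0Sn // [leRHS]mulrC -ler_pdivrMr //.
    by apply: le_trans (ltW h) _; rewrite ler_nat.
  have -> : v = (x - u n) + (u n - s) by rewrite addrA subrK.
  apply: bnd_le (bndD (Nbnd (boundedB bx (bu n))) (hs n)) _.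
  have [_ h1] := hu n.
  have : Num.sqrt (N (x - u n)) <= Num.sqrt d + eps n.
    rewrite -(ler_pXn2r (n := 2)) ?nnegrE ?sqrtr_ge0 ?addr_ge0 ?sqrtr_ge0 ?(ltW (eps0 _)) //.
    rewrite sqr_sqrtr; last by apply: N_ge0; have := bu n; bb.
    apply: le_trans h1 _; rewrite sqrrD sqr_sqrtr // lerD2r lerDl.
    by rewrite mulrn_wge0 // mulr_ge0 ?sqrtr_ge0 // ltW.
  lra.
apply: eq0_normc; rewrite -/v.
(* The competitor is [s] moved by [k] times the component along [t], and both sides have been
   divided by [k]. For [k = (N t + 1)^-1] the right-hand side is at most half of the left one, so
   both vanish. *)
have H (k : R) : 0 < k -> 2 * normc ((opadj t ** v) tt tt) ^+ 2 <=
    k * normc ((opadj t ** v) tt tt) ^+ 2 * N t.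
  move=> k0; have := dle (s + opscale ((k%:C)%C * (opadj t ** v) tt tt) t).
  rewrite opprD addrA => /(_ (csubD sS Ss (csubZ _ sS St))).
  rewrite N_quadratic // => h; rewrite -(ler_pM2l k0); move: Nv h.
  move: (N v) (N t) (normc _ ^+ 2) => Nv Nt n2 h1 h2; lra.
have Nt0 := N_ge0 bt; set n := normc _ in H *; have n0 : 0 <= n by exact: normc_ge0.
have k0 : 0 < (N t + 1)^-1 by rewrite invr_gt0 ltr_wpDl.
have h := H _ k0; rewrite mulrAC in h.
have kN : (N t + 1)^-1 * N t <= 1.
  by rewrite mulrC ler_pdivrMr ?ltr_wpDl // mul1r lerDl.
have h2 := ler_wpM2r (sqr_ge0 n) kN; have h3 := sqr_ge0 n.
by apply/eqP; rewrite -sqrf_eq0; apply/eqP; lra.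
Qed.

End Projection.

(** * Nondegenerate representations *)

Section Nondegenerate.
Context {R : realType}.
Implicit Types (I J K L : choiceType) (M N e : R).

(** The hypothesis speaks of vectors killed by [A], the conclusion of closed spans. They are linked
    by projecting the basis vector [e k] onto the closed subspace of those [x] for which the
    rank-one operator from [e k] to [x] lies in $A\mathbb K$: the remainder is orthogonal to every
    [opadj a ** e i], hence is killed by [A], hence is zero. *)
Lemma cstar_dense I (A : set (mat R I)) : cstar A -> sprod A (compacts R I) = compacts R I.
Proof.
move=> hA; have [sA bA mA jA] := cstar_star hA; have [_ _ _ _ nd] := hA.
have sS := sprod_csub A (compacts R I).
apply/seteqP; split.
  apply: cspan_min; first exact: csub_compacts.
  by move=> _ [a [c [Aa Kc ->]]]; apply: compacts_mull => //; exact: bA.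
have Sr c d : sprod A (compacts R I) c -> bounded d -> sprod A (compacts R I) (c ** d).
  move=> hc bd; apply: (sprod_ind (@csub_bounded R I) (blin_mulr bd _) sS _ _ hc) => //.
    by move=> a k Aa Kk /=; have := bA _ Aa; have := compacts_bounded Kk; bb.
  move=> a k Aa Kk; have ba := bA _ Aa; have bk := compacts_bounded Kk.
  by rewrite -opmulA //; apply: sub_sprod => //; exact: compacts_mulr.
apply: compacts_min => // k l.
pose e (j : I) : op R I unit := colop (fun i => (i == j)%:R).
have be j : bounded (e j) by exact: bounded_col_entry.
have dE i j : dlt i j = e i ** opadj (e j).
  by rewrite -[dlt i j]opmul1l colop_dlt; congr (_ ** _).
pose S1 := [set x : op R I unit | bounded x /\ sprod A (compacts R I) (x ** opadj (e k))].
have sb : csub [set x : op R I unit | bounded x].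
  split=> /=; [exact: bounded0|by move=> c a b ba b_; apply: boundedD => //; exact: boundedZ|].
  move=> T /(_ 1 ltr01)[a /= ba bT].
  by rewrite -(subrK a T) -opprB; apply: boundedD => //; apply: boundedN; exact: bnd_bounded bT.
have sS1 : csub S1 by apply: blin_csub => //; apply: blin_mulr => //; exact: bounded_adj.
have [s [[bs Ss] hs]] := projection sS1 (fun x h => h.1) (be k).
suff ves : e k - s = 0.
  have es : e k = s by apply/eqP; rewrite -subr_eq0 ves.
  have : sprod A (compacts R I) (dlt k k) by rewrite dE {1}es; exact: Ss.
  by move=> /Sr /(_ (bounded_dlt k l)); rewrite dlt_mul.
have bv : bounded (e k - s) by bb.
have vE : e k - s = colop ((e k - s)^~ tt) by apply/funext=> i; apply/funext=> -[].
have H a : A a -> a ** (e k - s) = 0.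
  move=> Aa; apply/funext=> i; apply/funext=> -[]; have ba := bA _ Aa.
  have := hs (opadj a ** e i); rewrite opadj_mul ?opadjK -?opmulA //; try bb.
  have -> : (opadj (e i) ** (a ** (e k - s))) tt tt = (a ** (e k - s)) i tt.
    rewrite [LHS]/opmul (@csum_fin _ _ [:: i]) ?big_seq1 //.
      by rewrite /opadj /e /colop eqxx conjC_nat mul1r.
    by move=> j; rewrite inE /opadj /e /colop => /negbTE ->; rewrite conjC_nat mul0r.
  apply; split; first by bb.
  rewrite -opmulA -?dE //; try bb.
  by apply: sub_sprod; [exact: jA|exact: compacts_dlt].
have := nd ((e k - s)^~ tt); rewrite vE => nd'.
apply: (congr1 (@colop R I)) (nd' _ _) => //.
  by apply/l2_colop; rewrite -vE.
move=> a /H h; apply/funext=> i.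
exact: (congr1 (fun X => X i tt) h).
Qed.

(* Nondegenerate representations, as *-homomorphisms on the multiplier algebra. *)
Definition nrep I J (A : set (mat R I)) (f : mat R I -> mat R J) : Prop :=
  [/\ star_alg A, shom (multiplier A) f & compacts R J `<=` sprod (f @` A) (compacts R J)].

(** Since $f(A)\mathbb K$ contains every matrix unit, an operator is determined by its products with
    [f a]. *)
Lemma nrep_eq I J K (A : set (mat R I)) (f : mat R I -> mat R J) (S T : op R K J) :
  nrep A f -> bounded S -> bounded T -> (forall a, A a -> S ** f a = T ** f a) -> S = T.
Proof.
move=> [hA hf nd] bS bT h; apply/eqP; rewrite -subr_eq0; apply/eqP/mul_dlt_eq0 => k.
have bST : bounded (S - T) by bb.
apply: (sprod_ind (@csub_bounded R J) (blin_mull bST _) (@csub_zero R K J) _ _ (nd _ (compacts_dlt k k))) => //.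
  move=> _ c [a Aa <-] Kc /=; apply: bounded_mul; last exact: compacts_bounded.
  exact: (shom_bounded hf (star_alg_mult hA Aa)).
move=> _ c [a Aa <-] Kc /=; have bc := compacts_bounded Kc.
have ba := shom_bounded hf (star_alg_mult hA Aa).
by rewrite opmulA // opmulBl // h // subrr opmul0l.
Qed.

(** That the unit is preserved follows from nondegeneracy: [f mone] acts as the identity on
    $f(A)\mathbb K=\mathbb K$. *)
Lemma nrepI I J (A : set (mat R I)) (f : mat R I -> mat R J) :
  star_alg A ->
  (forall m, multiplier A m -> bounded (f m)) ->
  (forall c m n, multiplier A m -> multiplier A n ->
     f (opscale c m + n) = opscale c (f m) + f n) ->
  (forall m n, multiplier A m -> multiplier A n -> f (m ** n) = f m ** f n) ->
  (forall m, multiplier A m -> f (opadj m) = opadj (f m)) ->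
  compacts R J `<=` sprod (f @` A) (compacts R J) -> nrep A f.
Proof.
move=> hA bf lf mf jf nd; split=> //; split=> //.
have m1 : multiplier A mone by exact: calg1 (calg_mult hA).
apply/eqP; rewrite -subr_eq0; apply/eqP/mul_dlt_eq0 => k.
have bST : bounded (f mone - mone) by have := bf _ m1; have := bounded_one (R := R) J; bb.
apply: (sprod_ind (@csub_bounded R J) (blin_mull bST _) (@csub_zero R J J) _ _ (nd _ (compacts_dlt k k))) => //.
  move=> _ c [a Aa <-] Kc /=; apply: bounded_mul; last exact: compacts_bounded.
  exact: (bf _ (star_alg_mult hA Aa)).
move=> _ c [a Aa <-] Kc /=; have bc := compacts_bounded Kc.
have ba := bf _ (star_alg_mult hA Aa); have b1 := bf _ m1; have b2 := bounded_one (R := R) J.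
rewrite opmulA // opmulBl // -mf ?opmul1l //; last exact: star_alg_mult.
by rewrite subrr opmul0l.
Qed.

Lemma representation_nrep I J (A : set (mat R I)) (f : mat R I -> mat R J) :
  star_alg A -> representation A f <-> nrep A f.
Proof.
move=> hA; split=> [[h1 h2 h3 h4 h5]|[_ hf nd]].
  apply: nrepI => //; last by rewrite h5.
  by move=> m /h1 /mult_bounded.
have hM := calg_mult hA; split.
- by move=> m hm; apply/multKP; exact: (shom_bounded hf).
- by move=> c m n hm hn; exact: (shom_lin hf).
- by move=> m n hm hn; exact: (shomM hf).
- by move=> m hm; exact: (shomJ hf).
apply/seteqP; split=> //; apply: cspan_min; first exact: csub_compacts.
move=> _ [_ [c [[a Aa <-] Kc ->]]]; apply: compacts_mull => //.
exact: (shom_bounded hf (star_alg_mult hA Aa)).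
Qed.

(* [f(A) g(B) K = g(B) K = K] *)
Lemma nondeg_comp I J L (A : set (mat R I)) (B : set (mat R J)) (f : mat R I -> mat R J)
    (g : mat R J -> mat R L) :
  nrep B g -> (forall a, A a -> multiplier B (f a)) -> sprod (f @` A) B = B ->
  compacts R L `<=` sprod ((fun x => g (f x)) @` A) (compacts R L).
Proof.
move=> [hB hg nd] fA fAB c /nd; apply: cspan_min; first exact: sprod_csub.
have hM := calg_mult hB; have [sB bB _ _] := hB.
move=> _ [_ [k [[b Bb <-] Kk ->]]]; rewrite -fAB in Bb.
have bk := compacts_bounded Kk.
apply: (sprod_ind (calg_csub hM) (blin_comp (blin_shom hM hg)
  (blin_mulr bk (fun T h => h)) (fun T hT => shom_bounded hg hT)) (sprod_csub _ _) _ _ Bb).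
  move=> _ b' [a Aa <-] Bb'; apply: calg_mul hM _ _; [exact: fA|exact: star_alg_mult].
move=> _ b' [a Aa <-] Bb'; have ma := fA _ Aa; have mb := star_alg_mult hB Bb'.
rewrite (shomM hg) // -opmulA //; try exact: (shom_bounded hg).
apply: sub_sprod; first by exists a.
by apply: compacts_mull => //; exact: (shom_bounded hg).
Qed.

Lemma nrep_id I (A : set (mat R I)) : cstar A -> nrep A (fun x => x).
Proof.
move=> hA; apply: nrepI => //; [exact: cstar_star|by move=> m /mult_bounded|].
by rewrite (_ : (fun x => x) @` A = A) ?cstar_dense //; rewrite image_id.
Qed.

Lemma nrep_comp I J L (A : set (mat R I)) (B : set (mat R J)) (f : mat R I -> mat R J)
    (g : mat R J -> mat R L) : star_alg A ->
  morphism A B f -> nrep B g -> nrep A (fun x => g (f x)).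
Proof.
move=> hA [h1 h2 h3 h4 h5] rg; have [hB hg _] := rg; apply: nrepI => //.
- by move=> m /h1 /(shom_bounded hg).
- move=> c m n hm hn; rewrite -(shom_lin hg); try exact: h1.
  by rewrite -[opscale c m + n]/(mlin c m n) h2.
- by move=> m n hm hn; rewrite -(shomM hg); try exact: h1; rewrite -[m ** n]/(mmul m n) h3.
- by move=> m hm; rewrite -(shomJ hg); try exact: h1; rewrite -[opadj m]/(madj m) h4.
apply: nondeg_comp rg _ h5 => a /(star_alg_mult hA); exact: h1.
Qed.

Lemma morphism_nrep I J (A : set (mat R I)) (B : set (mat R J)) (f : mat R I -> mat R J) :
  star_alg A -> cstar B -> morphism A B f -> nrep A f.
Proof. by move=> hA hB hf; exact: nrep_comp hA hf (nrep_id hB). Qed.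

End Nondegenerate.

(** * Tensor products of algebras and of their representations *)

Section TensorMorphisms.
Context {R : realType}.
Implicit Types (I J K L : choiceType) (M N e : R).

(** Nondegeneracy in the form $A\mathbb K=\mathbb K$ is what the tensor product arguments consume,
    and in this form it passes to tensor products directly ([nondeg_tens]). The algebra of compact
    operators is included. *)
Definition nalg I (A : set (mat R I)) : Prop :=
  star_alg A /\ compacts R I `<=` sprod A (compacts R I).

Lemma cstar_nalg I (A : set (mat R I)) : cstar A -> nalg A.
Proof. by move=> hA; split; [exact: cstar_star|rewrite cstar_dense]. Qed.

Lemma nalg_compacts I : nalg (compacts R I).
Proof.
split; first exact: star_compacts.
apply: compacts_min => [|k l]; first exact: sprod_csub.
rewrite -(dlt_mul k k l); apply: sub_sprod; exact: compacts_dlt.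
Qed.

Lemma csub_atens I J (A : set (mat R I)) (B : set (mat R J)) : csub (atens A B).
Proof. exact: cspan_csub. Qed.

Lemma sub_atens I J (A : set (mat R I)) (B : set (mat R J)) a b :
  A a -> B b -> atens A B (mtens a b).
Proof. by move=> Aa Bb; apply: sub_cspan; exists a, b. Qed.

Lemma atens_ind I J K L (A : set (mat R I)) (B : set (mat R J)) (D : set (mat R (I * J)%type))
    (F : mat R (I * J)%type -> op R K L) (E : set (op R K L)) :
  csub D -> blin D F -> csub E -> (forall a b, A a -> B b -> D (mtens a b)) ->
  (forall a b, A a -> B b -> E (F (mtens a b))) -> forall T, atens A B T -> E (F T).
Proof.
move=> hD bF hE h1 h2; apply: (blin_cspan hD bF hE) => [_ [a [b [Aa Bb ->]]]|_ [a [b [Aa Bb ->]]]].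
  exact: h1.
exact: h2.
Qed.

Lemma atens_min I J (A : set (mat R I)) (B : set (mat R J)) (E : set (mat R (I * J)%type)) :
  csub E -> (forall a b, A a -> B b -> E (mtens a b)) -> atens A B `<=` E.
Proof. by move=> hE h; apply: cspan_min => // _ [a [b [Aa Bb ->]]]; exact: h. Qed.

Lemma atens_bounded I J (A : set (mat R I)) (B : set (mat R J)) T :
  star_alg A -> star_alg B -> atens A B T -> bounded T.
Proof.
move=> [_ bA _ _] [_ bB _ _]; apply: (atens_min (@csub_bounded R _)) => a b Aa Bb /=.
by apply: bounded_mtens; [exact: bA|exact: bB].
Qed.

Lemma csub_adj I (E : set (mat R I)) : csub E -> csub [set T | E (opadj T)].
Proof.
move=> sE; split=> /=.
- suff -> : opadj (0 : mat R I) = 0 by exact: csub0.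
  by apply/funext=> i; apply/funext=> j; rewrite /opadj rmorph0.
- by move=> c a b ha hb; rewrite opadjD opadjZ; exact: (csub_lin _ sE ha hb).
- move=> T h; apply: (csub_closed sE) => e /h[a ha ba]; exists (opadj a) => //.
  by rewrite -opadjN -opadjD; exact: (bnd_adj ba).
Qed.

Lemma csub_flip I J (E : set (mat R (I * J)%type)) :
  csub E -> csub [set T : mat R (J * I)%type | E (flip T)].
Proof.
move=> sE; split=> /=; first exact: csub0.
- by move=> c a b ha hb; exact: (csub_lin c sE ha hb).
- move=> T h; apply: (csub_closed sE) => e /h[a ha ba]; exists (flip a) => //.
  exact: (bnd_flip ba).
Qed.

Lemma star_atens I J (A : set (mat R I)) (B : set (mat R J)) :
  star_alg A -> star_alg B -> star_alg (atens A B).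
Proof.
move=> hA hB; have [_ bA mA jA] := hA; have [_ bB mB jB] := hB.
have sT := csub_atens A B; split=> //; first by move=> T; exact: atens_bounded.
- move=> S T hS hT; have bT := atens_bounded hA hB hT.
  apply: (atens_ind (@csub_bounded R _) (blin_mulr bT (fun T h => h)) sT _ _ hS) => a b Aa Bb.
    by have := bA _ Aa; have := bB _ Bb; move=> ? ? /=; bb.
  have ba := bA _ Aa; have bb := bB _ Bb.
  apply: (atens_ind (@csub_bounded R _) (blin_mull (bounded_mtens ba bb) (fun T h => h)) sT _ _ hT) => a' b' Aa' Bb'.
    by have := bA _ Aa'; have := bB _ Bb'; move=> ? ? /=; apply: bounded_mtens.
  rewrite mtens_mul //; [|exact: bA|exact: bB].
  by apply: sub_atens; [exact: mA|exact: mB].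
- apply: (atens_min (csub_adj sT)) => a b Aa Bb /=.
  by rewrite mtens_adj; apply: sub_atens; [exact: jA|exact: jB].
Qed.

Lemma dlt_mtens I J (i k : I) (j l : J) : mtens (dlt i k) (dlt j l) = dlt (i, j) (k, l) :> mat R _.
Proof.
apply/funext=> -[a b]; apply/funext=> -[c d].
by rewrite /mtens /dlt /= -natrM mulnb !xpair_eqE andbACA.
Qed.

Lemma compacts_mtens I J (c : mat R I) (d : mat R J) :
  compacts R I c -> compacts R J d -> compacts R (I * J)%type (mtens c d).
Proof.
move=> hc hd; have bc := compacts_bounded hc.
suff [] : bounded d /\ compacts R (I * J)%type (mtens c d) by [].
apply: (compacts_min (A := [set T | bounded T /\ compacts R (I * J)%type (mtens c T)])) hd => [|k l].
  by apply: blin_csub (csub_compacts _); [exact: csub_bounded|exact: blin_tensr].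
split; first exact: bounded_dlt.
suff [] : bounded c /\ compacts R (I * J)%type (mtens c (dlt k l)) by [].
apply: (compacts_min (A := [set T | bounded T /\ compacts R (I * J)%type (mtens T (dlt k l))])) hc => [|i j].
  by apply: blin_csub (csub_compacts _); [exact: csub_bounded|apply: blin_tensl; exact: bounded_dlt].
by split; [exact: bounded_dlt|rewrite dlt_mtens; exact: compacts_dlt].
Qed.

(* [(f(A) (x) g(B)) K = K] from [f(A) K = K] and [g(B) K = K]. *)
Lemma nondeg_tens I J I' J' (A : set (mat R I)) (B : set (mat R J))
    (f : mat R I -> mat R I') (g : mat R J -> mat R J') (h : mat R (I * J)%type -> mat R (I' * J')%type) :
  (forall a, A a -> bounded (f a)) -> (forall b, B b -> bounded (g b)) ->
  compacts R I' `<=` sprod (f @` A) (compacts R I') ->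
  compacts R J' `<=` sprod (g @` B) (compacts R J') ->
  (forall a b, A a -> B b -> h (mtens a b) = mtens (f a) (g b)) ->
  compacts R (I' * J')%type `<=` sprod (h @` atens A B) (compacts R (I' * J')%type).
Proof.
move=> bf bg nf ng hh; apply: compacts_min => [|[i j] [k l]]; first exact: sprod_csub.
rewrite -dlt_mtens; have sS := sprod_csub (h @` atens A B) (compacts R (I' * J')%type).
have bd := bounded_dlt (R := R) j l.
apply: (sprod_ind (@csub_bounded R I') (blin_tensl _ bd) sS _ _ (nf _ (compacts_dlt i k))).
  by move=> _ c [a Aa <-] Kc /=; have := bf _ Aa; have := compacts_bounded Kc; bb.
move=> _ c [a Aa <-] Kc; have ba := bf _ Aa; have bc := compacts_bounded Kc.
apply: (sprod_ind (@csub_bounded R J') (blin_tensr _ (bounded_mul ba bc)) sS _ _ (ng _ (compacts_dlt j l))).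
  by move=> _ c' [b Bb <-] Kc' /=; have := bg _ Bb; have := compacts_bounded Kc'; bb.
move=> _ c' [b Bb <-] Kc'; have bb := bg _ Bb; have bc' := compacts_bounded Kc'.
rewrite -mtens_mul // -hh //; apply: sub_sprod; last exact: compacts_mtens.
by exists (mtens a b) => //; exact: sub_atens.
Qed.

Lemma nalg_atens I J (A : set (mat R I)) (B : set (mat R J)) :
  nalg A -> nalg B -> nalg (atens A B).
Proof.
move=> [hA nA] [hB nB]; split; first exact: star_atens.
have [_ bA _ _] := hA; have [_ bB _ _] := hB.
rewrite -[X in sprod X _]image_id.
by apply: (nondeg_tens (f := fun x => x) (g := fun x => x) bA bB) => //; rewrite image_id.
Qed.

Lemma nalg_nrep_id I (A : set (mat R I)) : nalg A -> nrep A (fun x => x).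
Proof.
move=> [hA nA]; apply: nrepI => //; first by move=> m /mult_bounded.
by rewrite image_id.
Qed.

Lemma atensK_min I J (A : set (mat R I)) (E : set (mat R (I * J)%type)) : star_alg A ->
  csub E -> (forall a k l, A a -> E (mtens a (dlt k l))) -> atens A (compacts R J) `<=` E.
Proof.
move=> [_ bA _ _] sE h; apply: atens_min => // a b Aa Kb.
suff [] : bounded b /\ E (mtens a b) by [].
apply: (compacts_min (A := [set T | bounded T /\ E (mtens a T)])) Kb => [|k l].
  by apply: (blin_csub _ _ sE); [exact: csub_bounded|apply: blin_tensr; exact: bA].
by split; [exact: bounded_dlt|exact: h].
Qed.

Lemma atens_blocks I J (A : set (mat R I)) (B : set (mat R J)) T : csub A ->
  atens A B T -> blocks_in A T.
Proof.
move=> sA; apply: (atens_min (E := blocks_in A)).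
  split; first by move=> j l; exact: csub0.
    by move=> c S S' hS hS' j l; rewrite blk_lin; exact: (csub_lin c sA (hS j l) (hS' j l)).
  move=> S hS j l; apply: (csub_closed sA) => e /hS[S' hS' bS].
  by exists (blk S' j l) => //; exact: (bnd_blk j l bS).
by move=> a b Aa _ j l; rewrite blk_mtens; exact: csubZ.
Qed.

(** A matrix unit leaves a single term of the infinite block sum; this is why multiplicativity of
    [amp] is always tested on such elements. *)
Lemma blk_mul_dlt I J (m : mat R (I * J)%type) a k l j l' : bounded m -> bounded a ->
  blk (m ** mtens a (dlt k l)) j l' = opscale (l' == l)%:R (blk m j k ** a).
Proof.
move=> bm ba; apply/funext=> i; apply/funext=> i'; rewrite /opscale.
apply: opmul_eq => //; first by apply: bounded_mtens => //; exact: bounded_dlt.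
have -> : (fun p => m (i, j) p * mtens a (dlt k l) p (i', l')) =
   (fun p => (l' == l)%:R * ((blk m j k i p.1 * a p.1 i') * (p.2 == k)%:R)).
  apply/funext=> -[p q]; rewrite /mtens /dlt /blk /=.
  case: eqP => [->|]; last by rewrite andFb !mulr0.
  by rewrite andTb mulr1 mulrCA mulrC -mulrA mulrCA mulrA.
apply: hassumZ; apply: (hassum_slice (f := fun p => blk m j k i p * a p i')).
  by apply: opmul_hassum => //; exact: bounded_blk.
have [M hM] := bounded_blk j k bm; have [N hN] := ba.
by exists (M * N); exact: mul_abs_bounded hM hN.
Qed.

Lemma mult_adj I (A : set (mat R I)) m : star_alg A -> multiplier A m -> multiplier A (opadj m).
Proof. by move=> hA; exact: (calg_adj (calg_mult hA)). Qed.

Lemma multI I (A : set (mat R I)) m : star_alg A -> bounded m ->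
  (forall a, A a -> A (m ** a)) -> (forall a, A a -> A (opadj m ** a)) -> multiplier A m.
Proof.
move=> [_ bA _ jA] bm h1 h2; apply/multP; split=> // a Aa; split; first exact: h1.
have ba := bA _ Aa; rewrite -[_ ** _]opadjK opadj_mul //.
by apply/jA/h2/jA.
Qed.

(** Multiplication by [mtens a (dlt l l)] isolates one column of blocks inside $A\otimes\mathbb K$,
    which shows that a block times [a] is in [A]; the adjoint provides the other side. *)
Lemma mult_blocks I J (A : set (mat R I)) m : star_alg A ->
  multiplier (atens A (compacts R J)) m -> blocks_in (multiplier A) m.
Proof.
move=> hA hm j l; have [sA bA _ _] := hA; have hT := star_atens hA (@star_compacts R J).
have H n a j' l' : multiplier (atens A (compacts R J)) n -> A a -> A (blk n j' l' ** a).
  move=> hn Aa; have bn := mult_bounded hn; have ba := bA _ Aa.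
  have := mult_mull hn (sub_atens Aa (compacts_dlt l' l')).
  move=> /(atens_blocks sA) /(_ j' l').
  by rewrite blk_mul_dlt // eqxx opscale1.
have bm := mult_bounded hm; apply: multI => //; first exact: bounded_blk.
  by move=> a Aa; exact: H.
by move=> a Aa; rewrite -blk_adj; apply: H => //; exact: mult_adj.
Qed.

(** Because $B\mathbb K=\mathbb K$, the algebra $A\otimes\mathbb K$ is the closed span of $(A\otimes
    B)(1\otimes\mathbb K)$. Every multiplier of a tensor product thus enters the domain on which
    [amp f] is a *-homomorphism. *)
Lemma mult_atensK I J (A : set (mat R I)) (B : set (mat R J)) m : star_alg A -> nalg B ->
  multiplier (atens A B) m -> multiplier (atens A (compacts R J)) m.
Proof.
move=> hA [hB nB] hm; have [sA bA _ _] := hA; have [sB bB _ _] := hB.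
have hT := star_atens hA (@star_compacts R J); have hAB := star_atens hA hB.
have sT := csub_atens A (compacts R J).
have H n : multiplier (atens A B) n -> forall t, atens A (compacts R J) t -> atens A (compacts R J) (n ** t).
  move=> hn; have bn := mult_bounded hn.
  suff h t : atens A (compacts R J) t -> bounded t /\ atens A (compacts R J) (n ** t) by move=> t /h[].
  apply: (atens_min (E := [set t | bounded t /\ atens A (compacts R J) (n ** t)])).
    by apply: (blin_csub _ _ sT); [exact: csub_bounded|exact: blin_mull].
  move=> a c Aa Kc; have ba := bA _ Aa; split; first by have := compacts_bounded Kc; move=> ? /=; bb.
  have bF : blin [set T : mat R J | bounded T] (fun c => n ** mtens a c).
    apply: (blin_comp (D' := [set T | bounded T]) (blin_tensr _ ba) (blin_mull bn (fun T h => h))) => T bT /=; bb.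
  apply: (sprod_ind (@csub_bounded R J) bF sT _ _ (nB _ Kc)) => b d Bb Kd.
    by have := bB _ Bb; have := compacts_bounded Kd; move=> ? ? /=; bb.
  have bb := bB _ Bb; have bd := compacts_bounded Kd; have b1 := bounded_one (R := R) I.
  rewrite -[a in mtens a _]opmul1r -mtens_mul // opmulA //; try bb.
  have := mult_mull hn (sub_atens Aa Bb).
  have b1d := bounded_mtens b1 bd.
  apply: (atens_ind (@csub_bounded R _) (blin_mulr b1d (fun T h => h)) sT) => a' b' Aa' Bb'.
    by have := bA _ Aa'; have := bB _ Bb'; move=> ? ? /=; apply: bounded_mtens.
  rewrite mtens_mul ?opmul1r //; try by [exact: bA|exact: bB].
  apply: sub_atens => //; apply: compacts_mull => //; exact: bB.
by apply: multI => //; [exact: mult_bounded hm|exact: H|apply: H; exact: mult_adj].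
Qed.

Lemma flip_one I J : flip (mone : mat R (I * J)%type) = mone.
Proof. by rewrite -mtens_one flip_mtens mtens_one. Qed.

Lemma flip_adj I J (T : mat R (I * J)%type) : flip (opadj T) = opadj (flip T).
Proof. by []. Qed.

Lemma atens_flip I J (A : set (mat R I)) (B : set (mat R J)) T :
  atens A B T -> atens B A (flip T).
Proof.
apply: (atens_min (csub_flip (csub_atens B A))) => a b Aa Bb /=.
by rewrite flip_mtens; exact: sub_atens.
Qed.

Lemma mult_flip I J (A : set (mat R I)) (B : set (mat R J)) m : star_alg A -> star_alg B ->
  multiplier (atens A B) m -> multiplier (atens B A) (flip m).
Proof.
move=> hA hB hm; have bm := mult_bounded hm; apply/multP; split; first exact: bounded_flip.
move=> t ht; have bt := atens_bounded hB hA ht; have ht' := atens_flip ht.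
have bt' := bounded_flip bt.
have -> : flip m ** t = flip (m ** flip t) by rewrite flip_mul ?flipK.
have -> : t ** flip m = flip (flip t ** m) by rewrite flip_mul ?flipK.
by split; apply: atens_flip; [exact: (mult_mull hm)|exact: (mult_mulr hm)].
Qed.

Lemma nrep_uniq I K (X : set (mat R I)) (h h' : mat R I -> mat R K) :
  nrep (cspan X) h -> nrep (cspan X) h' -> (forall x, X x -> h x = h' x) ->
  forall m, multiplier (cspan X) m -> h m = h' m.
Proof.
move=> rh rh' E m hm; have [hX sh nd] := rh; have [_ sh' _] := rh'.
have hM := calg_mult hX.
have XM : X `<=` multiplier (cspan X) by move=> x /sub_cspan; exact: star_alg_mult.
have E' : forall d, cspan X d -> h d = h' d.
  by apply: (blin_eq (calg_csub hM) (blin_shom hM sh) (blin_shom hM sh')).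
apply: (nrep_eq rh); try by [exact: (shom_bounded sh)|exact: (shom_bounded sh')].
move=> d hd; have md := star_alg_mult hX hd.
rewrite -(shomM sh) // (E' _ hd) -(shomM sh') // E' //.
exact: (mult_mull hm hd).
Qed.

(** * Amplifications of a nondegenerate representation *)

Section Amplification.
Context {I I' : choiceType} {A : set (mat R I)} {f : mat R I -> mat R I'}.
Hypothesis hf : nrep A f.

Let hA : star_alg A. Proof. by case: hf. Qed.
Let sf : shom (multiplier A) f. Proof. by case: hf. Qed.
Let hM : calg (multiplier A). Proof. exact: calg_mult. Qed.
Let AM a : A a -> multiplier A a. Proof. exact: star_alg_mult. Qed.
Let bA a : A a -> bounded a. Proof. by case: hA => _ h _ _; exact: h. Qed.

Lemma nrep_amp_eq J (S T : mat R (I' * J)%type) : bounded S -> bounded T ->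
  (forall a k l, A a -> S ** mtens (f a) (dlt k l) = T ** mtens (f a) (dlt k l)) -> S = T.
Proof.
move=> bS bT h; apply: blkP => j l; apply: (nrep_eq hf); try exact: bounded_blk.
move=> a Aa; have ba := shom_bounded sf (AM Aa).
have := congr1 (fun X => blk X j l) (h a l l Aa).
by rewrite !blk_mul_dlt // eqxx !opscale1.
Qed.

(** Both sides are bounded linear in [t], so [t] may be an elementary tensor with a matrix unit, for
    which the block product has a single term. *)
Lemma amp_mul_atens J (m t : mat R (I * J)%type) :
  multiplier (atens A (compacts R J)) m -> atens A (compacts R J) t ->
  amp f (m ** t) = amp f m ** amp f t.
Proof.
move=> hm; have bm := mult_bounded hm; have hT := star_atens hA (@star_compacts R J).
have mb := mult_blocks hA hm.
have bfm := amp_bounded hM sf mb bm.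
have sT := csub_atens A (compacts R J); have [sA _ mA _] := hA.
have TB s : atens A (compacts R J) s -> blocks_in (multiplier A) s.
  by move=> /(atens_blocks sA) h j l; exact: AM.
have b1 : blin (atens A (compacts R J)) (fun s => amp f (m ** s)).
  apply: (blin_comp (D' := blocks_in (multiplier A)) (blin_mull bm _) (blin_amp _ hM sf)).
    by move=> s; exact: atens_bounded hA (@star_compacts R J).
  by move=> s hs; apply: TB; exact: (mult_mull hm hs).
have b2 : blin (atens A (compacts R J)) (fun s => amp f m ** amp f s).
  apply: (blin_comp (D' := [set s | bounded s]) (blin_subset (blin_amp _ hM sf) TB) (blin_mull bfm (fun T h => h))).
  by move=> s hs; apply: (amp_bounded hM sf (TB _ hs)); exact: atens_bounded hA (@star_compacts R J) hs.
move=> ht; apply/eqP; rewrite -subr_eq0; apply/eqP.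
suff [] : atens A (compacts R J) t /\ amp f (m ** t) - amp f m ** amp f t = 0 by [].
apply: (atensK_min hA (blin_csub sT (blin_sub b1 b2) (@csub_zero R _ _))) ht => a k l Aa.
split; first by apply: sub_atens => //; exact: compacts_dlt.
apply/eqP; rewrite subr_eq0; apply/eqP.
have ba := bA Aa; have bfa := shom_bounded sf (AM Aa).
rewrite (amp_mtens hM sf) //; last exact: AM.
apply: blkP => j l'; rewrite blk_amp !blk_mul_dlt //.
have bb := mb j k; rewrite (shomZ hM sf) ?(shomM sf) ?blk_amp //; try exact: AM.
by apply: (calg_mul hM) => //; exact: AM.
Qed.

(** For a product of two general multipliers the infinite block sums are avoided by multiplying on
    the right with [mtens (f a) (dlt k l)], which is enough by nondegeneracy ([nrep_amp_eq]) and
    brings [amp_mul_atens] into play. *)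
Lemma amp_shom J : shom (multiplier (atens A (compacts R J))) (amp f).
Proof.
have hT := star_atens hA (@star_compacts R J).
have MB m := @mult_blocks _ J _ m hA.
have bf m : multiplier (atens A (compacts R J)) m -> bounded (amp f m).
  by move=> hm; apply: (amp_bounded hM sf (MB _ hm)); exact: mult_bounded hm.
split=> //.
- by move=> c m n hm hn; apply: (amp_lin sf); exact: MB.
- move=> m n hm hn; have hMT := calg_mult hT.
  have hmn := calg_mul hMT hm hn; have bm := mult_bounded hm; have bn := mult_bounded hn.
  apply: nrep_amp_eq; try exact: bf.
    by apply: bounded_mul; exact: bf.
  move=> a k l Aa; have ht := sub_atens Aa (@compacts_dlt R _ k l).
  have bt := atens_bounded hA (@star_compacts R J) ht.
  have bft : bounded (mtens (f a) (dlt k l)).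
    by apply: bounded_mtens; [exact: (shom_bounded sf (AM Aa))|exact: bounded_dlt].
  rewrite -(opmulA (bf _ hm) (bf _ hn) bft) -(amp_mtens hM sf _ (AM Aa)).
  rewrite -amp_mul_atens // -amp_mul_atens // -amp_mul_atens //; last exact: (mult_mull hn ht).
  by rewrite opmulA.
- by move=> m hm; apply: (amp_adj sf); exact: MB.
- exact: (amp_one hM sf).
Qed.

(** After [f] has replaced the first leg by an arbitrary space, the second leg must still consist of
    multipliers of [B]; this is what allows [amq g] to be applied next. *)
Lemma amp_mult J (B : set (mat R J)) m : nalg B -> multiplier (atens A B) m ->
  multiplier (atens (compacts R I') B) (amp f m).
Proof.
move=> nB; have hB := nB.1; have [_ bB _ _] := hB; have [_ _ nd] := hf.
have hT := star_atens hA hB; have hK := star_atens (@star_compacts R I') hB.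
have sK := csub_atens (compacts R I') B; have sh := amp_shom J.
have MK n := @mult_atensK _ _ _ _ n hA nB.
have bf n : multiplier (atens A B) n -> bounded (amp f n).
  by move=> /MK hn; exact: (shom_bounded sh).
have H n t : multiplier (atens A B) n -> atens (compacts R I') B t ->
    atens (compacts R I') B (amp f n ** t).
  move=> hn ht; have bn := bf _ hn.
  apply: (atens_ind (@csub_bounded R _) (blin_mull bn (fun T h => h)) sK _ _ ht).
    by move=> c b Kc Bb /=; have := compacts_bounded Kc; have := bB _ Bb; move=> ? ?; bb.
  move=> c b Kc Bb; have bb := bB _ Bb.
  have bF : blin [set T : mat R I' | bounded T] (fun c => amp f n ** mtens c b).
    apply: (blin_comp (D' := [set T | bounded T]) (blin_tensl _ bb) (blin_mull bn (fun T h => h))) => T bT /=; bb.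
  apply: (sprod_ind (@csub_bounded R I') bF sK _ _ (nd _ Kc)).
    move=> _ d [a Aa <-] Kd /=; apply: bounded_mul; last exact: compacts_bounded.
    exact: (shom_bounded sf (AM Aa)).
  move=> _ d [a Aa <-] Kd; have bd := compacts_bounded Kd.
  have bfa := shom_bounded sf (AM Aa); have b1 := bounded_one (R := R) J.
  have hab := sub_atens Aa Bb.
  have -> : mtens (f a ** d) b = mtens (f a) b ** mtens d mone by rewrite mtens_mul ?opmul1r.
  rewrite opmulA //; try bb.
  rewrite -(amp_mtens hM sf _ (AM Aa)) -(shomM sh); try by apply: MK => //; exact: star_alg_mult.
  have {hab} := mult_mull hn hab.
  have bd1 := bounded_mtens bd b1.
  have bG : blin (multiplier (atens A B)) (fun T => amp f T ** mtens d mone).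
    apply: (blin_comp (D' := [set T | bounded T]) _ (blin_mulr bd1 (fun T h => h))); last exact: bf.
    by apply: blin_subset (blin_amp _ hM sf) _ => T /MK; exact: mult_blocks.
  apply: (atens_ind (calg_csub (calg_mult hT)) bG sK) => a' b' Aa' Bb'.
    by apply: star_alg_mult => //; exact: sub_atens.
  have bfa' := shom_bounded sf (AM Aa').
  rewrite (amp_mtens hM sf) ?mtens_mul ?opmul1r //; try by [exact: AM|exact: bB].
  by apply: sub_atens => //; exact: compacts_mull.
move=> hm; apply: multI => //; first exact: bf.
  by move=> t ht; exact: H.
move=> t ht; rewrite -(amp_adj sf); last by apply: (mult_blocks hA); exact: MK.
by apply: H => //; exact: mult_adj.
Qed.

End Amplification.

Lemma amq_shom I J J' (B : set (mat R J)) (g : mat R J -> mat R J') : nrep B g ->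
  shom (multiplier (atens (compacts R I) B)) (amq g).
Proof.
move=> rg; have [hB sg _] := rg; have [h1 h2 h3 h4 h5] := amp_shom rg I.
have F m := @mult_flip _ _ _ _ m (@star_compacts R I) hB.
have B1 m : multiplier (atens (compacts R I) B) m -> bounded m by exact: mult_bounded.
split.
- by move=> c m n hm hn; rewrite !amqE -[flip (opscale c m + n)]/(opscale c (flip m) + flip n) h1 //; exact: F.
- move=> m n hm hn; rewrite !amqE flip_mul; try exact: B1.
  rewrite h2 ?flip_mul //; try exact: F.
    by apply: h5; exact: F.
  by apply: h5; exact: F.
- by move=> m hm; rewrite !amqE flip_adj h3 ?flip_adj //; exact: F.
- by rewrite amqE flip_one h4 flip_one.
- by move=> m hm; rewrite amqE; apply: bounded_flip; apply: h5; exact: F.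
Qed.

Lemma amq_mtens I J J' (B : set (mat R J)) (g : mat R J -> mat R J') (a : mat R I) b :
  nrep B g -> multiplier B b -> amq g (mtens a b) = mtens a (g b).
Proof.
move=> rg hb; have [hB sg _] := rg.
by rewrite amqE flip_mtens (amp_mtens (calg_mult hB) sg) // flip_mtens.
Qed.

Lemma nrep_tens I J I' J' (A : set (mat R I)) (B : set (mat R J)) (f : mat R I -> mat R I')
    (g : mat R J -> mat R J') : nrep A f -> nalg B -> nrep B g ->
  nrep (atens A B) (fun m => amq g (amp f m)).
Proof.
move=> rf nB rg; have [hA sf nf] := rf; have [hB sg ng] := rg.
have hT := star_atens hA hB; have s1 := amp_shom rf J; have s2 := amq_shom I' rg.
have MK m := @mult_atensK _ _ _ _ m hA nB.
have MM m := @amp_mult _ _ _ _ rf _ _ m nB.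
have AM a : A a -> multiplier A a by exact: star_alg_mult.
have BM b : B b -> multiplier B b by exact: star_alg_mult.
apply: nrepI => //.
- by move=> m hm; apply: (shom_bounded s2); exact: MM.
- by move=> c m n hm hn; rewrite (shom_lin s1) ?(shom_lin s2) //; try exact: MK; exact: MM.
- by move=> m n hm hn; rewrite (shomM s1) ?(shomM s2) //; try exact: MK; exact: MM.
- by move=> m hm; rewrite (shomJ s1) ?(shomJ s2) //; try exact: MK; exact: MM.
- apply: (nondeg_tens (f := f) (g := g)) => //.
  + by move=> a /AM; exact: (shom_bounded sf).
  + by move=> b /BM; exact: (shom_bounded sg).
  + move=> a b Aa Bb; rewrite (amp_mtens (calg_mult hA) sf) ?(amq_mtens _ rg) //.
      exact: BM.
    exact: AM.
Qed.

(** Replaces the choice in [tmor] by a formula: the composite of the two entrywise maps is an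
    admissible representation, and admissible ones agree on multipliers. *)
Lemma tmorE I J I' J' (A : set (mat R I)) (B : set (mat R J)) (f : mat R I -> mat R I')
    (g : mat R J -> mat R J') m : nrep A f -> nalg B -> nrep B g ->
  multiplier (atens A B) m -> tmor A B f g m = amq g (amp f m).
Proof.
move=> rf nB rg; have rh := nrep_tens rf nB rg; have [hA sf nf] := rf; have [hB sg ng] := rg.
have hT := star_atens hA hB.
have E a b : A a -> B b -> amq g (amp f (mtens a b)) = mtens (f a) (g b).
  move=> Aa Bb; rewrite (amp_mtens (calg_mult hA) sf) ?(amq_mtens _ rg) //;
  exact: star_alg_mult.
have := @xgetPex _ (fun=> mone) [set h | representation (atens A B) h /\
   (forall a b, A a -> B b -> h (mtens a b) = mtens (f a) (g b))].
case; first by exists (fun m => amq g (amp f m)); split=> //; exact/(representation_nrep _ hT).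
rewrite -[xget _ _]/(tmor A B f g) => /(representation_nrep _ hT) rt Et.
move=> hm; apply: (nrep_uniq rt rh) hm => _ [a [b [Aa Bb ->]]].
by rewrite Et ?E.
Qed.

End TensorMorphisms.

(** * Slices and leg numbering *)

Section NormalFunctionals.
Context {R : realType}.
Implicit Types (I J K L : choiceType) (M N e : R).

Definition entry_form J (phi : seq (J * J * R[i])) (S : mat R J) : R[i] :=
  \sum_(p <- phi) p.2 * S p.1.1 p.1.2.

(** Norm approximation of the functional [w] by finite combinations of matrix entries, with an error
    uniform over bounded sets of operators. *)
Definition entry_limit J (w : mat R J -> R[i]) : Prop :=
  forall e, 0 < e -> exists phi, forall M S, bnd M S ->
    normc (w S - entry_form phi S) <= e * M.

Lemma entry_limitD J (w w' : mat R J -> R[i]) :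
  entry_limit w -> entry_limit w' -> entry_limit (fun S => w S + w' S).
Proof.
move=> h h' e e0; have e2 : 0 < e / 2 by rewrite divr_gt0.
have [phi hp] := h _ e2; have [psi hs] := h' _ e2; exists (phi ++ psi) => M S bS.
rewrite /entry_form big_cat /= opprD addrACA (le_trans (normcD _ _)) //.
by rewrite [e]splitr mulrDl lerD ?hp ?hs.
Qed.

Lemma entry_limit_sum J (A : Type) (s : seq A) (w : A -> mat R J -> R[i]) :
  (forall a, entry_limit (w a)) -> entry_limit (fun S => \sum_(a <- s) w a S).
Proof.
move=> h; elim: s => [|a s IH] e e0.
  exists [::] => M S bS; rewrite /entry_form !big_nil subrr normc_0.
  by rewrite mulr_ge0 ?(ltW e0) ?(bnd_ge0 bS).
have [phi hp] := entry_limitD (h a) IH e0; exists phi => M S bS.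
by rewrite big_cons; exact: hp.
Qed.

Lemma entry_limit_trans J (w : mat R J -> R[i]) :
  (forall e, 0 < e -> exists2 w', entry_limit w' &
     forall M S, bnd M S -> normc (w S - w' S) <= e * M) -> entry_limit w.
Proof.
move=> h e e0; have e2 : 0 < e / 2 by rewrite divr_gt0.
have [w' hw' hd] := h _ e2; have [phi hp] := hw' _ e2; exists phi => M S bS.
rewrite (_ : _ - _ = (w S - w' S) + (w' S - entry_form phi S)); last by rewrite addrA subrK.
by rewrite (le_trans (normcD _ _)) // [e]splitr mulrDl lerD ?hp ?hd.
Qed.

Lemma entry_limit_vec J (x y : J -> R[i]) : bounded (colop x) -> bounded (colop y) ->
  entry_limit (fun S => (opadj (colop x) ** (S ** colop y)) tt tt).
Proof.
move=> [N hx] [N' hy]; have N0 := bnd_ge0 hx; have N'0 := bnd_ge0 hy.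
apply: entry_limit_trans => e e0.
have K0 : 0 < N + N' + 1 by rewrite ltr_wpDl // addr_ge0.
have d0 : 0 < e / (N + N' + 1) by rewrite divr_gt0.
have [s us hs] := nrm_tail (fun s us => bnd_nrm_col tt hx us) d0.
have [t ut ht] := nrm_tail (fun s us => bnd_nrm_col tt hy us) d0.
pose xs j := if j \in s then x j else 0; pose yt j := if j \in t then y j else 0.
have tail (z : J -> R[i]) (r : seq J) : colop z =
    colop (fun i => if i \in r then z i else 0) + colop (fun i => if i \in r then 0 else z i).
  by apply/funext=> i; apply/funext=> -[]; rewrite fctE /colop; case: ifP; rewrite ?addr0 ?add0r.
have b1 := bnd_colop (ltW d0) hs; have b2 := bnd_colop (ltW d0) ht.
have bxs : bounded (colop xs).
  by rewrite /xs colop_fin //; apply: bounded_sum => k; apply: boundedZ; exact: bounded_col_entry.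
have byt : bnd N' (colop yt).
  apply: bnd_colop => // r ur; apply: le_trans (bnd_nrm_col tt hy ur).
  apply: ler_wsqrtr; apply: ler_sum => i _; rewrite /yt; case: ifP => // _.
  by rewrite normc_0 expr0n sqr_ge0.
exists (fun S => (opadj (colop xs) ** (S ** colop yt)) tt tt).
  move=> d dd; exists [seq (p, Num.conj (x p.1) * y p.2) | p <- allpairs pair s t] => M S bS.
  rewrite (_ : _ - _ = 0); first by rewrite normc_0 mulr_ge0 ?(ltW dd) ?(bnd_ge0 bS).
  apply/eqP; rewrite subr_eq0; apply/eqP.
  rewrite /entry_form big_map big_allpairs /= {1}/opmul (csum_fin us); last first.
    by move=> j /negbTE js; rewrite /opadj /colop /xs js rmorph0 mul0r.
  apply: eq_big_seq => j js; rewrite /opmul (csum_fin ut); last first.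
    by move=> k /negbTE kt; rewrite /colop /yt kt mulr0.
  rewrite mulr_sumr; apply: eq_big_seq => k kt.
  by rewrite /opadj /colop /xs /yt js kt; ring.
move=> M S bS; have M0 := bnd_ge0 bS; have bS' := bnd_bounded bS.
have bx := bnd_bounded hx; have by_ := bnd_bounded hy.
have bx2 := bnd_bounded b1; have by2 := bnd_bounded b2; have byt' := bnd_bounded byt.
have E : opadj (colop x) ** (S ** colop y) - opadj (colop xs) ** (S ** colop yt) =
    opadj (colop (fun i => if i \in s then 0 else x i)) ** (S ** colop yt) +
    opadj (colop x) ** (S ** (colop (fun i => if i \in t then 0 else y i))).
  have -> : colop (fun i => if i \in t then 0 else y i) = colop y - colop yt.
    by rewrite (tail y t) addrC addKr.
  have -> : colop (fun i => if i \in s then 0 else x i) = colop x - colop xs.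
    by rewrite (tail x s) addrC addKr.
  rewrite opadjD opadjN opmulBl ?opmulBr ?opmulBr //; try bb.
  by opext.
have := bnd_entry tt tt (bndD (bnd_mul (bnd_adj b1) (bnd_mul bS byt)) (bnd_mul (bnd_adj hx) (bnd_mul bS b2))).
rewrite -E => H; apply: le_trans H _.
rewrite (_ : _ + _ = e / (N + N' + 1) * (N + N') * M); last by ring.
rewrite ler_wpM2r // mulrAC ler_pdivrMr // ler_wpM2l ?(ltW e0) // lerDl //.
Qed.

(** By the Cauchy-Schwarz inequality for the square-summable norms [X n] and [Y n], the tail of the
    series is at most [e] times the norm of [S]; each of the finitely many remaining vector
    functionals is covered by [entry_limit_vec]. *)
Lemma normal_entry_limit J (w : mat R J -> R[i]) : normal_functional w -> entry_limit w.
Proof.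
move=> [x [y [hx hy ->]]].
have nn (z : vec R J) : (0 <= normsq z)%E.
  by apply: esum_ge0 => i _; rewrite lee_fin addr_ge0 // sqr_ge0.
have prep (z : nat -> vec R J) : (\esum_(n in [set: nat]) normsq (z n) < +oo)%E ->
    exists (Z : nat -> R) (C : R), [/\ forall n, bnd (Z n) (colop (z n)) &
      forall s, uniq s -> nrm s (fun n => ((Z n)%:C)%C) <= C].
  move=> fin.
  have le1 (s : seq nat) : uniq s -> (\sum_(n <- s) normsq (z n) <= \esum_(n in [set: nat]) normsq (z n))%E.
    move=> us; apply: esum_ge; exists [set` s]; first by split => //; exact: finite_seq.
    by rewrite -fsbig_seq.
  have fz n : (normsq (z n) < +oo)%E.
    by apply: le_lt_trans fin; have := le1 [:: n] isT; rewrite big_seq1.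
  pose Z n := Num.sqrt (fine (normsq (z n))).
  have Zn n : ((Z n ^+ 2)%:E = normsq (z n))%E.
    by rewrite sqr_sqrtr ?fine_ge0 // fineK // ge0_fin_numE.
  have ge0 : (0 <= \esum_(n in [set: nat]) normsq (z n))%E by apply: esum_ge0.
  exists Z, (fine (\esum_(n in [set: nat]) normsq (z n)) + 1); split.
    move=> n; apply: bnd_colop; first exact: sqrtr_ge0.
    move=> s us; rewrite -(ler_pXn2r (n := 2)) ?nnegrE ?nrm_ge0 ?sqrtr_ge0 //.
    rewrite -lee_fin Zn sqr_nrm; apply: esum_ge; exists [set` s].
      by split => //; exact: finite_seq.
    rewrite -fsbig_seq // -sumEFin; apply: lee_sum => i _.
    by rewrite lee_fin sqr_normc.
  move=> s us; have := le1 s us.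
  have -> : (\sum_(n <- s) normsq (z n) = (nrm s (fun n => ((Z n)%:C)%C) ^+ 2)%:E)%E.
    rewrite sqr_nrm -sumEFin; apply: eq_bigr => n _.
    by rewrite -Zn normc_real real_normK ?num_real.
  rewrite -[X in (_ <= X)%E]fineK ?ge0_fin_numE // lee_fin => h.
  have := fine_ge0 ge0; have := nrm_ge0 s (fun n => ((Z n)%:C)%C); nra.
have [X [C [hX hC]]] := prep x hx; have [Y [D [hY hD]]] := prep y hy.
have D0 : 0 <= D by rewrite (le_trans _ (hD [::] isT)) // nrm_ge0.
pose a n (S : mat R J) := (opadj (colop (x n)) ** (S ** colop (y n))) tt tt.
have aE n M S : bnd M S -> normc (a n S) <= M * (X n * Y n).
  move=> bS; have := bnd_entry tt tt (bnd_mul (bnd_adj (hX n)) (bnd_mul bS (hY n))).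
  by rewrite mulrCA.
have XY n : X n * Y n = normc ((X n)%:C)%C * normc ((Y n)%:C)%C.
  by rewrite !normc_real !ger0_norm // ?(bnd_ge0 (hX n)) ?(bnd_ge0 (hY n)).
apply: entry_limit_trans => e e0; have d0 : 0 < e / (D + 1) by rewrite divr_gt0 // ltr_wpDl.
have [s0 us0 hs0] := nrm_tail hC d0.
exists (fun S => \sum_(n <- s0) a n S).
  by apply: entry_limit_sum => n; apply: entry_limit_vec; [exact: bnd_bounded (hX n)|exact: bnd_bounded (hY n)].
move=> M S bS; have M0 := bnd_ge0 bS.
have ab : abs_bounded (M * (C * D)) (fun n => a n S).
  move=> s us; apply: le_trans (_ : \sum_(n <- s) M * (X n * Y n) <= _).
    by apply: ler_sum => n _; exact: aE.
  rewrite -mulr_sumr ler_wpM2l //; under eq_bigr do rewrite XY.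
  by apply: le_trans (cauchy_schwarz _ _ _) _; apply: ler_pM; rewrite ?nrm_ge0 ?hC ?hD.
have hs := hassum_csum ab; rewrite -/(csum (fun n => a n S)).
have hd : hassum (fun n => a n S - (if n \in s0 then a n S else 0))
    (csum (fun n => a n S) - \sum_(n <- s0) a n S).
  have hf : hassum (fun n => if n \in s0 then a n S else 0) (\sum_(n <- s0) a n S).
    have := hassum_fin (f := fun n => if n \in s0 then a n S else 0) us0.
    rewrite (eq_big_seq (fun n => a n S)) => [|n ->//]; apply => n /negbTE -> //.
  by have := hassum_lin (-1) hf hs; congr (hassum _ _); [apply/funext=> n|]; rewrite mulN1r addrC.
apply: (hassum_le hd) => s us; apply: le_trans (normc_sum _ _) _.
apply: le_trans (_ : \sum_(n <- s) M * (normc (if n \in s0 then 0 else ((X n)%:C)%C) * normc ((Y n)%:C)%C) <= _).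
  apply: ler_sum => n _; case: ifP => _; first by rewrite subrr normc_0 mul0r mulr0.
  by rewrite subr0 -XY aE.
rewrite -mulr_sumr mulrC ler_wpM2r //.
apply: le_trans (cauchy_schwarz s (fun n => if n \in s0 then 0 else ((X n)%:C)%C) (fun n => ((Y n)%:C)%C)) _.
apply: le_trans (ler_pM (nrm_ge0 _ _) (nrm_ge0 _ _) (hs0 _ us) (hD _ us)) _.
by rewrite mulrAC ler_pdivrMr ?ltr_wpDl // ler_wpM2l ?(ltW e0) // lerDl.
Qed.

(** Linearity is inherited from the approximating combinations of entries, which avoids handling the
    nested infinite sums. *)
Lemma normal_lin J (w : mat R J -> R[i]) : normal_functional w ->
  forall c S T, bounded S -> bounded T -> w (opscale c S + T) = c * w S + w T.
Proof.
move=> /normal_entry_limit hw c S T [M bS] [N bT]; apply: normc_eps => e e0.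
have M0 := bnd_ge0 bS; have N0 := bnd_ge0 bT; have c0 := normc_ge0 c.
pose K := 2 * (normc c * M + N) + 1.
have K0 : 0 < K by rewrite /K; nra.
have [phi hp] := hw _ (divr_gt0 e0 K0).
have h1 := hp _ _ (bnd_lin c bS bT); have h2 := hp _ _ bS; have h3 := hp _ _ bT.
have E : entry_form phi (opscale c S + T) = c * entry_form phi S + entry_form phi T.
  rewrite /entry_form mulr_sumr -big_split /=; apply: eq_bigr => p _.
  by rewrite /opscale !fctE; ring.
rewrite (_ : _ - _ = (w (opscale c S + T) - entry_form phi (opscale c S + T)) -
   (c * (w S - entry_form phi S) + (w T - entry_form phi T))); last by rewrite E; ring.
rewrite (le_trans (normcD _ _)) // normcN'.
apply: le_trans (lerD h1 (le_trans (normcD _ _) (lerD (_ : _ <= normc c * (e / K * M)) h3))) _.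
  by rewrite normcM ler_wpM2l.
apply: le_trans (_ : e / K * (K - 1) <= _).
  by rewrite /K le_eqVlt; apply/orP; left; apply/eqP; ring.
by rewrite mulrAC ler_pdivrMr // ler_wpM2l ?(ltW e0) // gerBl.
Qed.

Lemma nrm_tensor I J (s : seq I) (t : seq J) (x : I -> R[i]) (y : J -> R[i]) :
  nrm (allpairs pair s t) (fun p => x p.1 * y p.2) = nrm s x * nrm t y.
Proof.
rewrite /nrm -sqrtrM; last by apply: sumr_ge0 => i _; rewrite sqr_ge0.
congr Num.sqrt; rewrite big_allpairs mulr_suml; apply: eq_bigr => i _.
by rewrite mulr_sumr; apply: eq_bigr => j _; rewrite normcM exprMn.
Qed.

(** This removes normal functionals from the later arguments: the algebras of the quantum group and
    its universal duals lie in the closed spans of the matrix entries of [W] or [V]. *)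
Lemma rslice_blocks I J (w : mat R J -> R[i]) (T : mat R (I * J)%type) :
  normal_functional w -> bounded T ->
  cspan [set X | exists j l, X = blk T j l] (rslice w T).
Proof.
move=> nw [M bT]; have M0 := bnd_ge0 bT; have hw := normal_entry_limit nw.
have sC := @cspan_csub R I [set X | exists j l, X = blk T j l].
apply: (csub_closed sC) => e e0; have M1 : 0 < M + 1 by rewrite ltr_wpDl.
have [phi hp] := hw _ (divr_gt0 e0 M1).
exists (\sum_(p <- phi) opscale p.2 (blk T p.1.1 p.1.2)).
  by apply: (csub_sum _ sC) => p; apply: (csubZ _ sC); apply: sub_cspan; exists p.1.1, p.1.2.
rewrite -[X in bnd e X]opprK opprB; apply: bndN; split=> [|s t us ut y x]; first exact: ltW.
(* The test vectors are contracted with the first leg of [T]. The resulting operator on the second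
   leg has norm at most [M * (nrm s y * nrm t x)], so the uniform approximation of [w] bounds the
   whole form at once. *)
pose S := \sum_(i <- s) \sum_(j <- t) opscale (Num.conj (y i) * x j) (blk2 T i j).
have SE k l : S k l = \sum_(i <- s) \sum_(j <- t) Num.conj (y i) * x j * T (i, k) (j, l).
  by rewrite /S op_sumE; apply: eq_bigr => i _; rewrite op_sumE.
have bS : bnd (M * (nrm s y * nrm t x)) S.
  split=> [|s' t' us' ut' y' x']; first by rewrite !mulr_ge0 // nrm_ge0.
  have [_ h] := bT.
  have ap (U V : choiceType) (u : seq U) (v : seq V) : uniq u -> uniq v -> uniq (allpairs pair u v).
    by move=> uu uv; apply: allpairs_uniq => // -[a b] [c d].
  have := h _ _ (ap _ _ _ _ us us') (ap _ _ _ _ ut ut') (fun p => y p.1 * y' p.2) (fun p => x p.1 * x' p.2).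
  rewrite !nrm_tensor -[in X in _ -> X]mulrA (mulrACA (nrm s y)).
  congr (normc _ <= _); rewrite big_allpairs /= exchange_big /=; apply: eq_bigr => k _.
  under eq_bigr do rewrite big_allpairs /=.
  under [RHS]eq_bigr do rewrite SE mulr_sumr mulr_suml.
  rewrite [RHS]exchange_big /=; apply: eq_bigr => i _.
  rewrite exchange_big /=; apply: eq_bigr => l _.
  rewrite mulr_sumr mulr_suml; apply: eq_bigr => j _.
  by rewrite rmorphM; ring.
have wsum (A : Type) (r : seq A) (F : A -> mat R J) : (forall a, bounded (F a)) ->
    w (\sum_(a <- r) F a) = \sum_(a <- r) w (F a).
  move=> bF; elim: r => [|a r IH].
    rewrite !big_nil; have := normal_lin nw 1 (bounded0 J J) (bounded0 J J).
    by rewrite opscale1 addr0 mul1r => /eqP; rewrite -subr_eq0 opprD addrA subrr sub0r oppr_eq0 => /eqP.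
  rewrite !big_cons -IH; have := normal_lin nw 1 (bF a) (bounded_sum r bF).
  by rewrite opscale1 mul1r.
have bT' := bnd_bounded bT.
have wS : w S = \sum_(i <- s) \sum_(j <- t) Num.conj (y i) * x j * w (blk2 T i j).
  rewrite wsum => [|i]; last by apply: bounded_sum => j; apply: boundedZ; exact: bounded_blk2.
  apply: eq_bigr => i _; rewrite wsum => [|j]; last by apply: boundedZ; exact: bounded_blk2.
  apply: eq_bigr => j _.
  have := normal_lin nw (Num.conj (y i) * x j) (bounded_blk2 i j bT') (bounded0 J J).
  rewrite !addr0 => ->; have -> : w 0 = 0; last by rewrite addr0.
  by have := wsum J [::] (fun=> 0) (fun=> bounded0 J J); rewrite !big_nil.
have := hp _ _ bS; rewrite wS.
have -> : entry_form phi S = \sum_(i <- s) \sum_(j <- t) Num.conj (y i) * x j *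
    (\sum_(p <- phi) p.2 * T (i, p.1.1) (j, p.1.2)).
  rewrite /entry_form; under eq_bigr do (rewrite SE mulr_sumr; under eq_bigr do rewrite mulr_sumr).
  rewrite exchange_big; apply: eq_bigr => i _; rewrite exchange_big; apply: eq_bigr => j _.
  by rewrite mulr_sumr; apply: eq_bigr => p _; ring.
rewrite -sumrB; under eq_bigr do (rewrite -sumrB; under eq_bigr do rewrite -mulrBr).
move=> H; apply: le_trans (le_trans (_ : _ <= _) H) _.
  rewrite le_eqVlt; apply/orP; left; apply/eqP; congr normc.
  apply: eq_bigr => i _; apply: eq_bigr => j _.
  rewrite !fctE op_sumE /rslice mulrAC; congr (_ * (_ - _)).
rewrite mulrA ler_wpM2r ?mulr_ge0 ?nrm_ge0 //.
by rewrite mulrAC ler_pdivrMr // ler_wpM2l ?(ltW e0) // lerDl.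
Qed.

End NormalFunctionals.

(** * Leg numbering, unitaries and conjugation *)

Section Legs.
Context {R : realType}.
Implicit Types (I J K L : choiceType).

Lemma leg12E I J K (T : mat R (I * J)%type) (p q : I * J * K) :
  leg12 T p q = T p.1 q.1 * (p.2 == q.2)%:R.
Proof. by []. Qed.

Lemma leg13E I J K (T : mat R (I * K)%type) (p q : I * J * K) :
  leg13 T p q = T (p.1.1, p.2) (q.1.1, q.2) * (p.1.2 == q.1.2)%:R.
Proof. by []. Qed.

Lemma leg23E I J K (T : mat R (J * K)%type) (p q : I * J * K) :
  leg23 T p q = (p.1.1 == q.1.1)%:R * T (p.1.2, p.2) (q.1.2, q.2).
Proof. by []. Qed.

Definition asc I J K (p : I * J * K) : I * (J * K) := (p.1.1, (p.1.2, p.2)).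
Definition unasc I J K (p : I * (J * K)) : I * J * K := (p.1, p.2.1, p.2.2).
Definition swp23 I J K (p : I * J * K) : I * K * J := (p.1.1, p.2, p.1.2).

Lemma ascK I J K : cancel (@asc I J K) (@unasc I J K). Proof. by move=> [[? ?] ?]. Qed.
Lemma unascK I J K : cancel (@unasc I J K) (@asc I J K). Proof. by move=> [? [? ?]]. Qed.
Lemma swp23K I J K : cancel (@swp23 I J K) (@swp23 I K J). Proof. by move=> [[? ?] ?]. Qed.

Definition unreassoc I J K (T : mat R (I * J * K)%type) : mat R (I * (J * K))%type :=
  ridx (@unasc I J K) T.

Lemma unreassocK I J K (T : mat R (I * J * K)%type) : reassoc (unreassoc T) = T.
Proof. by apply/funext=> -[[? ?] ?]; apply/funext=> -[[? ?] ?]. Qed.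

Lemma reassocK I J K (T : mat R (I * (J * K))%type) : unreassoc (reassoc T) = T.
Proof. by apply/funext=> -[? [? ?]]; apply/funext=> -[? [? ?]]. Qed.

Lemma bounded_reassoc I J K (T : mat R (I * (J * K))%type) : bounded T -> bounded (reassoc T).
Proof. exact: bounded_ridx (can_inj (@ascK _ _ _)). Qed.
Lemma bnd_unreassoc I J K M (T : mat R (I * J * K)%type) : bnd M T -> bnd M (unreassoc T).
Proof. exact: bnd_ridx (can_inj (@unascK _ _ _)). Qed.
Lemma bounded_unreassoc I J K (T : mat R (I * J * K)%type) : bounded T -> bounded (unreassoc T).
Proof. exact: bounded_ridx (can_inj (@unascK _ _ _)). Qed.
Lemma bounded_flip23 I J K (T : mat R (I * J * K)%type) : bounded T -> bounded (flip23 T).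
Proof. exact: bounded_ridx (can_inj (@swp23K _ _ _)). Qed.

Lemma reassoc_mul I J K (S T : mat R (I * (J * K))%type) : bounded S -> bounded T ->
  reassoc (S ** T) = reassoc S ** reassoc T.
Proof. exact: ridx_mul (@ascK _ _ _) (@unascK _ _ _). Qed.
Lemma flip23_mul I J K (S T : mat R (I * J * K)%type) : bounded S -> bounded T ->
  flip23 (S ** T) = flip23 S ** flip23 T.
Proof. exact: ridx_mul (@swp23K _ _ _) (@swp23K _ _ _). Qed.

Lemma bounded_leg12 I J K (T : mat R (I * J)%type) : bounded T -> bounded (leg12 T : mat R (I * J * K)%type).
Proof. exact: bounded_mtens1. Qed.
Lemma bounded_leg13 I J K (T : mat R (I * K)%type) : bounded T -> bounded (leg13 T : mat R (I * J * K)%type).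
Proof. by move=> bT; apply: bounded_flip23; exact: bounded_mtens1. Qed.
Lemma bounded_leg23 I J K (T : mat R (J * K)%type) : bounded T -> bounded (leg23 T : mat R (I * J * K)%type).
Proof. by move=> bT; apply: bounded_reassoc; exact: bounded_mtens1l. Qed.

Lemma leg12_mul I J K (S T : mat R (I * J)%type) : bounded S -> bounded T ->
  leg12 (S ** T) = leg12 S ** leg12 T :> mat R (I * J * K)%type.
Proof. by move=> bS bT; rewrite /leg12 mtens_mul ?opmul1l //; exact: bounded_one. Qed.

Lemma leg13_mul I J K (S T : mat R (I * K)%type) : bounded S -> bounded T ->
  leg13 (S ** T) = leg13 S ** leg13 T :> mat R (I * J * K)%type.
Proof.
move=> bS bT; have b1 := bounded_one (R := R) J; rewrite /leg13 -flip23_mul; try exact: bounded_mtens1.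
by rewrite mtens_mul ?opmul1l.
Qed.

Lemma leg23_mul I J K (S T : mat R (J * K)%type) : bounded S -> bounded T ->
  leg23 (S ** T) = leg23 S ** leg23 T :> mat R (I * J * K)%type.
Proof.
move=> bS bT; have b1 := bounded_one (R := R) I; rewrite /leg23 -reassoc_mul; try exact: bounded_mtens1l.
by rewrite mtens_mul ?opmul1l.
Qed.

Lemma leg12_adj I J K (T : mat R (I * J)%type) :
  opadj (leg12 T : mat R (I * J * K)%type) = leg12 (opadj T).
Proof. by rewrite /leg12 mtens_adj opadj1. Qed.

Lemma leg13_adj I J K (T : mat R (I * K)%type) :
  opadj (leg13 T : mat R (I * J * K)%type) = leg13 (opadj T).
Proof. by rewrite /leg13 -ridx_adj mtens_adj opadj1. Qed.

Lemma leg23_adj I J K (T : mat R (J * K)%type) :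
  opadj (leg23 T : mat R (I * J * K)%type) = leg23 (opadj T).
Proof. by rewrite /leg23 -ridx_adj mtens_adj opadj1. Qed.

Lemma unitaryP I (u : mat R I) : unitary_op u <->
  [/\ bounded u, opadj u ** u = mone & u ** opadj u = mone].
Proof. by split=> -[/bounded_opP ? ? ?]; split. Qed.

Lemma unitary_adj I (u : mat R I) : unitary_op u -> unitary_op (opadj u).
Proof. by move=> /unitaryP[bu h1 h2]; apply/unitaryP; rewrite opadjK; split=> //; exact: bounded_adj. Qed.

Lemma unitary_mul I (u v : mat R I) : unitary_op u -> unitary_op v -> unitary_op (u ** v).
Proof.
move=> /unitaryP[bu u1 u2] /unitaryP[bv v1 v2]; apply/unitaryP.
have bu' := bounded_adj bu; have bv' := bounded_adj bv.
rewrite opadj_mul //; split; first exact: bounded_mul.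
  transitivity (opadj v ** (opadj u ** u) ** v); last by rewrite u1 opmul1r.
  by rewrite -!opmulA //; exact: bounded_mul.
transitivity (u ** (v ** opadj v) ** opadj u); last by rewrite v2 opmul1r.
by rewrite -!opmulA //; exact: bounded_mul.
Qed.

Lemma unitary_ridx I I' (a : I' -> I) (b : I -> I') (u : mat R I) :
  cancel a b -> cancel b a -> unitary_op u -> unitary_op (ridx a u).
Proof.
move=> aK bK /unitaryP[bu u1 u2]; have ai := can_inj aK; apply/unitaryP; split.
- exact: bounded_ridx.
- by rewrite -ridx_adj -(ridx_mul aK bK) ?u1 ?ridx_one //; exact: bounded_adj.
- by rewrite -ridx_adj -(ridx_mul aK bK) ?u2 ?ridx_one //; exact: bounded_adj.
Qed.

Lemma unitary_mtens1 I J (u : mat R I) : unitary_op u -> unitary_op (mtens u (mone : mat R J)).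
Proof.
move=> /unitaryP[bu u1 u2]; have b1 := bounded_one (R := R) J; have bu' := bounded_adj bu.
apply/unitaryP; split; first exact: bounded_mtens1.
  by rewrite mtens_adj opadj1 mtens_mul // u1 opmul1l mtens_one.
by rewrite mtens_adj opadj1 mtens_mul // u2 opmul1l mtens_one.
Qed.

Lemma unitary_flip I J (u : mat R (I * J)%type) : unitary_op u -> unitary_op (flip u).
Proof. exact: unitary_ridx (@swpK _ _) (@swpK _ _). Qed.

Lemma unitary_leg12 I J K (u : mat R (I * J)%type) : unitary_op u ->
  unitary_op (leg12 u : mat R (I * J * K)%type).
Proof. exact: unitary_mtens1. Qed.

Lemma unitary_leg13 I J K (u : mat R (I * K)%type) : unitary_op u ->
  unitary_op (leg13 u : mat R (I * J * K)%type).
Proof. by move=> hu; apply: unitary_ridx (@swp23K _ _ _) (@swp23K _ _ _) _; exact: unitary_mtens1. Qed.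

Lemma unitary_leg23 I J K (u : mat R (J * K)%type) : unitary_op u ->
  unitary_op (leg23 u : mat R (I * J * K)%type).
Proof.
move=> hu; apply: unitary_ridx (@ascK _ _ _) (@unascK _ _ _) _.
by rewrite -(flipK (mtens _ _)) flip_mtens; apply: unitary_flip; exact: unitary_mtens1.
Qed.

Lemma unitary_bounded I (u : mat R I) : unitary_op u -> bounded u.
Proof. by move=> /unitaryP[]. Qed.

Lemma unitaryKl I J (u : mat R I) (T : op R I J) : unitary_op u -> bounded T ->
  opadj u ** (u ** T) = T.
Proof. by move=> /unitaryP[bu u1 _] bT; rewrite opmulA ?u1 ?opmul1l //; bb. Qed.

Lemma unitaryKr I J (u : mat R I) (T : op R J I) : unitary_op u -> bounded T ->
  T ** u ** opadj u = T.
Proof. by move=> /unitaryP[bu _ u1] bT; rewrite -opmulA ?u1 ?opmul1r //; bb. Qed.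

Lemma unitaryKVl I J (u : mat R I) (T : op R I J) : unitary_op u -> bounded T ->
  u ** (opadj u ** T) = T.
Proof. by move=> /unitaryP[bu _ u2] bT; rewrite opmulA ?u2 ?opmul1l //; bb. Qed.

Lemma unitaryKVr I J (u : mat R I) (T : op R J I) : unitary_op u -> bounded T ->
  T ** opadj u ** u = T.
Proof. by move=> /unitaryP[bu u2 _] bT; rewrite -opmulA ?u2 ?opmul1r //; bb. Qed.

Lemma mconjgE I (u x : mat R I) : mconjg u x = u ** (x ** opadj u).
Proof. by []. Qed.

Lemma shom_conj I (u : mat R I) : unitary_op u ->
  shom [set T : mat R I | bounded T] (fun x => u ** x ** opadj u).
Proof.
move=> hu; have bu := unitary_bounded hu; have /unitaryP[_ u1 u2] := hu.
split=> /=.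
- by move=> c a b ba bb; rewrite opmul_linr // opmul_linl //; bb.
- move=> a b ba bb; have bu' := bounded_adj bu.
  transitivity (u ** (a ** (opadj u ** u) ** b) ** opadj u); first by rewrite u1 opmul1r.
  by rewrite -!opmulA //; bb.
- by move=> a ba; rewrite !opadj_mul ?opadjK ?opmulA //; bb.
- by rewrite opmul1r.
- by move=> a ba; bb.
Qed.

Definition blk3 I J K (T : mat R (I * J * K)%type) (i i' : I) : mat R (J * K)%type :=
  fun p q => T (i, p.1, p.2) (i', q.1, q.2).

Lemma blk3P I J K (S T : mat R (I * J * K)%type) :
  (forall i i', blk3 S i i' = blk3 T i i') -> S = T.
Proof.
move=> h; apply/funext=> -[[i j] k]; apply/funext=> -[[i' j'] k'].
exact: (congr1 (fun X => X (j, k) (j', k')) (h i i')).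
Qed.

Lemma blk_mul1l I J (W : mat R I) (T : mat R (I * J)%type) k l : bounded W -> bounded T ->
  blk (mtens W mone ** T) k l = W ** blk T k l.
Proof.
move=> bW bT; apply/funext=> i; apply/funext=> i'; apply: opmul_eq => //.
  exact: bounded_mtens1.
have -> : (fun p => mtens W mone (i, k) p * T p (i', l)) =
   (fun p : I * J => (W i p.1 * blk T k l p.1 i') * (p.2 == k)%:R).
  apply/funext=> -[a b]; rewrite /mtens /mone /blk /= [k == b]eq_sym.
  by case: eqP => [->|]; rewrite ?mulr1 // !mulr0 mul0r.
apply: (hassum_slice (f := fun a => W i a * blk T k l a i')).
  by apply: opmul_hassum => //; exact: bounded_blk.
have [M hM] := bW; have [N hN] := bounded_blk k l bT.
by exists (M * N); exact: mul_abs_bounded hM hN.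
Qed.

Lemma blk_mul1r I J (W : mat R I) (T : mat R (I * J)%type) k l : bounded W -> bounded T ->
  blk (T ** mtens W mone) k l = blk T k l ** W.
Proof.
move=> bW bT; have bW1 := @bounded_mtens1 R I J _ bW.
suff H : opadj (blk (T ** mtens W mone) k l) = opadj (blk T k l ** W).
  by rewrite -[LHS]opadjK H opadjK.
rewrite -[LHS]/(blk (opadj (T ** mtens W mone)) l k) opadj_mul // mtens_adj opadj1.
have bW' := bounded_adj bW; have bT' := bounded_adj bT.
rewrite blk_mul1l // blk_adj opadj_mul //.
exact: bounded_blk.
Qed.

Lemma blk3_mull I J K (W : mat R (J * K)%type) (T : mat R (I * J * K)%type) i i' :
  bounded W -> bounded T -> blk3 (leg23 W ** T) i i' = W ** blk3 T i i'.
Proof.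
move=> bW bT.
have -> : leg23 W ** T = reassoc (flip (mtens W mone ** flip (unreassoc T))).
  rewrite flip_mul ?flipK ?reassoc_mul ?unreassocK ?flip_mtens //.
  - exact: bounded_mtens1l.
  - exact: bounded_unreassoc.
  - exact: bounded_mtens1.
  - by apply: bounded_flip; exact: bounded_unreassoc.
have -> : blk3 T i i' = blk (flip (unreassoc T)) i i' by apply/funext=> -[? ?]; apply/funext=> -[? ?].
rewrite -blk_mul1l //; last by apply: bounded_flip; exact: bounded_unreassoc.
by apply/funext=> -[? ?]; apply/funext=> -[? ?].
Qed.

Lemma blk3_adj I J K (T : mat R (I * J * K)%type) i i' :
  blk3 (opadj T) i i' = opadj (blk3 T i' i).
Proof. by []. Qed.

Lemma bounded_blk3 I J K (T : mat R (I * J * K)%type) i i' : bounded T -> bounded (blk3 T i i').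
Proof.
move=> bT; have -> : blk3 T i i' = blk2 (unreassoc T) i i' by apply/funext=> -[? ?]; apply/funext=> -[? ?].
by apply: bounded_blk2; exact: bounded_unreassoc.
Qed.

Lemma blk3_mulr I J K (W : mat R (J * K)%type) (T : mat R (I * J * K)%type) i i' :
  bounded W -> bounded T -> blk3 (T ** leg23 W) i i' = blk3 T i i' ** W.
Proof.
move=> bW bT; have bW1 := @bounded_leg23 I J K _ bW.
suff H : opadj (blk3 (T ** leg23 W) i i') = opadj (blk3 T i i' ** W).
  by rewrite -[LHS]opadjK H opadjK.
rewrite -[LHS]/(blk3 (opadj (T ** leg23 W)) i' i) opadj_mul // leg23_adj.
have bW' := bounded_adj bW; have bT' := bounded_adj bT.
rewrite blk3_mull // blk3_adj opadj_mul //.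
exact: bounded_blk3.
Qed.

Lemma blk3_leg12 I J K (X : mat R (I * J)%type) i i' :
  blk3 (leg12 X : mat R (I * J * K)%type) i i' = mtens (blk2 X i i') mone.
Proof. by []. Qed.

Lemma blk3_reassoc I J K (X : mat R (I * (J * K))%type) i i' :
  blk3 (reassoc X) i i' = blk2 X i i'.
Proof. by apply/funext=> -[? ?]; apply/funext=> -[? ?]. Qed.

End Legs.
#[global] Hint Resolve bounded_leg12 bounded_leg13 bounded_leg23 bounded_blk3
  bounded_reassoc bounded_unreassoc bounded_flip23 bounded_mtens1 bounded_mtens1l : bdb.

(** * Multipliers under leg numbering *)

Section LegMultipliers.
Context {R : realType}.
Implicit Types (I J K L : choiceType).

Lemma mult_ridx I I' (u : I' -> I) (v : I -> I') (X : set (mat R I)) (Y : set (mat R I')) m :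
  cancel u v -> cancel v u -> (forall t, Y t -> bounded t) ->
  (forall t, X t -> Y (ridx u t)) -> (forall t, Y t -> X (ridx v t)) ->
  multiplier X m -> multiplier Y (ridx u m).
Proof.
move=> uK vK bY XY YX hm; have bm := mult_bounded hm; have ui := can_inj uK; have vi := can_inj vK.
apply/multP; split=> [|t Yt]; first exact: bounded_ridx.
have bt := bounded_ridx vi (bY _ Yt); have Xt := YX _ Yt.
have E : ridx u (ridx v t) = t by apply/funext=> p; apply/funext=> q; rewrite /ridx !uK.
by rewrite -[t]E -!(ridx_mul uK vK) //; split; apply: XY; [exact: (mult_mull hm)|exact: (mult_mulr hm)].
Qed.

Lemma mult_mtens I J (A : set (mat R I)) (B : set (mat R J)) m n :
  star_alg A -> star_alg B -> multiplier A m -> multiplier B n ->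
  multiplier (atens A B) (mtens m n).
Proof.
move=> hA hB; have [_ bA _ _] := hA; have [_ bB _ _] := hB.
have H m' n' : multiplier A m' -> multiplier B n' -> forall t, atens A B t -> atens A B (mtens m' n' ** t).
  move=> hm hn; have bm := mult_bounded hm; have bn := mult_bounded hn.
  have bmn := bounded_mtens bm bn.
  apply: (atens_ind (@csub_bounded R _) (blin_mull bmn (fun T h => h)) (csub_atens A B)) => a b Aa Bb.
    by have := bA _ Aa; have := bB _ Bb; move=> ? ? /=; bb.
  rewrite mtens_mul //; try by [exact: bA|exact: bB].
  by apply: sub_atens; [exact: (mult_mull hm)|exact: (mult_mull hn)].
move=> hm hn; apply: multI; first exact: star_atens.
- by apply: bounded_mtens; [exact: mult_bounded hm|exact: mult_bounded hn].
- exact: H.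
- by rewrite mtens_adj; apply: H; exact: mult_adj.
Qed.

Lemma mult1 I (A : set (mat R I)) : star_alg A -> multiplier A mone.
Proof. by move=> hA; exact: calg1 (calg_mult hA). Qed.

Section Three.
Context {I J K : choiceType} {A : set (mat R I)} {B : set (mat R J)} {C : set (mat R K)}.
Hypotheses (hA : star_alg A) (hB : star_alg B) (hC : star_alg C).

Let bA a : A a -> bounded a. Proof. by case: hA => _ h _ _; exact: h. Qed.
Let bB a : B a -> bounded a. Proof. by case: hB => _ h _ _; exact: h. Qed.
Let bC a : C a -> bounded a. Proof. by case: hC => _ h _ _; exact: h. Qed.

Lemma csub_ridx I1 I2 (u : I2 -> I1) (E : set (mat R I2)) : injective u -> csub E ->
  csub [set T : mat R I1 | E (ridx u T)].
Proof.
move=> ui sE; split=> /=; first exact: csub0.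
- by move=> c a b ha hb; exact: (csub_lin c sE ha hb).
- move=> T h; apply: (csub_closed sE) => e /h[a ha ba]; exists (ridx u a) => //.
  exact: (bnd_ridx ui ba).
Qed.

Lemma atens3_ind I1 (u : I1 -> I * J * K) (E : set (mat R I1)) : injective u -> csub E ->
  (forall a b c, A a -> B b -> C c -> E (ridx u (mtens (mtens a b) c))) ->
  forall t, atens (atens A B) C t -> E (ridx u t).
Proof.
move=> ui sE h; apply: (atens_min (csub_ridx ui sE)) => t c ht Cc /=.
suff [] : bounded t /\ E (ridx u (mtens t c)) by [].
apply: (atens_min (E := [set t | bounded t /\ E (ridx u (mtens t c))])) ht => [|a b Aa Bb].
  apply: (blin_csub (@csub_bounded R _) (blin_tensl _ (bC Cc)) (csub_ridx ui sE)).
by split; [apply: bounded_mtens; [exact: bA|exact: bB]|exact: h].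
Qed.

Lemma atens3_ind' I1 (u : I1 -> I * (J * K)) (E : set (mat R I1)) : injective u -> csub E ->
  (forall a b c, A a -> B b -> C c -> E (ridx u (mtens a (mtens b c)))) ->
  forall t, atens A (atens B C) t -> E (ridx u t).
Proof.
move=> ui sE h; apply: (atens_min (csub_ridx ui sE)) => a t Aa ht /=.
suff [] : bounded t /\ E (ridx u (mtens a t)) by [].
apply: (atens_min (E := [set t | bounded t /\ E (ridx u (mtens a t))])) ht => [|b c Bb Cc].
  apply: (blin_csub (@csub_bounded R _) (blin_tensr _ (bA Aa)) (csub_ridx ui sE)).
by split; [apply: bounded_mtens; [exact: bB|exact: bC]|exact: h].
Qed.

Lemma reassoc_mtens (a : mat R I) (b : mat R J) (c : mat R K) :
  reassoc (mtens a (mtens b c)) = mtens (mtens a b) c.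
Proof. by apply/funext=> p; apply/funext=> q; rewrite /reassoc /mtens mulrA. Qed.

Lemma unreassoc_mtens (a : mat R I) (b : mat R J) (c : mat R K) :
  unreassoc (mtens (mtens a b) c) = mtens a (mtens b c).
Proof. by rewrite -reassoc_mtens reassocK. Qed.

Lemma flip23_mtens (a : mat R I) (b : mat R J) (c : mat R K) :
  flip23 (mtens (mtens a b) c) = mtens (mtens a c) b.
Proof. by apply/funext=> p; apply/funext=> q; rewrite /flip23 /mtens mulrAC. Qed.

Lemma atens_reassoc t : atens A (atens B C) t -> atens (atens A B) C (reassoc t).
Proof.
apply: (atens3_ind' (can_inj (@ascK _ _ _)) (csub_atens _ _)) => a b c Aa Bb Cc.
by rewrite -[ridx _ _]/(reassoc _) reassoc_mtens; do 2! [apply: sub_atens => //].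
Qed.

Lemma atens_unreassoc t : atens (atens A B) C t -> atens A (atens B C) (unreassoc t).
Proof.
apply: (atens3_ind (can_inj (@unascK _ _ _)) (csub_atens _ _)) => a b c Aa Bb Cc.
by rewrite -[ridx _ _]/(unreassoc _) unreassoc_mtens; do 2! [apply: sub_atens => //].
Qed.

Lemma atens_flip23 t : atens (atens A B) C t -> atens (atens A C) B (flip23 t).
Proof.
apply: (atens3_ind (can_inj (@swp23K _ _ _)) (csub_atens _ _)) => a b c Aa Bb Cc.
by rewrite -[ridx _ _]/(flip23 _) flip23_mtens; do 2! [apply: sub_atens => //].
Qed.

Lemma mult_leg12 m : multiplier (atens A B) m -> multiplier (atens (atens A B) C) (leg12 m).
Proof. by move=> hm; apply: mult_mtens => //; [exact: star_atens|exact: mult1]. Qed.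

Lemma mult_reassoc m : multiplier (atens A (atens B C)) m ->
  multiplier (atens (atens A B) C) (reassoc m).
Proof.
apply: (mult_ridx (@ascK _ _ _) (@unascK _ _ _)).
- by move=> t; apply: atens_bounded => //; exact: star_atens.
- exact: atens_reassoc.
- exact: atens_unreassoc.
Qed.

Lemma mult_leg23 m : multiplier (atens B C) m -> multiplier (atens (atens A B) C) (leg23 m).
Proof. by move=> hm; apply: mult_reassoc; apply: mult_mtens => //; [exact: star_atens|exact: mult1]. Qed.

End Three.

Lemma mult_leg13 I J K (A : set (mat R I)) (B : set (mat R J)) (C : set (mat R K)) m :
  star_alg A -> star_alg B -> star_alg C ->
  multiplier (atens A C) m -> multiplier (atens (atens A B) C) (leg13 m).
Proof.
move=> hA hB hC hm.
apply: (mult_ridx (X := atens (atens A C) B) (@swp23K _ _ _) (@swp23K _ _ _)).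
- by move=> t; apply: atens_bounded => //; exact: star_atens.
- by move=> t; exact: atens_flip23.
- by move=> t; exact: atens_flip23.
- by apply: mult_mtens => //; [exact: star_atens|exact: mult1].
Qed.

Lemma mult_Katens I J (A : set (mat R I)) (B : set (mat R J)) m : nalg A -> star_alg B ->
  multiplier (atens A B) m -> multiplier (atens (compacts R I) B) m.
Proof.
move=> nA hB hm; rewrite -[m]flipK; apply: mult_flip => //; first exact: star_compacts.
exact: (mult_atensK hB nA (mult_flip nA.1 hB hm)).
Qed.

Lemma mult_blocks_nalg I J (A : set (mat R I)) (B : set (mat R J)) m : star_alg A -> nalg B ->
  multiplier (atens A B) m -> blocks_in (multiplier A) m.
Proof. by move=> hA nB hm; exact: (mult_blocks hA (mult_atensK hA nB hm)). Qed.

Lemma mult_blk2 I J (A : set (mat R I)) (B : set (mat R J)) m i i' : nalg A -> star_alg B ->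
  multiplier (atens A B) m -> multiplier B (blk2 m i i').
Proof.
move=> nA hB hm; have hf := mult_flip nA.1 hB hm.
exact: (mult_blocks_nalg hB nA hf i i').
Qed.

(** Values on multipliers are forced: [h m ** h a] and [h' m ** h' a] are values at [m ** a], which
    is in [A], and [h(A)] is nondegenerate. *)
Lemma nrep_ext I K (A : set (mat R I)) (h h' : mat R I -> mat R K) :
  nrep A h -> shom (multiplier A) h' -> (forall x, A x -> h x = h' x) ->
  forall m, multiplier A m -> h m = h' m.
Proof.
move=> rh sh' E m hm; have [hX sh nd] := rh.
apply: (nrep_eq rh); try by [exact: (shom_bounded sh)|exact: (shom_bounded sh')].
move=> d hd; have md := star_alg_mult hX hd.
rewrite -(shomM sh) // (E _ hd) -(shomM sh') // E //.
exact: (mult_mull hm hd).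
Qed.

End LegMultipliers.

(** * Quantum groups and universal duals *)

Section Comultiplication.
Context {R : realType}.
Implicit Types (I J K L : choiceType).

Lemma morphism_mult I J (A : set (mat R I)) (B : set (mat R J)) f m :
  morphism A B f -> multiplier A m -> multiplier B (f m).
Proof. by case=> h _ _ _ _; exact: h. Qed.

Lemma morphism_rep I J (A : set (mat R I)) (B : set (mat R J)) f :
  star_alg A -> nalg B -> morphism A B f -> nrep A f.
Proof. by move=> hA nB hf; exact: nrep_comp hA hf (nalg_nrep_id nB). Qed.

(** The character property of [W] and the pentagon equation together give $(\mathrm{id}\otimes
    D)W=W_{23}W_{12}W_{23}^*$. Entrywise in the first leg this is the claim for the entries of [W],
    which suffice by density. The data are kept abstract so that the lemma serves both the quantum
    group and its dual. *)
Lemma comult_conj L (A Ah : set (mat R L)) (D : mat R L -> mat R (L * L)%type)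
    (W : mat R (L * L)%type) :
  nalg A -> nalg Ah -> unitary_op W -> multiplier (atens Ah A) W ->
  A `<=` cspan [set X | exists i i', X = blk2 W i i'] ->
  morphism A (atens A A) D ->
  reassoc (amq D W) = leg12 W ** leg13 W :> mat R (L * L * L)%type ->
  leg23 W ** leg12 W = leg12 W ** (leg13 W ** leg23 W) :> mat R (L * L * L)%type ->
  forall m, multiplier A m -> D m = W ** mtens m mone ** opadj W.
Proof.
move=> nA nAh uW mW AX hD DW pent; have bW := unitary_bounded uW.
have rD := morphism_rep nA.1 (nalg_atens nA nA) hD; have [hA sD _] := rD.
have hM := calg_mult hA.
have sc : shom (multiplier A) (fun m => W ** mtens m mone ** opadj W).
  have [h1 h2 h3 h4 h5] := shom_conj uW; have b1 := bounded_one (R := R) L.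
  have bm m : multiplier A m -> bounded (mtens m (mone : mat R L)).
    by move=> /mult_bounded; exact: bounded_mtens1.
  split.
  - by move=> c a b ha hb; rewrite mtens_linl h1 //; exact: bm.
  - move=> a b ha hb; have ba := mult_bounded ha; have bb' := mult_bounded hb.
    by rewrite -h2 ?mtens_mul ?opmul1l //; exact: bm.
  - by move=> a ha; rewrite -h3 ?mtens_adj ?opadj1 //; exact: bm.
  - by rewrite mtens_one h4.
  - by move=> a ha; apply: h5; exact: bm.
have E i i' : D (blk2 W i i') = W ** mtens (blk2 W i i') mone ** opadj W.
  have uW23 : unitary_op (leg23 W : mat R (L * L * L)%type) by exact: unitary_leg23.
  have := congr1 (fun X => blk3 X i i') DW; rewrite blk3_reassoc.
  have -> : leg12 W ** leg13 W = leg23 W ** leg12 W ** opadj (leg23 W) :> mat R (L * L * L)%type.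
    have b12 : bounded (leg12 W : mat R (L * L * L)%type) by exact: bounded_leg12.
    have b13 : bounded (leg13 W : mat R (L * L * L)%type) by exact: bounded_leg13.
    have b23 := unitary_bounded uW23.
    by rewrite pent (opmulA b12 b13 b23) unitaryKr //; exact: bounded_mul.
  by rewrite leg23_adj blk3_mulr ?blk3_mull ?blk3_leg12 //; bb.
have mB i i' : multiplier A (blk2 W i i') by apply: mult_blk2 mW.
apply: (nrep_ext rD sc) => a /AX.
apply: (blin_eq (calg_csub hM) (blin_shom hM sD) (blin_shom hM sc)).
  by move=> _ [i [i' ->]].
by move=> _ [i [i' ->]].
Qed.

End Comultiplication.

Section Permutations.
Context {R : realType}.
Implicit Types (I J K : choiceType).

Definition rot I J K (p : K * I * J) : I * J * K := (p.1.2, p.2, p.1.1).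
Definition rotV I J K (p : I * J * K) : K * I * J := (p.2, p.1.1, p.1.2).
Lemma rotK I J K : cancel (@rot I J K) (@rotV I J K). Proof. by move=> [[? ?] ?]. Qed.
Lemma rotVK I J K : cancel (@rotV I J K) (@rot I J K). Proof. by move=> [[? ?] ?]. Qed.

Definition rev3 I J K (p : K * J * I) : I * J * K := (p.2, p.1.2, p.1.1).
Lemma rev3K I J K : cancel (@rev3 I J K) (@rev3 K J I). Proof. by move=> [[? ?] ?]. Qed.

Lemma rot_leg13 I J K (T : mat R (I * K)%type) :
  ridx (@rot I J K) (leg13 T) = leg12 (flip T).
Proof. by []. Qed.
Lemma rot_leg23 I J K (T : mat R (J * K)%type) :
  ridx (@rot I J K) (leg23 T) = leg13 (flip T).
Proof. by apply/funext=> -[[? ?] ?]; apply/funext=> -[[? ?] ?]; rewrite /ridx leg13E leg23E mulrC. Qed.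
Lemma rev3_leg12 I J K (T : mat R (I * J)%type) :
  ridx (@rev3 I J K) (leg12 T) = leg23 (flip T).
Proof. by apply/funext=> -[[? ?] ?]; apply/funext=> -[[? ?] ?]; rewrite /ridx leg12E leg23E mulrC. Qed.
Lemma rev3_leg13 I J K (T : mat R (I * K)%type) :
  ridx (@rev3 I J K) (leg13 T) = leg13 (flip T).
Proof. by []. Qed.
Lemma rev3_leg23 I J K (T : mat R (J * K)%type) :
  ridx (@rev3 I J K) (leg23 T) = leg12 (flip T).
Proof. by apply/funext=> -[[? ?] ?]; apply/funext=> -[[? ?] ?]; rewrite /ridx leg12E leg23E mulrC. Qed.
Lemma rotV_leg12 I J K (T : mat R (K * I)%type) :
  ridx (@rotV I J K) (leg12 T) = leg13 (flip T).
Proof. by []. Qed.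
Lemma rotV_leg13 I J K (T : mat R (K * J)%type) :
  ridx (@rotV I J K) (leg13 T) = leg23 (flip T).
Proof. by apply/funext=> -[[? ?] ?]; apply/funext=> -[[? ?] ?]; rewrite /ridx leg13E leg23E mulrC. Qed.

End Permutations.

Section QuantumGroup.
Context {R : realType} (G : qgroup R).
Local Notation L := (qL G).
Local Notation A := (qA G).
Local Notation Ah := (qAh G).
Local Notation W := (qW G).

Lemma nA : nalg A. Proof. exact: cstar_nalg (qA_cstar G). Qed.
Lemma nAh : nalg Ah. Proof. exact: cstar_nalg (qAh_cstar G). Qed.
Lemma uW : unitary_op W. Proof. exact: qW_unitary. Qed.
Lemma mW : multiplier (atens Ah A) W. Proof. by case: (qW_mult G). Qed.
Lemma bW : bounded W. Proof. exact: unitary_bounded uW. Qed.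

Lemma qA_blocks : A `<=` cspan [set X | exists i i', X = blk2 W i i'].
Proof.
rewrite [X in X `<=` _]qA_def; apply: cspan_min; first exact: cspan_csub.
move=> _ [w nw <-]; exact: (rslice_blocks nw (bounded_flip bW)).
Qed.

Lemma qAh_blocks : Ah `<=` cspan [set X | exists i i', X = blk W i i'].
Proof.
rewrite [X in X `<=` _]qAh_def; apply: cspan_min; first exact: cspan_csub.
move=> _ [w nw <-]; exact: (rslice_blocks nw bW).
Qed.

Lemma qD_rep : nrep A (qD G).
Proof. exact: morphism_rep nA.1 (nalg_atens nA nA) (qD_mor G). Qed.

Lemma qDh_rep : nrep Ah (qDh G).
Proof. exact: morphism_rep nAh.1 (nalg_atens nAh nAh) (qDh_mor G). Qed.

Lemma qD_conj m : multiplier A m -> qD G m = W ** mtens m mone ** opadj W.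
Proof.
apply: (comult_conj nA nAh uW mW qA_blocks (qD_mor G) _ (qW_pentagon G)).
rewrite -[RHS]/(mmul _ _) -qD_W (tmorE (nalg_nrep_id nAh) nA qD_rep mW).
by [].
Qed.

Lemma uWh : unitary_op (qWh G).
Proof. by apply: unitary_flip; apply: unitary_adj; exact: uW. Qed.

Lemma mWh : multiplier (atens A Ah) (qWh G).
Proof.
apply: (mult_flip nAh.1 nA.1); apply: mult_adj mW.
exact: star_atens nAh.1 nA.1.
Qed.

Lemma qAh_blocks_hat : Ah `<=` cspan [set X | exists i i', X = blk2 (qWh G) i i'].
Proof.
move=> a Aha; have [_ _ _ jA] := nAh.1; rewrite -[a]opadjK.
have /qAh_blocks := jA _ Aha; move: (opadj a).
apply: cspan_min => [|_ [i [i' ->]] /=]; first exact: (csub_adj (cspan_csub _)).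
by apply: sub_cspan; exists i', i.
Qed.

(** The adjoint of the defining relation of [qDh], with the last leg moved to the front. It brings
    the dual into the form required by [comult_conj]. *)
Lemma qDh_W_hat : reassoc (amq (qDh G) (qWh G)) = leg12 (qWh G) ** leg13 (qWh G) :> mat R (L * L * L)%type.
Proof.
have bWs := bounded_adj bW; have [hAh sD _] := qDh_rep.
have bl : blocks_in (multiplier Ah) W by exact: mult_blocks_nalg nAh.1 nA mW.
have E : amp (qDh G) W = leg23 W ** leg13 W :> mat R (L * L * L)%type.
  by rewrite -[RHS]/(mmul _ _) -qDh_W (tmorE qDh_rep nA (nalg_nrep_id nA) mW).
have b13 : bounded (leg13 W : mat R (L * L * L)%type) by apply: bounded_leg13; exact: bW.
have b23 : bounded (leg23 W : mat R (L * L * L)%type) by apply: bounded_leg23; exact: bW.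
have -> : reassoc (amq (qDh G) (qWh G)) = ridx (@rot L L L) (amp (qDh G) (opadj W)) by [].
rewrite (amp_adj sD bl) E opadj_mul // (ridx_mul (@rotK L L L) (@rotVK L L L)); try exact: bounded_adj.
by rewrite leg13_adj leg23_adj rot_leg13 rot_leg23.
Qed.

(** The adjoint of the pentagon equation with the three legs in reverse order. *)
Lemma pentagon_hat :
  leg23 (qWh G) ** leg12 (qWh G) = leg12 (qWh G) ** (leg13 (qWh G) ** leg23 (qWh G)) :> mat R (L * L * L)%type.
Proof.
have b12 : bounded (leg12 W : mat R (L * L * L)%type) by apply: bounded_leg12; exact: bW.
have b13 : bounded (leg13 W : mat R (L * L * L)%type) by apply: bounded_leg13; exact: bW.
have b23 : bounded (leg23 W : mat R (L * L * L)%type) by apply: bounded_leg23; exact: bW.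
have b := @bounded_adj R; have pent : leg23 W ** leg12 W = leg12 W ** (leg13 W ** leg23 W) := qW_pentagon G.
have m := ridx_mul (@rev3K L L L) (@rev3K L L L).
have := congr1 (fun X => ridx (@rev3 L L L) (opadj X)) pent.
rewrite !opadj_mul //; last exact: bounded_mul.
rewrite !m; try (by apply: b); last by apply: bounded_mul; apply: b.
rewrite !leg12_adj !leg13_adj !leg23_adj !rev3_leg12 !rev3_leg13 !rev3_leg23 -/(qWh G) => ->.
by rewrite opmulA //; have := unitary_bounded uWh; auto with bdb.
Qed.

Lemma qDh_conj m : multiplier Ah m -> qDh G m = qWh G ** mtens m mone ** opadj (qWh G).
Proof.
exact: (comult_conj nAh nA uWh mWh qAh_blocks_hat (qDh_mor G) qDh_W_hat pentagon_hat).
Qed.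

End QuantumGroup.

Section SliceMaps.
Context {R : realType}.
Implicit Types (I J K : choiceType).

Definition swp12 I J K (p : J * I * K) : I * J * K := (p.1.2, p.1.1, p.2).
Lemma swp12K I J K : cancel (@swp12 I J K) (@swp12 J I K). Proof. by move=> [[? ?] ?]. Qed.

Lemma swp12_leg12 I J K (T : mat R (I * J)%type) :
  ridx (@swp12 I J K) (leg12 T) = leg12 (flip T).
Proof. by []. Qed.
Lemma swp12_leg13 I J K (T : mat R (I * K)%type) :
  ridx (@swp12 I J K) (leg13 T) = leg23 T.
Proof. by apply/funext=> -[[? ?] ?]; apply/funext=> -[[? ?] ?]; rewrite /ridx leg13E leg23E mulrC. Qed.
Lemma swp12_leg23 I J K (T : mat R (J * K)%type) :
  ridx (@swp12 I J K) (leg23 T) = leg13 T.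
Proof. by apply/funext=> -[[? ?] ?]; apply/funext=> -[[? ?] ?]; rewrite /ridx leg13E leg23E mulrC. Qed.

Lemma blk_leg23 I J K (T : mat R (J * K)%type) k k' :
  blk (leg23 T : mat R (I * J * K)%type) k k' = mtens mone (blk T k k').
Proof. by apply/funext=> -[? ?]; apply/funext=> -[? ?]; rewrite /blk leg23E. Qed.

Lemma blk_leg13 I J K (T : mat R (I * K)%type) k k' :
  blk (leg13 T : mat R (I * J * K)%type) k k' = mtens (blk T k k') mone.
Proof. by []. Qed.

Lemma amp_amp_leg23 I I' J K (X : set (mat R I)) (f : mat R I -> mat R I')
    (T : mat R (J * K)%type) : calg X -> shom X f ->
  amp (amp f) (leg23 T : mat R (I * J * K)%type) = leg23 T.
Proof.
move=> cX sf; apply: blkP => k k'; rewrite blk_amp !blk_leg23.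
rewrite (amp_mtens cX sf _ (calg1 cX)).
by have [_ _ _ -> _] := sf.
Qed.

Lemma amp_amp_leg13 I I' J K (X : set (mat R I)) (f : mat R I -> mat R I')
    (T : mat R (I * K)%type) : calg X -> shom X f -> blocks_in X T ->
  amp (amp f) (leg13 T : mat R (I * J * K)%type) = leg13 (amp f T).
Proof.
move=> cX sf h; apply: blkP => k k'; rewrite blk_amp !blk_leg13.
by rewrite (amp_mtens cX sf _ (h _ _)).
Qed.

Lemma nrep_amp I I' J (A : set (mat R I)) (B : set (mat R J)) (f : mat R I -> mat R I') :
  nrep A f -> nalg B -> nrep (atens A B) (amp f).
Proof. by move=> rf nB; exact: (nrep_tens rf nB (nalg_nrep_id nB)). Qed.

Lemma nrep_amq I J J' (A : set (mat R I)) (B : set (mat R J)) (g : mat R J -> mat R J') :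
  nrep B g -> nalg A -> nalg B -> nrep (atens A B) (amq g).
Proof. by move=> rg nA nB; exact: (nrep_tens (nalg_nrep_id nA) nB rg). Qed.

End SliceMaps.

(** * The universal dual, for a quantum group or its dual alike *)

Section UniversalDual.
Context {R : realType} {L : choiceType} {A Ah : set (mat R L)}
  {D : mat R L -> mat R (L * L)%type} {W : mat R (L * L)%type} (u : udual A Ah D W).
Implicit Types (J : choiceType).
Hypotheses (nA : nalg A) (nAh : nalg Ah) (uW : unitary_op W) (rD : nrep A D)
  (D_conj : forall m, multiplier A m -> D m = W ** mtens m mone ** opadj W).
Local Notation P := (uA u).
Local Notation V := (uV u).
Local Notation Lam := (uLam u).
Local Notation UI := (uI u).

Lemma nP : nalg P. Proof. exact: cstar_nalg (uA_cstar u). Qed.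
Lemma uVu : unitary_op V. Proof. by have [] := uV_mult u. Qed.
Lemma mV : multiplier (atens P A) V. Proof. by have [] := uV_mult u. Qed.
Lemma rLam : nrep P Lam. Proof. exact: morphism_rep nP.1 nAh (uLam_mor u). Qed.
Lemma ruD : nrep P (uD u). Proof. exact: morphism_rep nP.1 (nalg_atens nP nP) (uD_mor u). Qed.

Lemma uD_uV : amp (uD u) V = leg23 V ** leg13 V :> mat R (UI * UI * L)%type.
Proof. by rewrite -[RHS]/(mmul _ _) -uD_V (tmorE ruD nA (nalg_nrep_id nA) mV). Qed.

Lemma uLam_uV : amp Lam V = W.
Proof. by rewrite -[RHS](uLam_V u) (tmorE rLam nA (nalg_nrep_id nA) mV). Qed.

(** The corepresentation equation of [V], with the comultiplication written as conjugation by
    [W]. *)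
Lemma uV_conj : leg12 V ** leg13 V = leg23 W ** leg12 V ** opadj (leg23 W) :> mat R (UI * L * L)%type.
Proof.
have bV := unitary_bounded uVu; have bW := unitary_bounded uW.
rewrite -[LHS]/(mmul _ _) -uV_corep (tmorE (nalg_nrep_id nP) nA rD mV).
apply: blk3P => i i'.
have b12 : bounded (leg12 V : mat R (UI * L * L)%type) by exact: bounded_leg12.
have c23 : bounded (leg23 W : mat R (UI * L * L)%type) by exact: bounded_leg23.
have bWs := bounded_adj bW; have bm := bounded_mul c23 b12.
rewrite leg23_adj blk3_mulr // blk3_mull // blk3_leg12.
rewrite blk3_reassoc -D_conj //; exact: mult_blk2 nP nA.1 mV.
Qed.

(** [uV_conj] with its first two legs exchanged and solved for $V_{23}W_{13}$, which is what the
    comultiplication of the universal dual followed by the reducing map produces from [V]. *)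
Lemma uV_conj_flip :
  leg23 V ** leg13 W = opadj (leg12 (flip V)) ** leg13 W ** leg12 (flip V) :> mat R (L * UI * L)%type.
Proof.
have bV := unitary_bounded uVu; have bW := unitary_bounded uW.
have uF : unitary_op (leg12 (flip V) : mat R (L * UI * L)%type).
  by apply: unitary_leg12; apply: unitary_flip; exact: uVu.
have u13 : unitary_op (leg13 W : mat R (L * UI * L)%type) by exact: unitary_leg13.
have bF := unitary_bounded uF; have b13 := unitary_bounded u13.
have m := ridx_mul (@swp12K UI L L) (@swp12K L UI L).
have := congr1 (fun X => ridx (@swp12 UI L L) X) uV_conj.
have b12 : bounded (leg12 V : mat R (UI * L * L)%type) by exact: bounded_leg12.
have c13 : bounded (leg13 V : mat R (UI * L * L)%type) by exact: bounded_leg13.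
have c23 : bounded (leg23 W : mat R (UI * L * L)%type) by exact: bounded_leg23.
have d23 : bounded (leg23 V : mat R (L * UI * L)%type) by exact: bounded_leg23.
have e := bounded_adj c23; have e' := bounded_adj b13; have f' := bounded_adj bF.
rewrite !m //; last exact: bounded_mul.
rewrite ridx_adj swp12_leg12 swp12_leg13 swp12_leg23 => E.
transitivity (opadj (leg12 (flip V)) ** (leg12 (flip V) ** leg23 V) ** leg13 W : mat R (L * UI * L)%type).
  by rewrite unitaryKl.
have bSF := bounded_mul b13 bF.
by rewrite E -(opmulA f' (bounded_mul bSF e') b13) unitaryKVr // (opmulA f' b13 bF).
Qed.

Lemma amp_Lam_comult J (E : set (mat R J)) (Y : mat R (UI * J)%type) : nalg E ->
  multiplier (atens P E) Y -> amp (uD u) Y = leg23 Y ** leg13 Y ->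
  amp (fun m => amp Lam (uD u m)) Y = leg23 Y ** leg13 (amp Lam Y) :> mat R (L * UI * J)%type.
Proof.
move=> nE mY EY; have [hP sL _] := rLam; have nP := nP.
have -> : amp (fun m => amp Lam (uD u m)) Y = amp (amp Lam) (amp (uD u) Y) by [].
have rL := nrep_amp (B := P) rLam nP; have [hPP _ _] := rL.
have [_ sM _ _ _] := amp_shom rL J.
rewrite EY sM.
- rewrite (amp_amp_leg23 _ (calg_mult hP) sL) (amp_amp_leg13 _ (calg_mult hP) sL) //.
  exact: mult_blocks_nalg nP.1 nE mY.
- by apply: (mult_atensK hPP nE); apply: mult_leg23 mY => //; exact: nE.1.
- by apply: (mult_atensK hPP nE); apply: mult_leg13 mY => //; exact: nE.1.
Qed.

Lemma amp_conj_flip J (Y : mat R (UI * J)%type) : bounded (amp Lam Y) ->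
  amp (fun m => opadj (flip V) ** mtens (Lam m) mone ** flip V) Y =
  opadj (leg12 (flip V)) ** leg13 (amp Lam Y) ** leg12 (flip V) :> mat R (L * UI * J)%type.
Proof.
move=> bY; have bV := bounded_flip (unitary_bounded uVu); have bV' := bounded_adj bV.
have b13 : bounded (leg13 (amp Lam Y) : mat R (L * UI * J)%type) by exact: bounded_leg13.
have b12 : bounded (leg12 (opadj (flip V)) : mat R (L * UI * J)%type) by exact: bounded_leg12.
apply: blkP => k k'; rewrite blk_amp leg12_adj blk_mul1r ?blk_mul1l //.
exact: bounded_mul.
Qed.

(** Both sides are *-homomorphisms, and they are compared on the entries of [V] in its second leg,
    whose closed span contains the algebra. There the claim is [uV_conj_flip] read entrywise. *)
Lemma uD_conj m : multiplier P m ->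
  amp Lam (uD u m) = opadj (flip V) ** mtens (Lam m) mone ** flip V.
Proof.
have nP := nP; have rL := nrep_amp (B := P) rLam nP; have [hP sL _] := rLam.
have rd := nrep_comp nP.1 (uD_mor u) rL; have [_ sd _] := rd.
have uF := unitary_adj (unitary_flip uVu); have cM := calg_mult hP.
have sc : shom (multiplier P) (fun m => opadj (flip V) ** mtens (Lam m) mone ** flip V).
  have [h1 h2 h3 h4 h5] := shom_conj uF; rewrite opadjK in h1 h2 h3 h4 h5.
  have [l1 l2 l3 l4 l5] := sL; have b1 := bounded_one (R := R) UI.
  have bm x : multiplier P x -> bounded (mtens (Lam x) (mone : mat R UI)).
    by move=> /l5; exact: bounded_mtens1.
  split.
  - by move=> c a b ha hb; rewrite l1 // mtens_linl h1 //; exact: bm.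
  - move=> a b ha hb; have ba := l5 _ ha; have bb' := l5 _ hb.
    by rewrite l2 // -h2 ?mtens_mul ?opmul1l //; exact: bm.
  - by move=> a ha; rewrite -h3 ?mtens_adj ?opadj1 ?l3 //; exact: bm.
  - by rewrite l4 mtens_one h4.
  - by move=> a ha; apply: h5; exact: bm.
have E j j' : amp Lam (uD u (blk V j j')) =
    opadj (flip V) ** mtens (Lam (blk V j j')) mone ** flip V.
  have bA : bounded (amp Lam V) by rewrite uLam_uV; exact: unitary_bounded uW.
  have := amp_conj_flip bA; rewrite uLam_uV -uV_conj_flip => Ec.
  have := amp_Lam_comult nA mV uD_uV; rewrite uLam_uV -Ec.
  exact: (congr1 (fun X => blk X j j')).
have mB j j' : multiplier P (blk V j j') by exact: (mult_blocks_nalg nP.1 nA mV).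
move: m; apply: (nrep_ext rd sc) => a.
have -> : P = cspan [set rslice w V | w in @normal_functional R L] by exact: uA_span.
move=> Pa; have {Pa} : cspan [set X | exists j j', X = blk V j j'] a.
  move: a Pa; apply: cspan_min; first exact: cspan_csub.
  by move=> _ [w nw <-]; exact: rslice_blocks nw (unitary_bounded uVu).
move: a; apply: (blin_eq (calg_csub cM) (blin_shom cM sd) (blin_shom cM sc)).
  by move=> _ [j [j' ->]].
by move=> _ [j [j' ->]].
Qed.

(** [uD_conj] applied to all entries of a unitary or multiplier [Y] with the character property in
    its first leg. It is used for the lifted bicharacter [Wu] and, over the dual, for the flipped
    adjoint of [Wu]. *)
Lemma comult_uV_conj J (E : set (mat R J)) (Y : mat R (UI * J)%type) : nalg E ->
  multiplier (atens P E) Y -> amp (uD u) Y = leg23 Y ** leg13 Y ->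
  leg23 Y ** leg13 (amp Lam Y) =
  opadj (leg12 (flip V)) ** leg13 (amp Lam Y) ** leg12 (flip V) :> mat R (L * UI * J)%type.
Proof.
move=> nE mY EY; rewrite -(amp_Lam_comult nE mY EY) -amp_conj_flip.
  by apply: blkP => j j'; rewrite !blk_amp uD_conj //; exact: (mult_blocks_nalg nP.1 nE mY).
have [hP sL _] := rLam; apply: (amp_bounded (calg_mult hP) sL); last exact: mult_bounded mY.
exact: mult_blocks_nalg nP.1 nE mY.
Qed.

End UniversalDual.

Section LegMaps.
Context {R : realType}.
Implicit Types (I J K : choiceType).

Lemma atens_compacts I J : atens (compacts R I) (compacts R J) = compacts R (I * J)%type.
Proof.
apply/seteqP; split.
  by apply: atens_min => [|a b]; [exact: csub_compacts|exact: compacts_mtens].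
apply: compacts_min => [|[i j] [k l]]; first exact: csub_atens.
by rewrite -dlt_mtens; apply: sub_atens; exact: compacts_dlt.
Qed.

Lemma mult_atens_compacts I J (T : mat R (I * J)%type) : bounded T ->
  multiplier (atens (compacts R I) (compacts R J)) T.
Proof. by rewrite atens_compacts => /multKP. Qed.

Section Third.
Context {J J' : choiceType} {B : set (mat R J)} {g : mat R J -> mat R J'}.
Hypothesis rg : nrep B g.

Let hB : star_alg B. Proof. by case: rg. Qed.
Let sg : shom (multiplier B) g. Proof. by case: rg. Qed.
Let cB := calg_mult hB.

Let scaleE c m : multiplier B m -> g (opscale c m) = opscale c (g m).
Proof. exact: (shomZ cB sg). Qed.

Let scale1E c : g (opscale c mone) = opscale c mone.
Proof. by rewrite scaleE; [have [_ _ _ -> _] := sg|exact: mult1]. Qed.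

Lemma amq_leg12 I K (T : mat R (I * K)%type) : amq g (leg12 T) = leg12 T.
Proof.
apply/funext=> -[[i k] j]; apply/funext=> -[[i' k'] j']; rewrite /amq /=.
by rewrite [blk2 _ _ _](_ : _ = opscale (T (i, k) (i', k')) mone) // scale1E.
Qed.

Lemma amq_leg13 I K (T : mat R (I * J)%type) : (forall i i', multiplier B (blk2 T i i')) ->
  amq g (leg13 T : mat R (I * K * J)%type) = leg13 (amq g T).
Proof.
move=> h; apply/funext=> -[[i k] j]; apply/funext=> -[[i' k'] j']; rewrite /amq /=.
rewrite [blk2 _ _ _](_ : _ = opscale (k == k')%:R (blk2 T i i')).
  by rewrite scaleE // leg13E mulrC.
by apply/funext=> x; apply/funext=> y; rewrite /blk2 leg13E /= mulrC.
Qed.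

Lemma amq_leg23 I K (T : mat R (K * J)%type) : (forall i i', multiplier B (blk2 T i i')) ->
  amq g (leg23 T : mat R (I * K * J)%type) = leg23 (amq g T).
Proof.
move=> h; apply/funext=> -[[i k] j]; apply/funext=> -[[i' k'] j']; rewrite /amq /=.
rewrite [blk2 _ _ _](_ : _ = opscale (i == i')%:R (blk2 T k k')).
  by rewrite scaleE // leg23E.
by apply/funext=> x; apply/funext=> y; rewrite /blk2 leg23E.
Qed.

Lemma amp_amq_leg12 I K (T : mat R (I * J)%type) : (forall i i', multiplier B (blk2 T i i')) ->
  amp (amq g) (leg12 T : mat R (I * J * K)%type) = leg12 (amq g T).
Proof.
move=> h; apply/funext=> -[[i j] k]; apply/funext=> -[[i' j'] k']; rewrite /amp /amq /=.
rewrite [blk2 _ _ _](_ : _ = opscale (k == k')%:R (blk2 T i i')).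
  by rewrite scaleE // leg12E mulrC.
by apply/funext=> x; apply/funext=> y; rewrite /blk2 /blk leg12E /= mulrC.
Qed.

Lemma amp_amq_leg13 I K (T : mat R (I * K)%type) :
  amp (amq g) (leg13 T : mat R (I * J * K)%type) = leg13 T.
Proof.
apply/funext=> -[[i j] k]; apply/funext=> -[[i' j'] k']; rewrite /amp /amq /=.
rewrite [blk2 _ _ _](_ : _ = opscale (T (i, k) (i', k')) mone) ?scale1E ?leg13E //.
Qed.

Lemma amp_amq_leg23 I K (T : mat R (J * K)%type) : blocks_in (multiplier B) T ->
  amp (amq g) (leg23 T : mat R (I * J * K)%type) = leg23 (amp g T).
Proof.
move=> h; apply/funext=> -[[i j] k]; apply/funext=> -[[i' j'] k']; rewrite /amp /amq /=.
rewrite [blk2 _ _ _](_ : _ = opscale (i == i')%:R (blk T k k')).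
  by rewrite scaleE // leg23E.
by apply/funext=> x; apply/funext=> y; rewrite /blk2 /blk leg23E.
Qed.

End Third.

Lemma mult_Kleg12 I K J (B : set (mat R J)) (T : mat R (I * K)%type) : star_alg B -> bounded T ->
  multiplier (atens (compacts R (I * K)%type) B) (leg12 T).
Proof.
by move=> hB bT; apply: mult_mtens; [exact: star_compacts| |exact/multKP|exact: mult1].
Qed.

Lemma mult_Kleg13 I K J (B : set (mat R J)) (T : mat R (I * J)%type) : star_alg B ->
  multiplier (atens (compacts R I) B) T -> multiplier (atens (compacts R (I * K)%type) B) (leg13 T).
Proof. by move=> hB hT; rewrite -atens_compacts; apply: mult_leg13; rewrite //; exact: star_compacts. Qed.

Lemma mult_Kleg23 I K J (B : set (mat R J)) (T : mat R (K * J)%type) : star_alg B ->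
  multiplier (atens (compacts R K) B) T -> multiplier (atens (compacts R (I * K)%type) B) (leg23 T).
Proof. by move=> hB hT; rewrite -atens_compacts; apply: mult_leg23; rewrite //; exact: star_compacts. Qed.

End LegMaps.

Section Universal.
Context {R : realType} {G : qgroup R} (w : universal G).
Local Notation L := (qL G).
Local Notation A := (qA G).
Local Notation Ah := (qAh G).
Local Notation W := (qW G).
Local Notation P := (uA (ud w)).
Local Notation Q := (uA (udh w)).
Local Notation PI := (uI (ud w)).
Local Notation QI := (uI (udh w)).
Local Notation V := (uV (ud w)).
Local Notation Vh := (uV (udh w)).

Let nA := nA G.
Let nAh := nAh G.
Lemma nalg_ud : nalg P. Proof. exact: nP. Qed.
Lemma nalg_udh : nalg Q. Proof. exact: nP. Qed.
Lemma uWu : unitary_op (Wu w). Proof. by have [] := Wu_mult w. Qed.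
Lemma mWu : multiplier (atens P Q) (Wu w). Proof. by have [] := Wu_mult w. Qed.

Lemma uD_Wu : amp (uD (ud w)) (Wu w) = leg23 (Wu w) ** leg13 (Wu w) :> mat R (PI * PI * QI)%type.
Proof.
rewrite -[RHS]/(mmul _ _) -Wu_l (tmorE (ruD _) nalg_udh (nalg_nrep_id nalg_udh) mWu) //.
Qed.

(** The character property of [Wu] in its second leg, after an adjoint and a rotation of legs: over
    the dual, the flipped adjoint of [Wu] plays the part of [Wu]. *)
Lemma uDh_Wu : amp (uD (udh w)) (flip (opadj (Wu w))) =
  leg23 (flip (opadj (Wu w))) ** leg13 (flip (opadj (Wu w))) :> mat R (QI * QI * PI)%type.
Proof.
have bWu := unitary_bounded uWu; have rD : nrep Q (uD (udh w)) by exact: ruD.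
have [_ sD _] := rD.
have bl : blocks_in (multiplier Q) (flip (Wu w)).
  exact: mult_blocks_nalg nalg_udh.1 nalg_ud (mult_flip nalg_ud.1 nalg_udh.1 mWu).
have E : reassoc (amq (uD (udh w)) (Wu w)) = leg12 (Wu w) ** leg13 (Wu w) :> mat R (PI * QI * QI)%type.
  by rewrite -[RHS]/(mmul _ _) -Wu_r (tmorE (nalg_nrep_id nalg_ud) nalg_udh rD mWu).
have b12 : bounded (leg12 (Wu w) : mat R (PI * QI * QI)%type) by exact: bounded_leg12.
have b13 : bounded (leg13 (Wu w) : mat R (PI * QI * QI)%type) by exact: bounded_leg13.
rewrite flip_adj (amp_adj sD bl).
have -> : amp (uD (udh w)) (flip (Wu w)) = ridx (@rotV QI QI PI) (reassoc (amq (uD (udh w)) (Wu w))).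
  by apply/funext=> -[[? ?] ?]; apply/funext=> -[[? ?] ?].
have c13 : bounded (leg13 (flip (Wu w)) : mat R (QI * QI * PI)%type) by apply: bounded_leg13; exact: bounded_flip.
have c23 : bounded (leg23 (flip (Wu w)) : mat R (QI * QI * PI)%type) by apply: bounded_leg23; exact: bounded_flip.
rewrite E (ridx_mul (@rotVK QI QI PI) (@rotK QI QI PI)) // rotV_leg12 rotV_leg13 opadj_mul //.
by rewrite leg13_adj leg23_adj.
Qed.

(** Write $X$ for the left-hand side. Reducing the last leg of [comult_uV_conj] for [Wu] gives
    $X_{23}W_{13}$ on the left and, on the right, the conjugate of $W_{13}$ that [uV_conj_flip]
    identifies with $V_{23}W_{13}$; then $W_{13}$ cancels. *)
Lemma uLamh_Wu : amq (uLam (udh w)) (Wu w) = V.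
Proof.
have rL : nrep P (uLam (ud w)) by exact: rLam.
have rLh : nrep Q (uLam (udh w)) by exact: rLam.
have [hQ sLh _] := rLh; have nP := nalg_ud; have nQ := nalg_udh.
pose Y := amp (uLam (ud w)) (Wu w).
have mY : multiplier (atens (compacts R L) Q) Y by exact: (amp_mult rL nQ mWu).
have mWK : multiplier (atens (compacts R PI) Q) (Wu w) by exact: mult_Katens nP hQ mWu.
have EY : amq (uLam (udh w)) Y = W by rewrite -[RHS](Wu_lift w) (tmorE rL nQ rLh mWu).
have [_ sM _ _ _] := amq_shom (L * PI)%type rLh.
have m23 : multiplier (atens (compacts R (L * PI)%type) Q) (leg23 (Wu w)) by exact: mult_Kleg23.
have m13 : multiplier (atens (compacts R (L * PI)%type) Q) (leg13 Y) by exact: mult_Kleg13.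
have bV : bounded (flip V) by apply: bounded_flip; apply: unitary_bounded; exact: uVu.
have m12 : multiplier (atens (compacts R (L * PI)%type) Q) (leg12 (flip V)) by exact: mult_Kleg12.
have m12' : multiplier (atens (compacts R (L * PI)%type) Q) (opadj (leg12 (flip V))).
  by rewrite leg12_adj; apply: mult_Kleg12 => //; exact: bounded_adj.
have hT : star_alg (atens (compacts R (L * PI)%type) Q) by apply: star_atens => //; exact: star_compacts.
have cM := calg_mult hT.
have := congr1 (amq (uLam (udh w)))
  (comult_uV_conj nA nAh (uW G) (qD_rep G) (@qD_conj R G) nQ mWu uD_Wu).
rewrite -/Y (sM _ _ m23 m13) (sM _ _ (calg_mul cM m12' m13) m12) (sM _ _ m12' m13).
have b2 i i' : multiplier Q (blk2 (Wu w) i i') by exact: mult_blk2 nP hQ mWu.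
have b2' i i' : multiplier Q (blk2 Y i i') by exact: (mult_blk2 _ _ (@nalg_compacts R L) hQ mY).
rewrite leg12_adj !(amq_leg12 rLh) (amq_leg13 rLh _ b2') (amq_leg23 rLh _ b2) EY.
rewrite -leg12_adj -(uV_conj_flip _ nA (uW G) (qD_rep G) (@qD_conj R G)) => E.
have uW13 : unitary_op (leg13 W : mat R (L * PI * L)%type) by apply: unitary_leg13; exact: uW.
have bV23 : bounded (leg23 V : mat R (L * PI * L)%type).
  by apply: bounded_leg23; apply: unitary_bounded; exact: uVu.
have bX : bounded (amq (uLam (udh w)) (Wu w)).
  by have [_ _ _ _ h] := amq_shom PI rLh; exact: h.
have := congr1 (fun X => X ** opadj (leg13 W)) E; rewrite !unitaryKr //; last exact: bounded_leg23.
move=> E'; apply/funext=> -[i j]; apply/funext=> -[i' j'].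
(* The first leg is also indexed by [L], so [j] serves as its diagonal index. *)
have := congr1 (fun X => X (j, i, j) (j, i', j')) E'.
by rewrite !leg23E eqxx !mul1r.
Qed.

End Universal.

(** * The exchange relation between [Z] and the two corepresentations *)

Section Braid.
Context {R : realType} {G : qgroup R} (w : universal G).
Local Notation L := (qL G).
Local Notation A := (qA G).
Local Notation Ah := (qAh G).
Local Notation P := (uA (ud w)).
Local Notation Q := (uA (udh w)).
Local Notation PI := (uI (ud w)).
Local Notation QI := (uI (udh w)).
Local Notation V := (uV (ud w)).
Local Notation Vh := (uV (udh w)).

Let nP := nalg_ud w.
Let nQ := nalg_udh w.
Let Y : mat R (QI * PI)%type := flip (opadj (Wu w)).

Let mYW : multiplier (atens Q P) Y.
Proof. by apply: (mult_flip nP.1 nQ.1); apply: mult_adj (mWu w); exact: star_atens nP.1 nQ.1. Qed.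

Lemma uLamh_Wu_adj : amp (uLam (udh w)) Y = flip (opadj V).
Proof.
have rLh : nrep Q (uLam (udh w)) by exact: rLam (nA G).
have [hQ sLh _] := rLh; rewrite /Y flip_adj (amp_adj sLh) -?uLamh_Wu //.
exact: mult_blocks_nalg nQ.1 nP (mult_flip nP.1 nQ.1 (mWu w)).
Qed.

(** [comult_uV_conj] over the dual for [Y], whose reduction in the first leg is known from
    [uLamh_Wu]. *)
Lemma Wu_uV_conj : leg23 Y ** leg13 (flip (opadj V)) =
  opadj (leg12 (flip Vh)) ** leg13 (flip (opadj V)) ** leg12 (flip Vh) :> mat R (L * QI * PI)%type.
Proof.
rewrite -uLamh_Wu_adj.
exact: (comult_uV_conj (nAh G) (nA G) (uWh G) (qDh_rep G) (@qDh_conj R G) nP mYW (uDh_Wu w)).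
Qed.

Context {H K : choiceType} {r : mat R PI -> mat R H} {s : mat R QI -> mat R K}.
Hypotheses (rr : nrep P r) (rs : nrep Q s).
Local Notation U := (amp r V).
Local Notation U' := (amp s Vh).
Local Notation Z := (opadj (amq s (amp r (Wu w)))).

Let mVf : multiplier (atens A P) (flip (opadj V)).
Proof.
apply: (mult_flip nP.1 (nA G).1); apply: mult_adj; first exact: star_atens nP.1 (nA G).1.
exact: mV.
Qed.

Let amq_Vf : amq r (flip (opadj V)) = flip (opadj U).
Proof.
have [hP sr _] := rr; rewrite amqE flipK (amp_adj sr) //.
exact: mult_blocks_nalg nP.1 (nA G) (mV _).
Qed.

Let amq_Y : amq r Y = flip (opadj (amp r (Wu w))).
Proof.
have [hP sr _] := rr; rewrite amqE flipK (amp_adj sr) //.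
exact: mult_blocks_nalg nP.1 nQ (mWu w).
Qed.

Let bVh : bounded (flip Vh).
Proof. by apply: bounded_flip; apply: unitary_bounded; exact: uVu. Qed.

(** The representations are inserted one leg at a time, [r] in the third leg here and [s] in the
    second leg in [Z_conj_flip]; each time the factors must first be seen to be multipliers for that
    leg. *)
Lemma Wu_rep_conj : leg23 (flip (opadj (amp r (Wu w)))) ** leg13 (flip (opadj U)) =
  opadj (leg12 (flip Vh)) ** leg13 (flip (opadj U)) ** leg12 (flip Vh) :> mat R (L * QI * H)%type.
Proof.
have [hP sr _] := rr; have [_ sM _ _ _] := amq_shom (L * QI)%type rr.
have mYK : multiplier (atens (compacts R QI) P) Y by exact: mult_Katens nQ hP mYW.
have mVK : multiplier (atens (compacts R L) P) (flip (opadj V)) by exact: mult_Katens (nA G) hP mVf.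
have m23 : multiplier (atens (compacts R (L * QI)%type) P) (leg23 Y) by exact: mult_Kleg23.
have m13 : multiplier (atens (compacts R (L * QI)%type) P) (leg13 (flip (opadj V))) by exact: mult_Kleg13.
have m12 : multiplier (atens (compacts R (L * QI)%type) P) (leg12 (flip Vh)) by exact: mult_Kleg12.
have m12' : multiplier (atens (compacts R (L * QI)%type) P) (opadj (leg12 (flip Vh))).
  by rewrite leg12_adj; apply: mult_Kleg12 => //; exact: bounded_adj.
have hT : star_alg (atens (compacts R (L * QI)%type) P) by exact: star_atens (@star_compacts _ _) hP.
have cM := calg_mult hT.
have := congr1 (amq r) Wu_uV_conj.
rewrite (sM _ _ m23 m13) (sM _ _ (calg_mul cM m12' m13) m12) (sM _ _ m12' m13).
have b2 i i' : multiplier P (blk2 Y i i') by exact: mult_blk2 nQ hP mYW.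
have b2' i i' : multiplier P (blk2 (flip (opadj V)) i i') by exact: mult_blk2 (nA G) hP mVf.
rewrite leg12_adj !(amq_leg12 rr) (amq_leg13 rr _ b2') (amq_leg23 rr _ b2) amq_Y amq_Vf.
by rewrite -leg12_adj.
Qed.

Let mT : multiplier (atens Q (compacts R H)) (flip (opadj (amp r (Wu w)))).
Proof.
have hK := star_atens (@star_compacts R H) nQ.1.
apply: mult_flip nQ.1 _; first exact: star_compacts.
apply: mult_adj hK _; exact: (amp_mult rr nQ (mWu w)).
Qed.

Let bU : bounded U.
Proof.
by have [hP sr _] := rr; apply: (amp_bounded (calg_mult hP) sr);
  [exact: mult_blocks_nalg nP.1 (nA G) (mV _)|apply: unitary_bounded; exact: uVu].
Qed.

Let amp_T : amp s (flip (opadj (amp r (Wu w)))) = flip Z.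
Proof.
have [hQ ss _] := rs; have mrW := amp_mult rr nQ (mWu w).
rewrite flip_adj (amp_adj ss) ?[amq _ _]amqE //.
exact: (mult_blocks_nalg hQ (@nalg_compacts R H) (mult_flip (@star_compacts R H) hQ mrW)).
Qed.

Lemma Z_conj_flip : leg23 (flip Z) ** leg13 (flip (opadj U)) =
  opadj (leg12 (flip U')) ** leg13 (flip (opadj U)) ** leg12 (flip U') :> mat R (L * K * H)%type.
Proof.
have [hQ ss _] := rs; have nK := @nalg_compacts R.
have rq := nrep_amq rs (nK L) nQ; have [hKQ _ _] := rq.
have [_ sM _ _ _] := amp_shom rq H.
pose M := multiplier (atens (atens (compacts R L) Q) (compacts R H)).
have m23 : M (leg23 (flip (opadj (amp r (Wu w))))) by apply: mult_leg23 => //; exact: star_compacts.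
have m13 : M (leg13 (flip (opadj U))).
  apply: mult_leg13 => //; try exact: star_compacts.
  by apply: mult_atens_compacts; apply: bounded_flip; exact: bounded_adj.
have mVh : multiplier (atens Ah Q) (flip Vh) by apply: (mult_flip nQ.1 (nAh G).1); exact: mV.
have mVK : multiplier (atens (compacts R L) Q) (flip Vh) by exact: mult_Katens (nAh G) hQ mVh.
have m12 : M (leg12 (flip Vh)) by apply: mult_leg12 => //; exact: star_compacts.
have hT : star_alg (atens (atens (compacts R L) Q) (compacts R H)).
  by apply: star_atens => //; exact: star_compacts.
have cM := calg_mult hT; have m12' := calg_adj cM m12.
have := congr1 (amp (amq s)) Wu_rep_conj.
rewrite (sM _ _ m23 m13) (sM _ _ (calg_mul cM m12' m13) m12) (sM _ _ m12' m13).
have mVk : multiplier (atens (compacts R L) Q) (opadj (flip Vh)).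
  by apply: mult_adj mVK; exact: hKQ.
have b2 i i' : multiplier Q (blk2 (flip Vh) i i') by exact: mult_blk2 (nK L) hQ mVK.
have b2' i i' : multiplier Q (blk2 (opadj (flip Vh)) i i') by exact: mult_blk2 (nK L) hQ mVk.
rewrite !leg12_adj (amp_amq_leg12 rs _ b2) (amp_amq_leg12 rs _ b2') (amp_amq_leg13 rs) (amp_amq_leg23 rs) ?amp_T.
  have -> : amq s (opadj (flip Vh)) = opadj (flip U'); last by [].
  rewrite -flip_adj amqE flipK (amp_adj ss) //.
exact: (mult_blocks_nalg hQ (nK H) mT).
Qed.

(** With the legs reversed, [Z_conj_flip] says that $Z_{12}$ is the group commutator
    $U'^*_{23}U_{13}^*U'_{23}U_{13}$, where $U'$ comes from the dual; the unitaries then cancel. *)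
Lemma Z_exchange : leg13 U ** leg23 U' ** leg12 Z = leg23 U' ** leg13 U :> mat R (H * K * L)%type.
Proof.
have [hP sr _] := rr; have [hQ ss _] := rs.
have uU : unitary_op U.
  have := uV_mult (ud w); case=> _ /unitaryP[bV V1 V2]; apply/unitaryP.
  have [_ sM sJ s1 _] := amp_shom rr L; have mV' := mult_atensK hP (nA G) (mV (ud w)).
  have cM := calg_mult (star_atens hP (@star_compacts R L)); have mVs := calg_adj cM mV'.
  by rewrite -sJ // -!sM // V1 V2 s1; split.
have uU' : unitary_op U'.
  have := uV_mult (udh w); case=> _ /unitaryP[bV V1 V2]; apply/unitaryP.
  have [_ sM sJ s1 b] := amp_shom rs L; have mV' := mult_atensK hQ (nAh G) (mV (udh w)).
  have cM := calg_mult (star_atens hQ (@star_compacts R L)); have mVs := calg_adj cM mV'.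
  by rewrite -sJ // -!sM // V1 V2 s1; split=> //; exact: b.
have u23 : unitary_op (leg23 U' : mat R (H * K * L)%type) by exact: unitary_leg23.
have u13 : unitary_op (leg13 U : mat R (H * K * L)%type) by exact: unitary_leg13.
have b23 := unitary_bounded u23; have b13 := unitary_bounded u13.
have b13' := bounded_adj b13; have b23' := bounded_adj b23.
have bZ : bounded Z.
  apply: bounded_adj; have [_ _ _ _ h] := amq_shom H rs; apply: h.
  exact: (amp_mult rr nQ (mWu w)).
have bZ12 : bounded (leg12 Z : mat R (H * K * L)%type) by exact: bounded_leg12.
have bU'' := unitary_bounded uU'.
have m (S T : mat R (L * K * H)%type) : bounded S -> bounded T ->
    ridx (@rev3 L K H) (S ** T) = ridx (@rev3 L K H) S ** ridx (@rev3 L K H) T.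
  exact: (ridx_mul (@rev3K L K H) (@rev3K H K L)).
have := congr1 (fun X => ridx (@rev3 L K H) X) Z_conj_flip.
have c12 : bounded (leg12 (flip U') : mat R (L * K * H)%type) by apply: bounded_leg12; exact: bounded_flip.
have c13 : bounded (leg13 (flip (opadj U)) : mat R (L * K * H)%type).
  by apply: bounded_leg13; apply: bounded_flip; exact: bounded_adj.
have c23 : bounded (leg23 (flip Z) : mat R (L * K * H)%type) by apply: bounded_leg23; exact: bounded_flip.
have c12' := bounded_adj c12.
rewrite (m _ _ c23 c13) (m _ _ (bounded_mul c12' c13) c12) (m _ _ c12' c13).
rewrite ridx_adj rev3_leg12 rev3_leg13 rev3_leg23 !flipK -leg13_adj => E.
have {}E : leg12 Z = opadj (leg23 U') ** opadj (leg13 U) ** leg23 U' ** leg13 U :> mat R (H * K * L)%type.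
  by have := congr1 (fun X => X ** leg13 U) E; rewrite unitaryKVr.
have uX := unitary_mul u13 u23; have bX' := bounded_adj (unitary_bounded uX).
by rewrite E -opadj_mul // -(opmulA bX' b23 b13) unitaryKVl //; exact: bounded_mul.
Qed.

End Braid.

(** * The Heisenberg form of the twisted tensor product *)

Section Heisenberg.
Context {R : realType}.
Implicit Types (I J K L : choiceType).

Lemma leg12_tens1 I J K (a : mat R I) :
  leg12 (mtens a mone) = leg13 (mtens a mone) :> mat R (I * J * K)%type.
Proof.
apply/funext=> -[[i j] k]; apply/funext=> -[[i' j'] k'].
by rewrite leg12E leg13E /mtens /mone /=; ring.
Qed.

Lemma leg12_tens1l I J K (b : mat R J) :
  leg12 (mtens mone b) = leg23 (mtens b mone) :> mat R (I * J * K)%type.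
Proof.
apply/funext=> -[[i j] k]; apply/funext=> -[[i' j'] k'].
by rewrite leg12E leg23E /mtens /mone /=; ring.
Qed.

Lemma leg23_comm I J K (V : mat R (J * K)%type) (a : mat R I) : bounded V -> bounded a ->
  leg23 V ** leg12 (mtens a mone) = leg12 (mtens a mone) ** leg23 V :> mat R (I * J * K)%type.
Proof.
move=> bV ba; have b1 := @bounded_one R.
have -> : leg12 (mtens a mone) = reassoc (mtens a mone) :> mat R (I * J * K)%type.
  rewrite -mtens_one reassoc_mtens //.
have bm : bounded (mtens a (mone : mat R (J * K)%type)) by exact: bounded_mtens1.
have bv : bounded (mtens (mone : mat R I) V) by exact: bounded_mtens1l.
by rewrite /leg23 -!reassoc_mul // !mtens_mul // !opmul1l // !opmul1r.
Qed.

Lemma leg13_comm I J K (U : mat R (I * K)%type) (b : mat R J) : bounded U -> bounded b ->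
  leg13 U ** leg12 (mtens mone b) = leg12 (mtens mone b) ** leg13 U :> mat R (I * J * K)%type.
Proof.
move=> bU bb'; have b1 := @bounded_one R.
have -> : leg12 (mtens mone b) = flip23 (mtens mone b) :> mat R (I * J * K)%type.
  by rewrite -mtens_one flip23_mtens.
have bm : bounded (mtens (mone : mat R (I * K)%type) b) by exact: bounded_mtens1l.
have bv : bounded (mtens U (mone : mat R J)) by exact: bounded_mtens1.
by rewrite /leg13 -!flip23_mul // !mtens_mul // !opmul1l // !opmul1r.
Qed.

Lemma unitary_conj_id I (u t : mat R I) : unitary_op u -> bounded t -> u ** t = t ** u ->
  u ** t ** opadj u = t.
Proof. by move=> uu bt ->; rewrite unitaryKr. Qed.

Lemma conj_comp I (u v t : mat R I) : bounded u -> bounded v -> bounded t ->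
  (u ** v) ** t ** opadj (u ** v) = u ** (v ** t ** opadj v) ** opadj u.
Proof.
move=> bu bv bt.
have bu' := bounded_adj bu; have bv' := bounded_adj bv; have bvt := bounded_mul bv bt.
rewrite opadj_mul // -(opmulA bu bv bt) (opmulA (bounded_mul bu bvt) bv' bu').
by rewrite (opmulA bu bvt bv').
Qed.

Lemma conj_inj I (u s t : mat R I) : unitary_op u -> bounded s -> bounded t ->
  u ** s ** opadj u = u ** t ** opadj u -> s = t.
Proof.
move=> uu bs bt E; have bu := unitary_bounded uu; have bu' := bounded_adj bu.
have H x : bounded x -> opadj u ** (u ** x ** opadj u) ** u = x.
  by move=> bx; rewrite -(opmulA bu bx bu') unitaryKl ?unitaryKVr //; exact: bounded_mul.
by rewrite -(H s bs) E H.
Qed.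

Lemma shom_conj_tens1 I J L (X : set (mat R I)) (f : mat R I -> mat R J)
    (u : mat R (J * L)%type) : unitary_op u -> shom X f ->
  shom X (fun x => u ** mtens (f x) mone ** opadj u).
Proof.
move=> uu sf; have [h1 h2 h3 h4 h5] := shom_conj uu; have [l1 l2 l3 l4 l5] := sf.
have b1 := @bounded_one R L; have bm e : X e -> bounded (mtens (f e) (mone : mat R L)).
  by move=> /l5; exact: bounded_mtens1.
split.
- move=> c a b ha hb; rewrite l1; [|exact: ha|exact: hb].
  by rewrite mtens_linl h1; [|exact: bm|exact: bm].
- move=> a b ha hb; have ba := l5 _ ha; have bb' := l5 _ hb.
  rewrite l2; [|exact: ha|exact: hb].
  rewrite -h2; [|exact: bm|exact: bm].
  by rewrite mtens_mul // opmul1l.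
- move=> a ha; rewrite -h3; last exact: bm.
  by rewrite l3 ?mtens_adj ?opadj1.
- by rewrite l4 mtens_one h4.
- by move=> a ha; apply: h5; exact: bm.
Qed.

Lemma conj_tens1_inj J L (l : L) (u : mat R (J * L)%type) s t :
  unitary_op u -> bounded s -> bounded t ->
  u ** mtens s mone ** opadj u = u ** mtens t mone ** opadj u -> s = t.
Proof.
move=> uu bs bt E.
have E1 := conj_inj uu (@bounded_mtens1 R _ L _ bs) (@bounded_mtens1 R _ L _ bt) E.
apply/funext=> p; apply/funext=> q; have := congr1 (fun T => T (p, l) (q, l)) E1.
by rewrite /mtens /mone /= eqxx !mulr1.
Qed.

Section Exchange.
Context {H K L : choiceType} {U : mat R (H * L)%type} {V : mat R (K * L)%type} {Z : mat R (H * K)%type}.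
Hypotheses (uU : unitary_op U) (uV : unitary_op V) (bZ : bounded Z).
Hypothesis ZX : leg13 U ** leg23 V ** leg12 Z = leg23 V ** leg13 U :> mat R (H * K * L)%type.
Let X : mat R (H * K * L)%type := leg13 U ** leg23 V.
Let u13 : unitary_op (leg13 U : mat R (H * K * L)%type). Proof. exact: unitary_leg13. Qed.
Let u23 : unitary_op (leg23 V : mat R (H * K * L)%type). Proof. exact: unitary_leg23. Qed.
Let b13 := unitary_bounded u13.
Let b23 := unitary_bounded u23.
Let bU := unitary_bounded uU.
Let bV := unitary_bounded uV.

(** An operator on the first leg commutes with $V_{23}$, so only the conjugation by $U_{13}$
    remains. *)
Lemma exchange_left a : bounded a ->
  X ** leg12 (mtens a mone) ** opadj X = leg13 (mconjg U (mtens a mone)).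
Proof.
move=> ba; have b1 := @bounded_mtens1 R; have bU' := bounded_adj bU.
have bl : bounded (leg12 (mtens a mone) : mat R (H * K * L)%type).
  by apply: bounded_leg12; exact: b1.
rewrite (conj_comp b13 b23 bl) (unitary_conj_id u23 bl) ?leg12_tens1 ?leg13_adj.
  rewrite -!leg13_mul; try by [exact: b1|exact: bounded_mul bU (b1 _ _ _ ba)|].
  by rewrite mconjgE (opmulA bU (b1 _ _ _ ba) bU').
by rewrite -leg12_tens1; exact: leg23_comm.
Qed.

(** The relation [ZX] absorbs [Z] and leaves $V_{23}U_{13}$; now $U_{13}$ is innermost and commutes
    with an operator on the second leg. *)
Lemma exchange_right b : bounded b ->
  X ** leg12 (mconjg Z (mtens mone b)) ** opadj X = leg23 (mconjg V (mtens b mone)).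
Proof.
move=> bb'; have b1 := @bounded_mtens1 R; have bV' := bounded_adj bV.
have bt := @bounded_mtens1l R H K b bb'; have bZ' := bounded_adj bZ.
have bl : bounded (leg12 (mtens mone b) : mat R (H * K * L)%type) by exact: bounded_leg12.
have bZ12 : bounded (leg12 Z : mat R (H * K * L)%type) by exact: bounded_leg12.
have bX : bounded X by exact: bounded_mul.
have bb1 := b1 _ L _ bb'.
rewrite mconjgE (opmulA bZ bt bZ') (leg12_mul _ (bounded_mul bZ bt) bZ') (leg12_mul _ bZ bt).
rewrite -leg12_adj -(conj_comp bX bZ12 bl) /X ZX (conj_comp b23 b13 bl).
rewrite (unitary_conj_id u13 bl); last exact: leg13_comm.
rewrite leg12_tens1l leg23_adj -(leg23_mul _ bV bb1) -(leg23_mul _ (bounded_mul bV bb1) bV').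
by rewrite mconjgE (opmulA bV bb1 bV').
Qed.

End Exchange.

(** If [L] is empty there is only one operator on $\ell^2(I\times L)$, so an injective coaction
    leaves room only for zero. *)
Lemma coaction_empty (L : choiceType) (A : set (mat R L)) D I (C : set (mat R I)) g :
  ~ (exists l : L, True) -> star_alg C -> @coaction R L A D I C g -> forall c, C c -> c = 0.
Proof.
move=> nl [csC _ _ _] [_ ig _ _] c Cc; apply: ig; [exact: Cc|exact: csub0|].
by apply/funext=> -[i l]; case: nl; exists l.
Qed.

(** The map [kappa] adds a third leg to [th] and conjugates by $U_{13}V_{23}$. The covariance
    conditions then turn the results of [exchange_left] and [exchange_right] into coactions, and
    [U], [V] and [Z] are no longer visible. *)
Lemma twisted_heis (G : qgroup R) (w : universal G) I C g J D d N E i1 i2 :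
  @twisted R G w I C g J D d N E i1 i2 ->
  exists (H K : choiceType) (phi : mat R I -> mat R H) (psi : mat R J -> mat R K)
    (kappa : mat R N -> mat R (H * K * qL G)%type),
    [/\ nrep C phi /\ injective_on C phi, nrep D psi /\ injective_on D psi,
        shom (multiplier E) kappa /\ injective_on E kappa,
        (forall c, C c -> kappa (i1 c) = leg13 (amp phi (g c))) &
        (forall x, D x -> kappa (i2 x) = leg23 (amp psi (d x)))].
Proof.
case=> [[hC hD cg cd] [hE mi1 mi2 E12] [H [K [phi [U [r [psi [V [s [th hth]]]]]]]]]].
have sC := cstar_star hC; have sD := cstar_star hD; have sE := cstar_star hE.
have nC := cstar_nalg hC; have nD := cstar_nalg hD; have nA := nA G; have nAh := nAh G.
case: hth => [[[/(representation_nrep _ sC) rphi iphi] cU Uc rr Ur]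
  [[/(representation_nrep _ sD) rpsi ipsi] cV Vd rs Vs]
  [/(representation_nrep _ sE) rth ith] th1 th2].
have uU : unitary_op U by case: cU => -[].
have uV : unitary_op V by case: cV => -[].
move: rr rs => /(representation_nrep _ (nP _).1) rr /(representation_nrep _ (nP _).1) rs.
have EU : amp r (Defs.uV (ud w)) = U by rewrite -Ur (tmorE rr nA (nalg_nrep_id nA) (mV _)).
have EV : amp s (Defs.uV (udh w)) = V by rewrite -Vs (tmorE rs nAh (nalg_nrep_id nAh) (mV _)).
have ZX := Z_exchange rr rs; rewrite EU EV in ZX.
have bZ : bounded (opadj (amq s (amp r (Wu w)))).
  apply: bounded_adj; have [_ _ _ _ h] := amq_shom H rs; apply: h.
  exact: (amp_mult rr (nalg_udh w) (mWu w)).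
have uX : unitary_op (leg13 U ** leg23 V : mat R (H * K * qL G)%type).
  by apply: unitary_mul; [exact: unitary_leg13|exact: unitary_leg23].
have [hX sth _] := rth.
exists H, K, phi, psi, (fun e => (leg13 U ** leg23 V) ** leg12 (th e) ** opadj (leg13 U ** leg23 V)).
split; [by split|by split|split|..].
- exact: shom_conj_tens1 uX sth.
- move=> a b Ea Eb E0; apply: (ith _ _ Ea Eb).
  have ba := shom_bounded sth (star_alg_mult sE Ea).
  have bb' := shom_bounded sth (star_alg_mult sE Eb).
  (* Removing the added tensor factor 1 uses an index of [L]; an empty [L] forces [E] to be zero. *)
  have [[l _]|nl] := pselect (exists l : qL G, True).
    exact: (conj_tens1_inj l uX ba bb' E0).
  suff E1 : forall e, E e -> e = 0 by rewrite (E1 _ Ea) (E1 _ Eb).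
  rewrite -E12; apply: (cspan_min (@csub_zero R N N)).
  move=> _ [_ [y [[c Cc <-] _ ->]]] /=; rewrite (coaction_empty nl sC cg Cc).
  have [_ si1 _] := morphism_nrep sC hE mi1.
  by rewrite (shom0 (calg_mult sC) si1) -[mmul _ _]/(_ ** _) opmul0l.
- move=> c Cc; have mg : multiplier (atens C (qA G)) (g c).
    by case: cg => mo _ _ _; exact: morphism_mult mo (star_alg_mult sC Cc).
  have bc : bounded (phi c) by have [_ /shom_bounded h _] := rphi; apply: h; exact: star_alg_mult.
  rewrite (th1 _ Cc) (exchange_left uU uV bc) -(Uc _ Cc).
  by rewrite (tmorE rphi nA (nalg_nrep_id nA) mg).
- move=> x Dx; have mg : multiplier (atens D (qAh G)) (d x).
    by case: cd => mo _ _ _; exact: morphism_mult mo (star_alg_mult sD Dx).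
  have bx : bounded (psi x) by have [_ /shom_bounded h _] := rpsi; apply: h; exact: star_alg_mult.
  rewrite (th2 _ Dx) (tmorE rr (nalg_udh w) rs (mWu w)).
  rewrite (exchange_right uU uV bZ ZX bx) -(Vd _ Dx).
  by rewrite (tmorE rpsi nAh (nalg_nrep_id nAh) mg).
Qed.
End Heisenberg.

(** * Unital algebras *)

Section Unital.
Context {R : realType}.
Implicit Types (I J K : choiceType).

(** The codomain for homomorphisms of which only boundedness of the values is known. *)
Definition bop I : set (mat R I) := [set T | bounded T].

(* Unital *-homomorphisms between unital algebras, where multipliers and
   nondegeneracy play no role. *)
Definition uhom I J (X : set (mat R I)) (Y : set (mat R J)) (f : mat R I -> mat R J) : Prop :=
  [/\ calg X, calg Y, shom X f & forall x, X x -> Y (f x)].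

Lemma sprod_unital I J (X : set (mat R I)) (f : mat R I -> mat R J) :
  X mone -> f mone = mone -> compacts R J `<=` sprod (f @` X) (compacts R J).
Proof.
move=> X1 f1 k hk; rewrite -[k]opmul1l.
by apply: sub_sprod => //; exists mone.
Qed.

Lemma calg_multE I (X : set (mat R I)) : calg X -> multiplier X = X.
Proof.
move=> cX; apply/seteqP; split=> m; first exact: mult_unital (calg1 cX).
exact: star_alg_mult (calg_star cX).
Qed.

Lemma nrep_unital I J (X : set (mat R I)) (f : mat R I -> mat R J) :
  calg X -> shom X f -> nrep X f.
Proof.
move=> cX sf; split; [exact: calg_star|by rewrite calg_multE|].
by apply: sprod_unital (calg1 cX) _; case: sf.
Qed.

Lemma nalg_unital I (X : set (mat R I)) : calg X -> nalg X.
Proof.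
move=> cX; split; first exact: calg_star.
by rewrite -[X in sprod X _]image_id; exact: sprod_unital (calg1 cX) _.
Qed.

Lemma calg_atens I J (X : set (mat R I)) (Y : set (mat R J)) :
  calg X -> calg Y -> calg (atens X Y).
Proof.
move=> cX cY; apply: star_alg_unital; first exact: star_atens (calg_star cX) (calg_star cY).
by rewrite -mtens_one; apply: sub_atens; exact: calg1.
Qed.

Lemma uhom_id I (X : set (mat R I)) : calg X -> uhom X X (fun x => x).
Proof. by move=> cX; split=> //; split=> // a; exact: calg_bounded cX. Qed.

Lemma uhom_bop I J (X : set (mat R I)) (f : mat R I -> mat R J) :
  calg X -> shom X f -> uhom X (@bop J) f.
Proof. by move=> cX sf; split=> //; [exact: calg_all|move=> x Xx; case: sf => _ _ _ _; exact]. Qed.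

Lemma uhom_comp I J K (X : set (mat R I)) (Y : set (mat R J)) (Z : set (mat R K)) f g :
  uhom X Y f -> uhom Y Z g -> uhom X Z (fun x => g (f x)).
Proof.
case=> cX cY [f1 f2 f3 f4 f5] XY [_ cZ [g1 g2 g3 g4 g5] YZ]; split=> //.
- split.
  + by move=> c a b ha hb; rewrite f1 // g1 //; exact: XY.
  + by move=> a b ha hb; rewrite f2 // g2 //; exact: XY.
  + by move=> a ha; rewrite f3 // g3 //; exact: XY.
  + by rewrite f4.
  + by move=> a ha; apply: g5; exact: XY.
- by move=> x hx; apply: YZ; exact: XY.
Qed.

Lemma uhom_amp I I' J (X : set (mat R I)) (X' : set (mat R I')) (Y : set (mat R J)) f :
  uhom X X' f -> calg Y -> uhom (atens X Y) (atens X' Y) (amp f).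
Proof.
case=> cX cX' sf XX' cY; have cT := calg_atens cX cY; have cT' := calg_atens cX' cY.
have [_ sa _] := nrep_amp (nrep_unital cX sf) (nalg_unital cY).
rewrite calg_multE // in sa; split=> //.
apply: (atens_ind (calg_csub cT) (blin_shom cT sa) (csub_atens X' Y)) => a b Xa Yb.
  exact: sub_atens.
by rewrite (amp_mtens cX sf) //; apply: sub_atens => //; exact: XX'.
Qed.

Lemma uhom_amp_mtens I I' J (X : set (mat R I)) (X' : set (mat R I')) f a (b : mat R J) :
  uhom X X' f -> X a -> amp f (mtens a b) = mtens (f a) b.
Proof. by case=> cX _ sf _; exact: amp_mtens. Qed.

Lemma uhom_amq_mtens I J J' (Y : set (mat R J)) (Y' : set (mat R J')) g (a : mat R I) b :
  uhom Y Y' g -> Y b -> amq g (mtens a b) = mtens a (g b).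
Proof.
case=> cY _ sg _ Yb; apply: (amq_mtens _ (nrep_unital cY sg)).
exact: star_alg_mult (calg_star cY) Yb.
Qed.

Lemma uhom_amq I J J' (X : set (mat R I)) (Y : set (mat R J)) (Y' : set (mat R J')) g :
  uhom Y Y' g -> calg X -> uhom (atens X Y) (atens X Y') (amq g).
Proof.
move=> hg cX; case: (hg) => cY cY' sg YY'.
have cT := calg_atens cX cY; have cT' := calg_atens cX cY'.
have [_ sa _] := nrep_amq (nrep_unital cY sg) (nalg_unital cX) (nalg_unital cY).
rewrite calg_multE // in sa; split=> //.
apply: (atens_ind (calg_csub cT) (blin_shom cT sa) (csub_atens X Y')) => a b Xa Yb.
  exact: sub_atens.
by rewrite (uhom_amq_mtens _ hg) //; apply: sub_atens => //; exact: YY'.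
Qed.

Lemma uhom_atens_eq I J K (X : set (mat R I)) (Y : set (mat R J)) (Z Z' : set (mat R K)) h h' :
  uhom (atens X Y) Z h -> uhom (atens X Y) Z' h' ->
  (forall a b, X a -> Y b -> h (mtens a b) = h' (mtens a b)) ->
  forall t, atens X Y t -> h t = h' t.
Proof.
case=> cT _ sh _ [_ _ sh' _] E.
apply: (blin_eq (calg_csub cT) (blin_shom cT sh) (blin_shom cT sh')).
  by move=> _ [a [b [Xa Yb ->]]]; exact: sub_atens.
by move=> _ [a [b [Xa Yb ->]]]; exact: E.
Qed.

Lemma uhom_sprod_eq I J N K (X : set (mat R I)) (Y : set (mat R J)) (E : set (mat R N))
    (Z Z' : set (mat R K)) i j h h' :
  (forall x, X x -> E (i x)) -> (forall y, Y y -> E (j y)) -> sprod (i @` X) (j @` Y) = E ->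
  uhom E Z h -> uhom E Z' h' ->
  (forall x, X x -> h (i x) = h' (i x)) -> (forall y, Y y -> h (j y) = h' (j y)) ->
  forall e, E e -> h e = h' e.
Proof.
move=> Xi Yj EE [cE _ sh _] [_ _ sh' _] hX hY; rewrite -{1}EE.
apply: (blin_eq (calg_csub cE) (blin_shom cE sh) (blin_shom cE sh')) => _ [_ [_ [[x Xx <-] [y Yy <-] ->]]].
  by apply: calg_mul => //; [exact: Xi|exact: Yj].
have [_ m _ _ _] := sh; have [_ m' _ _ _] := sh'.
have [ex ey] := (Xi x Xx, Yj y Yy).
by rewrite -[mmul _ _]/(_ ** _) m // m' // hX // hY.
Qed.

Lemma shom_ridx I I' (u : I' -> I) (v : I -> I') (X : set (mat R I)) : calg X ->
  cancel u v -> cancel v u -> shom X (ridx u).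
Proof.
move=> cX uK vK; have ui := can_inj uK; have b x : X x -> bounded x by exact: calg_bounded cX.
split=> //.
- by move=> a c /b ha /b hc; exact: (ridx_mul uK vK).
- exact: ridx_one.
- by move=> a /b; exact: bounded_ridx.
Qed.

Lemma uhom_reassoc I J K (X : set (mat R I)) (Y : set (mat R J)) (Z : set (mat R K)) :
  calg X -> calg Y -> calg Z ->
  uhom (atens X (atens Y Z)) (atens (atens X Y) Z) (@reassoc R I J K).
Proof.
move=> cX cY cZ; have [s1 s2 s3] := And3 (calg_star cX) (calg_star cY) (calg_star cZ).
have cT : calg (atens X (atens Y Z)) by do ?apply: calg_atens.
split=> //; first by do ?apply: calg_atens.
  exact: shom_ridx cT (@ascK _ _ _) (@unascK _ _ _).
exact: atens_reassoc.
Qed.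

Lemma morphism_uhom I J (X : set (mat R I)) (Y : set (mat R J)) f :
  calg X -> nalg Y -> calg Y -> morphism X Y f -> uhom X Y f.
Proof.
move=> cX nY cY mf; have [_ sf _] := morphism_rep (calg_star cX) nY mf.
rewrite calg_multE // in sf; split=> // x Xx; have [h _ _ _ _] := mf.
by move: (h x); rewrite !calg_multE //; exact.
Qed.

Lemma uhom_morphism I J (X : set (mat R I)) (Y : set (mat R J)) f :
  uhom X Y f -> morphism X Y f.
Proof.
case=> cX cY [h1 h2 h3 h4 h5] XY; rewrite /morphism !calg_multE //; split=> //.
have sY := calg_csub cY; apply/seteqP; split.
  by apply: cspan_min => // _ [_ [y [[x Xx <-] Yy ->]]]; exact: calg_mul cY (XY _ Xx) Yy.
move=> y Yy; rewrite -[y]opmul1l.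
by apply: sub_sprod => //; exists mone => //; exact: calg1.
Qed.

Lemma tmor_uhom I J I' J' (X : set (mat R I)) (Y : set (mat R J)) (X' : set (mat R I'))
    (Y' : set (mat R J')) f g t : uhom X X' f -> uhom Y Y' g -> atens X Y t ->
  tmor X Y f g t = amq g (amp f t).
Proof.
case=> cX _ sf _ [cY _ sg _] ht; apply: tmorE.
- exact: nrep_unital.
- exact: nalg_unital.
- exact: nrep_unital.
- exact: star_alg_mult (calg_star (calg_atens cX cY)) ht.
Qed.

(* The image is closed because an injective *-homomorphism is isometric. *)
Lemma calg_image I J (X : set (mat R I)) (phi : mat R I -> mat R J) :
  calg X -> shom X phi -> injective_on X phi -> calg (phi @` X).
Proof.
move=> cX sp ip; have [p1 p2 p3 p4 p5] := sp; have sX := calg_csub cX.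
have XB a b : X a -> X b -> X (a - b) by exact: csubB.
have pB a b : X a -> X b -> phi (a - b) = phi a - phi b by exact: shomB.
split; last 4 first.
- by exists mone => //; exact: calg1.
- by move=> _ _ [x Xx <-] [y Xy <-]; exists (x ** y); [exact: calg_mul|exact: p2].
- by move=> _ [x Xx <-]; exists (opadj x); [exact: calg_adj|exact: p3].
- by move=> _ [x Xx <-]; exact: p5.
split.
- by exists 0; [exact: csub0|exact: (shom0 cX sp)].
- move=> c _ _ [x Xx <-] [y Xy <-]; exists (opscale c x + y); first exact: csub_lin.
  exact: p1.
move=> T hT; pose e (n : nat) : R := n.+1%:R^-1.
have e0 n : 0 < e n by rewrite invr_gt0 ltr0n.
have H n : exists x, X x /\ bnd (e n) (phi x - T).
  by have [_ [x Xx <-] bx] := hT _ (e0 n); exists x.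
have [x hx] := choice H.
have Xx n : X (x n) by have [] := hx n.
have bx n : bnd (e n) (phi (x n) - T) by have [] := hx n.
have em n m : (n <= m)%N -> e m <= e n.
  by move=> nm; rewrite lef_pV2 ?posrE ?ltr0n // ler_nat.
have cx n m : (n <= m)%N -> bnd (e n + e n) (x m - x n).
  move=> nm; apply: (shom_isometric cX sp ip (XB _ _ (Xx m) (Xx n))).
  rewrite (pB _ _ (Xx m) (Xx n)).
  rewrite [_ - _](_ : _ = (phi (x m) - T) - (phi (x n) - T)); last by opext.
  exact: (bndB (bnd_le (bx m) (em _ _ nm)) (bx n)).
have ce (d : R) : 0 < d -> exists n, e n + e n <= d.
  move=> d0; have d2 : 0 < d / 2 by rewrite divr_gt0.
  have [n] : exists n : nat, (d / 2)^-1 < n%:R.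
    by exists (Num.truncn (d / 2)^-1).+1; exact: truncnS_gt.
  move=> hn; exists n; rewrite [d]splitr; have h : e n <= d / 2.
    rewrite -[d / 2]invrK lef_pV2 ?posrE ?ltr0n ?invr_gt0 //.
    by rewrite (le_trans (ltW hn)) // ler_nat.
  exact: lerD.
have [S bS] := op_complete cx ce.
have XS : X S.
  apply: (csub_closed sX) => d /ce[n hn]; exists (x n) => //.
  exact: bnd_le (bS n) hn.
exists S => //; apply/eqP; rewrite -subr_eq0; apply/eqP; apply: bnd0_eq => d d0.
have d2 : 0 < d / 2 by rewrite divr_gt0.
have [n hn] := ce _ d2.
rewrite [_ - _](_ : _ = (phi (x n) - T) - (phi (x n) - phi S)); last by opext.
rewrite [d]splitr; apply: bndB.
  by apply: (bnd_le (bx n)); apply: le_trans hn; rewrite lerDl ltW.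
rewrite -(pB _ _ (Xx n) XS).
exact: bnd_le (shom_contr cX sp (XB _ _ (Xx n) XS) (bS n)) hn.
Qed.

(** A faithful representation identifies the algebra with its image, which is itself a closed
    algebra by [calg_image]; any other homomorphism can therefore be read off that image. This is
    the mechanism for replacing representations in the Heisenberg form. *)
Lemma uhom_factor I J K (X : set (mat R I)) (phi : mat R I -> mat R J) (Z : set (mat R K)) mu :
  shom X phi -> injective_on X phi -> uhom X Z mu ->
  exists f, uhom (phi @` X) Z f /\ forall x, X x -> f (phi x) = mu x.
Proof.
move=> sp ip [cX cZ sm XZ]; have cP := calg_image cX sp ip.
pose inv y := xget mone [set x | X x /\ phi x = y].
have invK x : X x -> inv (phi x) = x.
  move=> Xx; rewrite /inv; case: xgetP => [y _ [Xy E]|/(_ x) []]; last by [].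
  by apply: ip.
exists (fun y => mu (inv y)); split; last by move=> x /invK ->.
have [p1 p2 p3 p4 p5] := sp; have [m1 m2 m3 m4 m5] := sm; split=> //.
- split.
  + move=> c _ _ [x Xx <-] [y Xy <-]; rewrite -p1 // !invK //; first exact: m1.
    exact: (csub_lin c (calg_csub cX) Xx Xy).
  + move=> _ _ [x Xx <-] [y Xy <-]; rewrite -p2 // !invK //; first exact: m2.
    exact: calg_mul cX Xx Xy.
  + move=> _ [x Xx <-]; rewrite -p3 // !invK //; first exact: m3.
    exact: calg_adj cX Xx.
  + by rewrite -p4 invK ?m4 //; exact: calg1.
  + by move=> _ [x Xx <-]; rewrite invK //; exact: m5.
- by move=> _ [x Xx <-]; rewrite invK //; exact: XZ.
Qed.

End Unital.

(** * Representations of the twisted tensor product *)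

Section Transfer.
Context {R : realType}.
Implicit Types (I J K L H N : choiceType).

Lemma mult_unreassoc I J K (A : set (mat R I)) (B : set (mat R J)) (C : set (mat R K)) m :
  star_alg A -> star_alg B -> star_alg C ->
  multiplier (atens (atens A B) C) m -> multiplier (atens A (atens B C)) (unreassoc m).
Proof.
move=> hA hB hC; apply: (mult_ridx (@unascK _ _ _) (@ascK _ _ _)).
- by move=> t; apply: (atens_bounded hA); exact: star_atens.
- exact: atens_unreassoc.
- exact: atens_reassoc.
Qed.

(** Locates the values of [amp phi] over the image of [phi] instead of over all bounded operators,
    so that a homomorphism defined only on that image can be amplified. *)
Lemma amp_mult_image I I' J (X : set (mat R I)) (B : set (mat R J)) (phi : mat R I -> mat R I') m :
  calg X -> shom X phi -> calg (phi @` X) -> nalg B -> multiplier (atens X B) m ->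
  multiplier (atens (phi @` X) (compacts R J)) (amp phi m).
Proof.
move=> cX sp cP nB hm; have rp := nrep_unital cX sp; have sX := calg_star cX.
have sXK := star_atens sX (@star_compacts R J).
have sPK := star_atens (calg_star cP) (@star_compacts R J).
have [_ sM sJ _ bM] := amp_shom rp J.
have hmK := mult_atensK sX nB hm.
have T0 t : atens X (compacts R J) t -> atens (phi @` X) (compacts R J) (amp phi t).
  have bl := @blin_amp R I I' J X phi cX sp.
  move: t; apply: (atens_ind (@csub_blocks R I J X cX) bl (csub_atens _ _)) => a k Xa Kk.
    exact: (blocks_in_mtens cX k Xa).
  by rewrite (amp_mtens cX sp) //; apply: sub_atens => //; exists a.
have H n : multiplier (atens X (compacts R J)) n ->
    forall t, atens (phi @` X) (compacts R J) t -> atens (phi @` X) (compacts R J) (amp phi n ** t).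
  move=> hn; have bn := bM _ hn; have bP := calg_bounded cP.
  have bt t : atens (phi @` X) (compacts R J) t -> bounded t.
    exact: (atens_bounded (calg_star cP) (@star_compacts R J)).
  apply: (atens_ind (csub_atens _ _) (blin_mull bn bt) (csub_atens _ _)); first by move=> *; exact: sub_atens.
  move=> _ k [x Xx <-] Kk; rewrite -(amp_mtens cX sp) // -sM //; last first.
    by apply: star_alg_mult sXK _; exact: sub_atens.
  by apply: T0; apply: (mult_mull hn); exact: sub_atens.
apply: multI sPK (bM _ hmK) (H _ hmK) _; rewrite -sJ //; apply: H.
exact: mult_adj sXK hmK.
Qed.

Lemma uhom_sprod I J N K (X : set (mat R I)) (Y : set (mat R J)) (E : set (mat R N))
    (Z : set (mat R K)) i j h :
  calg E -> calg Z -> shom E h ->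
  (forall x, X x -> E (i x)) -> (forall y, Y y -> E (j y)) -> sprod (i @` X) (j @` Y) = E ->
  (forall x, X x -> Z (h (i x))) -> (forall y, Y y -> Z (h (j y))) -> uhom E Z h.
Proof.
move=> cE cZ sh Xi Yj EE hX hY; split=> //; rewrite -{1}EE.
apply: (blin_cspan (calg_csub cE) (blin_shom cE sh) (calg_csub cZ)) => _ [_ [_ [[x Xx <-] [y Yy <-] ->]]].
  by apply: calg_mul cE _ _; [exact: Xi|exact: Yj].
rewrite -[mmul _ _]/(_ ** _) (shomM sh (Xi _ Xx) (Yj _ Yy)).
by apply: calg_mul cZ _ _; [exact: hX|exact: hY].
Qed.

Lemma reassoc_amp_leg13 I I' J K (X : set (mat R I)) (f : mat R I -> mat R I')
    (T : mat R (I * K)%type) : calg X -> shom X f -> blocks_in X T ->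
  reassoc (amp f (unreassoc (leg13 T : mat R (I * J * K)%type))) = leg13 (amp f T).
Proof.
move=> cX sf h; apply/funext=> -[[i j] k]; apply/funext=> -[[i' j'] k'].
rewrite /reassoc /amp /= [blk _ _ _](_ : _ = opscale (j == j')%:R (blk T k k')).
  by rewrite (shomZ cX sf) // leg13E mulrC.
by apply/funext=> x; apply/funext=> y; rewrite /unreassoc /ridx /blk leg13E /= mulrC.
Qed.

Lemma amp_factor I I' I'' J (X : set (mat R I)) (f : mat R I' -> mat R I'') (g : mat R I -> mat R I')
    (h : mat R I -> mat R I'') (T : mat R (I * J)%type) :
  (forall x, X x -> f (g x) = h x) -> blocks_in X T -> amp f (amp g T) = amp h T.
Proof. by move=> E hT; apply: blkP => j l; rewrite !blk_amp E. Qed.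

(* This is why the twisted tensor product does not depend on the faithful
   covariant representations that define it. *)
Lemma twisted_universal (G : qgroup R) (w : universal G) I C g J D d N E i1 i2 H K mu nu :
  @twisted R G w I C g J D d N E i1 i2 -> calg C -> calg D -> calg E ->
  uhom C (@bop R H) mu -> uhom D (@bop R K) nu ->
  exists th, [/\ uhom E (@bop R (H * K * qL G)%type) th,
    (forall c, C c -> th (i1 c) = leg13 (amp mu (g c))) &
    (forall x, D x -> th (i2 x) = leg23 (amp nu (d x)))].
Proof.
move=> tw cC cD cE hmu hnu.
have [H0 [K0 [phi [psi [kappa [[rphi iphi] [rpsi ipsi] [sk _] k1 k2]]]]]] := twisted_heis tw.
case: tw => [[_ _ [mg _ _ _] [md _ _ _]] [hE m1 m2 E12] _].
have {m1 m2} [C1 D2] : (forall c, C c -> E (i1 c)) /\ (forall x, D x -> E (i2 x)).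
  have nE := cstar_nalg hE.
  by have [[_ _ _ h1] [_ _ _ h2]] := (morphism_uhom cC nE cE m1, morphism_uhom cD nE cE m2).
have sphi : shom C phi by case: rphi => _; rewrite calg_multE.
have spsi : shom D psi by case: rpsi => _; rewrite calg_multE.
rewrite (calg_multE cE) in sk.
(* The arbitrary homomorphisms factor through the faithful ones; [f1] will be applied to the first
   leg and then [f2] to the second. *)
have [f1 [uf1 Ef1]] := uhom_factor sphi iphi hmu.
have [f2 [uf2 Ef2]] := uhom_factor spsi ipsi hnu.
have cX := calg_image cC sphi iphi; have cY := calg_image cD spsi ipsi.
have nA := nA G; have nAh := nAh G; have sK := @star_compacts R.
have gC c : C c -> multiplier (atens C (qA G)) (g c).
  by move=> Cc; apply: morphism_mult mg (star_alg_mult (calg_star cC) Cc).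
have dD x : D x -> multiplier (atens D (qAh G)) (d x).
  by move=> Dx; apply: morphism_mult md (star_alg_mult (calg_star cD) Dx).
have bg c : C c -> blocks_in C (g c).
  by move=> /gC /(mult_blocks_nalg (calg_star cC) nA); rewrite calg_multE.
have bd x : D x -> blocks_in D (d x).
  by move=> /dD /(mult_blocks_nalg (calg_star cD) nAh); rewrite calg_multE.
have tg c : C c -> multiplier (atens (phi @` C) (compacts R (qL G))) (amp phi (g c)).
  by move=> /gC; exact: amp_mult_image cC sphi cX nA.
have td x : D x -> multiplier (atens (psi @` D) (compacts R (qL G))) (amp psi (d x)).
  by move=> /dD; exact: amp_mult_image cD spsi cY nAh.
(* [amp f1] is multiplicative only on multipliers over the image of [phi]. With the first leg split
   off, the values of [kappa] lie there, which has to be checked on the two generating subalgebras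
   only. *)
pose M1 := multiplier (atens (phi @` C) (compacts R (K0 * qL G)%type)).
have cM1 : calg M1 by apply: calg_mult; exact: star_atens (calg_star cX) (sK _).
have uk1 : uhom E M1 (fun e => unreassoc (kappa e)).
  have sk1 : shom E (fun e => unreassoc (kappa e)).
    have [_ _ sk1 _] := uhom_comp (uhom_bop cE sk)
      (uhom_bop (@calg_all R _) (shom_ridx (@calg_all R _) (@unascK H0 K0 (qL G)) (@ascK _ _ _))).
    exact: sk1.
  apply: (uhom_sprod cE cM1 sk1 C1 D2 E12) => [c Cc|x Dx].
    rewrite (k1 _ Cc) /M1 -atens_compacts; apply: mult_unreassoc (calg_star cX) (sK _) (sK _) _.
    by apply: mult_leg13 (calg_star cX) (sK _) (sK _) _; exact: tg.
  rewrite (k2 _ Dx) /leg23 reassocK; apply: mult_mtens (calg_star cX) (sK _) _ _.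
    exact: mult1 (calg_star cX).
  by apply/multKP; exact: mult_bounded (td _ Dx).
(* The analogous domain for applying [f2] to the middle leg, once the first leg has become an
   arbitrary space. *)
pose M2 := multiplier (atens (atens (compacts R H) (psi @` D)) (compacts R (qL G))).
have sHY := star_atens (sK H) (calg_star cY).
have cM2 : calg M2 by apply: calg_mult; exact: star_atens sHY (sK _).
have [_ _ sf1 _] := uf1; have [_ _ sf2 _] := uf2.
have rf2 := nrep_unital cY sf2.
pose kk e := reassoc (amp f1 (unreassoc (kappa e))).
have kk1 c : C c -> kk (i1 c) = leg13 (amp mu (g c)).
  move=> Cc; rewrite /kk (k1 _ Cc) (reassoc_amp_leg13 _ cX sf1).
    by rewrite (amp_factor Ef1 (bg _ Cc)).
  by move=> l l'; rewrite blk_amp; exists (blk (g c) l l') => //; exact: bg.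
have kk2 x : D x -> kk (i2 x) = leg23 (amp psi (d x)).
  move=> Dx; rewrite /kk (k2 _ Dx) /leg23 reassocK (amp_mtens cX sf1 _ (calg1 cX)).
  by have [_ _ _ -> _] := sf1.
have bmu c : C c -> bounded (amp mu (g c)).
  move=> Cc; case: (hmu) => _ _ sm _; apply: (amp_bounded cC sm (bg _ Cc)).
  exact: mult_bounded (gC _ Cc).
have uk2 : uhom E M2 kk.
  have sk2 : shom E kk.
    have [_ s1 _] := nrep_unital cX sf1.
    have u1 : uhom M1 (@bop R (H * (K0 * qL G))%type) (amp f1).
      by apply: uhom_bop cM1 _; exact: (amp_shom (nrep_unital cX sf1)).
    have [_ _ sk2 _] := uhom_comp (uhom_comp uk1 u1)
      (uhom_bop (@calg_all R _) (shom_ridx (@calg_all R _) (@ascK H K0 (qL G)) (@unascK _ _ _))).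
    exact: sk2.
  apply: (uhom_sprod cE cM2 sk2 C1 D2 E12) => [c Cc|x Dx].
    rewrite (kk1 _ Cc); apply: mult_leg13 (sK _) (calg_star cY) (sK _) _.
    by apply: mult_atens_compacts; exact: bmu.
  rewrite (kk2 _ Dx); apply: mult_leg23; [..|exact: td]; by [exact: sK|exact: calg_star cY].
have rq := nrep_amq rf2 (@nalg_compacts R H) (nalg_unital cY).
exists (fun e => amp (amq f2) (kk e)); split.
- exact: uhom_comp uk2 (uhom_bop cM2 (amp_shom rq (qL G))).
- by move=> c Cc; rewrite (kk1 _ Cc) (amp_amq_leg13 rf2).
- move=> x Dx; rewrite (kk2 _ Dx) (amp_amq_leg23 rf2) ?(amp_factor Ef2 (bd _ Dx)) // => l l'.
  apply: (star_alg_mult (calg_star cY)); rewrite blk_amp.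
  by exists (blk (d x) l l') => //; exact: bd.
Qed.

End Transfer.

(** * The bosonization *)

Section Tens2.
Context {R : realType}.
Implicit Types (I J K L H N : choiceType).

(** The formula behind [tmor], free of choice and of the algebras; at the unital level its
    compositions and rebracketings are verified on elementary tensors. *)
Definition tens2 I I' J J' (f : mat R I -> mat R I') (g : mat R J -> mat R J')
    (t : mat R (I * J)%type) : mat R (I' * J')%type := amq g (amp f t).

Section Maps.
Context {I I' I'' J J' J'' : choiceType} {X : set (mat R I)} {X' : set (mat R I')}
  {X'' : set (mat R I'')} {Y : set (mat R J)} {Y' : set (mat R J')} {Y'' : set (mat R J'')}
  {f : mat R I -> mat R I'} {g : mat R J -> mat R J'}
  {f' : mat R I' -> mat R I''} {g' : mat R J' -> mat R J''}.
Hypotheses (hf : uhom X X' f) (hg : uhom Y Y' g) (hf' : uhom X' X'' f') (hg' : uhom Y' Y'' g').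

Lemma uhom_tens2 : uhom (atens X Y) (atens X' Y') (tens2 f g).
Proof.
by case: (hf) (hg) => _ cX' _ _ [cY _ _ _]; exact: uhom_comp (uhom_amp hf cY) (uhom_amq hg cX').
Qed.

Lemma tens2_mtens a b : X a -> Y b -> tens2 f g (mtens a b) = mtens (f a) (g b).
Proof. by move=> Xa Yb; rewrite /tens2 (uhom_amp_mtens _ hf Xa) (uhom_amq_mtens _ hg Yb). Qed.

Lemma tmor_tens2 t : atens X Y t -> tmor X Y f g t = tens2 f g t.
Proof. exact: tmor_uhom hf hg. Qed.

End Maps.

Lemma tens2_comp I I' I'' J J' J'' (X : set (mat R I)) (X' : set (mat R I'))
    (X'' : set (mat R I'')) (Y : set (mat R J)) (Y' : set (mat R J')) (Y'' : set (mat R J''))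
    f g f' g' t :
  uhom X X' f -> uhom Y Y' g -> uhom X' X'' f' -> uhom Y' Y'' g' -> atens X Y t ->
  tens2 f' g' (tens2 f g t) = tens2 (fun x => f' (f x)) (fun y => g' (g y)) t.
Proof.
move=> hf hg hf' hg'; have h1 := uhom_comp hf hf'; have h2 := uhom_comp hg hg'.
have [_ _ _ fX] := hf; have [_ _ _ gY] := hg; move: t.
apply: (uhom_atens_eq (uhom_comp (uhom_tens2 hf hg) (uhom_tens2 hf' hg')) (uhom_tens2 h1 h2)).
move=> a b Xa Yb; rewrite (tens2_mtens hf hg Xa Yb) (tens2_mtens h1 h2 Xa Yb).
by rewrite (tens2_mtens hf' hg' (fX _ Xa) (gY _ Yb)).
Qed.

Lemma tens2_eq I I' J J' (X : set (mat R I)) (X' X1 : set (mat R I'))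
    (Y : set (mat R J)) (Y' Y1 : set (mat R J')) f g f1 g1 t :
  uhom X X' f -> uhom Y Y' g -> uhom X X1 f1 -> uhom Y Y1 g1 ->
  (forall x, X x -> f x = f1 x) -> (forall y, Y y -> g y = g1 y) -> atens X Y t ->
  tens2 f g t = tens2 f1 g1 t.
Proof.
move=> hf hg hf1 hg1 E1 E2; move: t.
apply: (uhom_atens_eq (uhom_tens2 hf hg) (uhom_tens2 hf1 hg1)) => a b Xa Yb.
by rewrite (tens2_mtens hf hg Xa Yb) (tens2_mtens hf1 hg1 Xa Yb) E1 // E2.
Qed.

Lemma uhom_atens3_eq I J K N (X : set (mat R I)) (Y : set (mat R J)) (Z : set (mat R K))
    (W W' : set (mat R N)) h h' :
  calg X -> calg Y -> calg Z ->
  uhom (atens X (atens Y Z)) W h -> uhom (atens X (atens Y Z)) W' h' ->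
  (forall a b c, X a -> Y b -> Z c -> h (mtens a (mtens b c)) = h' (mtens a (mtens b c))) ->
  forall t, atens X (atens Y Z) t -> h t = h' t.
Proof.
move=> cX cY cZ uh uh' E; apply: (uhom_atens_eq uh uh') => a s Xa hs.
have [cT _ sh _] := uh; have [_ _ sh' _] := uh'; have cYZ := calg_atens cY cZ.
have ba := calg_bounded cX Xa.
have bl h0 : shom (atens X (atens Y Z)) h0 -> blin (atens Y Z) (fun s => h0 (mtens a s)).
  move=> s0; apply: (blin_comp (blin_tensr _ ba) (blin_shom cT s0)) => s1 hs1.
  exact: sub_atens.
have EE := blin_eq (calg_csub cYZ) (bl _ _ sh) (bl _ _ sh') _ _ hs.
apply: EE => _ [b [c [Yb Zc ->]]]; [exact: sub_atens|exact: E].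
Qed.

Lemma tens2_assoc I I' J J' K K' (X : set (mat R I)) (X' : set (mat R I'))
    (Y : set (mat R J)) (Y' : set (mat R J')) (Z : set (mat R K)) (Z' : set (mat R K')) f g h t :
  uhom X X' f -> uhom Y Y' g -> uhom Z Z' h -> atens X (atens Y Z) t ->
  reassoc (tens2 f (tens2 g h) t) = tens2 (tens2 f g) h (reassoc t).
Proof.
move=> hf hg hh; have [cX cX' _ _] := hf; have [cY cY' _ _] := hg; have [cZ cZ' _ _] := hh.
move: t; apply: (uhom_atens3_eq cX cY cZ
  (uhom_comp (uhom_tens2 hf (uhom_tens2 hg hh)) (uhom_reassoc cX' cY' cZ'))
  (uhom_comp (uhom_reassoc cX cY cZ) (uhom_tens2 (uhom_tens2 hf hg) hh))) => a b c Xa Yb Zc.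
rewrite (tens2_mtens hf (uhom_tens2 hg hh) Xa (sub_atens Yb Zc)) (tens2_mtens hg hh Yb Zc).
rewrite !reassoc_mtens (tens2_mtens (uhom_tens2 hf hg) hh (sub_atens Xa Yb) Zc).
by rewrite (tens2_mtens hf hg Xa Yb).
Qed.

Lemma uhom_tensr1 I J (X : set (mat R I)) (Y : set (mat R J)) : calg X -> calg Y ->
  uhom Y (atens X Y) (fun y => mtens (mone : mat R I) y).
Proof.
move=> cX cY; have b1 := @bounded_one R I; have X1 := calg1 cX; split=> //.
- exact: calg_atens.
- split.
  + by move=> c a b _ _; exact: mtens_linr.
  + move=> a b Ya Yb; rewrite mtens_mul ?opmul1l //; exact: calg_bounded cY _.
  + by move=> a _; rewrite mtens_adj opadj1.
  + exact: mtens_one.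
  + by move=> a Ya; apply: bounded_mtens1l; exact: calg_bounded cY Ya.
- by move=> y Yy; exact: sub_atens.
Qed.

Lemma amq_inj I J J' (X : set (mat R I)) (Y : set (mat R J)) (g : mat R J -> mat R J') s t :
  calg X -> calg Y -> injective_on Y g -> atens X Y s -> atens X Y t -> amq g s = amq g t -> s = t.
Proof.
move=> cX cY ig hs ht E; have b T := @atens_blocks _ _ _ Y X T (calg_csub cY).
have E2 i i' : blk2 s i i' = blk2 t i i'.
  apply: ig; [exact: (b _ (atens_flip hs))|exact: (b _ (atens_flip ht))|].
  exact: (congr1 (fun X => blk2 X i i') E).
apply/funext=> -[i j]; apply/funext=> -[i' j'].
exact: (congr1 (fun X => X j j') (E2 i i')).
Qed.

Lemma ridx_cancel I J (a : I -> J) (b : J -> I) (T : mat R I) : cancel a b ->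
  ridx a (ridx b T) = T.
Proof. by move=> aK; apply/funext=> p; apply/funext=> q; rewrite /ridx !aK. Qed.

(** Flattens an amplified Heisenberg form: the space [N] placed in front of [H * K * L] is merged
    with it as in a left-associated product. *)
Definition ridx4 N H K L (p : N * H * K * L) : N * (H * K * L) := (p.1.1.1, (p.1.1.2, p.1.2, p.2)).
Definition ridx4V N H K L (p : N * (H * K * L)) : N * H * K * L := (p.1, p.2.1.1, p.2.1.2, p.2.2).
Lemma ridx4K N H K L : cancel (@ridx4 N H K L) (@ridx4V N H K L). Proof. by move=> [[[? ?] ?] ?]. Qed.
Lemma ridx4VK N H K L : cancel (@ridx4V N H K L) (@ridx4 N H K L). Proof. by move=> [? [[? ?] ?]]. Qed.

Lemma ridx4_leg13 N H K L J (q : mat R J -> mat R (H * L)%type) (T : mat R (N * J)%type) :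
  ridx (@ridx4 N H K L) (amq (fun x => leg13 (q x)) T) = leg13 (reassoc (amq q T)).
Proof. by apply/funext=> -[[[? ?] ?] ?]; apply/funext=> -[[[? ?] ?] ?]. Qed.

Lemma ridx4_leg23 N H K L (S : mat R (K * L)%type) :
  ridx (@ridx4 N H K L) (mtens mone (leg23 S)) = leg23 S.
Proof.
apply/funext=> -[[[n h] k] l]; apply/funext=> -[[[n' h'] k'] l'].
rewrite /ridx /mtens !leg23E /mone /= !xpair_eqE mulrA -natrM mulnb.
by [].
Qed.

End Tens2.

Section Density.
Context {R : realType}.
Implicit Types (I J K : choiceType).

Lemma sprod_mull I (X Y : set (mat R I)) x t :
  (forall x, X x -> bounded x) -> (forall y, Y y -> bounded y) ->
  (forall x x', X x -> X x' -> X (x ** x')) -> X x -> sprod X Y t -> sprod X Y (x ** t).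
Proof.
move=> bX bY mX Xx; have sS := sprod_csub X Y; have bx := bX _ Xx; move: t.
apply: (sprod_ind (@csub_bounded R I) (blin_mull bx (fun T h => h)) sS) => x' y Xx' Yy.
  by apply: bounded_mul; [exact: bX|exact: bY].
rewrite (opmulA bx (bX _ Xx') (bY _ Yy)); apply: sub_sprod Yy; exact: mX.
Qed.

Lemma sprod_mulr I (X Y : set (mat R I)) y t :
  (forall x, X x -> bounded x) -> (forall y, Y y -> bounded y) ->
  (forall y y', Y y -> Y y' -> Y (y ** y')) -> Y y -> sprod X Y t -> sprod X Y (t ** y).
Proof.
move=> bX bY mY Yy; have sS := sprod_csub X Y; have by_ := bY _ Yy; move: t.
apply: (sprod_ind (@csub_bounded R I) (blin_mulr by_ (fun T h => h)) sS) => x y' Xx Yy'.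
  by apply: bounded_mul; [exact: bX|exact: bY].
rewrite -(opmulA (bX _ Xx) (bY _ Yy') by_); apply: sub_sprod => //; exact: mY.
Qed.

Lemma blk3_leg13 I J K (T : mat R (I * K)%type) i i' :
  blk3 (leg13 T : mat R (I * J * K)%type) i i' = mtens mone (blk2 T i i').
Proof. by apply/funext=> -[? ?]; apply/funext=> -[? ?]; rewrite /blk3 leg13E mulrC. Qed.

Lemma bnd_blk2 I J M (T : mat R (I * J)%type) i i' : bnd M T -> bnd M (blk2 T i i').
Proof. by move=> bT; exact: (bnd_blk i i' (bnd_flip bT)). Qed.

Lemma blin_blk2 I J (D : set (mat R (I * J)%type)) i i' : blin D (fun T => blk2 T i i').
Proof.
split=> //; exists 1; split=> // M T _ bT; rewrite mul1r; exact: bnd_blk2.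
Qed.

Lemma blin_blk3 I J K (D : set (mat R (I * J * K)%type)) i i' : blin D (fun T => blk3 T i i').
Proof.
split=> //; exists 1; split=> // M T _ bT; rewrite mul1r.
exact: (bnd_blk2 i i' (bnd_unreassoc bT)).
Qed.

Lemma blk2_mul_dlt I J (T : mat R (I * J)%type) p q i i' : bounded T ->
  blk2 (T ** mtens (dlt p q) mone) i i' = opscale (i' == q)%:R (blk2 T i p).
Proof.
move=> bT; have b1 := @bounded_one R J; have bd := @bounded_dlt R I p q.
have := blk_mul_dlt p q i i' (bounded_flip bT) b1; rewrite opmul1r => <-.
have -> : mtens mone (dlt p q) = flip (mtens (dlt p q) (mone : mat R J)) by rewrite flip_mtens.
by rewrite -flip_mul //; exact: bounded_mtens.
Qed.

End Density.

(** * The second cancellation law of a compact quantum group *)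

Section CompactCancellation.
Context {R : realType} (G : qgroup R).
Hypothesis A1 : qA G mone.
Local Notation L := (qL G).
Local Notation A := (qA G).
Local Notation Ah := (qAh G).
Local Notation W := (qW G).
Local Notation S0 := (sprod (qD G @` A) [set mtens a (mone : mat R L) | a in A]).

Let sS0 : csub S0. Proof. exact: sprod_csub. Qed.
Let u12 : unitary_op (leg12 W : mat R (L * L * L)%type). Proof. by apply: unitary_leg12; exact: uW. Qed.
Let u13 : unitary_op (leg13 W : mat R (L * L * L)%type). Proof. by apply: unitary_leg13; exact: uW. Qed.
Let u23 : unitary_op (leg23 W : mat R (L * L * L)%type). Proof. by apply: unitary_leg23; exact: uW. Qed.

(** The adjoint of $W_{12}W_{13}=W_{23}W_{12}W_{23}^*$, which is the pentagon equation solved for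
    its left-hand side. *)
Lemma pentagon_adj : opadj (leg13 W) ** opadj (leg12 W) =
  leg23 W ** opadj (leg12 W) ** opadj (leg23 W) :> mat R (L * L * L)%type.
Proof.
have b12 := unitary_bounded u12; have b13 := unitary_bounded u13; have b23 := unitary_bounded u23.
have pent : leg23 W ** leg12 W = leg12 W ** (leg13 W ** leg23 W) := qW_pentagon G.
have E : leg12 W ** leg13 W = leg23 W ** leg12 W ** opadj (leg23 W) :> mat R (L * L * L)%type.
  by rewrite pent (opmulA b12 b13 b23) unitaryKr //; exact: bounded_mul.
have b23' := bounded_adj b23; have b12' := bounded_adj b12.
rewrite -(opadj_mul b12 b13) E (opadj_mul (bounded_mul b23 b12) b23') (opadj_mul b23 b12) opadjK.
by rewrite opmulA.
Qed.

Lemma mult_Ws_tens1 ah : Ah ah -> multiplier (atens Ah A) (opadj W ** mtens ah mone).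
Proof.
move=> Ahh; have hT := star_atens (nAh G).1 (nA G).1; have cM := calg_mult hT.
apply: calg_mul cM (calg_adj cM (mW G)) _; apply: mult_mtens (nAh G).1 (nA G).1 _ _.
  exact: star_alg_mult (nAh G).1 Ahh.
exact: mult1 (nA G).1.
Qed.

(** For an elementary tensor [X = mtens ah a], [pentagon_adj] turns the operator into
    $(\mathrm{id}\otimes\Delta_A)(W^*(ah\otimes1))$ times [a] in the second leg, and every entry in
    the first leg is then in [S0]. General [X] follow by density. *)
Lemma slice_comult X i i' : atens Ah A X ->
  S0 (blk3 (opadj (leg13 W) ** opadj (leg12 W) ** leg12 X) i i').
Proof.
have b12 := unitary_bounded u12; have b13 := unitary_bounded u13; have b23 := unitary_bounded u23.
have b12' := bounded_adj b12; have b13' := bounded_adj b13; have b23' := bounded_adj b23.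
have cA := star_alg_unital (nA G).1 A1; have b1 := @bounded_one R L.
have bT t : atens Ah A t -> bounded t by exact: atens_bounded (nAh G).1 (nA G).1.
have bL t : atens Ah A t -> bounded (leg12 t : mat R (L * L * L)%type) by move=> /bT; exact: bounded_leg12.
have bl1 := blin_tensl (b := (mone : mat R L)) (atens Ah A) b1.
have bl2 := blin_comp bl1 (blin_mull (bounded_mul b13' b12') (fun T h => h)) bL.
have bl3 := blin_comp bl2 (blin_blk3 [set T | bounded T] i i') (fun T h => bounded_mul (bounded_mul b13' b12') (bL T h)).
move: X; apply: (atens_ind (csub_atens _ _) bl3 sS0) => [a b|ah a Aha Aa]; first exact: sub_atens.
have bah : bounded ah by have [_ h _ _] := (nAh G).1; exact: h.
have ba := calg_bounded cA Aa; have bW' := bounded_adj (bW G).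
have ba1 := @bounded_mtens1 R _ L _ bah; have b1a := @bounded_mtens1l R L _ _ ba.
have -> : mtens ah a = mtens ah mone ** mtens mone a by rewrite mtens_mul // opmul1l opmul1r.
have bl := @bounded_leg12 R L L L _ ba1; have bla := @bounded_leg12 R L L L _ b1a.
have cm : opadj (leg23 W) ** leg12 (mtens ah mone) = leg12 (mtens ah mone) ** opadj (leg23 W) :> mat R (L * L * L)%type.
  by rewrite leg23_adj; exact: leg23_comm.
have -> : opadj (leg13 W) ** opadj (leg12 W) ** leg12 (mtens ah mone ** mtens mone a) =
    leg23 W ** leg12 (opadj W ** mtens ah mone) ** leg23 (opadj W ** mtens a mone) :> mat R (L * L * L)%type.
  rewrite pentagon_adj (leg12_mul _ ba1 b1a) (leg12_mul _ bW' ba1) -leg12_adj.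
  rewrite (leg23_mul _ bW' (@bounded_mtens1 R _ L _ ba)) -leg23_adj -leg12_tens1l.
  have b0 := bounded_mul b23 b12'.
  rewrite (opmulA (bounded_mul b0 b23') bl bla) -(opmulA b0 b23' bl) cm (opmulA b0 bl b23').
  by rewrite -(opmulA b23 b12' bl) (opmulA (bounded_mul b23 (bounded_mul b12' bl)) b23' bla).
have bWa := bounded_mul bW' ba1.
have bWt := bounded_mul bW' (@bounded_mtens1 R _ L _ ba).
rewrite (blk3_mulr _ _ bWt) ?(blk3_mull _ _ (bW G)) ?blk3_leg12; try exact: bounded_leg12; last first.
  by apply: (bounded_mul b23); exact: bounded_leg12.
have Ax : A (blk2 (opadj W ** mtens ah mone) i i').
  by have := mult_blk2 i i' (nAh G) (nA G).1 (mult_Ws_tens1 Aha); rewrite calg_multE.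
have bx := @bounded_mtens1 R _ L _ (calg_bounded cA Ax).
rewrite (opmulA (bounded_mul (bW G) bx) bW' (@bounded_mtens1 R _ L _ ba)).
rewrite -qD_conj; last exact: star_alg_mult (nA G).1 Ax.
by apply: sub_sprod; [exists (blk2 (opadj W ** mtens ah mone) i i')|exists a].
Qed.

(** Take $X=W(ah\otimes1)$ in [slice_comult]: it lies in $\hat A\otimes A$ because [A] has a unit,
    and $W_{12}$ cancels, so that only $W_{13}^*$ is left and the middle leg becomes trivial. *)
Lemma slice_tens1 ah i i' : Ah ah -> S0 (mtens mone (blk2 (opadj W ** mtens ah mone) i i')).
Proof.
move=> Aha; have bah : bounded ah by have [_ h _ _] := (nAh G).1; exact: h.
have ba1 := @bounded_mtens1 R _ L _ bah; have bW' := bounded_adj (bW G).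
have h1 : atens Ah A (W ** mtens ah mone) by apply: (mult_mull (mW G)); exact: sub_atens.
have b12 := unitary_bounded u12; have b13 := unitary_bounded u13; have b12' := bounded_adj b12.
have b13' := bounded_adj b13; have bl := @bounded_leg12 R L L L _ ba1.
have := slice_comult i i' h1; rewrite (leg12_mul _ (bW G) ba1).
rewrite -(opmulA b13' b12' (bounded_mul b12 bl)) (unitaryKl u12 bl) leg12_tens1 leg13_adj.
by rewrite -(leg13_mul _ bW' ba1) blk3_leg13.
Qed.

(** The factor [ah] may be exchanged for a compact operator since $\hat A\mathbb K=\mathbb K$, and
    multiplication by a matrix unit only selects or kills entries. *)
Lemma slice_compact k i i' : compacts R L k -> S0 (mtens mone (blk2 (opadj W ** mtens k mone) i i')).
Proof.
have bW' := bounded_adj (bW G); have b1 := @bounded_one R L.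
have bl (T : mat R (L * L)%type) : bounded T ->
    blin [set k : mat R L | bounded k] (fun k => mtens (mone : mat R L) (blk2 (T ** mtens k mone) i i')).
  move=> bT; have l1 := blin_tensl (b := (mone : mat R L)) [set k : mat R L | bounded k] b1.
  have l2 := blin_comp l1 (blin_mull bT (fun T h => h)) (fun k h => @bounded_mtens1 R _ L _ h).
  have l3 := blin_comp l2 (blin_blk2 [set T | bounded T] i i')
    (fun k h => bounded_mul bT (@bounded_mtens1 R _ L _ h)).
  apply: (blin_comp l3 (blin_tensr [set T | bounded T] b1)) => k' h.
  by apply: bounded_blk2; apply: bounded_mul bT _; exact: bounded_mtens1.
move=> /((nAh G).2); move: k; apply: (sprod_ind (@csub_bounded R L) (bl _ bW') sS0) => ah c Aha Kc.
  by apply: bounded_mul; [have [_ h _ _] := (nAh G).1; exact: h|exact: compacts_bounded].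
have bah : bounded ah by have [_ h _ _] := (nAh G).1; exact: h.
have ba1 := @bounded_mtens1 R _ L _ bah; have bc1 := @bounded_mtens1 R _ L _ (compacts_bounded Kc).
have -> : mtens (ah ** c) (mone : mat R L) = mtens ah mone ** mtens c mone.
  by rewrite mtens_mul ?opmul1l //; exact: compacts_bounded.
have bT := bounded_mul bW' ba1; rewrite (opmulA bW' ba1 bc1).
have [_ h] : bounded c /\ S0 (mtens mone (blk2 (opadj W ** mtens ah mone ** mtens c mone) i i')).
  move: c Kc {bc1}; apply: (compacts_min (blin_csub (@csub_bounded R L) (bl _ bT) sS0)) => p q.
  split; first exact: bounded_dlt.
  rewrite (blk2_mul_dlt p q i i' bT); case: eqP => _.
    by rewrite opscale1; exact: slice_tens1.
  have -> : mtens (mone : mat R L) (opscale 0 (blk2 (opadj W ** mtens ah mone) i p)) = 0.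
    by apply/funext=> x; apply/funext=> y; rewrite /mtens /opscale mul0r mulr0.
  exact: csub0.
exact: h.
Qed.

(** With the matrix unit [dlt i i], the slice in [slice_compact] is a bare entry of the adjoint of
    [W]. The adjoints of the entries of [W] span a dense subspace around [A], as [A] is closed under
    adjoints. *)
Lemma cancellation_left a : A a -> S0 (mtens mone a).
Proof.
move=> Aa; have [_ bA _ jA] := (nA G).1; have b1 := @bounded_one R L.
have {Aa} : cspan [set X | exists i i', X = opadj (blk2 W i i')] a.
  rewrite -[a]opadjK; have /qA_blocks := jA _ Aa; move: (opadj a).
  apply: cspan_min => [|_ [i [i' ->]] /=]; first exact: (csub_adj (cspan_csub _)).
  by apply: sub_cspan; exists i, i'.
have bb2 i i' : bounded (blk2 W i i') by apply: bounded_blk2; exact: bW.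
apply: (blin_cspan (@csub_bounded R L) (blin_tensr _ b1) sS0).
  by move=> _ [i [i' ->]]; apply: bounded_adj.
move=> _ [i [i' ->]]; have := slice_compact i' i (@compacts_dlt R L i i).
by rewrite (blk2_mul_dlt i i i' i (bounded_adj (bW G))) eqxx opscale1.
Qed.

End CompactCancellation.

(** * The bosonization: coassociativity and cancellation *)

Section Bosonization.
Context {R : realType}.

(** The product of the images of the two units is the unit of the underlying Hilbert space, and it
    lies in the product of the two embedded algebras. *)
Lemma twisted_unital (G : qgroup R) (w : universal G) I C g J D d N E i1 i2 :
  @twisted R G w I C g J D d N E i1 i2 -> calg C -> calg D ->
  [/\ calg E, uhom C E i1, uhom D E i2 & sprod (i1 @` C) (i2 @` D) = E].
Proof.
case=> [_ [hE m1 m2 E12] _] cC cD; have nE := cstar_nalg hE.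
have [_ [_ _ _ e1 _] _] := morphism_rep (calg_star cC) nE m1.
have [_ [_ _ _ e2 _] _] := morphism_rep (calg_star cD) nE m2.
have cE : calg E.
  apply: (star_alg_unital nE.1); rewrite -E12 -[mone]opmul1l.
  by apply: sub_sprod; [exists mone|exists mone] => //; exact: calg1.
by split=> //; exact: morphism_uhom.
Qed.

Lemma coaction_unital (G : qgroup R) I (X : set (mat R I)) g :
  coaction (qA G) (qD G) X g -> calg X -> calg (qA G) -> uhom (qA G) (atens (qA G) (qA G)) (qD G) ->
  uhom X (atens X (qA G)) g /\
  forall x, X x -> reassoc (tens2 id (qD G) (g x)) = tens2 g id (g x).
Proof.
case=> mg _ co _ cX cA uD; have cXA := calg_atens cX cA.
have ug := morphism_uhom cX (nalg_unital cXA) cXA mg.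
split=> // x Xx; have [_ _ _ gx] := ug; have := co _ Xx.
by rewrite (tmor_tens2 (uhom_id cX) uD (gx _ Xx)) (tmor_tens2 ug (uhom_id cA) (gx _ Xx)).
Qed.

Context {G : qgroup R} {w : universal G} {B : braided_bialgebra w}.
Context {N : choiceType} {C : set (mat R N)} {iA : mat R (qL G) -> mat R N} {iB : mat R (bI B) -> mat R N}.
Hypothesis hC : twisted w (qA G) (qD G) (bB B) (bcoh B) C iA iB.
Context {M : choiceType} {T : set (mat R M)} {tA : mat R (qL G) -> mat R M} {tBB : mat R (bbI B) -> mat R M}.
Hypothesis hT : twisted w (qA G) (qD G) (bBB B) (bbcoh B) T tA tBB.
Context {idDelta : mat R N -> mat R M}.
Hypothesis hid : is_bmor (qA G) (bB B) C iA iB T tA tBB id (bD B) idDelta.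
Context {Psi : mat R M -> mat R (N * N)%type}.
Hypothesis hPsi : is_Psi C iA iB T tA tBB Psi.
Hypotheses (A1 : qA G mone) (B1 : bB B mone).

Local Notation A := (qA G).
Local Notation BB := (bBB B).
Local Notation BA := (bB B).
Local Notation L := (qL G).
Local Notation CC := (atens C C).
Definition bos_comult (c : mat R N) : mat R (N * N)%type := Psi (idDelta c).
Definition bos_leg (y : mat R (bbI B)) : mat R (N * N)%type := Psi (tBB y).
Local Notation D := bos_comult.
Local Notation JJ := bos_leg.

Lemma cA : calg A. Proof. exact: star_alg_unital (nA G).1 A1. Qed.
Lemma cB : calg BA.
Proof. by case: (b_yd B) => hB _ _ _; exact: star_alg_unital (cstar_star hB) B1. Qed.
Lemma uBB : [/\ calg BB, uhom BA BB (bi1 B), uhom BA BB (bi2 B) & sprod (bi1 B @` BA) (bi2 B @` BA) = BB].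
Proof. exact: twisted_unital (bb_twisted B) cB cB. Qed.
Lemma cBB : calg BB. Proof. by case: uBB. Qed.
Lemma uC : [/\ calg C, uhom A C iA, uhom BA C iB & sprod (iA @` A) (iB @` BA) = C].
Proof. exact: twisted_unital hC cA cB. Qed.
Lemma cC : calg C. Proof. by case: uC. Qed.
Lemma uT : [/\ calg T, uhom A T tA, uhom BB T tBB & sprod (tA @` A) (tBB @` BB) = T].
Proof. exact: twisted_unital hT cA cBB. Qed.
Lemma uiA : uhom A C iA. Proof. by case: uC. Qed.
Lemma uiB : uhom BA C iB. Proof. by case: uC. Qed.
Lemma cCC : calg CC. Proof. exact: calg_atens cC cC. Qed.

Lemma uqD : uhom A (atens A A) (qD G).
Proof. exact: morphism_uhom cA (nalg_atens (nA G) (nA G)) (calg_atens cA cA) (qD_mor G). Qed.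

Lemma ubD : uhom BA BB (bD B).
Proof. exact: morphism_uhom cB (nalg_unital cBB) cBB (bD_mor B). Qed.

Lemma uPsi : uhom T CC Psi.
Proof.
have [cT _ _ _] := uT; have [m _ _ _] := hPsi.
exact: morphism_uhom cT (nalg_unital cCC) cCC m.
Qed.

Lemma uD : uhom C CC D.
Proof.
have [cT _ _ _] := uT; have [m _ _] := hid.
exact: uhom_comp (morphism_uhom cC (nalg_unital cT) cT m) uPsi.
Qed.

Lemma uJ : uhom BB CC JJ.
Proof. by have [_ _ h _] := uT; exact: uhom_comp h uPsi. Qed.

Lemma qD_coaction : forall a, A a -> reassoc (tens2 id (qD G) (qD G a)) = tens2 (qD G) id (qD G a).
Proof. by have [[_ _ h _] _ _] := hC; have [_] := coaction_unital h cA cA uqD. Qed.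

Lemma uco : uhom BA (atens BA A) (bco B).
Proof. by have [_ h _ _] := b_yd B; have [] := coaction_unital h cB cA uqD. Qed.
Lemma co_coaction : forall x, BA x -> reassoc (tens2 id (qD G) (bco B x)) = tens2 (bco B) id (bco B x).
Proof. by have [_ h _ _] := b_yd B; have [] := coaction_unital h cB cA uqD. Qed.
Lemma ubbco : uhom BB (atens BB A) (bbco B).
Proof. by have [_ h _ _] := bb_yd B; have [] := coaction_unital h cBB cA uqD. Qed.
Lemma bbco_coaction : forall x, BB x -> reassoc (tens2 id (qD G) (bbco B x)) = tens2 (bbco B) id (bbco B x).
Proof. by have [_ h _ _] := bb_yd B; have [] := coaction_unital h cBB cA uqD. Qed.

Lemma equiv_tens2 (f : mat R (bI B) -> mat R (bbI B)) : uhom BA BB f ->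
  equivariant A BA (bco B) (bbco B) f -> forall x, BA x -> bbco B (f x) = tens2 f id (bco B x).
Proof.
move=> uf h x Bx; have [_ _ _ cox] := uco.
by rewrite (h _ Bx) (tmor_tens2 uf (uhom_id cA) (cox _ Bx)).
Qed.

Lemma D_iA a : A a -> D (iA a) = tens2 iA iA (qD G a).
Proof.
move=> Aa; have [_ h _] := hid; have [_ h' _ _] := hPsi; have [_ _ _ Da] := uqD.
by rewrite /D (h _ Aa) (h' _ Aa) (tmor_tens2 uiA uiA (Da _ Aa)).
Qed.

Lemma D_iB x : BA x -> D (iB x) = JJ (bD B x).
Proof. by move=> Bx; have [_ _ h] := hid; rewrite /D (h _ Bx). Qed.

Lemma J_i1 x : BA x -> JJ (bi1 B x) = tens2 iB iA (bco B x).
Proof.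
move=> Bx; have [_ _ h _] := hPsi; have [_ _ _ cox] := uco.
by rewrite /JJ (h _ Bx) (tmor_tens2 uiB uiA (cox _ Bx)).
Qed.

Lemma J_i2 x : BA x -> JJ (bi2 B x) = mtens mone (iB x).
Proof. by move=> Bx; have [_ _ _ h] := hPsi; exact: h. Qed.

Lemma D_coassoc_A a : A a -> tens2 D id (D (iA a)) = reassoc (tens2 id D (D (iA a))).
Proof.
move=> Aa; rewrite (D_iA Aa); have [_ _ _ Da] := uqD; have m := Da _ Aa.
have [uA uC] := (uhom_id cA, uhom_id cC); have uAA := uhom_tens2 uiA uiA.
have mm : atens A (atens A A) (tens2 id (qD G) (qD G a)).
  by have [_ _ _ h] := uhom_tens2 uA uqD; exact: h.
rewrite (tens2_comp uiA uiA uD uC m) (tens2_comp uiA uiA uC uD m).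
transitivity (tens2 (tens2 iA iA) iA (tens2 (qD G) id (qD G a))).
  rewrite (tens2_comp uqD uA uAA uiA m).
  exact: (tens2_eq (uhom_comp uiA uD) uiA (uhom_comp uqD uAA) uiA D_iA (fun _ _ => erefl _) m).
rewrite -(qD_coaction Aa) -(tens2_assoc uiA uiA uiA mm); congr reassoc.
rewrite (tens2_comp uA uqD uiA uAA m); symmetry.
exact: (tens2_eq uiA (uhom_comp uiA uD) uiA (uhom_comp uqD uAA) (fun _ _ => erefl _) D_iA m).
Qed.

(* Both sides are compared in the Heisenberg representation [kap] of the last
   leg, where they become the values of one homomorphism [th] on the two sides
   of the coassociativity of [B]. *)
Lemma D_coassoc_B x : BA x -> tens2 D id (D (iB x)) = reassoc (tens2 id D (D (iB x))).
Proof.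
move=> Bx; rewrite (D_iB Bx).
have [H [K [phi [psi [kap [[rphi _] [rpsi _] [sk ik] k1 k2]]]]]] := twisted_heis hC.
have uphi : uhom A (@bop R H) phi.
  by case: rphi => _ h _; apply: (uhom_bop cA); rewrite (calg_multE cA) in h.
have upsi : uhom BA (@bop R K) psi.
  by case: rpsi => _ h _; apply: (uhom_bop cB); rewrite (calg_multE cB) in h.
have ukap : uhom C (@bop R (H * K * L)%type) kap.
  by apply: (uhom_bop cC); rewrite (calg_multE cC) in sk.
have [F1 [F2 [F [f1 [f2 [F' [f1' [f2' [al [Did [idD [[tF tF'] [mal ial alF] hal [hDid hidD] co]]]]]]]]]]]] :=
  bD_coassoc B.
have [cF uf1 uf2 FE] := twisted_unital tF cBB cB.
have [cF' uf1' uf2' FE'] := twisted_unital tF' cB cBB.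
have [_ ui1 ui2 BBE] := uBB.
have [_ _ _ Xi1] := ui1; have [_ _ _ Xi2] := ui2.
have [_ _ _ cox] := uco; have [_ _ _ bbcox] := ubbco; have [_ _ _ BDx] := ubD.
have [_ _ _ JC] := uJ; have [_ _ _ qDA] := uqD; have [_ _ _ BC] := uiB.
have [uA uCi] := (uhom_id cA, uhom_id cC); have uAA := uhom_tens2 uiA uiA.
have uPA := uhom_tens2 uphi uA.
(* This homomorphism takes the place of the first representation in the Heisenberg form of [F]; it
   keeps [JJ] for the first two copies of [B] and [phi] for what the coaction leaves in [A]. *)
have umu : uhom BB (@bop R (N * N * H)%type) (fun y => tens2 JJ phi (bbco B y)).
  have [_ _ h _] := uhom_comp ubbco (uhom_tens2 uJ uphi); exact: (uhom_bop cBB h).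
have [th [uth t1 t2]] := twisted_universal tF cBB cB cF umu upsi.
(* [kap] on the last leg, relabelled so that [Th] and [th] take values on the same index set. As
   [kap] is injective, nothing is lost ([iTh]). *)
pose Th s := ridx (@ridx4 (N * N)%type H K L) (amq kap s).
have uTh : uhom (atens CC C) (@bop R (N * N * H * K * L)%type) Th.
  have uk := uhom_amq ukap cCC; have [_ cb _ _] := uk.
  exact: uhom_comp uk (uhom_bop cb (shom_ridx cb (@ridx4K _ _ _ _) (@ridx4VK _ _ _ _))).
have iTh s t : atens CC C s -> atens CC C t -> Th s = Th t -> s = t.
  move=> hs ht E; apply: (amq_inj cCC cC ik hs ht).
  have := congr1 (ridx (@ridx4V (N * N)%type H K L)) E; rewrite /Th.
  by rewrite !(ridx_cancel _ (@ridx4VK (N * N)%type H K L)).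
(* Coassociativity of [bbco] converts the second coaction in [th (f1 y)] into [qD] on the last leg,
   and [qD] is what [kap] shows on [iA]. *)
have Th1 y : BB y -> Th (tens2 JJ iA (bbco B y)) = th (f1 y).
  move=> By; have m := bbcox _ By; rewrite (t1 _ By).
  have mm : atens BB (atens A A) (tens2 id (qD G) (bbco B y)).
    by have [_ _ _ h] := uhom_tens2 (uhom_id cBB) uqD; exact: h.
  have -> : amp (fun y => tens2 JJ phi (bbco B y)) (bbco B y) =
      reassoc (amq (fun a => amp phi (qD G a)) (amp JJ (bbco B y))).
    transitivity (tens2 (tens2 JJ phi) id (tens2 (bbco B) id (bbco B y))).
      by rewrite (tens2_comp ubbco uA (uhom_tens2 uJ uphi) uA m).
    rewrite -(bbco_coaction By) -(tens2_assoc uJ uphi uA mm); congr reassoc.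
    by rewrite (tens2_comp (uhom_id cBB) uqD uJ uPA m).
  rewrite -ridx4_leg13 /Th; congr ridx.
  transitivity (tens2 id kap (tens2 JJ iA (bbco B y))); first by [].
  rewrite (tens2_comp uJ uiA (uhom_id cCC) ukap m).
  rewrite /tens2; have bl : forall i i', A (blk2 (amp JJ (bbco B y)) i i').
    have [_ _ _ h] := uhom_amp uJ cA; have := atens_blocks (calg_csub cA) (atens_flip (h _ m)).
    by move=> h' i i'; exact: h'.
  apply/funext=> -[i j]; apply/funext=> -[i' j']; rewrite /amq /=.
  by rewrite (k1 _ (bl _ _)).
have Th2 z : BA z -> Th (mtens mone (iB z)) = th (f2 z).
  move=> Bz; rewrite (t2 _ Bz) -ridx4_leg23 /Th; congr ridx.
  by rewrite (uhom_amq_mtens _ ukap (BC _ Bz)) k2.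
have uR := uhom_reassoc cC cC cC.
(* Compared on the two copies of [B] generating [BB]: on the first, equivariance of [bD] carries the
   comultiplication past the coaction, so that [Th1] applies; on the second, [Th2] does. *)
have DidE y : BB y -> Th (tens2 D id (JJ y)) = th (Did y).
  have [mDid Di1 Di2] := hDid.
  have uDid := morphism_uhom cBB (nalg_unital cF) cF mDid.
  move: y; apply: (uhom_sprod_eq Xi1 Xi2 BBE
    (uhom_comp (uhom_comp uJ (uhom_tens2 uD uCi)) uTh) (uhom_comp uDid uth)) => z Bz.
    rewrite (J_i1 Bz) (Di1 _ Bz) -(Th1 _ (BDx _ Bz)) (equiv_tens2 ubD (bD_equiv (b:=B)) Bz).
    have m := cox _ Bz; rewrite (tens2_comp uiB uiA uD uCi m) (tens2_comp ubD uA uJ uiA m).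
    by rewrite (tens2_eq (uhom_comp uiB uD) uiA (uhom_comp ubD uJ) uiA D_iB (fun _ _ => erefl _) m).
  rewrite (J_i2 Bz) (Di2 _ Bz) (tens2_mtens uD uCi (calg1 cC) (BC _ Bz)) -(Th2 _ Bz).
  by have [_ _ [_ _ _ -> _] _] := uD.
have umal := morphism_uhom cF (nalg_unital cF') cF' mal.
(* [av] is the inverse of [al], through which elements of the other model [F'] are seen by [th]. *)
have [_ _ sal _] := umal; have [av [uav avK]] := uhom_factor sal ial (uhom_id cF).
rewrite alF in uav.
have [_ _ _ F1x] := uf1; have [_ _ _ F2x] := uf2.
have u1J : uhom BB (atens C CC) (fun y => mtens mone (JJ y)).
  exact: uhom_comp uJ (uhom_tensr1 cC cCC).
have u1B : uhom BA CC (fun x => mtens mone (iB x)) by exact: uhom_comp uiB (uhom_tensr1 cC cC).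
have u1BA := uhom_tens2 u1B uiA; have uBiA := uhom_tens2 uiB uiA.
(* Describes the last two copies of [B] inside [F'], again on generators. It is needed for [idD],
   which applies the comultiplication to the last copy and so ends in [f2']. *)
have Th3 y : BB y -> Th (reassoc (mtens mone (JJ y))) = th (av (f2' y)).
  move: y; apply: (uhom_sprod_eq Xi1 Xi2 BBE (uhom_comp (uhom_comp u1J uR) uTh)
    (uhom_comp uf2' (uhom_comp uav uth))) => z Bz; have [e1 e2 e3] := hal _ Bz.
    rewrite -e2 (avK _ (F1x _ (Xi2 _ Bz))) -(Th1 _ (Xi2 _ Bz)) (J_i1 Bz); congr Th.
    have m := cox _ Bz; rewrite (equiv_tens2 ui2 (bi2_equiv (b:=B)) Bz) (tens2_comp ui2 uA uJ uiA m).
    rewrite (tens2_eq (uhom_comp ui2 uJ) uiA u1B uiA J_i2 (fun _ _ => erefl _) m).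
    move: m; move: (bco B z); apply: (uhom_atens_eq
      (uhom_comp (uhom_comp uBiA (uhom_tensr1 cC cCC)) uR) u1BA) => b a Bb Aa.
    by rewrite (tens2_mtens uiB uiA Bb Aa) (tens2_mtens u1B uiA Bb Aa) reassoc_mtens.
  by rewrite -e3 (avK _ (F2x _ Bz)) -(Th2 _ Bz) (J_i2 Bz) reassoc_mtens mtens_one.
(* On the first copy this combines coassociativity of [bco] with equivariance of [bi1]; the second
   copy is [Th3]. *)
have idDE y : BB y -> Th (reassoc (tens2 id D (JJ y))) = th (av (idD y)).
  have [midD Di1 Di2] := hidD.
  have uidD := morphism_uhom cBB (nalg_unital cF') cF' midD.
  move: y; apply: (uhom_sprod_eq Xi1 Xi2 BBE
    (uhom_comp (uhom_comp uJ (uhom_comp (uhom_tens2 uCi uD) uR)) uTh)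
    (uhom_comp uidD (uhom_comp uav uth))) => z Bz; have [e1 e2 e3] := hal _ Bz.
    have m := cox _ Bz; rewrite (J_i1 Bz) (Di1 _ Bz) -e1 (avK _ (F1x _ (Xi1 _ Bz))).
    rewrite -(Th1 _ (Xi1 _ Bz)); congr Th.
    have mm : atens BA (atens A A) (tens2 id (qD G) (bco B z)).
      by have [_ _ _ h] := uhom_tens2 (uhom_id cB) uqD; exact: h.
    rewrite (tens2_comp uiB uiA uCi uD m).
    rewrite (tens2_eq (uhom_comp uiB uCi) (uhom_comp uiA uD) uiB (uhom_comp uqD uAA)
      (fun _ _ => erefl _) D_iA m).
    rewrite -(tens2_comp (uhom_id cB) uqD uiB uAA m) (tens2_assoc uiB uiA uiA mm) (co_coaction Bz).
    rewrite (tens2_comp uco uA uBiA uiA m) (equiv_tens2 ui1 (bi1_equiv (b:=B)) Bz).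
    rewrite (tens2_comp ui1 uA uJ uiA m); symmetry.
    exact: (tens2_eq (uhom_comp ui1 uJ) uiA (uhom_comp uco uBiA) uiA J_i1 (fun _ _ => erefl _) m).
  rewrite (J_i2 Bz) (Di2 _ Bz) (tens2_mtens uCi uD (calg1 cC) (BC _ Bz)) (D_iB Bz).
  exact: Th3 (BDx _ Bz).
have By := BDx _ Bx; apply: iTh.
- by have [_ _ _ h] := uhom_tens2 uD uCi; apply: h; exact: JC.
- by have [_ _ _ h] := uhom_comp (uhom_tens2 uCi uD) uR; apply: h; exact: JC.
rewrite (DidE _ By) (idDE _ By) -(co _ Bx) avK //.
have [mDid _ _] := hDid; have [_ _ _ h] := morphism_uhom cBB (nalg_unital cF) cF mDid.
exact: h.
Qed.

Lemma D_coassoc c : C c -> tens2 D id (D c) = reassoc (tens2 id D (D c)).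
Proof.
have [_ _ _ CE] := uC; have [_ _ _ XA] := uiA; have [_ _ _ XB] := uiB.
have uCi := uhom_id cC; move: c; apply: (uhom_sprod_eq XA XB CE
  (uhom_comp uD (uhom_tens2 uD uCi))
  (uhom_comp uD (uhom_comp (uhom_tens2 uCi uD) (uhom_reassoc cC cC cC)))).
- exact: D_coassoc_A.
- exact: D_coassoc_B.
Qed.

Local Notation DC := (D @` C).
Local Notation C2 := [set mtens (mone : mat R N) c | c in C].
Local Notation C1 := [set mtens c (mone : mat R N) | c in C].

Let DC_mul x x' : DC x -> DC x' -> DC (x ** x').
Proof.
move=> [c Cc <-] [c' Cc' <-]; exists (c ** c'); first exact: calg_mul cC Cc Cc'.
by have [_ _ [_ h _ _ _] _] := uD; exact: h.
Qed.

Let DC_bounded x : DC x -> bounded x.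
Proof. by move=> [c Cc <-]; have [_ _ [_ _ _ _ h] _] := uD; exact: h. Qed.

Let bC c : C c -> bounded c. Proof. exact: calg_bounded cC. Qed.
Let b1 := @bounded_one R N.

Let C1_bounded x : C1 x -> bounded x.
Proof. by move=> [c Cc <-]; exact: bounded_mtens1 (bC Cc). Qed.
Let C2_bounded x : C2 x -> bounded x.
Proof. by move=> [c Cc <-]; exact: bounded_mtens1l (bC Cc). Qed.
Let C1_mul x x' : C1 x -> C1 x' -> C1 (x ** x').
Proof.
move=> [c Cc <-] [c' Cc' <-]; exists (c ** c'); first exact: calg_mul cC Cc Cc'.
by rewrite mtens_mul ?opmul1l //; exact: bC.
Qed.
Let C2_mul x x' : C2 x -> C2 x' -> C2 (x ** x').
Proof.
move=> [c Cc <-] [c' Cc' <-]; exists (c ** c'); first exact: calg_mul cC Cc Cc'.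
by rewrite mtens_mul ?opmul1l //; exact: bC.
Qed.

(** The density condition of the coaction [bco], carried over by $i_B\otimes i_A$. An arbitrary
    closed subspace [E] in the conclusion allows use under a further multiplication. *)
Lemma J_i1_dense b a : BA b -> A a ->
  forall E : set (mat R (N * N)%type), csub E ->
  (forall x y, BA x -> A y -> E (JJ (bi1 B x) ** mtens mone (iA y))) -> E (mtens (iB b) (iA a)).
Proof.
move=> Bb Aa E sE h; have [_ [_ _ _ co] _ _] := b_yd B.
have := sub_atens Bb Aa; rewrite -co -(tens2_mtens uiB uiA Bb Aa); move: (mtens b a).
have [cBA _ sI _] := uhom_tens2 uiB uiA; have [_ _ _ cox] := uco; have [_ m _ _ _] := sI.
have cA' := cA; have cB' := cB.
have B1A y : A y -> atens BA A (mtens mone y) by move=> Ay; apply: sub_atens => //; exact: calg1.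
apply: (sprod_ind (calg_csub cBA) (blin_shom cBA sI) sE) => _ _ [x Bx <-] [y Ay <-].
  by apply: (calg_mul cBA (cox _ Bx)); exact: B1A.
rewrite (m _ _ (cox _ Bx) (B1A _ Ay)) -(J_i1 Bx) (tens2_mtens uiB uiA (calg1 cB') Ay).
have [_ _ [_ _ _ -> _] _] := uiB; exact: h.
Qed.

Lemma J_dense (E : set (mat R (N * N)%type)) (S : set (mat R (bbI B))) y :
  csub E -> sprod (bD B @` BA) S = BB -> (forall z, S z -> BB z) ->
  (forall x z, BA x -> S z -> E (D (iB x) ** JJ z)) -> BB y -> E (JJ y).
Proof.
move=> sE SE SB h; rewrite -SE; have [_ _ sJ _] := uJ; have [_ m _ _ _] := sJ.
have [_ _ _ BDx] := ubD; have cBB' := cBB; move: y.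
apply: (sprod_ind (calg_csub cBB') (blin_shom cBB' sJ) sE) => _ z [x Bx <-] Sz.
  exact: calg_mul cBB' (BDx _ Bx) (SB _ Sz).
by rewrite (m _ _ (BDx _ Bx) (SB _ Sz)) -(D_iB Bx); exact: h.
Qed.

Lemma C_dense c (E : set (mat R N)) : csub E ->
  (forall a b, A a -> BA b -> E (iA a ** iB b)) -> C c -> E c.
Proof.
move=> sE h; have [_ _ _ CE] := uC; rewrite -CE; move: c.
by apply: (cspan_min sE) => _ [_ [_ [[a Aa <-] [b Bb <-] ->]]]; exact: h.
Qed.

(** Taking adjoints in [C_dense] reverses the two factors: [C] is also the closed span of products
    with [iB] on the left. *)
Lemma C_dense_op c (E : set (mat R N)) : csub E ->
  (forall a b, A a -> BA b -> E (iB b ** iA a)) -> C c -> E c.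
Proof.
move=> sE h Cc; rewrite -[c]opadjK.
apply: (@C_dense (opadj c) [set T | E (opadj T)]); last exact: calg_adj cC Cc.
  exact: csub_adj.
move=> a b Aa Bb /=; have [_ _ sA XA] := uiA; have [_ _ sB XB] := uiB.
rewrite opadj_mul; [|exact: bC (XA _ Aa)|exact: bC (XB _ Bb)].
have [_ _ jA _ _] := sA; have [_ _ jB _ _] := sB.
rewrite -(shomJ sA Aa) -(shomJ sB Bb); apply: h; [exact: calg_adj cA Aa|exact: calg_adj cB Bb].
Qed.

(** The right factor $1\otimes C$ can be absorbed at any time, and so can [D] of an element on the
    left. From the image of [JJ] one gets $i_B(B)\otimes i_A(A)$ and then, multiplying by $1\otimes
    i_B(B)$, all of $i_B(B)\otimes C$. A remaining factor $i_A(a)\otimes1$ on the left is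
    approximated by sums of $\Delta_C(i_A(x))(1\otimes i_A(y))$. *)
Lemma D_dense2 : sprod (bD B @` BA) (bi2 B @` BA) = BB -> sprod DC C2 = CC.
Proof.
move=> hB; have sS := sprod_csub DC C2; have [_ _ _ DCC] := uD; have cCC' := cCC.
have [_ _ _ XA] := uiA; have [_ _ _ XB] := uiB; have [_ _ _ JC] := uJ.
have [_ _ ui2 _] := uBB; have [_ _ _ Xi2] := ui2; have [_ ui1 _ _] := uBB; have [_ _ _ Xi1] := ui1.
have mulr y t : C2 y -> sprod DC C2 t -> sprod DC C2 (t ** y).
  exact: sprod_mulr DC_bounded C2_bounded C2_mul.
have mull x t : DC x -> sprod DC C2 t -> sprod DC C2 (x ** t).
  exact: sprod_mull DC_bounded C2_bounded DC_mul.
apply/seteqP; split.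
  apply: cspan_min (calg_csub cCC') _ => _ [_ [_ [[c Cc <-] [c' Cc' <-] ->]]].
  apply: (calg_mul cCC' (DCC _ Cc)); apply: sub_atens Cc'; exact: calg1 cC.
have SJ y : BB y -> sprod DC C2 (JJ y).
  apply: (J_dense sS hB) => [_ [x Bx <-]|x _ Bx [z Bz <-]]; first exact: Xi2.
  by rewrite (J_i2 Bz); apply: sub_sprod; [exists (iB x) => //; exact: XB|exists (iB z) => //; exact: XB].
have SBA b a : BA b -> A a -> sprod DC C2 (mtens (iB b) (iA a)).
  move=> Bb Aa; apply: (J_i1_dense Bb Aa sS) => x y Bx Ay; apply: mulr; last exact: SJ (Xi1 _ Bx).
  by exists (iA y) => //; exact: XA.
have SBC b c : BA b -> C c -> sprod DC C2 (mtens (iB b) c).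
  move=> Bb Cc; have bb' := bC (XB _ Bb).
  suff [] : C c /\ sprod DC C2 (mtens (iB b) c) by [].
  have sE := blin_csub (calg_csub cC) (blin_tensr C bb') sS.
  apply: (C_dense sE _ Cc) => a b' Aa Bb'; split; first exact: calg_mul cC (XA _ Aa) (XB _ Bb').
  have -> : mtens (iB b) (iA a ** iB b') = mtens (iB b) (iA a) ** mtens mone (iB b').
    by rewrite mtens_mul ?opmul1r //; apply: bC; [exact: XA|exact: XB].
  by apply: mulr; [exists (iB b') => //; exact: XB|exact: SBA].
apply: (atens_min sS) => c c' Cc Cc'; have bc' := bC Cc'.
suff [] : C c /\ sprod DC C2 (mtens c c') by [].
have sE := blin_csub (calg_csub cC) (blin_tensl C bc') sS.
apply: (C_dense sE _ Cc) => a b Aa Bb; split; first exact: calg_mul cC (XA _ Aa) (XB _ Bb).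
have bBC := @bounded_mtens R _ _ _ _ (bC (XB _ Bb)) bc'.
have -> : mtens (iA a ** iB b) c' = mtens (iA a) mone ** mtens (iB b) c'.
  by rewrite mtens_mul ?opmul1l //; apply: bC; [exact: XA|exact: XB].
have [cAA uAA] := (calg_atens cA cA, uhom_tens2 uiA uiA); have [_ _ sAA _] := uAA.
have [_ _ [_ _ _ iA1 _] _] := uiA; have [_ m _ _ _] := sAA; have [_ _ _ qDA] := uqD.
have A1y y : A y -> atens A A (mtens mone y) by move=> Ay; exact: sub_atens.
have bAA t : atens A A t -> bounded (tens2 iA iA t) by have [_ _ _ _ h] := sAA; exact: h.
have [[_ _ [_ _ _ co] _] _ _] := hC.
have -> : mtens (iA a) mone = tens2 iA iA (mtens a mone) by rewrite (tens2_mtens uiA uiA Aa A1) iA1.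
have := sub_atens Aa A1; rewrite -{1}co; move: (mtens a mone).
apply: (sprod_ind (calg_csub cAA) (blin_comp (blin_shom cAA sAA)
  (blin_mulr (D := [set T | bounded T]) bBC (fun T h => h)) bAA) sS) => _ _ [x Ax <-] [y Ay <-].
  exact: calg_mul cAA (qDA _ Ax) (A1y _ Ay).
rewrite (m _ _ (qDA _ Ax) (A1y _ Ay)) -(D_iA Ax) (tens2_mtens uiA uiA A1 Ay) iA1.
have [bx by_] := (DC_bounded (ex_intro2 _ _ _ (XA _ Ax) (erefl (D (iA x)))), bC (XA _ Ay)).
rewrite -(opmulA bx (@bounded_mtens1l R N _ _ by_) bBC).
rewrite mtens_mul ?opmul1l //; last exact: bC (XB _ Bb).
apply: mull; first by exists (iA x) => //; exact: XA.
by apply: SBC Bb _; exact: calg_mul cC (XA _ Ay) Cc'.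
Qed.

(** Now $C\otimes1$ is absorbed on the right, so elements of [C] are written with [iA] last and
    $i_A(a)\otimes1$ is split off on the right. What remains is the factor $1\otimes i_B(b')$, which
    is not of the absorbable form and has to pass through the image of [JJ]. *)
Lemma D_dense1 : sprod (bD B @` BA) (bi1 B @` BA) = BB -> sprod DC C1 = CC.
Proof.
move=> hB; have sS := sprod_csub DC C1; have [_ _ _ DCC] := uD; have cCC' := cCC.
have [_ _ _ XA] := uiA; have [_ _ _ XB] := uiB; have [_ _ sJ JC] := uJ.
have [_ ui1 ui2 _] := uBB; have [_ _ _ Xi2] := ui2; have [_ _ _ Xi1] := ui1.
have mulr y t : C1 y -> sprod DC C1 t -> sprod DC C1 (t ** y).
  exact: sprod_mulr DC_bounded C1_bounded C1_mul.
have mull x t : DC x -> sprod DC C1 t -> sprod DC C1 (x ** t).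
  exact: sprod_mull DC_bounded C1_bounded DC_mul.
apply/seteqP; split.
  apply: cspan_min (calg_csub cCC') _ => _ [_ [_ [[c Cc <-] [c' Cc' <-] ->]]].
  apply: (calg_mul cCC' (DCC _ Cc)); apply: sub_atens Cc' _; exact: calg1 cC.
have [_ _ sA _] := uiA; have [_ _ _ iA1 _] := sA; have [_ _ sB _] := uiB; have [_ _ _ iB1 _] := sB.
(* The only use of [cancellation_left]: it provides the elements of [A] in the second leg. *)
have S1A a : A a -> sprod DC C1 (mtens mone (iA a)).
  move=> Aa; have [cAA uAA] := (calg_atens cA cA, uhom_tens2 uiA uiA); have [_ _ sAA _] := uAA.
  have [_ m _ _ _] := sAA; have [_ _ _ qDA] := uqD.
  have -> : mtens mone (iA a) = tens2 iA iA (mtens mone a) by rewrite (tens2_mtens uiA uiA A1 Aa) iA1.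
  have := cancellation_left A1 Aa; move: (mtens mone a).
  apply: (sprod_ind (calg_csub cAA) (blin_shom cAA sAA) sS) => _ _ [x Ax <-] [y Ay <-].
    by apply: calg_mul cAA (qDA _ Ax) _; exact: sub_atens.
  rewrite (m _ _ (qDA _ Ax) (sub_atens Ay A1)) -(D_iA Ax) (tens2_mtens uiA uiA Ay A1) iA1.
  by apply: sub_sprod; [exists (iA x) => //; exact: XA|exists (iA y) => //; exact: XA].
have SBA b a : BA b -> A a -> sprod DC C1 (mtens (iB b) (iA a)).
  move=> Bb Aa; have -> : mtens (iB b) (iA a) = mtens mone (iA a) ** mtens (iB b) mone.
    have [hx hy] := (bC (XA _ Aa), bC (XB _ Bb)).
    by rewrite mtens_mul // opmul1l opmul1r.
  by apply: mulr; [exists (iB b) => //; exact: XB|exact: S1A].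
(* After [y] is written through [bD] and [bi1], the element [JJ (bi1 z)] lies in $i_B(B)\otimes
   i_A(A)$, so the additional $1\otimes i_A(a)$ merges with its second leg and [SBA] applies. *)
have SJA y a : BB y -> A a -> sprod DC C1 (JJ y ** mtens mone (iA a)).
  move=> By Aa; have b1A := @bounded_mtens1l R N _ _ (bC (XA _ Aa)).
  suff [] : bounded (JJ y) /\ sprod DC C1 (JJ y ** mtens mone (iA a)) by [].
  have sE := blin_csub (@csub_bounded R _) (blin_mulr b1A (fun T h => h)) sS.
  apply: (J_dense sE hB _ _ By) => [_ [x Bx <-]|x _ Bx [z Bz <-]]; first exact: Xi1.
  have bD1 := DC_bounded (ex_intro2 _ _ _ (XB _ Bx) (erefl (D (iB x)))).
  have bJ : bounded (JJ (bi1 B z)) by have [_ _ _ _ h] := sJ; apply: h; exact: Xi1.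
  split; first exact: bounded_mul.
  rewrite -(opmulA bD1 bJ b1A); apply: mull; first by exists (iB x) => //; exact: XB.
  rewrite (J_i1 Bz); have [_ _ _ cox] := uco; have := cox _ Bz; move: (bco B z).
  have [cBA _ sI _] := uhom_tens2 uiB uiA.
  have bI t : atens BA A t -> bounded (tens2 iB iA t) by have [_ _ _ _ h] := sI; exact: h.
  apply: (atens_ind (calg_csub cBA) (blin_comp (blin_shom cBA sI)
    (blin_mulr (D := [set T | bounded T]) b1A (fun T h => h)) bI) sS) => b a' Bb Aa'.
    exact: sub_atens.
  have [hx hy hz] := And3 (bC (XB _ Bb)) (bC (XA _ Aa')) (bC (XA _ Aa)).
  rewrite (tens2_mtens uiB uiA Bb Aa') mtens_mul // opmul1r.
  have [_ mA _ _ _] := sA; rewrite -(mA _ _ Aa' Aa); apply: SBA => //.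
  exact: calg_mul cA Aa' Aa.
(* By [J_i1_dense], $i_B(b)\otimes i_A(a)$ is exchanged for [JJ (bi1 x)] times $1\otimes i_A(y)$.
   Then $1\otimes i_B(b')$, being [JJ (bi2 b')], multiplies into a single value of [JJ], and [SJA]
   applies. *)
have SBBA b' b a : BA b' -> BA b -> A a -> sprod DC C1 (mtens mone (iB b') ** mtens (iB b) (iA a)).
  move=> Bb' Bb Aa; have bB := @bounded_mtens1l R N _ _ (bC (XB _ Bb')).
  suff [] : bounded (mtens (iB b) (iA a)) /\
    sprod DC C1 (mtens mone (iB b') ** mtens (iB b) (iA a)) by [].
  have sE := blin_csub (@csub_bounded R _) (blin_mull bB (fun T h => h)) sS.
  apply: (J_i1_dense Bb Aa sE) => x y Bx Ay.
  have bJ : bounded (JJ (bi1 B x)) by have [_ _ _ _ h] := sJ; apply: h; exact: Xi1.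
  have b1A := @bounded_mtens1l R N _ _ (bC (XA _ Ay)); split; first exact: bounded_mul.
  have [_ mJ _ _ _] := sJ.
  rewrite (opmulA bB bJ b1A) -(J_i2 Bb') -(mJ _ _ (Xi2 _ Bb') (Xi1 _ Bx)).
  apply: SJA Ay; exact: calg_mul cBB (Xi2 _ Bb') (Xi1 _ Bx).
apply: (atens_min sS) => c c' Cc Cc'.
suff [] : C c /\ sprod DC C1 (mtens c c') by [].
have sE := blin_csub (calg_csub cC) (blin_tensl C (bC Cc')) sS.
apply: (C_dense_op sE _ Cc) => a b Aa Bb; have Cba := calg_mul cC (XB _ Bb) (XA _ Aa); split=> //.
suff [] : C c' /\ sprod DC C1 (mtens (iB b ** iA a) c') by [].
have sE' := blin_csub (calg_csub cC) (blin_tensr C (bC Cba)) sS.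
apply: (C_dense_op sE' _ Cc') => a' b' Aa' Bb'; split; first exact: calg_mul cC (XB _ Bb') (XA _ Aa').
have -> : mtens (iB b ** iA a) (iB b' ** iA a') =
    mtens mone (iB b') ** mtens (iB b) (iA a') ** mtens (iA a) mone.
  have [h1 h2] := (bC (XB _ Bb), bC (XA _ Aa)); have [h3 h4] := (bC (XB _ Bb'), bC (XA _ Aa')).
  by rewrite !mtens_mul // ?opmul1l ?opmul1r //; exact: bounded_mul.
by apply: mulr; [exists (iA a) => //; exact: XA|exact: SBBA].
Qed.

Lemma bosonization_compact :
  sprod (bD B @` BA) (bi1 B @` BA) = BB -> sprod (bD B @` BA) (bi2 B @` BA) = BB ->
  compact_quantum_group C D.
Proof.
move=> h1 h2; have [_ _ [_ _ _ D1 _] DC_] := uD.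
split; [|split|..].
- by split; [have [_ [hE _ _ _] _] := hC|exact: calg1 cC].
- exact: uhom_morphism uD.
- exact: D1.
- move=> c Cc; have m := DC_ _ Cc; have uCi := uhom_id cC.
  by rewrite (tmor_tens2 uD uCi m) (tmor_tens2 uCi uD m) D_coassoc.
- exact: D_dense2.
- exact: D_dense1.
Qed.

End Bosonization.

Theorem corollary6p8 (R : realType) (G : qgroup R) (w : universal G)
    (B : braided_bialgebra w)
    (N : choiceType) (C : set (mat R N))
    (iA : mat R (qL G) -> mat R N) (iB : mat R (bI B) -> mat R N)
    (hC : twisted w (qA G) (qD G) (bB B) (bcoh B) C iA iB)
    (M : choiceType) (T : set (mat R M))
    (tA : mat R (qL G) -> mat R M) (tBB : mat R (bbI B) -> mat R M)
    (hT : twisted w (qA G) (qD G) (bBB B) (bbcoh B) T tA tBB)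
    (idDelta : mat R N -> mat R M)
    (hidDelta : is_bmor (qA G) (bB B) C iA iB T tA tBB id (bD B) idDelta)
    (Psi : mat R M -> mat R (N * N)%type)
    (hPsi : is_Psi C iA iB T tA tBB Psi) :
  compact_qgroup G -> braided_compact_qgroup B ->
  compact_quantum_group C (fun c => Psi (idDelta c)).
Proof.
move=> A1 [B1 h1 h2]; exact: (bosonization_compact hC hT hidDelta hPsi A1 B1 h1 h2).
Qed.
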